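(* Let $F:\mathcal{S}_n\to\mathbb{R}$ be continuous, quasiconcave and uniformly elliptic (no further smoothness assumed), and let $u\in C(B_1)$ be a viscosity solution of $F(D^2u)=0$ in $B_1\subset\mathbb{R}^n$. Then $u\in C^{2,\alpha}(\overline{B}_{1/2})$ and \[ \|u\|_{C^{2,\alpha}(\overline{B}_{1/2})}\leq C, \] where $\alpha\in(0,1)$ depends only on $n,\lambda,\Lambda$, and $C$ depends on $n,\lambda,\Lambda$, $\sup_{B_1}|u|$ and $|F(0)|$.
   Context: $\mathcal{S}_n$ is the space of real symmetric $n\times n$ matrices. $F$ is uniformly elliptic with constants $0<\lambda\le\Lambda$ if $\lambda\|N\|\leq F(M+N)-F(M)\leq\Lambda\|N\|$ for all $M,N\in\mathcal{S}_n$ with $N\geq0$, where $\|N\|=\sup_{|x|=1}|Nx|$. $F$ is quasiconcave if $F(\theta M_1+(1-\theta)M_2)\geq\min\{F(M_1),F(M_2)\}$ for all $M_1,M_2\in\mathcal{S}_n$, $\theta\in[0,1]$. A continuous $u$ is a viscosity subsolution (supersolution) of $F(D^2u)=0$ in $\Omega$ if whenever $\varphi\in C^2(\Omega)$ and $u-\varphi$ has a local maximum (minimum) at $x_0\in\Omega$, then $F(D^2\varphi(x_0))\geq0$ (resp. $\leq 0$); a viscosity solution is both. *)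

(* Defs.v *)
From HB Require Import structures.
From mathcomp Require Import all_boot all_order all_algebra.
From mathcomp Require Import all_classical all_reals all_analysis.
Set Implicit Arguments. Unset Strict Implicit. Unset Printing Implicit Defensive.
Import Order.TTheory GRing.Theory Num.Theory.
Import numFieldNormedType.Exports.
Local Open Scope classical_set_scope.
Local Open Scope ring_scope.

Section Defs.
Variables (R : realType) (n : nat).

Definition enorm (p q : nat) (A : 'M[R]_(p, q)) : R :=
  Num.sqrt (\sum_(i < p) \sum_(j < q) A i j ^+ 2).

Definition symm (M : 'M[R]_n) : Prop := M^T = M.

Definition psd (N : 'M[R]_n) : Prop := forall x : 'cV[R]_n, 0 <= (x^T *m N *m x) 0 0.

Definition opnorm (N : 'M[R]_n) : R :=
  sup [set enorm (N *m x) | x in [set x : 'cV[R]_n | enorm x = 1]].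

Definition unif_elliptic (lam Lam : R) (F : 'M[R]_n -> R) : Prop :=
  forall M N, symm M -> symm N -> psd N ->
    lam * opnorm N <= F (M + N) - F M <= Lam * opnorm N.

Definition quasiconcave (F : 'M[R]_n -> R) : Prop :=
  forall M1 M2 (t : R), symm M1 -> symm M2 -> 0 <= t <= 1 ->
    Num.min (F M1) (F M2) <= F (t *: M1 + (1 - t) *: M2).

Definition cont_on_Sn (F : 'M[R]_n -> R) : Prop :=
  {within [set M | symm M], continuous F}.

Definition oball (c : 'rV[R]_n) (r : R) : set 'rV[R]_n :=
  [set x | enorm (x - c) < r].
Definition cball (c : 'rV[R]_n) (r : R) : set 'rV[R]_n :=
  [set x | enorm (x - c) <= r].

Definition pd (f : 'rV[R]_n -> R) (i : 'I_n) : 'rV[R]_n -> R :=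
  fun x => 'D_(delta_mx 0 i : 'rV[R]_n) f x.

Definition C2on (A : set 'rV[R]_n) (f : 'rV[R]_n -> R) : Prop :=
  forall x, A x ->
    [/\ {for x, continuous f},
        forall i, derivable f x (delta_mx 0 i) /\ {for x, continuous (pd f i)} &
        forall i j, derivable (pd f i) x (delta_mx 0 j) /\
                    {for x, continuous (pd (pd f i) j)}].

Definition hess (f : 'rV[R]_n -> R) (x : 'rV[R]_n) : 'M[R]_n :=
  \matrix_(i, j) pd (pd f i) j x.

Definition loc_max_on (A : set 'rV[R]_n) (g : 'rV[R]_n -> R) (x0 : 'rV[R]_n) : Prop :=
  exists2 r : R, 0 < r & forall x, A x -> enorm (x - x0) < r -> g x <= g x0.
Definition loc_min_on (A : set 'rV[R]_n) (g : 'rV[R]_n -> R) (x0 : 'rV[R]_n) : Prop :=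
  exists2 r : R, 0 < r & forall x, A x -> enorm (x - x0) < r -> g x0 <= g x.

Definition visc_sub (F : 'M[R]_n -> R) (O : set 'rV[R]_n) (u : 'rV[R]_n -> R) : Prop :=
  (forall x, O x -> {for x, continuous u}) /\
  forall (phi : 'rV[R]_n -> R) x0, O x0 -> C2on O phi ->
    loc_max_on O (fun x => u x - phi x) x0 -> 0 <= F (hess phi x0).
Definition visc_super (F : 'M[R]_n -> R) (O : set 'rV[R]_n) (u : 'rV[R]_n -> R) : Prop :=
  (forall x, O x -> {for x, continuous u}) /\
  forall (phi : 'rV[R]_n -> R) x0, O x0 -> C2on O phi ->
    loc_min_on O (fun x => u x - phi x) x0 -> F (hess phi x0) <= 0.
Definition visc_sol F O u := visc_sub F O u /\ visc_super F O u.

Definition esupn (A : set 'rV[R]_n) (g : 'rV[R]_n -> R) : \bar R :=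
  ereal_sup [set (`|g x|)%:E | x in A].
Definition holder (A : set 'rV[R]_n) (a : R) (g : 'rV[R]_n -> R) : \bar R :=
  ereal_sup [set z | exists x y, [/\ A x, A y, x <> y &
               z = (`|g x - g y| / (enorm (x - y)) `^ a)%:E]].

(* ||u||_{C^{2,a}(closure A)} (sums over multi-indices |b|<=2, second order ones
   indexed by i <= j), computed on the open set A *)
Definition C2a_norm (A : set 'rV[R]_n) (a : R) (u : 'rV[R]_n -> R) : \bar R :=
  (esupn A u + \sum_(i < n) esupn A (pd u i) +
   \sum_(i < n) \sum_(j < n | (i <= j)%N)
      (esupn A (pd (pd u i) j) + holder A a (pd (pd u i) j)))%E.

End Defs.

(* Main.v *)
(* Extend F to all matrices by M |-> F ((M + M^T) / 2); ellipticity and quasiconcavity are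
   then expressed with traces of positive semidefinite matrices.

   Decay for Pucci supersolutions.  Points where a supersolution is touched from below by
   paraboloids of a fixed opening determine the vertices of the paraboloids in a Lipschitz
   way.  Sliding paraboloids over a ball of vertices and counting the grid cells that meet
   the contact set replaces the measure estimate: with a barrier, this gives a growth lemma,
   and a covering argument on dyadic cubes gives geometric decay of the set where a
   nonnegative supersolution is large, and of the set where a supersolution is not touched
   from below by a paraboloid of large opening.

   Second differences.  If a quadratic polynomial touches a finite sum of supersolutions from
   below, its Hessian is, up to an error, below a sum of admissible Hessians: regularise
   by inf-convolution, blow up at a density point of the contact set, and blow up once more
   where the slopes of the gradients are almost extremal; the limits are quadratic.  Hence,
   by quasiconcavity, 2 u - u (. + y) - u (. - y) is a Pucci supersolution for every
   solution u.  The decay lemmas then bound the second differences of u above, and the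
   equation bounds them below: u is C^{1,1}.

   Liouville.  Let u be an entire C^{1,1} solution and S e the supremum of its second
   difference quotients in the direction e.  By the decay lemma the suprema for finitely
   many directions are almost attained at a common place; blowing up there, the strong
   maximum principle gives a quadratic solution with D_ee = S e in all these directions.
   As enough directions determine the quadratic form, u minus this quadratic is concave; it
   also lies in the Pucci class, so it is affine by the strong maximum principle.

   By compactness, there is a scale r such that a bounded solution is within r^2 / 2 of a
   quadratic solution on the ball of radius r; iterating gives second order Taylor
   expansions with error C |h|^{2 + alpha}, where r^alpha = 1 / 2, at all points, hence the
   estimate. *)

(* [F] is not differentiable, so the equation can be neither linearised nor differentiated;
   everything is drawn from comparing Hessians of touching polynomials. Quasiconcavity acts at the
   level 0: [F >= 0] describes a convex set, so the mean of Hessians admissible for [u (. + y)] and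
   [u (. - y)] is admissible again, while the Hessian of [u] itself has [F <= 0]. Each classical
   tool resting on measure theory has a finite counterpart here: for the area formula, a Lipschitz
   relation that multiplies cell counts by a bounded factor; for additivity of measure, additivity
   of counts at positive distance; for a density point, a cube all of whose subcells are hit. Limits
   are taken along ultrafilters, so that functions, gradients and operators converge together at all
   points without a choice of subsequences. The normalisation [F 0 = 0], which makes the constants
   uniform, is kept along the iteration by subtracting quadratic polynomials whose Hessian is a zero
   of [F]. *)
Require Import Defs.
From HB Require Import structures.
From mathcomp Require Import all_boot all_order all_algebra.
From mathcomp Require Import all_classical all_reals all_analysis.
From mathcomp Require Import zify ring lra.
Import Order.TTheory GRing.Theory Num.Theory.
Import numFieldNormedType.Exports.
Set Implicit Arguments. Unset Strict Implicit. Unset Printing Implicit Defensive.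
Local Open Scope classical_set_scope.
Local Open Scope ring_scope.

(** * Euclidean products and quadratic forms on row vectors, next to the sup norm, whose balls are
    cubes *)

Section Euclid.
Variables (R : realType) (n : nat).
Local Notation V := 'rV[R]_n.
Implicit Types (x y z p v : V) (M N P Q : 'M[R]_n).

Definition dot x y : R := \sum_i x 0 i * y 0 i.
Definition nsq x : R := dot x x.
Definition qf M x : R := dot (x *m M) x.
(** Stated for all matrices: the extended operators see a matrix only through its symmetric part,
    which its quadratic form determines. *)
Definition psdq M := forall x, 0 <= qf M x.

Lemma dotC x y : dot x y = dot y x.
Proof. by apply: eq_bigr => i _; rewrite mulrC. Qed.
Lemma dotDl x y z : dot (x + y) z = dot x z + dot y z.
Proof. by rewrite /dot -big_split; apply: eq_bigr => i _; rewrite mxE mulrDl. Qed.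
Lemma dotDr x y z : dot z (x + y) = dot z x + dot z y.
Proof. by rewrite dotC dotDl !(dotC z). Qed.
Lemma dotZl (a : R) x z : dot (a *: x) z = a * dot x z.
Proof. by rewrite /dot mulr_sumr; apply: eq_bigr => i _; rewrite mxE mulrA. Qed.
Lemma dotZr (a : R) x z : dot z (a *: x) = a * dot z x.
Proof. by rewrite dotC dotZl dotC. Qed.
Lemma dotNl x z : dot (- x) z = - dot x z.
Proof. by rewrite -scaleN1r dotZl mulN1r. Qed.
Lemma dotNr x z : dot z (- x) = - dot z x.
Proof. by rewrite dotC dotNl dotC. Qed.
Lemma dot0l z : dot 0 z = 0.
Proof. by rewrite -(scale0r 0) dotZl mul0r. Qed.
Lemma dot0r z : dot z 0 = 0. Proof. by rewrite dotC dot0l. Qed.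
Definition dotE := (dotDl, dotDr, dotNl, dotNr, dotZl, dotZr, dot0l, dot0r).

Lemma dot_delta x i : dot x (delta_mx 0 i) = x 0 i.
Proof.
rewrite /dot (bigD1 i) //= mxE !eqxx mulr1 big1 ?addr0 // => j ji.
by rewrite mxE eqxx (negPf ji) mulr0.
Qed.
Lemma nsq_delta i : nsq (delta_mx 0 i) = 1.
Proof. by rewrite /nsq dot_delta mxE !eqxx. Qed.

Lemma nsq_ge0 x : 0 <= nsq x.
Proof. by apply: sumr_ge0 => i _; rewrite -expr2 sqr_ge0. Qed.
Lemma nsq0 : nsq 0 = 0. Proof. exact: dot0l. Qed.
Lemma nsqZ (a : R) x : nsq (a *: x) = a ^+ 2 * nsq x.
Proof. by rewrite /nsq !dotE mulrA -expr2. Qed.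
Lemma nsqN x : nsq (- x) = nsq x.
Proof. by rewrite /nsq !dotE opprK. Qed.
Lemma nsqD x y : nsq (x + y) = nsq x + 2 * dot x y + nsq y.
Proof. by rewrite /nsq !dotE (dotC y x); ring. Qed.
Lemma nsqB x y : nsq (x - y) = nsq x - 2 * dot x y + nsq y.
Proof. by rewrite /nsq !dotE (dotC y x); ring. Qed.
Lemma nsqC x y : nsq (x - y) = nsq (y - x).
Proof. by rewrite -nsqN opprB. Qed.
Lemma nsqD_le x y : nsq (x + y) <= 2 * nsq x + 2 * nsq y.
Proof. by have := nsq_ge0 (x - y); rewrite nsqB nsqD; lra. Qed.
Lemma coord_sq_le x i : x 0 i ^+ 2 <= nsq x.
Proof.
rewrite /nsq /dot (bigD1 i) //= -expr2 lerDl.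
by apply: sumr_ge0 => j _; rewrite -expr2 sqr_ge0.
Qed.
Lemma nsq_eq0 x : nsq x = 0 -> x = 0.
Proof.
move=> x0; apply/rowP => i; rewrite mxE; apply/eqP; rewrite -sqrf_eq0.
by rewrite eq_le sqr_ge0 andbT -x0 coord_sq_le.
Qed.
Lemma nsq_gt0 x : x != 0 -> 0 < nsq x.
Proof.
move=> x0; rewrite lt_def nsq_ge0 andbT; apply: contra x0 => /eqP.
by move/nsq_eq0 ->.
Qed.

Lemma cauchy_schwarz x y : dot x y ^+ 2 <= nsq x * nsq y.
Proof.
have [->|y0] := eqVneq y 0; first by rewrite dot0r nsq0 mulr0 expr0n.
have yp := nsq_gt0 y0.
have := nsq_ge0 (nsq y *: x - dot x y *: y).
rewrite nsqB !nsqZ !dotE.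
rewrite (_ : _ - _ + _ = nsq y * (nsq x * nsq y - dot x y ^+ 2)); last by rewrite /nsq; ring.
by rewrite pmulr_rge0 // subr_ge0.
Qed.

Lemma dot_le x y (a b : R) : 0 <= a -> 0 <= b ->
  nsq x <= a ^+ 2 -> nsq y <= b ^+ 2 -> `|dot x y| <= a * b.
Proof.
move=> a0 b0 xa yb; rewrite -ler_sqr ?nnegrE ?mulr_ge0 // real_normK ?num_real //.
by apply: le_trans (cauchy_schwarz _ _) _; rewrite exprMn ler_pM // nsq_ge0.
Qed.

Lemma coord_le_norm x i : `|x 0 i| <= `|x|.
Proof.
rewrite [X in _ <= X]/Num.norm /= mx_normrE.
exact: (le_bigmax _ (fun ij : 'I_1 * 'I_n => `|x ij.1 ij.2|) (ord0, i)).
Qed.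
Lemma norm_le_coord x (c : R) : 0 <= c -> (forall i, `|x 0 i| <= c) -> `|x| <= c.
Proof.
move=> c0 H; rewrite [X in X <= _]/Num.norm /= mx_normrE.
by apply/bigmax_leP; split=> // -[i j] _ /=; rewrite (ord1 i).
Qed.
Lemma norm_sq_le x : `|x| ^+ 2 <= nsq x.
Proof.
have h : `|x| <= Num.sqrt (nsq x).
  apply: norm_le_coord; first exact: sqrtr_ge0.
  move=> i; rewrite -[X in X <= _]sqrtr_sqr.
  by rewrite ler_wsqrtr // coord_sq_le.
by rewrite -[X in _ <= X]sqr_sqrtr ?nsq_ge0 // ler_sqr ?nnegrE ?sqrtr_ge0.
Qed.
Lemma nsq_le_norm x : nsq x <= n%:R * `|x| ^+ 2.
Proof.
rewrite /nsq /dot.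
apply: le_trans (_ : \sum_(i < n) `|x| ^+ 2 <= _); last first.
  by rewrite sumr_const card_ord mulr_natl.
apply: ler_sum => i _; rewrite -expr2 -[x 0 i ^+ 2]real_normK ?num_real //.
by rewrite ler_sqr ?nnegrE // coord_le_norm.
Qed.
Lemma norm_le_of_nsq x (c : R) : 0 <= c -> nsq x <= c ^+ 2 -> `|x| <= c.
Proof.
move=> c0 h; rewrite -ler_sqr ?nnegrE //.
exact: le_trans (norm_sq_le _) h.
Qed.
Lemma norm_lt_of_nsq x (c : R) : 0 <= c -> nsq x < c ^+ 2 -> `|x| < c.
Proof.
move=> c0 h; rewrite -ltr_sqr ?nnegrE //.
exact: le_lt_trans (norm_sq_le _) h.
Qed.
Lemma dot_norm_le x y : `|dot x y| <= n%:R * `|x| * `|y|.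
Proof.
apply: le_trans (ler_norm_sum _ _ _) _.
apply: le_trans (_ : \sum_(i < n) `|x| * `|y| <= _); last first.
  by rewrite sumr_const card_ord -mulrA mulr_natl.
by apply: ler_sum => i _; rewrite normrM ler_pM // coord_le_norm.
Qed.

Lemma mulmx_sum x M j : (x *m M) 0 j = \sum_i x 0 i * M i j.
Proof. by rewrite mxE. Qed.
Lemma qfD M N x : qf (M + N) x = qf M x + qf N x.
Proof. by rewrite /qf mulmxDr dotDl. Qed.
Lemma qfN M x : qf (- M) x = - qf M x.
Proof. by rewrite /qf mulmxN dotNl. Qed.
Lemma qfZ (a : R) M x : qf (a *: M) x = a * qf M x.
Proof. by rewrite /qf -scalemxAr dotZl. Qed.
Lemma qf0 x : qf 0 x = 0. Proof. by rewrite /qf mulmx0 dot0l. Qed.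
Lemma qf_scalar (a : R) x : qf (a%:M) x = a * nsq x.
Proof. by rewrite /qf mul_mx_scalar dotZl. Qed.
Lemma qf_outer p x : qf (p^T *m p) x = dot p x ^+ 2.
Proof.
rewrite /qf mulmxA (_ : x *m p^T = (dot x p)%:M); last first.
  apply/matrixP => i j; rewrite !mxE !ord1 eqxx mulr1n.
  by apply: eq_bigr => k _; rewrite mxE.
by rewrite mul_scalar_mx dotZl (dotC x p) expr2.
Qed.
Lemma dot_mulmx x M y : dot (x *m M) y = dot x (y *m M^T).
Proof.
rewrite /dot; under eq_bigr => i _ do rewrite mulmx_sum mulr_suml.
rewrite exchange_big /=; apply: eq_bigr => i _.
rewrite mulmx_sum mulr_sumr; apply: eq_bigr => j _.
by rewrite [M^T _ _]mxE; ring.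
Qed.
Lemma qf_addr M x y :
  qf M (x + y) = qf M x + dot (x *m (M + M^T)) y + qf M y.
Proof.
rewrite /qf !(mulmxDl, mulmxDr, dotDl, dotDr) (dot_mulmx y M x) (dotC y (x *m _)); ring.
Qed.
Lemma qf_scale M (a : R) x : qf M (a *: x) = a ^+ 2 * qf M x.
Proof. by rewrite /qf -scalemxAl dotZl dotZr mulrA expr2. Qed.
Lemma qf_opp M x : qf M (- x) = qf M x.
Proof. by rewrite -scaleN1r qf_scale sqrrN expr1n mul1r. Qed.
Lemma qf_zero M : qf M 0 = 0. Proof. by rewrite /qf dot0r. Qed.
Definition qfE := (qfD, qfN, qfZ, qf0, qf_scalar, qf_outer).
Lemma qf_delta M i : qf M (delta_mx 0 i) = M i i.
Proof. by rewrite /qf -rowE dot_delta mxE. Qed.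

Lemma psdqD M N : psdq M -> psdq N -> psdq (M + N).
Proof. by move=> hM hN x; rewrite qfD addr_ge0. Qed.
Lemma psdqZ (a : R) M : 0 <= a -> psdq M -> psdq (a *: M).
Proof. by move=> a0 hM x; rewrite qfZ mulr_ge0. Qed.
Lemma psdq_scalar (a : R) : 0 <= a -> psdq a%:M.
Proof. by move=> a0 x; rewrite qf_scalar mulr_ge0 // nsq_ge0. Qed.
Lemma psdq_outer p : psdq (p^T *m p).
Proof. by move=> x; rewrite qf_outer sqr_ge0. Qed.
Lemma trace_outer p : \tr (p^T *m p) = nsq p.
Proof.
rewrite /mxtrace; apply: eq_bigr => i _.
by rewrite mxE big_ord1 mxE.
Qed.
Lemma psdq_tr_ge0 M : psdq M -> 0 <= \tr M.
Proof. by move=> h; apply: sumr_ge0 => i _; rewrite -qf_delta; apply: h. Qed.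

Lemma qf_bound M : exists2 C : R, 0 <= C & forall x, `|qf M x| <= C * nsq x.
Proof.
exists (\sum_i \sum_j `|M i j|).
  by apply: sumr_ge0 => i _; apply: sumr_ge0.
move=> x.
have -> : qf M x = \sum_i \sum_j M j i * (x 0 j * x 0 i).
  apply: eq_bigr => i _; rewrite mulmx_sum mulr_suml; apply: eq_bigr => j _; ring.
rewrite exchange_big /= mulr_suml; apply: le_trans (ler_norm_sum _ _ _) _.
apply: ler_sum => i _; rewrite mulr_suml; apply: le_trans (ler_norm_sum _ _ _) _.
apply: ler_sum => j _; rewrite normrM ler_wpM2l //.
have h1 := coord_sq_le x i; have h2 := coord_sq_le x j.
rewrite ler_norml; apply/andP; split; last first.
  by have := sqr_ge0 (x 0 i - x 0 j); rewrite sqrrB; lra.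
by have := sqr_ge0 (x 0 i + x 0 j); rewrite sqrrD; lra.
Qed.

End Euclid.

Ltac pos := lazymatch goal with
  | |- is_true (0 <= _) => first [ done | assumption | exact: sqr_ge0 | exact: nsq_ge0
     | exact: expR_ge0 | (apply: ltW; assumption) | (apply: mulr_ge0; pos) | (rewrite invr_ge0; pos)
     | (apply: exprn_ge0; pos) | (apply: addr_ge0; pos) ]
  | |- is_true (0 < _) => first [ assumption | done | exact: expR_gt0
     | (apply: mulr_gt0; pos) | (rewrite invr_gt0; pos) | (apply: exprn_gt0; pos)
     | (apply: ltr_wpDl; pos) | (apply: ltr_pwDl; pos) | (apply: lt_le_trans; eassumption) ]
  end.

Lemma ultra_fmap (T S : Type) (f : T -> S) (U : set_system T) :
  UltraFilter U -> UltraFilter (f @ U).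
Proof.
move=> UU; split; first exact: fmap_proper_filter.
move=> G GF sG; rewrite predeqE => A; split; last exact: sG.
move=> GA; have [//|nA] := in_ultra_setVsetC (f @^-1` A) UU.
have GnA : G (~` A) by apply: sG; exact: nA.
by have [x []] := filter_ex (filterI GA GnA).
Qed.

(** * Continuity and minimisation on compact sets *)

Section Cont.
Variables (R : realType) (n : nat).
Local Notation V := 'rV[R]_n.
Implicit Types (x y z p v c : V) (M N P Q : 'M[R]_n) (s u : V -> R).

Lemma contP s x : {for x, continuous s} <->
  forall e : R, 0 < e -> exists2 d : R, 0 < d &
    forall y, `|y - x| < d -> `|s y - s x| < e.
Proof.
split=> [/cvgrPdist_lt h e e0|h].
  have /nbhs_ballP[d /= d0 hd] := h e e0.
  exists d => // y yx; rewrite distrC; apply: hd.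
  by rewrite -ball_normE /= distrC.
change (s @ nbhs x --> s x); apply/cvgrPdist_lt => e e0; have [d d0 hd] := h e e0.
apply/nbhs_ballP; exists d => //= y; rewrite -ball_normE /= => yx.
by rewrite distrC; apply: hd; rewrite distrC.
Qed.

Lemma cont_ext s u x : (forall y, s y = u y) ->
  {for x, continuous s} -> {for x, continuous u}.
Proof. by move=> /funext ->. Qed.

Lemma cont_lip s x (C : R) :
  (forall y, `|y - x| < 1 -> `|s y - s x| <= C * `|y - x|) -> {for x, continuous s}.
Proof.
move=> h; apply/contP => e e0.
have C1 : 0 < `|C| + 1 by apply: ltr_wpDl.
exists (Num.min 1 (e / (`|C| + 1))); first by rewrite lt_min ltr01 divr_gt0.
move=> y; rewrite lt_min => /andP[y1 y2].
apply: le_lt_trans (h _ y1) _.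
apply: le_lt_trans (_ : _ <= (`|C| + 1) * `|y - x|) _.
  by rewrite ler_wpM2r // (le_trans (ler_norm C)) // lerDl.
by rewrite mulrC -ltr_pdivlMr.
Qed.

Lemma cont_comp_affine s c (r : R) x :
  {for c + r *: x, continuous s} -> {for x, continuous (fun y => s (c + r *: y))}.
Proof.
move=> /contP h; apply/contP => e e0; have [d d0 hd] := h e e0.
have r1 : 0 < `|r| + 1 by apply: ltr_wpDl.
exists (d / (`|r| + 1)); first by rewrite divr_gt0.
move=> y yx; apply: hd.
have -> : c + r *: y - (c + r *: x) = r *: (y - x).
  by rewrite opprD addrACA subrr add0r scalerBr.
rewrite normrZ.
rewrite ltr_pdivlMr // in yx; apply: le_lt_trans yx.
by rewrite mulrC ler_wpM2l // lerDl.
Qed.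

Lemma cont_shift s c x :
  {for x + c, continuous s} -> {for x, continuous (fun y => s (y + c))}.
Proof.
move=> h; have := @cont_comp_affine s c 1 x; rewrite scale1r addrC => /(_ h).
by apply: cont_ext => y; rewrite scale1r addrC.
Qed.

Lemma contD s u x : {for x, continuous s} -> {for x, continuous u} ->
  {for x, continuous (fun y => s y + u y)}.
Proof. by move=> hs hu; apply: continuousD. Qed.
Lemma contN s x : {for x, continuous s} -> {for x, continuous (fun y => - s y)}.
Proof. by move=> hs; apply: continuousN. Qed.
Lemma contB s u x : {for x, continuous s} -> {for x, continuous u} ->
  {for x, continuous (fun y => s y - u y)}.
Proof. by move=> hs hu; apply: contD => //; apply: contN. Qed.
Lemma contM s u x : {for x, continuous s} -> {for x, continuous u} ->
  {for x, continuous (fun y => s y * u y)}.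
Proof. by move=> hs hu; apply: continuousM. Qed.
Lemma contK (a : R) x : {for x, continuous (fun _ : V => a)}.
Proof. exact: cst_continuous. Qed.
Lemma cont_max s u x : {for x, continuous s} -> {for x, continuous u} ->
  {for x, continuous (fun y => Num.max (s y) (u y))}.
Proof. by move=> hs hu; apply: continuous_max. Qed.
Lemma cont_norm c x : {for x, continuous (fun y : V => `|y - c|)}.
Proof.
apply: (@cont_lip _ _ 1) => y _; rewrite mul1r.
by apply: le_trans (ler_dist_dist _ _) _; rewrite opprB addrA subrK.
Qed.
Lemma cont_dot p c x : {for x, continuous (fun y => dot p (y - c))}.
Proof.
apply: (@cont_lip _ _ (n%:R * `|p|)) => y _.
rewrite -dotNr -dotDr; apply: le_trans (dot_norm_le _ _) _.
by rewrite opprB addrA subrK.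
Qed.
Lemma cont_qf M c x : {for x, continuous (fun y => qf M (y - c))}.
Proof.
have [C C0 hC] := qf_bound M.
apply: (@cont_lip _ _ (n%:R * `|(x - c) *m (M + M^T)| + C * n%:R)) => y y1.
have -> : qf M (y - c) - qf M (x - c) =
    dot ((x - c) *m (M + M^T)) (y - x) + qf M (y - x).
  have -> : y - c = (x - c) + (y - x) by rewrite [RHS]addrC addrA subrK.
  by rewrite qf_addr; ring.
apply: le_trans (ler_normD _ _) _; rewrite mulrDl lerD ?dot_norm_le //.
apply: le_trans (hC _) _; rewrite -mulrA ler_wpM2l //.
apply: le_trans (nsq_le_norm _) _; rewrite ler_wpM2l // expr2.
by rewrite ler_piMl // ltW.
Qed.
Lemma cont_nsq c x : {for x, continuous (fun y => nsq (y - c))}.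
Proof.
by have := @cont_qf 1%:M c x; apply: cont_ext => y; rewrite qf_scalar mul1r.
Qed.

Lemma closed_le0 (h : V -> R) :
  (forall x, {for x, continuous h}) -> closed [set x | h x <= 0].
Proof.
move=> hc; have := @closed_comp _ _ h [set y : R | y <= 0].
by move=> H; apply: H; [move=> x _; exact: hc|exact: closed_le].
Qed.

(** Compact sets are given as sublevel sets, so that [h < 0] and [h = 0] can play the roles of
    interior and boundary in comparison arguments. *)
Lemma evt_min (h g : V -> R) (B : R) x0 :
  (forall x, {for x, continuous h}) -> (forall x, h x <= 0 -> `|x| <= B) ->
  (forall x, h x <= 0 -> {for x, continuous g}) -> h x0 <= 0 ->
  exists2 c, h c <= 0 & forall x, h x <= 0 -> g c <= g x.
Proof.
move=> hc hB gc hx0; set D := [set x | h x <= 0].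
have cD : compact D.
  apply: bounded_closed_compact; last exact: closed_le0.
  exists B; split; first exact: num_real.
  by move=> x Bx y /hB hy; apply: le_trans hy _; apply: ltW.
have D0 : D !=set0 by exists x0.
have gD : {within D, continuous g}.
  by apply: continuous_in_subspaceT => x; rewrite inE; apply: gc.
have [c] := EVT_min_rV D0 cD gD.
rewrite inE => Dc hcm; exists c => // x hx; apply: hcm; rewrite inE; exact: hx.
Qed.

(** The comparison device of all later contradiction arguments: a value at [x0] below all boundary
    values pushes the minimum inside, where it yields a touching polynomial. *)
Lemma interior_min (h g : V -> R) (B b : R) x0 :
  (forall x, {for x, continuous h}) -> (forall x, h x <= 0 -> `|x| <= B) ->
  (forall x, h x <= 0 -> {for x, continuous g}) -> h x0 <= 0 -> g x0 < b ->
  (forall x, h x = 0 -> b <= g x) ->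
  exists c, [/\ h c < 0, g c <= g x0 &
     exists2 r : R, 0 < r & forall y, `|y - c| < r -> g c <= g y].
Proof.
move=> hc hB gc hx0 gx0 hb; have [c hcc hm] := evt_min hc hB gc hx0.
have hc0 : h c < 0.
  rewrite lt_neqAle hcc andbT; apply/negP => /eqP /hb.
  by rewrite leNgt (le_lt_trans (hm _ hx0)).
exists c; split=> //; first exact: hm.
have [|d d0 hd] := (contP h c).1 (hc c) (- h c); first by rewrite oppr_gt0.
exists d => // y /hd; rewrite ltr_norml => /andP[_].
by move=> ?; apply: hm; lra.
Qed.

Lemma unif_cont s c (r : R) :
  (forall x, `|x - c| <= r -> {for x, continuous s}) ->
  forall e : R, 0 < e -> exists2 d : R, 0 < d & forall x y,
    `|x - c| <= r -> `|y - c| <= r -> `|x - y| < d -> `|s x - s y| < e.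
Proof.
move=> sc e e0.
have [hr|hr] := ltP r 0.
  exists 1 => // x y hx; exfalso.
  by have := le_lt_trans hx hr; rewrite normr_lt0.
pose D := [set x : V | `|x - c| <= r].
have cD : compact D.
  apply: bounded_closed_compact; last first.
    have -> : D = [set x | `|x - c| - r <= 0].
      by apply/funext => x; rewrite /D /= subr_le0.
    apply: (@closed_le0 (fun x => `|x - c| - r)) => x.
    apply: (@contB (fun y => `|y - c|) (fun=> r)); first exact: cont_norm.
    exact: contK.
  exists (r + `|c|); split; first exact: num_real.
  move=> x Bx y hy; apply: le_trans (ltW Bx).
  rewrite -(subrK c y); apply: le_trans (ler_normD _ _) _.
  by rewrite lerD2r.
apply: contrapT => /forall2NP hno.
have hno' k : exists xy : V * V, [/\ `|xy.1 - c| <= r, `|xy.2 - c| <= r,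
   `|xy.1 - xy.2| < k.+1%:R^-1 & e <= `|s xy.1 - s xy.2|].
  have [/negP|] := hno k.+1%:R^-1; first by rewrite invr_gt0 ltr0Sn.
  move=> /existsNP[x] /existsNP[y] /not_implyP[h1] /not_implyP[h2] /not_implyP[h3] /negP.
  by rewrite -leNgt => h4; exists (x, y).
have [f hf] := choice hno'.
(* Both members of the bad pairs converge along [U] to one point of the compact cube, and continuity
   there contradicts the gap [e]. *)
have [U [UU oU]] := ultraFilterLemma (@eventually_filter).
have : compact D by [].
rewrite compact_ultra => /(_ ((fun k => (f k).1) @ U)) [].
    exact: ultra_fmap.
  have : U ((fun k => (f k).1) @^-1` D) by apply: filterE => k; have [] := hf k.
  exact.
move=> x [Dx Ux].
have /contP/(_ (e / 2)) [|d d0 hd] := sc x Dx; first by rewrite divr_gt0.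
have H1 : U [set k | `|(f k).1 - x| < d / 2].
  have := Ux [set y | `|y - x| < d / 2]; apply.
  apply/nbhs_ballP; exists (d / 2); first by rewrite /= divr_gt0.
  by move=> y; rewrite -ball_normE /= distrC.
have H2 : U [set k : nat | k.+1%:R^-1 < d / 2].
  apply: oU; have := near_infty_natSinv_lt (PosNum (divr_gt0 d0 (ltr0Sn R 1))).
  exact.
have [k [/= k1 k2]] := filter_ex (filterI H1 H2).
have [h1 h2 h3 h4] := hf k.
have a1 : `|s (f k).1 - s x| < e / 2 by apply: hd; apply: lt_trans k1 _; lra.
have a2 : `|s (f k).2 - s x| < e / 2.
  apply: hd; rewrite -(subrK (f k).1 (f k).2) -addrA.
  apply: le_lt_trans (ler_normD _ _) _; rewrite distrC.
  by have := lt_trans h3 k2; lra.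
have : `|s (f k).1 - s (f k).2| < e.
  rewrite -(subrK (s x) (s (f k).1)) -addrA.
  apply: le_lt_trans (ler_normD _ _) _; rewrite (distrC (s x)); lra.
by rewrite ltNge h4.
Qed.
End Cont.

(** * Limits of real sequences along a free ultrafilter *)

Section Ulim.
Variables (R : realType) (U : set_system nat).
Hypothesis UU : UltraFilter U.
Hypothesis oU : \oo `<=` U.
Implicit Types a b : nat -> R.

(** Every bounded sequence has such a limit, so a sequence of functions converges at all points at
    once, without a diagonal argument. *)
Definition utends a (l : R) := forall e : R, 0 < e -> U [set k | `|a k - l| < e].

Lemma utends_ex a (B : R) : U [set k | `|a k| <= B] -> exists l, utends a l.
Proof.
move=> aB; have := @segment_compact R (- B) B.
rewrite compact_ultra => /(_ (a @ U) (ultra_fmap _ UU)) [].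
  have : U (a @^-1` `[- B, B]%classic); last exact.
  by apply: filterS aB => k /=; rewrite ler_norml in_itv.
move=> l [_ hl]; exists l => e e0.
have := hl [set y | `|y - l| < e]; apply.
by apply/nbhs_ballP; exists e => // y; rewrite -ball_normE /= distrC.
Qed.

Lemma utends_cst (c : R) : utends (fun=> c) c.
Proof. by move=> e e0; apply: filterE => k /=; rewrite subrr normr0. Qed.

Lemma utendsD a b (l m : R) : utends a l -> utends b m ->
  utends (fun k => a k + b k) (l + m).
Proof.
move=> ha hb e e0; have e2 : 0 < e / 2 by rewrite divr_gt0.
apply: filterS (filterI (ha _ e2) (hb _ e2)) => k /= [h1 h2].
have -> : a k + b k - (l + m) = (a k - l) + (b k - m) by ring.
by apply: le_lt_trans (ler_normD _ _) _; lra.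
Qed.

Lemma utendsZ a (c l : R) : utends a l -> utends (fun k => c * a k) (c * l).
Proof.
move=> ha e e0; have c1 : 0 < `|c| + 1 by apply: ltr_wpDl.
have e2 : 0 < e / (`|c| + 1) by rewrite divr_gt0.
apply: filterS (ha _ e2) => k /= h.
rewrite -mulrBr normrM; rewrite ltr_pdivlMr // in h; apply: le_lt_trans h.
by rewrite mulrC ler_wpM2l // lerDl.
Qed.

Lemma utendsN a (l : R) : utends a l -> utends (fun k => - a k) (- l).
Proof.
move=> h e e0; apply: filterS (h e e0) => k /=.
by rewrite -opprD normrN.
Qed.

Lemma utendsB a b (l m : R) : utends a l -> utends b m ->
  utends (fun k => a k - b k) (l - m).
Proof. by move=> ha hb; apply: utendsD => //; apply: utendsN. Qed.

Lemma utends_le a b (l m : R) : utends a l -> utends b m ->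
  U [set k | a k <= b k] -> l <= m.
Proof.
move=> ha hb hab; rewrite leNgt; apply/negP => ml.
have e0 : 0 < (l - m) / 2 by rewrite divr_gt0 // subr_gt0.
have [k [[]/=]] := filter_ex (filterI (filterI (ha _ e0) (hb _ e0)) hab).
by rewrite !ltr_norml => /andP[h1 _] /andP[_ h2] h3; lra.
Qed.

Lemma utends_uniq a (l m : R) : utends a l -> utends a m -> l = m.
Proof.
by move=> h1 h2; apply/eqP; rewrite eq_le; apply/andP; split;
  [apply: utends_le h1 h2 _|apply: utends_le h2 h1 _]; apply: filterE => k /=.
Qed.

Lemma utends_eq a b (l : R) : U [set k | a k = b k] -> utends a l -> utends b l.
Proof.
by move=> hab ha e e0; apply: filterS (filterI hab (ha _ e0)) => k /= [<-].
Qed.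

Lemma utends_sqz a b (l : R) : utends b 0 -> U [set k | `|a k - l| <= b k] -> utends a l.
Proof.
move=> hb hab e e0; apply: filterS (filterI (hb _ e0) hab) => k /= [h1 h2].
by apply: le_lt_trans h2 _; apply: le_lt_trans h1; rewrite subr0 ler_norm.
Qed.

Lemma utends_abs a (l : R) : utends a l -> utends (fun k => `|a k|) `|l|.
Proof.
move=> h e e0; apply: filterS (h e e0) => k /=.
by apply: le_lt_trans; apply: ler_dist_dist.
Qed.

Lemma utends_inv : utends (fun k => k.+1%:R^-1) 0.
Proof.
move=> e e0; apply: oU; have := near_infty_natSinv_lt (PosNum e0).
by apply: filterS => k /= h; rewrite subr0 ger0_norm // invr_ge0.
Qed.

Lemma utends_sum (I : finType) (a : I -> nat -> R) (l : I -> R) :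
  (forall i, utends (a i) (l i)) ->
  utends (fun k => \sum_i a i k) (\sum_i l i).
Proof.
move=> h; suff H s : utends (fun k => \sum_(i <- s) a i k) (\sum_(i <- s) l i) by exact: H.
elim: s => [|i s IH].
  rewrite big_nil (_ : (fun k => _) = fun=> 0); first exact: utends_cst.
  by apply/funext => k; rewrite big_nil.
rewrite big_cons (_ : (fun k => _) = fun k => a i k + \sum_(i <- s) a i k).
  exact: utendsD.
by apply/funext => k; rewrite big_cons.
Qed.

Lemma utends_dot (n : nat) (p : nat -> 'rV[R]_n) (l y : 'rV[R]_n) :
  (forall i, utends (fun k => p k 0 i) (l 0 i)) ->
  utends (fun k => dot (p k) y) (dot l y).
Proof.
move=> h; apply: utends_sum => i.
rewrite (_ : (fun k => _) = fun k => y 0 i * p k 0 i); last first.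
  by apply/funext => k; rewrite mulrC.
by rewrite mulrC; apply: utendsZ.
Qed.
End Ulim.

(** * Viscosity conditions through touching quadratic polynomials *)

Section Visc.
Variables (R : realType) (n : nat).
Local Notation V := 'rV[R]_n.
Implicit Types (x y z p v c : V) (M N P Q : 'M[R]_n) (s u : V -> R).

Definition touch s x p M := exists2 r : R, 0 < r & forall y, `|y - x| < r ->
  s x + dot p (y - x) + qf M (y - x) / 2 <= s y.

(** [A] is the set of Hessians allowed for polynomials touching from below. Subsolutions become
    conditions of this kind on the opposite function, so one notion serves equations, Pucci
    inequalities and sums. *)
Definition visc (A : 'M[R]_n -> Prop) (O : set V) s :=
  (forall x, O x -> {for x, continuous s}) /\
  (forall x p M, O x -> touch s x p M -> A M).

(** Moving the centre of a quadratic polynomial from [x0] to [c] changes its slope but not its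
    Hessian, which is all that [visc] looks at. *)
Lemma touch_min s x0 c p M :
  (exists2 r : R, 0 < r & forall y, `|y - c| < r ->
     s c - (dot p (c - x0) + qf M (c - x0) / 2) <=
     s y - (dot p (y - x0) + qf M (y - x0) / 2)) ->
  exists p', touch s c p' M.
Proof.
move=> [r r0 h]; exists (p + 2^-1 *: ((c - x0) *m (M + M^T))); exists r => // y yr.
have := h y yr; have -> : y - x0 = (c - x0) + (y - c) by rewrite [RHS]addrC addrA subrK.
by rewrite (qf_addr M (c - x0)) !(dotDl, dotZl) (dotDr (c - x0)); lra.
Qed.

Lemma visc_subset A (O O' : set V) s : visc A O s -> O' `<=` O -> visc A O' s.
Proof. by move=> [h1 h2] sO; split=> [x /sO/h1 //|x p M /sO]; apply: h2. Qed.

Lemma touch_comp_affine s c (r k d : R) x p M : 0 < r -> 0 < k ->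
  touch (fun y => k * s (c + r *: y) + d) x p M ->
  touch s (c + r *: x) ((k * r)^-1 *: p) ((k * r ^+ 2)^-1 *: M).
Proof.
move=> r0 k0 [e e0 h]; exists (r * e); first by rewrite mulr_gt0.
move=> y hy; have r0' : r != 0 by rewrite gt_eqF.
have k0' : k != 0 by rewrite gt_eqF.
have := h (r^-1 *: (y - c)).
have -> : r^-1 *: (y - c) - x = r^-1 *: (y - (c + r *: x)).
  by rewrite opprD addrA [in RHS]scalerBr scalerA mulVf // scale1r.
rewrite scalerA mulfV // scale1r [c + (y - c)]addrC subrK.
rewrite normrZ gtr0_norm ?invr_gt0 // mulrC ltr_pdivrMr // mulrC => /(_ hy).
rewrite dotZr qf_scale qfZ dotZl.
set Y := y - _; move=> H.
rewrite -(ler_pM2l k0) -(lerD2r d); apply: le_trans H.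
rewrite le_eqVlt; apply/orP; left; apply/eqP.
by field; rewrite r0' k0'.
Qed.
End Visc.

Lemma max_eq0 (R : realType) (a b : R) : Num.max a b = 0 -> a = 0 \/ b = 0.
Proof. by rewrite /Num.max; case: ifP => _ ->; [right|left]. Qed.

Lemma tr_scalar (R : realType) n (a : R) : \tr (a%:M : 'M[R]_n) = a * n%:R.
Proof. by rewrite mxtrace_scalar mulr_natr. Qed.

(** * Pucci supersolutions: Lipschitz vertices and the barrier *)

Section Pucci.
Variables (R : realType) (n : nat) (lam Lam : R).
Hypotheses (lam0 : 0 < lam) (Lam0 : 0 < Lam).
Local Notation V := 'rV[R]_n.
Implicit Types (x y z p v c : V) (M N P Q : 'M[R]_n) (s u : V -> R).

(* The inequality satisfied by the Hessians of test functions touching from below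
   a supersolution of the minimal Pucci operator with right-hand side [f]; it is
   stated over all decompositions [P - Q], so that eigenvalues are not needed. *)
Definition supS (f : R) M := forall P Q, psdq P -> psdq Q -> M = P - Q ->
  lam * \tr P <= Lam * \tr Q + f.

Lemma visc_supS_affine (O : set V) s c (r k d f : R) : 0 < r -> 0 < k ->
  visc (supS f) O s ->
  visc (supS (k * r ^+ 2 * f)) [set y | O (c + r *: y)] (fun y => k * s (c + r *: y) + d).
Proof.
move=> r0 k0 [h1 h2]; split=> [x /h1 hx|x p M /= Ox].
  apply: (@contD _ _ (fun y => k * s (c + r *: y)) (fun=> d)); last exact: contK.
  apply: (@contM _ _ (fun=> k)); first exact: contK.
  exact: cont_comp_affine.
have K0 : 0 < k * r ^+ 2 by rewrite mulr_gt0 // exprn_gt0.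
move=> /(touch_comp_affine r0 k0) /h2 => /(_ Ox) h P Q hP hQ MPQ.
have := h ((k * r ^+ 2)^-1 *: P) ((k * r ^+ 2)^-1 *: Q).
rewrite MPQ scalerBr => /(_ _ _ (erefl _)) H.
have {H} := H (psdqZ (ltW _) hP) (psdqZ (ltW _) hQ).
rewrite invr_gt0 => /(_ K0 K0); rewrite !mxtraceZ => H.
rewrite -(ler_pM2l K0) in H.
set t := k * _ in K0 H *; have t0 : t != 0 by rewrite gt_eqF.
move: H; rewrite mulrDr [t * (lam * _)]mulrCA [t * (Lam * _)]mulrCA.
by rewrite !mulVKf.
Qed.

(** Paraboloids of opening [a] with vertices [v0], [v1] touch [s] from below at [x0], [x1]. Over the
    first one [s] has the excess [base], which is nonnegative and above the affine function
    [dot D (y - x1)]. Were [D] too long, [base] would bend upwards so sharply across a slab around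
    [x0] that a polynomial strongly convex across the slab and slightly concave along it touches it
    from below, against the Pucci inequality. *)
Lemma contact_lip s (O : set V) (f a rho r NN : R) x0 x1 v0 v1 :
  visc (supS f) O s -> 0 <= f -> 0 < a -> 0 < r -> 1 <= NN ->
  32 * n%:R * Lam <= lam * NN ^+ 2 -> NN * r < rho ->
  nsq (x1 - x0) <= r ^+ 2 ->
  (forall y, `|y - x0| < rho -> O y) ->
  (forall y, `|y - x0| < rho ->
     s x0 + a / 2 * nsq (x0 - v0) <= s y + a / 2 * nsq (y - v0)) ->
  (forall y, `|y - x0| < rho ->
     s x1 + a / 2 * nsq (x1 - v1) <= s y + a / 2 * nsq (y - v1)) ->
  a ^+ 2 * nsq (v1 - v0) <= (16 * (Lam * n%:R * a + f) / lam * r) ^+ 2.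
Proof.
move=> [sc sv] f0 a0 r0 NN1 NNb NNr xr hO h0 h1.
have NN0 : 0 < NN by apply: lt_le_trans NN1.
set D := a *: (v1 - v0).
have -> : a ^+ 2 * nsq (v1 - v0) = nsq D by rewrite nsqZ.
set K := 16 * _ / lam.
have K0 : 0 <= K.
  by rewrite /K mulr_ge0 ?invr_ge0 ?(ltW lam0) // mulr_ge0 // addr_ge0 // ?mulr_ge0 // ltW.
set de := Num.sqrt (nsq D).
have deE : nsq D = de ^+ 2 by rewrite sqr_sqrtr // nsq_ge0.
have de0' : 0 <= de by apply: sqrtr_ge0.
rewrite deE ler_sqr ?nnegrE //; last by rewrite mulr_ge0 // ltW.
rewrite leNgt; apply/negP => Kde.
have de0 : 0 < de by apply: le_lt_trans Kde; rewrite mulr_ge0 // ltW.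
have de1 : de != 0 by rewrite gt_eqF.
set nu := de^-1 *: D.
have nunu : nsq nu = 1 by rewrite nsqZ deE -exprMn mulVf ?expr1n.
have DE y : dot D y = de * dot nu y by rewrite [dot nu _]dotZl mulrA mulfV ?mul1r.
(* With this coefficient [al * (4 * r) ^+ 2 = de * r]: on the far face of the slab the square equals
   the least possible value of the affine bound. *)
clearbody nu; set al := de / (16 * r).
have al0 : 0 < al by rewrite divr_gt0 // mulr_gt0.
have alr : 16 * al * r = de by rewrite /al; field; rewrite gt_eqF.
(* Chosen so that [be * (NN * r) ^+ 2] cancels the square on the lateral boundary; the size of [NN]
   keeps this concavity small against [lam * al]. *)
set be := 16 * al / NN ^+ 2.
have be0 : 0 < be by rewrite divr_gt0 ?exprn_gt0 // mulr_gt0.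
have beN : be * NN ^+ 2 = 16 * al by rewrite mulfVK // sqrf_eq0 gt_eqF.
clearbody be; clearbody al; set base := fun y => s y + a / 2 * nsq (y - v0) - (s x0 + a / 2 * nsq (x0 - v0)).
have base0 y : `|y - x0| < rho -> 0 <= base y by move=> /h0; rewrite /base; lra.
have x1rho : `|x1 - x0| < rho.
  apply: le_lt_trans (norm_le_of_nsq (ltW r0) xr) _; apply: le_lt_trans NNr.
  by rewrite ler_peMl // ltW.
have base1 y : `|y - x0| < rho -> dot D (y - x1) <= base y.
  move=> hy; have := h1 _ hy; have := base0 _ x1rho.
  have -> : base y = base x1 + (s y - s x1) + a / 2 * (nsq (y - v0) - nsq (x1 - v0)).
    by rewrite /base; ring.
  move=> hb hs.
  suff : dot D (y - x1) = a / 2 * (nsq (x1 - v1) - nsq (y - v1) + nsq (y - v0) - nsq (x1 - v0)).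
    lra.
  by rewrite /D !nsqB !dotE (dotC v1 y) (dotC v1 x1) (dotC v0 y) (dotC v0 x1); field.
(* The slab of half width [2 * r] across [nu], cut off at distance [NN * r]. The polynomial compared
   with [base], namely [al * (dot nu (y - x0) + 2 * r) ^+ 2 - be * nsq (y - x0)], is positive at
   [x0], where [base] vanishes, and at most [base] on the boundary. *)
set h : V -> R := fun y => Num.max (nsq (y - x0) - (NN * r) ^+ 2)
   (Num.max (dot nu (y - x0) - 2 * r) (- dot nu (y - x0) - 2 * r)).
set p := - a *: (x0 - v0) + (4 * al * r) *: nu.
set M := (2 * al) *: (nu^T *m nu) - (2 * be + a)%:M.
set g := fun y => s y - (dot p (y - x0) + qf M (y - x0) / 2).
have gE y : g y = base y - (al * (dot nu (y - x0) + 2 * r) ^+ 2 - be * nsq (y - x0))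
   + (s x0 + 4 * al * r ^+ 2).
  rewrite /g /base /M /p !qfE.
  have -> : nsq (y - v0) = nsq (y - x0) + 2 * dot (y - x0) (x0 - v0) + nsq (x0 - v0).
    by rewrite -nsqD addrA subrK.
  rewrite (dotC (y - x0)) (dotDl (- a *: _)) (dotZl (- a)) (dotZl (4 * al * r)).
  by field.
have hc x : {for x, continuous h}.
  rewrite /h; apply: cont_max.
    by apply: (contB (@cont_nsq _ _ x0 x) (@contK _ _ _ x)).
  apply: cont_max.
    by apply: (contB (@cont_dot _ _ nu x0 x) (@contK _ _ _ x)).
  by apply: (contB (contN (@cont_dot _ _ nu x0 x)) (@contK _ _ _ x)).
have hle x : h x <= 0 -> [/\ nsq (x - x0) <= (NN * r) ^+ 2, dot nu (x - x0) <= 2 * r &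
    - (2 * r) <= dot nu (x - x0)].
  rewrite /h !ge_max => /andP[i1 /andP[i2 i3]].
  by split; [move: i1|move: i2|move: i3]; clear -lam0 Lam0; lra.
have hrho x : h x <= 0 -> `|x - x0| < rho.
  move=> /hle[hh _ _]; apply: le_lt_trans NNr; apply: norm_le_of_nsq => //.
  by rewrite mulr_ge0 // ltW.
have hbd x : h x <= 0 -> `|x| <= rho + `|x0|.
  move=> /hrho hx; rewrite -(subrK x0 x); apply: le_trans (ler_normD _ _) _.
  by rewrite lerD2r ltW.
have gcont x : h x <= 0 -> {for x, continuous g}.
  move=> /hrho/hO/sc hx; rewrite /g; apply: contB => //.
  apply: (@contD _ _ _ (fun y => qf M (y - x0) / 2)); first exact: cont_dot.
  by apply: (@contM _ _ _ (fun=> 2^-1)); [exact: cont_qf|exact: contK].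
have hx0 : h x0 <= 0.
  rewrite /h subrr dot0r nsq0 !ge_max !sub0r oppr0 add0r !oppr_le0.
  by rewrite exprn_ge0 ?mulr_ge0 ?ltW.
have gx0 : g x0 < s x0 + 4 * al * r ^+ 2.
  have h2 : 0 < al * (2 * r) ^+ 2 by rewrite mulr_gt0 // exprn_gt0 // mulr_gt0.
  by rewrite gE /base !subrr dot0r nsq0 add0r mulr0; lra.
have gb x : h x = 0 -> s x0 + 4 * al * r ^+ 2 <= g x.
  move=> hx; have hx' : h x <= 0 by rewrite hx.
  have [q1 q2 q3] := hle _ hx'; have xrho := hrho _ hx'.
  rewrite gE lerDr subr_ge0; have b0 := base0 _ xrho.
  have sq : (dot nu (x - x0) + 2 * r) ^+ 2 <= (4 * r) ^+ 2.
    by rewrite ler_sqr ?nnegrE; clear -q2 q3 r0; lra.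
  have sq' := ler_wpM2l (ltW al0) sq.
  have nb : 0 <= be * nsq (x - x0) by rewrite mulr_ge0 ?nsq_ge0 // ltW.
  have : [\/ nsq (x - x0) = (NN * r) ^+ 2, dot nu (x - x0) = 2 * r |
             dot nu (x - x0) = - (2 * r)].
    case/max_eq0: hx => [hx|/max_eq0[] hx];
      [constructor 1|constructor 2|constructor 3]; move: hx; clear -lam0 Lam0; lra.
  case=> hh.
    have hb : be * (NN * r) ^+ 2 = 16 * al * r ^+ 2 by rewrite exprMn mulrA beN.
    by rewrite hh hb; rewrite exprMn in sq'; clear -sq' b0; lra.
  apply: le_trans (base1 _ xrho); rewrite DE.
    have -> : x - x1 = (x - x0) - (x1 - x0) by rewrite opprB addrA subrK.
    rewrite (dotDr (x - x0)) dotNr hh.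
    have := @dot_le _ _ nu (x1 - x0) 1 r ler01 (ltW r0).
    rewrite nunu expr1n lexx => /(_ isT xr); rewrite mul1r ler_norml => /andP[_ hd].
    have : de * r <= de * (2 * r - dot nu (x1 - x0)) by rewrite ler_wpM2l //; lra.
    have : al * (4 * r) ^+ 2 = de * r by rewrite -alr; ring.
    by lra.
  by rewrite hh addNr expr0n /= mulr0; lra.
have [c [hc0 _ [e e0 gm]]] := interior_min hc hbd gcont hx0 gx0 gb.
have Oc : O c by apply/hO/hrho/ltW.
have [p' tch] : exists p', touch s c p' M.
  by apply: (@touch_min _ _ s x0 c p M); exists e.
have := sv _ _ _ Oc tch ((2 * al) *: (nu^T *m nu)) (2 * be + a)%:M.
have al2 : 0 <= 2 * al by lra.
have ba0 : 0 <= 2 * be + a by lra.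
move=> /(_ (psdqZ al2 (psdq_outer _)) (psdq_scalar ba0) (erefl _)).
rewrite mxtraceZ trace_outer nunu tr_scalar => H.
have NN2 : 0 < NN ^+ 2 by rewrite exprn_gt0.
have k1 : 2 * (Lam * n%:R) * be <= lam * al.
  rewrite -(ler_pM2r NN2) -[X in X <= _]mulrA beN; have := ler_wpM2l (ltW al0) NNb.
  by clear; lra.
have k2 : lam * al <= Lam * n%:R * a + f by clear -k1 H; lra.
have : K * r < 16 * al * r by rewrite alr.
by rewrite ltr_pM2r // /K ltr_pdivrMr //; clear -k2; lra.
Qed.

(** Squaring [1 + t / 2 <= expR (t / 2)] gives a quadratic minorant, which turns contact with the
    Gaussian barrier into contact with a polynomial. *)
Lemma expR_ge_quad (t : R) : -2 <= t -> 1 + t + t ^+ 2 / 4 <= expR t.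
Proof.
move=> t2; have -> : expR t = expR (t / 2) ^+ 2.
  by rewrite -expRM_natl; congr expR; field.
have h := expR_ge1Dx (t / 2).
have : (1 + t / 2) ^+ 2 <= expR (t / 2) ^+ 2.
  by rewrite ler_sqr ?nnegrE ?expR_ge0 //; lra.
by apply: le_trans; rewrite le_eqVlt; apply/orP; left; apply/eqP; field.
Qed.
(** If [s] exceeded [C] on the small ball, it would dominate a Gaussian barrier on both boundary
    spheres of an annulus but not at [y0]. The resulting interior contact contradicts the Pucci
    inequality, since a steep Gaussian is a strict subsolution away from its centre. *)
Lemma barrier (rho R1 R2 : R) : 0 < rho -> 0 <= R1 -> R1 < R2 ->
  exists C f0 : R, [/\ 1 <= C, 0 < f0 & forall s (O : set V) (f : R) x0 y0,
    f <= f0 -> visc (supS f) O s ->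
    (forall y, nsq (y - x0) <= R2 ^+ 2 -> O y /\ 0 <= s y) ->
    nsq (y0 - x0) <= R1 ^+ 2 -> s y0 <= 1 ->
    exists2 z, nsq (z - x0) <= rho ^+ 2 & s z <= C].
Proof.
move=> rho0 R10 R12.
have R20 : 0 < R2 by apply: le_lt_trans R12.
(* Makes [2 * lam * ga * rho ^+ 2] exceed [Lam * (5 / 2) * n] by one: outside the ball of radius
   [rho] the radial second derivative beats the others. *)
set ga := (Lam * (5 / 2) * n%:R + 1) / (2 * lam * rho ^+ 2).
have d0 : 0 < 2 * lam * rho ^+ 2 by rewrite mulr_gt0 ?exprn_gt0 // mulr_gt0.
have n0 : 0 <= Lam * (5 / 2) * n%:R.
  by rewrite mulr_ge0 // mulr_ge0 ?(ltW Lam0) // divr_ge0.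
have ga0 : 0 < ga by rewrite divr_gt0 // ltr_wpDl.
have gaE : ga * (2 * lam * rho ^+ 2) = Lam * (5 / 2) * n%:R + 1.
  by rewrite mulfVK // gt_eqF.
clearbody ga.
set E1 := expR (- ga * R1 ^+ 2); set E2 := expR (- ga * R2 ^+ 2).
have E12 : E2 < E1.
  by rewrite ltr_expR !mulNr ltrN2 ltr_pM2l // ltr_sqr ?nnegrE ?(ltW R20).
have E20 : 0 < E2 by apply: expR_gt0.
have E11 : E1 <= 1.
  by rewrite -expR0 ler_expR mulNr oppr_le0 mulr_ge0 ?exprn_ge0 // ltW.
have dE : 0 < E1 - E2 by rewrite subr_gt0.
(* The barrier [ka * (ph - E2)] is at least 2 on the ball of radius [R1], hence above [s y0], and
   vanishes at radius [R2]. *)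
set ka := 2 / (E1 - E2).
have ka2 : ka * (E1 - E2) = 2 by rewrite mulfVK // gt_eqF.
have ka0 : 0 < ka by rewrite divr_gt0.
have ka1 : 2 <= ka by rewrite ler_pdivlMr //; lra.
clearbody ka.
exists ka, (ka * E2 * ga / 2); split; first lra.
  by rewrite divr_gt0 // !mulr_gt0.
move=> s O f x0 y0 ff0 [sc sv] hO y0R sy0.
apply: contrapT => hno.
have hz z : nsq (z - x0) <= rho ^+ 2 -> ka < s z.
  by move=> hz; rewrite ltNge; apply/negP => sz; apply: hno; exists z.
set ph : V -> R := fun y => expR (- ga * nsq (y - x0)).
set g := fun y => s y - ka * (ph y - E2).
set h : V -> R := fun y => Num.max (nsq (y - x0) - R2 ^+ 2) (rho ^+ 2 - nsq (y - x0)).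
have hc x : {for x, continuous h}.
  apply: cont_max; first exact: (contB (@cont_nsq _ _ x0 x) (@contK _ _ _ x)).
  exact: (contB (@contK _ _ _ x) (@cont_nsq _ _ x0 x)).
have hle x : h x <= 0 -> nsq (x - x0) <= R2 ^+ 2 /\ rho ^+ 2 <= nsq (x - x0).
  by rewrite /h ge_max => /andP[? ?]; split; lra.
have hbd x : h x <= 0 -> `|x| <= R2 + `|x0|.
  move=> /hle[hx _]; rewrite -(subrK x0 x); apply: le_trans (ler_normD _ _) _.
  by rewrite lerD2r norm_le_of_nsq // ltW.
have phc x : {for x, continuous ph}.
  apply: (@continuous_comp _ _ _ (fun y => - ga * nsq (y - x0)) expR).
    by apply: (@contM _ _ (fun=> - ga)); [exact: contK|exact: cont_nsq].
  exact: continuous_expR.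
have gcont x : h x <= 0 -> {for x, continuous g}.
  move=> /hle[hx _]; apply: contB; first by apply/sc/(hO _ hx).1.
  apply: (@contM _ _ (fun=> ka)); first exact: contK.
  by apply: contB => //; exact: contK.
have hx0 : h y0 <= 0.
  rewrite /h ge_max; apply/andP; split.
    rewrite subr_le0; apply: le_trans y0R _.
    by rewrite ler_sqr ?nnegrE ?(ltW R20) ?(ltW R12).
  rewrite subr_le0 leNgt; apply/negP => /ltW/hz; lra.
have gy0 : g y0 < 0.
  rewrite /g; suff : ka * (E1 - E2) <= ka * (ph y0 - E2) by lra.
  rewrite ler_wpM2l ?(ltW ka0) // lerD2r ler_expR !mulNr lerN2.
  by rewrite ler_wpM2l ?(ltW ga0).
have gb x : h x = 0 -> 0 <= g x.
  move=> hx; have hx' : h x <= 0 by rewrite hx.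
  have [q1 q2] := hle _ hx'; have [_ s0] := hO _ q1.
  have [hh|hh] : nsq (x - x0) = R2 ^+ 2 \/ nsq (x - x0) = rho ^+ 2.
      by case/max_eq0: hx => hx; [left|right]; lra.
    by rewrite /g /ph hh subrr mulr0 subr0.
  have := hz x; rewrite hh lexx => /(_ isT) sz.
  have p1 : ph x <= 1.
    by rewrite -expR0 ler_expR mulNr oppr_le0 mulr_ge0 ?nsq_ge0 // ltW.
  have : ka * (ph x - E2) <= ka * 1 by rewrite ler_wpM2l ?(ltW ka0) //; lra.
  by rewrite /g; lra.
have [c [hc0 _ [e e0 gm]]] := interior_min hc hbd gcont hx0 gy0 gb.
have [q1 q2] := hle _ (ltW hc0); have [Oc _] := hO _ q1.
set X := c - x0; set T := nsq X; set E := expR (- ga * T).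
have E0 : 0 < E by apply: expR_gt0.
have EE2 : E2 <= E by rewrite ler_expR !mulNr lerN2 ler_wpM2l ?(ltW ga0).
(* The Hessian of the Gaussian has 4 and 2 in place of 2 and 5/2: the quadratic minorant of the
   exponential halves the first, and the surplus 1/2 absorbs the cubic term [dot X w * nsq w]. *)
set M := (ka * E * 2 * ga ^+ 2) *: (X^T *m X) - (ka * E * (5 / 2) * ga)%:M.
set p := (- 2 * ka * E * ga) *: X.
have tch : touch s c p M.
  have g1 : 0 < 2 / ga by rewrite divr_gt0.
  have g2 : 0 < (4 * ga)^-1 by rewrite invr_gt0 mulr_gt0.
  have [d1 d10 hd1] := (contP _ _).1 (@cont_nsq _ _ x0 c) _ g1.
  have [d2 d20 hd2] := (contP _ _).1 (@cont_dot _ _ X c c) _ g2.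
  exists (Num.min e (Num.min d1 d2)); first by rewrite !lt_min e0 d10 d20.
  move=> y; rewrite !lt_min => /andP[ye /andP[/hd1 y1 /hd2 y2]].
  have {gm} := gm _ ye; rewrite /g.
  set w := y - c in y2 *.
  have yE : nsq (y - x0) = T + (2 * dot X w + nsq w).
    have -> : y - x0 = X + w by rewrite [RHS]addrC addrA subrK.
    by rewrite (nsqD X w) -/T addrA.
  set sg := 2 * dot X w + nsq w in yE.
  have sgE : sg = 2 * dot X w + nsq w by []; clearbody sg.
  have sg2 : - 2 <= - ga * sg.
    move: y1; rewrite yE -/X -/T addrAC subrr add0r ltr_norml => /andP[_].
    by rewrite ltr_pdivlMr // mulrC; lra.
  have phy : ph y = E * expR (- ga * sg) by rewrite /ph yE -expRD mulrDr.
  have phcE : ph c = E by [].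
  rewrite phy phcE; have := expR_ge_quad sg2.
  set ex := expR _ => hex hg.
  have hex' := ler_wpM2l (ltW (mulr_gt0 ka0 E0)) hex.
  have w0 := nsq_ge0 w.
  have dw : - (4 * ga)^-1 <= dot X w.
    by move: y2; rewrite subrr dot0r subr0 ltr_norml => /andP[/ltW].
  have dw' : - nsq w <= 4 * ga * dot X w * nsq w.
    have := ler_wpM2r w0 dw; rewrite -(ler_pM2l (mulr_gt0 (ltr0Sn R 3) ga0)).
    by rewrite mulNr mulrN mulrA mulfV ?mul1r ?mulrA // gt_eqF // mulr_gt0.
  have sq1 : 4 * dot X w ^+ 2 * ga + 4 * ga * dot X w * nsq w <= ga * sg ^+ 2.
    rewrite -subr_ge0; have -> : ga * sg ^+ 2 - (4 * dot X w ^+ 2 * ga + 4 * ga * dot X w * nsq w) = ga * nsq w ^+ 2.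
      by rewrite sgE; ring.
    by rewrite mulr_ge0 ?sqr_ge0 // ltW.
  have sq2 : ga * (4 * dot X w ^+ 2 * ga - nsq w) <= ga * (ga * sg ^+ 2).
    by rewrite ler_wpM2l ?(ltW ga0) //; lra.
  have sq3 : ka * E * (ga ^+ 2 * dot X w ^+ 2 - ga * nsq w / 4) <=
             ka * E * ((- ga * sg) ^+ 2 / 4).
    have kE0 : 0 <= ka * E by rewrite mulr_ge0 // ltW.
    by rewrite ler_wpM2l //; clear -sq2; lra.
  rewrite /M /p !qfE dotZl.
  have : ka * E * (- ga * sg) = ka * E * (- (2 * ga * dot X w) - ga * nsq w) by rewrite sgE; ring.
  lra.
have := sv _ _ _ Oc tch ((ka * E * 2 * ga ^+ 2) *: (X^T *m X)) (ka * E * (5 / 2) * ga)%:M.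
have k1 : 0 <= ka * E * 2 * ga ^+ 2 by rewrite !mulr_ge0 ?sqr_ge0 ?ltW.
have k2 : 0 <= ka * E * (5 / 2) * ga by rewrite !mulr_ge0 ?invr_ge0 ?ltW.
move=> /(_ (psdqZ k1 (psdq_outer _)) (psdq_scalar k2) (erefl _)).
rewrite mxtraceZ trace_outer tr_scalar -/T => H.
have kE : 0 < ka * E * ga by rewrite !mulr_gt0.
have H2 : ka * E * ga * (ga * (2 * lam * rho ^+ 2)) <= ka * E * ga * (2 * lam * ga * T).
  rewrite ler_pM2l //; have -> : ga * (2 * lam * rho ^+ 2) = (2 * lam * ga) * rho ^+ 2 by ring.
  by rewrite ler_wpM2l // !mulr_ge0 // ltW.
rewrite gaE in H2.
have H3 : ka * E2 * ga <= ka * E * ga by rewrite ler_pM2r // ler_pM2l.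
have H4 : 0 < ka * E2 * ga by rewrite !mulr_gt0.
by clear -H H2 H3 H4 ff0; lra.
Qed.

End Pucci.

Lemma sqr_le_le (R : realType) (a b : R) : 0 <= b -> a ^+ 2 <= b ^+ 2 -> a <= b.
Proof.
move=> b0; have [a0|a0] := leP 0 a; first by rewrite ler_sqr ?nnegrE.
by move=> _; apply: ltW; apply: lt_le_trans a0 b0.
Qed.

(** * Growth lemma by sliding paraboloids *)

Section Growth.
Variables (R : realType) (n : nat) (lam Lam : R).
Hypotheses (lam0 : 0 < lam) (Lam0 : 0 < Lam) (n0 : (0 < n)%N).
Local Notation V := 'rV[R]_n.
Implicit Types (x y z p v c : V) (M N P Q : 'M[R]_n) (s u : V -> R).
Local Notation supS := (supS lam Lam).

(* The sup norm ball of radius [RR] contains the Euclidean ball of radius [4 n], outside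
   which the barrier vanishes. *)
Definition RR : R := 4 * n%:R + 1.

(** The concave paraboloid of opening [a] and vertex [v], raised until it first meets [s] over
    [Dom], does so at [x], at a height at most [M1]. *)
Definition contact s (Dom : set V) (a M1 r : R) x v :=
  [/\ `|x| <= r, s x <= M1 & forall y, Dom y ->
     s x + a / 2 * nsq (x - v) <= s y + a / 2 * nsq (y - v)].

(** [barrier] provides a [z] near the origin where [s] is bounded. Paraboloids with vertex near [z]
    then meet [s] inside the half cube, and by [contact_lip] the vertex is a locally Lipschitz
    function of the contact point, which is what counting needs. *)
Lemma growth : exists a M1 f0 L eta : R,
  [/\ 0 < a, 1 <= M1, 0 < f0, 0 <= L & 0 < eta] /\
  forall s (Dom : set V) (f : R) y0, 0 <= f -> f <= f0 ->
  visc (supS f) [set y | `|y| < RR] s -> (forall y, `|y| < RR -> Dom y) ->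
  (forall y, Dom y -> 0 <= s y) -> `|y0| <= 3 -> s y0 <= 1 ->
  exists z, [/\ `|z| <= 8^-1,
    (forall v, nsq (v - z) <= 8^-1 ^+ 2 -> exists x, contact s Dom a M1 2^-1 x v) &
    (forall x x' v v', contact s Dom a M1 2^-1 x v -> contact s Dom a M1 2^-1 x' v' ->
      `|x - x'| < eta -> `|v - v'| <= L * `|x - x'|)].
Proof.
have n1 : 1 <= n%:R :> R by rewrite ler1n.
have np : 0 < n%:R :> R by rewrite ltr0n.
set nn : R := n%:R in n1 np *.
have [|||C [f0 [C1 f00 hbar]]] := @barrier R n lam Lam lam0 Lam0 8^-1 (3 * nn) (4 * nn).
  by rewrite invr_gt0.
  by rewrite mulr_ge0 // ltW.
  by rewrite ltr_pM2r // ltr_nat.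
have Cp : 0 < C by apply: lt_le_trans C1.
set NN := 1 + 32 * nn * Lam / lam.
have NN1 : 1 <= NN by rewrite lerDl divr_ge0 ?(ltW lam0) // !mulr_ge0 // ltW.
have NNp : 0 < NN by apply: lt_le_trans NN1.
have NNb : 32 * nn * Lam <= lam * NN ^+ 2.
  have h : lam * NN = lam + 32 * nn * Lam by rewrite /NN mulrDr mulr1 mulrC mulfVK ?gt_eqF // mulrC.
  have : lam * NN * 1 <= lam * NN * NN by rewrite ler_wpM2l // mulr_ge0 // ltW.
  by rewrite mulr1 -mulrA -expr2 h; move: lam0; clear -n0 lam0 Lam0; lra.
clearbody NN.
(* With this opening [s + a / 2 * nsq (. - v)] is at most [3 / 2 * C] at [z], while its second term
   alone is at least [2 * C] at distance 1/4 from [v]; hence the contact stays in the half cube. *)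
set a := 64 * C; have ap : 0 < a by rewrite mulr_gt0.
set K0 := 16 * (Lam * nn * a + f0) / lam.
have K00 : 0 <= K0.
  by rewrite /K0; pos.
set eta := (4 * nn * NN)^-1.
have etap : 0 < eta by rewrite invr_gt0 !mulr_gt0.
have etaE : NN * (nn * (2 * eta)) = 2^-1.
  by rewrite /eta; field; rewrite !gt_eqF.
exists a, (2 * C), f0, (K0 * nn / a), eta; split.
  split=> //; first by move: C1; clear -n0 lam0 Lam0; lra.
  by pos.
move=> s Dom f y0 fp ff0 sv hDom spos y03 sy0.
have RR2 (y : V) : nsq y <= (4 * nn) ^+ 2 -> `|y| < RR.
  move=> /norm_le_of_nsq h; apply: le_lt_trans (h _) _; last by rewrite /RR ltrDl.
  by rewrite mulr_ge0 // ltW.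
have [|||z] := hbar s [set y | `|y| < RR] f 0 y0 ff0 sv; rewrite ?subr0 //.
    by move=> y; rewrite subr0 => /RR2 hy; split=> //; apply/spos/hDom.
  apply: le_trans (nsq_le_norm _) _; rewrite -/nn.
  have : `|y0| ^+ 2 <= 3 ^+ 2 by rewrite ler_sqr ?nnegrE.
  move=> /(ler_wpM2l (ltW np)) h; apply: le_trans h _.
  have := ler_wpM2l (ltW np) n1; clear -n0 lam0 Lam0; rewrite exprMn expr2; lra.
move=> z8 sz; have zn : `|z| <= 8^-1 by apply: norm_le_of_nsq.
exists z; split=> //.
  move=> v vz; set h : V -> R := fun y => `|y - 0| - 2^-1.
  set g := fun y => s y + a / 2 * nsq (y - v).
  have hle y : (h y <= 0) = (`|y| <= 2^-1) by rewrite /h subr0 subr_le0.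
  have [||||x hx xm] := @evt_min R n h g 2^-1 z.
    by move=> y; apply: (contB (@cont_norm _ _ 0 y) (@contK _ _ _ y)).
    by move=> y; rewrite hle.
    move=> y; rewrite hle => hy; apply: contD.
      apply: sv.1 => /=; apply: le_lt_trans hy _; rewrite /RR -/nn.
      by move: n1; clear -n0 lam0 Lam0; lra.
    apply: (@contM _ _ (fun=> a / 2)); [exact: contK|exact: cont_nsq].
    by rewrite hle; apply: le_trans zn _; lra.
  rewrite hle in hx.
  have gz : g z <= 3 / 2 * C.
    rewrite /g nsqC; have := ler_wpM2l (ltW ap) vz.
    by move: sz; rewrite /a; clear -n0 lam0 Lam0; lra.
  have gx : g x <= 3 / 2 * C.
    by apply: le_trans gz; apply: xm; rewrite hle; apply: le_trans zn _; lra.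
  exists x; split=> //.
    have := mulr_ge0 (ltW ap) (nsq_ge0 (x - v)); move: gx Cp; rewrite /g; clear -n0 lam0 Lam0; lra.
  move=> y Dy; have [hy|hy] := leP `|y| 2^-1; first by apply: xm; rewrite hle.
  apply: le_trans gx _.
  have vn : `|v| <= 4^-1.
    rewrite -(subrK z v); apply: le_trans (ler_normD _ _) _.
    have : `|v - z| <= 8^-1 by apply: norm_le_of_nsq.
    by move: zn; clear -n0 lam0 Lam0; lra.
  have yv : 4^-1 <= `|y - v|.
    have : `|y| <= `|y - v| + `|v| by rewrite -{1}(subrK v y) ler_normD.
    by move: vn hy; clear -n0 lam0 Lam0; lra.
  have : 4^-1 ^+ 2 <= nsq (y - v).
    by apply: le_trans (norm_sq_le _); rewrite ler_sqr ?nnegrE.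
  move=> /(ler_wpM2l (ltW ap)); have := spos _ Dy; move: Cp; rewrite /a; clear -n0 lam0 Lam0; lra.
move=> x x' v v' [x1 _ x2] [x1' _ x2'] xx.
(* [contact_lip] wants a positive radius, so the distance of [x] and [x'] is enlarged by a small
   [ep]; for [x = x'] this still shows that the vertices agree. *)
apply/ler_addgt0Pr => e e0.
set L := K0 * nn / a; have L0 : 0 <= L by pos.
set ep := Num.min eta (e / (L + 1)).
have L1 : 0 < L + 1 by apply: ltr_wpDl.
have ep0 : 0 < ep by rewrite lt_min etap divr_gt0.
have epe : L * ep <= e.
  apply: le_trans (_ : (L + 1) * ep <= _); first by rewrite ler_wpM2r ?(ltW ep0) // lerDl.
  by rewrite mulrC -ler_pdivlMr // ge_min lexx orbT.
set r := nn * (`|x - x'| + ep).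
have r0 : 0 < r by rewrite mulr_gt0 // ltr_wpDl.
have big y : `|y - x| < 1 -> `|y| < RR.
  move=> hy; rewrite -(subrK x y); apply: le_lt_trans (ler_normD _ _) _.
  rewrite /RR -/nn; move: hy x1 n1; clear -n0 lam0 Lam0; lra.
have := @contact_lip R n lam Lam lam0 Lam0 s [set y | `|y| < RR] f a 1 r NN x x' v v' sv fp ap r0 NN1 NNb.
have c1 : NN * r < 1.
  apply: lt_le_trans (_ : NN * (nn * (2 * eta)) <= _); last by rewrite etaE; lra.
  rewrite ltr_pM2l // /r ltr_pM2l //.
  have : ep <= eta by rewrite ge_min lexx.
  by move: xx; clear -n0 lam0 Lam0; lra.
have c2 : nsq (x' - x) <= r ^+ 2.
  apply: le_trans (nsq_le_norm _) _; rewrite distrC -/nn /r exprMn.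
  apply: ler_pM; [exact: ltW|exact: sqr_ge0| |].
    by rewrite expr2 ler_peMl // ltW.
  by rewrite ler_sqr ?nnegrE ?addr_ge0 ?(ltW ep0) // lerDl ltW.
move=> /(_ c1 c2 big) H.
have {}H := H (fun y hy => x2 y (hDom _ (big _ hy))) (fun y hy => x2' y (hDom _ (big _ hy))).
have Kr : 16 * (Lam * nn * a + f) / lam * r <= K0 * r.
  rewrite ler_wpM2r ?(ltW r0) // /K0 ler_wpM2r ?invr_ge0 ?(ltW lam0) //.
  by rewrite ler_wpM2l // lerD2l.
have K1 : 0 <= 16 * (Lam * nn * a + f) / lam * r.
  apply: mulr_ge0; last exact: ltW.
  by pos.
have : (a * `|v - v'|) ^+ 2 <= (K0 * r) ^+ 2.
  apply: le_trans (_ : a ^+ 2 * nsq (v' - v) <= _).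
    by rewrite exprMn distrC ler_wpM2l ?sqr_ge0 // norm_sq_le.
  by apply: le_trans H _; rewrite ler_sqr ?nnegrE // mulr_ge0 // ltW.
move=> /(sqr_le_le (mulr_ge0 K00 (ltW r0))) H2.
apply: le_trans (_ : L * (`|x - x'| + ep) <= _).
  rewrite -(ler_pM2l ap); apply: le_trans H2 _.
  have -> : a * (L * (`|x - x'| + ep)) = K0 * r; last by [].
  by rewrite /L /r; field; rewrite gt_eqF.
by rewrite mulrDr lerD2l.
Qed.
End Growth.

(** * Counting grid cells as a substitute for measure *)

Section Content.
Variables (R : realType) (n : nat).
Local Notation V := 'rV[R]_n.
Implicit Types (x y z p v c : V) (E F K W : set V) (m k : nat).
Local Notation trunc := Num.trunc.

Lemma ev_large (B : R) : \forall m \near \oo, B <= m%:R.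
Proof.
exists (trunc `|B|).+1 => // m /= hm.
apply: le_trans (ler_norm B) _; apply: ltW.
have /andP[_ h] := truncn_itv (normr_ge0 B).
by apply: lt_le_trans h _; rewrite ler_nat.
Qed.

(* The cube [-1, 1]^n is divided into cells of side 1 / m. *)
Definition cell m x : {ffun 'I_n -> 'I_(2 * m).+1} :=
  [ffun i => inord (trunc (m%:R * (x 0 i + 1)))].

Definition hits m E := [pred i | `[< exists2 x, E x & cell m x = i >]].
(** [Nm m E] over [m ^ n] replaces the measure of [E]. It is monotone and subadditive, but its
    additivity is obtained only for sets further apart than the mesh; hence the positive distances
    and the restriction to large [m] in later statements. *)
Definition Nm m E : nat := #|hits m E|.

Lemma hitsP m E i : reflect (exists2 x, E x & cell m x = i) (i \in hits m E).
Proof. by rewrite inE; exact: asboolP. Qed.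

Lemma cellE m x i : `|x| <= 1 ->
  (cell m x i : nat) = trunc (m%:R * (x 0 i + 1)).
Proof.
move=> x1; rewrite ffunE inordK // ltnS truncn_le_nat.
have := le_trans (coord_le_norm x i) x1; rewrite ler_norml => /andP[_ hx].
apply: le_lt_trans (_ : _ <= m%:R * 2) _; first by rewrite ler_wpM2l //; lra.
by rewrite -natrM ltr_nat mulnC.
Qed.

Lemma cell_arg_ge0 m x i : `|x| <= 1 -> 0 <= m%:R * (x 0 i + 1).
Proof.
move=> x1; have := le_trans (coord_le_norm x i) x1; rewrite ler_norml => /andP[hx _].
by rewrite mulr_ge0 //; lra.
Qed.

Lemma cell_near m k x y i : `|x| <= 1 -> `|y| <= 1 -> `|x - y| * m%:R <= k%:R ->
  (cell m x i <= cell m y i + k)%N.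
Proof.
move=> x1 y1 xy; rewrite !cellE //.
have /andP[h1 _] := truncn_itv (cell_arg_ge0 m i x1).
have /andP[_ h2] := truncn_itv (cell_arg_ge0 m i y1).
have h3 : x 0 i - y 0 i <= `|x - y|.
  by have := coord_le_norm (x - y) i; rewrite !mxE; apply: le_trans; apply: ler_norm.
have h4 := ler_wpM2r (ler0n R m) h3.
rewrite -ltnS -(ltr_nat R) -addSn natrD; apply: le_lt_trans h1 _.
apply: le_lt_trans (_ : _ <= m%:R * (y 0 i + 1) + k%:R) _; last by rewrite ltrD2r.
by lra.
Qed.

Lemma cell_eq m x y : (0 < m)%N -> `|x| <= 1 -> `|y| <= 1 ->
  cell m x = cell m y -> `|x - y| <= m%:R^-1.
Proof.
move=> m0 x1 y1 xy; have mp : 0 < m%:R :> R by rewrite ltr0n.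
apply: norm_le_coord; first by rewrite invr_ge0 ltW.
move=> i; have : (cell m x i : nat) = cell m y i by rewrite xy.
rewrite !cellE // => e.
have /andP[h1 h2] := truncn_itv (cell_arg_ge0 m i x1).
have /andP[h3 h4] := truncn_itv (cell_arg_ge0 m i y1).
rewrite e in h1 h2; rewrite -[_^-1]mul1r ler_pdivlMr // !mxE.
have -> : `|x 0 i - y 0 i| * m%:R = `|m%:R * (x 0 i + 1) - m%:R * (y 0 i + 1)|.
  by rewrite -mulrBr normrM (gtr0_norm mp) mulrC; congr (_ * `|_|); ring.
by rewrite -natr1 in h2 h4; rewrite ler_norml; apply/andP; split; lra.
Qed.

Lemma Nm_mono m E F : E `<=` F -> (Nm m E <= Nm m F)%N.
Proof.
move=> EF; apply: subset_leq_card; apply/fintype.subsetP => i /hitsP[x /EF Fx <-].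
by apply/hitsP; exists x.
Qed.
Lemma Nm0 m E : (forall x, ~ E x) -> Nm m E = 0%N.
Proof.
move=> E0; apply: eq_card0 => i; apply/negP => /hitsP[x /E0 //].
Qed.
Lemma NmU m E F : (Nm m (E `|` F) <= Nm m E + Nm m F)%N.
Proof.
have -> : Nm m (E `|` F) = #|predU (mem (hits m E)) (mem (hits m F))|.
  apply: eq_card => i; rewrite inE /=; apply/hitsP/orP.
    by move=> [x [Ex|Fx] <-]; [left|right]; apply/hitsP; exists x.
  by case=> /hitsP[x ? <-]; exists x => //; [left|right].
by rewrite /Nm -cardUI leq_addr.
Qed.

(** Outside the unit cube [cell] falls back on default values of [inord] and of truncation, so
    metric statements about counts are made for sets inside it. *)
Definition window E := forall x, E x -> `|x| <= 1.

Lemma NmU_sep m E F : (0 < m)%N -> window E -> window F ->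
  (forall x y, E x -> F y -> m%:R^-1 < `|x - y|) ->
  (Nm m E + Nm m F <= Nm m (E `|` F))%N.
Proof.
move=> m0 wE wF sep; rewrite /Nm -cardUI.
rewrite [X in (_ + X)%N](_ : _ = 0%N) ?addn0; last first.
  apply: eq_card0 => i; apply/negP; rewrite inE => /andP[/hitsP[x Ex <-] /hitsP[y Fy]].
  move=> /esym /(cell_eq m0 (wE _ Ex) (wF _ Fy)).
  by rewrite leNgt sep.
apply: subset_leq_card; apply/fintype.subsetP => i; rewrite inE => /orP[] /hitsP[x Ex <-].
  by apply/hitsP; apply: (ex_intro2 _ _ x) => //; left.
by apply/hitsP; apply: (ex_intro2 _ _ x) => //; right.
Qed.

Lemma Nm_bigU m (I : finType) (A : I -> set V) E :
  (forall x, E x -> exists i, A i x) -> (Nm m E <= \sum_i Nm m (A i))%N.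
Proof.
move=> EA.
have H (s : seq I) F : (forall x, F x -> exists2 i, i \in s & A i x) ->
    (Nm m F <= \sum_(i <- s) Nm m (A i))%N.
  elim: s F => [|i s IH] F FA.
    by rewrite Nm0 // => x /FA[].
  rewrite big_cons.
  apply: leq_trans (_ : Nm m (A i `|` (F `&` [set x | ~ A i x])) <= _)%N.
    by apply: Nm_mono => x Fx; have [?|?] := pselect (A i x); [left|right].
  apply: leq_trans (NmU _ _ _) _; rewrite leq_add2l; apply: IH => x [/FA[j]].
  by rewrite inE => /orP[/eqP->|js] Ax nA //; exists j.
by apply: H => x /EA[i Ai]; exists i; rewrite ?mem_index_enum.
Qed.

Lemma Nm_bigU_sep m (I : finType) (A : I -> set V) E : (0 < m)%N -> window E ->
  (forall i x, A i x -> E x) ->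
  (forall i j x y, i != j -> A i x -> A j y -> m%:R^-1 < `|x - y|) ->
  (\sum_i Nm m (A i) <= Nm m E)%N.
Proof.
move=> m0 wE AE sep.
have H (s : seq I) : uniq s ->
    (\sum_(i <- s) Nm m (A i) <= Nm m [set x | exists2 i, i \in s & A i x])%N.
  elim: s => [|i s IH] /=; first by rewrite big_nil.
  move=> /andP[nis us]; rewrite big_cons.
  apply: leq_trans (leq_add (leqnn _) (IH us)) _.
  apply: leq_trans (NmU_sep m0 _ _ _) _.
    by move=> x /AE/wE.
    by move=> x [j _ /AE/wE].
    move=> x y Aix [j js Ajy]; apply: (sep i j) => //.
    by apply: contraNneq nis => ->.
  apply: Nm_mono => x [Ax|[j js Ax]]; first by exists i; rewrite ?mem_head.
  by exists j; rewrite ?inE ?js ?orbT.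
apply: leq_trans (H _ (index_enum_uniq I)) _.
by apply: Nm_mono => x [i _ /AE].
Qed.

Lemma near_card m k (j0 : {ffun 'I_n -> 'I_(2 * m).+1})
    (A : pred {ffun 'I_n -> 'I_(2 * m).+1}) :
  (forall j i, A j -> (j i <= j0 i + k)%N /\ (j0 i <= j i + k)%N) ->
  (#|A| <= (2 * k).+1 ^ n)%N.
Proof.
move=> hA; pose f (j : {ffun 'I_n -> 'I_(2 * m).+1}) : {ffun 'I_n -> 'I_(2 * k).+1} :=
  [ffun i => inord (j i + k - j0 i)].
have fi : {in A &, injective f}.
  move=> j j' Aj Aj' /ffunP e; apply/ffunP => i; apply/val_inj => /=.
  have [h1 h2] := hA j i Aj; have [h1' h2'] := hA j' i Aj'.
  have := congr1 (fun a : 'I_(2 * k).+1 => a : nat) (e i).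
  rewrite !ffunE !inordK; [lia| |]; rewrite ltnS; lia.
rewrite -(card_in_imset fi); apply: leq_trans (max_card _) _.
by rewrite card_ffun !card_ord.
Qed.

(** A discrete area formula. Attach to each cell hit by [W] a cell of a related point of [E]: the
    cells with the same attached cell stay within [k] steps of each other in every coordinate. *)
Lemma Nm_lip m k E W (rel : V -> V -> Prop) : (0 < m)%N -> window E -> window W ->
  (forall v, W v -> exists2 x, E x & rel x v) ->
  (forall x x' v v', E x -> E x' -> W v -> W v' -> rel x v -> rel x' v' ->
     `|x - x'| <= m%:R^-1 -> `|v - v'| * m%:R <= k%:R) ->
  (Nm m W <= (2 * k).+1 ^ n * Nm m E)%N.
Proof.
move=> m0 wE wW ex lip.
have /choice[f hf] j : exists p : V * V,
    j \in hits m W -> [/\ E p.1, W p.2, rel p.1 p.2 & cell m p.2 = j].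
  have [/hitsP[v Wv vj]|] := boolP (j \in hits m W); last by exists (0, 0).
  by have [x Ex xv] := ex v Wv; exists (x, v).
pose g j := cell m (f j).1.
rewrite /Nm -sum1_card (partition_big g (mem (hits m E))) /=; last first.
  by move=> j /hf[Ex _ _ _]; apply/hitsP; exists (f j).1.
rewrite [X in (_ <= X)%N]mulnC -sum_nat_const; apply: leq_sum => e He.
rewrite sum1dep_card.
have [[j0 /andP[H0 /eqP g0]]|hno] := pselect (exists j0, (j0 \in hits m W) && (g j0 == e)); last first.
  rewrite (_ : #|_| = 0%N) //; apply: eq_card0 => j; rewrite inE.
  by apply/negP => h; apply: hno; exists j.
rewrite cardsE; apply: (near_card (j0 := j0)) => j i /andP[Hj /eqP gj].
have [E1 W1 r1 c1] := hf _ Hj; have [E2 W2 r2 c2] := hf _ H0.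
have d : `|(f j).1 - (f j0).1| <= m%:R^-1.
  by apply: cell_eq => //; [exact: wE|exact: wE|rewrite -/(g j) gj -g0].
have d' : `|(f j0).1 - (f j).1| <= m%:R^-1 by rewrite distrC.
have ci : j i = cell m (f j).2 i by rewrite c1.
have ci0 : j0 i = cell m (f j0).2 i by rewrite c2.
rewrite ci ci0; split.
  apply: cell_near; [exact: wW|exact: wW|].
  exact: (lip _ _ _ _ E1 E2 W1 W2 r1 r2 d).
apply: cell_near; [exact: wW|exact: wW|].
exact: (lip _ _ _ _ E2 E1 W2 W1 r2 r1 d').
Qed.

(** Points of [E] are at most [2 * r] apart, so all cells lie within [k <= 2 * r * m + 1] steps of
    one of them; the factor 5 absorbs the rounding in [2 * k + 1]. *)
Lemma Nm_cube_le m E c (r : R) : window E -> 0 < r -> 5 <= r * m%:R ->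
  (forall x, E x -> `|x - c| <= r) -> (Nm m E)%:R <= (5 * r * m%:R) ^+ n.
Proof.
move=> wE r0 mr hE.
have [[x0 Ex0]|hno] := pselect (exists x, E x); last first.
  rewrite Nm0; first by rewrite exprn_ge0 // !mulr_ge0 // ltW.
  by move=> x Ex; apply: hno; exists x.
set k := (trunc (2 * r * m%:R)).+1.
have h0 : 0 <= 2 * r * m%:R by rewrite !mulr_ge0 // ltW.
have /andP[k1 k2] := truncn_itv h0.
have : (Nm m E <= (2 * k).+1 ^ n)%N.
  apply: (near_card (j0 := cell m x0)) => j i /hitsP[x Ex <-].
  have d : `|x - x0| * m%:R <= k%:R.
    apply: le_trans (ltW k2); rewrite ler_wpM2r //.
    rewrite -(subrK c x) -addrA; apply: le_trans (ler_normD _ _) _.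
    by have := hE _ Ex; have := hE _ Ex0; rewrite (distrC c); lra.
  split; first by apply: cell_near => //; exact: wE.
  by apply: cell_near; [exact: wE|exact: wE|rewrite distrC].
rewrite -(ler_nat R) natrX => h; apply: le_trans h _.
apply: lerXn2r; rewrite ?nnegrE // ?mulr_ge0 ?(ltW r0) //.
by rewrite /k -[(2 * _).+1%:R]natr1 natrM -[X in 2 * X]natr1; lra.
Qed.

Lemma Nm_cube_ge m E z (r : R) : (0 < m)%N -> window E -> 0 <= r ->
  (forall x, (forall i, z 0 i <= x 0 i <= z 0 i + r) -> E x) ->
  (r * m%:R) ^+ n <= (Nm m E)%:R.
Proof.
move=> m0 wE r0 hE; have mp : 0 < m%:R :> R by rewrite ltr0n.
have h0 : 0 <= r * m%:R by rewrite !mulr_ge0.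
set t := trunc (r * m%:R); have /andP[k1 k2] := truncn_itv h0.
(* Translates of [z] by multiples of [1 / m] lie in distinct cells, and [t.+1 ^ n] of them fit into
   the cube. *)
pose pt (k : {ffun 'I_n -> 'I_t.+1}) : V := \row_i (z 0 i + (k i)%:R / m%:R).
have Ept (k : {ffun 'I_n -> 'I_t.+1}) : E (pt k).
  apply: hE => i; rewrite mxE lerDl lerD2l divr_ge0 //=.
  rewrite ler_pdivrMr //; apply: le_trans k1.
  by rewrite ler_nat -ltnS.
have inj : injective (fun k : {ffun 'I_n -> 'I_t.+1} => cell m (pt k)).
  move=> k k' /= e; apply/ffunP => i; apply/val_inj => /=.
  have := congr1 (fun a : {ffun 'I_n -> 'I_(2 * m).+1} => (a i : nat)) e => /= {}e.
  rewrite !cellE ?wE // in e.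
  have /andP[h1 h2] := truncn_itv (cell_arg_ge0 m i (wE _ (Ept k))).
  have /andP[h3 h4] := truncn_itv (cell_arg_ge0 m i (wE _ (Ept k'))).
  have E1 (l : {ffun 'I_n -> 'I_t.+1}) : m%:R * (pt l 0 i + 1) = m%:R * (z 0 i + 1) + (l i)%:R.
    by rewrite mxE; field; rewrite gt_eqF.
  rewrite e !E1 -natr1 in h1 h2 h3 h4.
  have a1 : (k i)%:R < (k' i)%:R + 1 :> R by lra.
  have a2 : (k' i)%:R < (k i)%:R + 1 :> R by lra.
  rewrite !natr1 !ltr_nat !ltnS in a1 a2.
  by apply/eqP; rewrite eqn_leq a1 a2.
apply: le_trans (_ : (t.+1 ^ n)%:R <= _).
  by rewrite natrX lerXn2r ?nnegrE // ltW.
rewrite ler_nat; have -> : (t.+1 ^ n = #|{ffun 'I_n -> 'I_t.+1}|)%N.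
  by rewrite card_ffun !card_ord.
rewrite -(card_codom inj) /Nm; apply: subset_leq_card; apply/fintype.subsetP => i /codomP[k ->].
by apply/hitsP; exists (pt k).
Qed.
End Content.

(** * The covering argument on dyadic cubes *)

Section InkSpots.
Variables (R : realType) (n : nat).
Local Notation V := 'rV[R]_n.
(** The [D k] are increasing good sets: in the applications [s <= M ^+ k], or being touched with
    opening [5 * M ^+ k]. [grow] is the growth lemma at arbitrary place and scale. What gets
    estimated is the count of sets [K] at positive distance from [D k]. *)
Variables (D : nat -> set V) (del r0 : R) (c0 : V).
Hypotheses (Dinc : forall k, D k `<=` D k.+1) (del0 : 0 < del) (r00 : 0 < r0).
Hypothesis win : forall x, `|x - c0| <= r0 -> `|x| <= 1.
Hypothesis grow : forall k c (r : R), 0 < r -> r <= r0 ->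
  (forall x, `|x - c| <= r -> `|x - c0| <= r0) ->
  (exists2 y, D k y & `|y - c| <= 3 * r) ->
  exists2 E : set V, (forall x, E x -> D k.+1 x /\ `|x - c| <= r / 2) &
    \forall m \near \oo, del * (r * m%:R) ^+ n <= (Nm m E)%:R.
Hypothesis root : exists2 y, D 0%N y & `|y - c0| <= 3 * r0.

Let Cst : R := 5 ^+ n / del.
Let Cst0 : 0 < Cst. Proof. by rewrite /Cst; pos. Qed.

Definition child (c : V) (r : R) (sg : {ffun 'I_n -> bool}) : V :=
  c + (r / 2) *: \row_i (if sg i then 1 else -1).

Lemma child_coord c r sg i : child c r sg 0 i = c 0 i + (if sg i then r / 2 else - (r / 2)).
Proof. by rewrite !mxE; case: (sg i); rewrite ?mulr1 ?mulrN1. Qed.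

Lemma child_dist c r sg : 0 < r -> `|child c r sg - c| <= r / 2.
Proof.
move=> r0'; apply: norm_le_coord; first by pos.
move=> i; have := child_coord c r sg i; rewrite !mxE => ->.
rewrite addrC addrA addNr add0r; case: (sg i); rewrite ?normrN ger0_norm //; pos.
Qed.

Lemma child_cover c r x : 0 < r -> `|x - c| <= r -> exists sg, `|x - child c r sg| <= r / 2.
Proof.
move=> r0' hx; exists [ffun i => c 0 i <= x 0 i].
apply: norm_le_coord; first by pos.
move=> i; have := le_trans (coord_le_norm (x - c) i) hx.
have := child_coord c r [ffun i => c 0 i <= x 0 i] i; rewrite ffunE !mxE => ->.
rewrite !ler_norml => /andP[h1 h2].
by case: (leP (c 0 i) (x 0 i)) => h; apply/andP; split; lra.
Qed.

(* Dyadic cubes are subdivided as long as they meet [D k]; a cube that misses [D k],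
   but whose triple meets it, carries a definite share of [D k.+1] by [grow]. *)
Lemma ink_rec k (K : set V) (rho : R) : 0 < rho ->
  (forall x y, K x -> D k y -> rho <= `|x - y|) ->
  forall J c (r : R), 0 < r -> r <= r0 ->
  (forall x, `|x - c| <= r -> `|x - c0| <= r0) ->
  4 * r < rho * 2 ^+ J -> (exists2 y, D k y & `|y - c| <= 3 * r) ->
  exists2 E : set V, E `<=` D k.+1 &
   \forall m \near \oo, [/\ (forall x, E x -> `|x - c| <= r - m%:R^-1),
      (forall x y, E x -> D k y -> m%:R^-1 <= `|x - y|) &
      (Nm m (K `&` [set x | `|x - c| <= r]))%:R <= Cst * (Nm m E)%:R].
Proof.
move=> rho0 KD; elim=> [|J IH] c r rp rr0 sub4 rJ [y Dy yc].
  (* A cube this small whose triple meets [D k] is too close to [D k] to contain a point of [K]. *)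
  exists set0 => //; apply: filterE => m; split=> //.
  rewrite Nm0; first by apply: mulr_ge0 => //; exact: ltW.
  move=> x [Kx /= xc]; have := KD _ _ Kx Dy; rewrite leNgt => /negP; apply.
  rewrite expr0 mulr1 in rJ; apply: le_lt_trans rJ.
  rewrite -(subrK c x) -addrA; apply: le_trans (ler_normD _ _) _.
  by rewrite (distrC c); lra.
(* If the cube misses [D k], subdivision stops: [grow] finds a share of [D k.+1] in the half cube,
   at distance at least [r / 2] from [D k] and from the faces. *)
have [[y' [Dy' yc']]|hno] := pselect (exists y', D k y' /\ `|y' - c| <= r); last first.
  have [|E hE evE] := @grow k c r rp rr0 sub4; first by exists y.
  exists E; first by move=> x /hE[].
  near=> m.
  have m1 : 5 <= r * m%:R.
    rewrite mulrC -ler_pdivrMr //; near: m; exact: ev_large.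
  have mp : 0 < m%:R :> R by rewrite -(pmulr_rgt0 _ rp); lra.
  have minv : m%:R^-1 <= r / 2.
    by rewrite -[_^-1]mul1r ler_pdivrMr //; lra.
  split.
    by move=> x /hE[_ hx]; lra.
    move=> x z /hE[_ hx] Dz; apply: le_trans minv _.
    have : r < `|z - c| by rewrite ltNge; apply/negP => hz; apply: hno; exists z.
    have := ler_normD (z - x) (x - c); rewrite addrA subrK (distrC z x); lra.
  apply: le_trans (_ : (5 * r * m%:R) ^+ n <= _).
    apply: (Nm_cube_le (c := c)) => //; last by move=> x [].
    by move=> x [_ /= /sub4/win].
  have : del * (r * m%:R) ^+ n <= (Nm m E)%:R by near: m; exact: evE.
  rewrite -(ler_pM2l Cst0); apply: le_trans.
  have -> : 5 * r * m%:R = 5 * (r * m%:R) by rewrite mulrA.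
  by rewrite exprMn /Cst -mulrA mulKf // gt_eqF.
have rp2 : 0 < r / 2 by pos.
have childsub sg x : `|x - child c r sg| <= r / 2 -> `|x - c| <= r.
  move=> hx; rewrite -(subrK (child c r sg) x) -addrA.
  apply: le_trans (ler_normD _ _) _; have := child_dist c sg rp; lra.
have /choice[E hE] sg : exists E : set V, E `<=` D k.+1 /\
   \forall m \near \oo, [/\ (forall x, E x -> `|x - child c r sg| <= r / 2 - m%:R^-1),
      (forall x y, E x -> D k y -> m%:R^-1 <= `|x - y|) &
      (Nm m (K `&` [set x | `|x - child c r sg| <= r / 2]))%:R <= Cst * (Nm m E)%:R].
  have [||||E h1 h2] := IH (child c r sg) (r / 2) rp2; last by exists E.
        by lra.
    by move=> x /childsub/sub4.
    by rewrite exprS in rJ; lra.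
  exists y' => //; rewrite -(subrK c y') -addrA; apply: le_trans (ler_normD _ _) _.
  by have := child_dist c sg rp; rewrite (distrC c); lra.
exists [set x | exists sg, E sg x]; first by move=> x [sg /(hE sg).1].
near=> m.
have all sg : [/\ (forall x, E sg x -> `|x - child c r sg| <= r / 2 - m%:R^-1),
      (forall x y, E sg x -> D k y -> m%:R^-1 <= `|x - y|) &
      (Nm m (K `&` [set x | `|x - child c r sg| <= r / 2]))%:R <= Cst * (Nm m (E sg))%:R].
  by move: sg; near: m; apply: filter_forall => sg; exact: (hE sg).2.
have m0 : (0 < m)%N by near: m; exists 1%N.
have mp : 0 < m%:R^-1 :> R by rewrite invr_gt0 ltr0n.
have Ec x sg : E sg x -> `|x - c| <= r - m%:R^-1.
  move=> Ex; have [h _ _] := all sg; have {}h := h _ Ex.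
  rewrite -(subrK (child c r sg) x) -addrA.
  by apply: le_trans (ler_normD _ _) _; have := child_dist c sg rp; lra.
split.
  by move=> x [sg /Ec].
  by move=> x z [sg Ex] Dz; have [_ h _] := all sg; exact: h.
pose S1 sg := Nm m (K `&` [set x | `|x - child c r sg| <= r / 2]).
apply: le_trans (_ : (\sum_sg S1 sg)%N%:R <= _).
  rewrite ler_nat; apply: Nm_bigU => x [Kx /= /(child_cover rp)[sg hsg]].
  by exists sg.
apply: le_trans (_ : Cst * (\sum_sg Nm m (E sg))%N%:R <= _).
  rewrite !natr_sum mulr_sumr; apply: ler_sum => sg _.
  by have [_ _] := all sg.
rewrite ler_pM2l // ler_nat; apply: Nm_bigU_sep => //.
  move=> x [sg /Ec hx]; apply/win/sub4; lra.
  by move=> sg x Ex; exists sg.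
(* The margin [m^-1] kept from the faces separates the sets of sibling cubes by more than the mesh,
   so that their counts add. *)
have Ei x sg i : E sg x -> if sg i then c 0 i + m%:R^-1 <= x 0 i else x 0 i <= c 0 i - m%:R^-1.
  move=> Ex; have [h _ _] := all sg; have {h} := le_trans (coord_le_norm _ i) (h _ Ex).
  have := child_coord c r sg i; rewrite !mxE => ->; rewrite ler_norml => /andP[].
  by case: (sg i) => h1 h2; lra.
move=> sg sg' x x' ne Ex Ex'.
have [i hi] : exists i, sg i != sg' i.
  apply/existsP; apply: contraNT ne; rewrite negb_exists => /forallP h.
  by apply/eqP/ffunP => i; have := h i; rewrite negbK => /eqP.
apply: lt_le_trans (coord_le_norm _ i); rewrite !mxE.
have := Ei x sg i Ex; have := Ei x' sg' i Ex'.
move: hi; case: (sg i); case: (sg' i) => // _ h1 h2.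
  by apply: lt_le_trans (ler_norm _); lra.
by rewrite distrC; apply: lt_le_trans (ler_norm _); lra.
Unshelve. all: by end_near. Qed.

Definition ink_rate := Cst / (Cst + 1).
Lemma ink_rate_bounds : 0 < ink_rate < 1.
Proof.
have C1 : 0 < Cst + 1 by pos.
by rewrite /ink_rate; apply/andP; split; [pos|rewrite ltr_pdivrMr // mul1r ltrDl].
Qed.

(** Induction on [k]. [ink_rec] finds [E] inside [D k.+1] and away from [D k], with
    [Nm K <= Cst * Nm E]. As [K] is separated from [E], the induction hypothesis for the union
    bounds [Nm K + Nm E]; eliminating [Nm E] produces the factor [Cst / (Cst + 1)]. *)
Lemma ink_spots k (K : set V) : (forall x, K x -> `|x - c0| <= r0) ->
  (exists2 rho : R, 0 < rho & forall x y, K x -> D k y -> rho <= `|x - y|) ->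
  \forall m \near \oo, (Nm m K)%:R <= (5 * r0 * m%:R) ^+ n * ink_rate ^+ k.
Proof.
elim: k K => [|k IH] K Kc [rho rho0 Kd].
  near=> m; rewrite expr0 mulr1; apply: (Nm_cube_le (c := c0)) => //.
    by move=> x /Kc/win.
  by rewrite mulrC -ler_pdivrMr //; near: m; exact: ev_large.
have Kd' x y : K x -> D k y -> rho <= `|x - y| by move=> Kx /Dinc; exact: Kd.
have Dr : exists2 y, D k y & `|y - c0| <= 3 * r0.
  have [y Dy yc] := root; exists y => //.
  by elim: (k) => // j; apply: Dinc.
have [J hJ] : exists J, 4 * r0 < rho * 2 ^+ J.
  have h0 : 0 <= 4 * r0 / rho by pos.
  have /andP[_ h] := truncn_itv h0; exists (Num.trunc (4 * r0 / rho)).+1.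
  rewrite [rho * _]mulrC -ltr_pdivrMr //; apply: lt_trans h _.
  by rewrite -natrX ltr_nat ltn_expl.
have [E EDk evE] := ink_rec rho0 Kd' r00 (lexx _) (fun x h => h) hJ Dr.
have Ec x : E x -> `|x - c0| <= r0.
  have [m0 _ hm] := evE; have [h _ _] := hm (maxn m0 1) (leq_maxl _ _) => /h.
  by move=> hx; apply: le_trans hx _; rewrite gerDl oppr_le0 invr_ge0.
have ED : exists2 rho' : R, 0 < rho' & forall x y, E x -> D k y -> rho' <= `|x - y|.
  have [m0 _ hm] := evE; have [_ h _] := hm (maxn m0 1) (leq_maxl _ _).
  exists (maxn m0 1)%:R^-1; first by rewrite invr_gt0 ltr0n leq_max orbT.
  exact: h.
have evU : \forall m \near \oo, (Nm m (K `|` E))%:R <= (5 * r0 * m%:R) ^+ n * ink_rate ^+ k.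
  apply: IH; first by move=> x [/Kc|/Ec].
  have [rho' r0' h] := ED; exists (Num.min rho rho'); first by rewrite lt_min rho0.
  by move=> x y [Kx|Ex] Dy; rewrite ge_min; apply/orP; [left; exact: Kd'|right; exact: h].
near=> m.
have m0 : (0 < m)%N by near: m; exists 1%N.
have mrho : m%:R^-1 < rho.
  rewrite -[_^-1]mul1r ltr_pdivrMr ?ltr0n // mulrC -ltr_pdivrMr //.
  apply: lt_le_trans (_ : 1 / rho + 1 <= _); first by rewrite ltrDl.
  by near: m; exact: ev_large.
have h1 : (Nm m K + Nm m E <= Nm m (K `|` E))%N.
  apply: NmU_sep => //; [by move=> x /Kc/win|by move=> x /Ec/win|].
  by move=> x y Kx /EDk Dy; apply: lt_le_trans mrho _; exact: Kd.
have h2 : (Nm m (K `|` E))%:R <= (5 * r0 * m%:R) ^+ n * ink_rate ^+ k by near: m; exact: evU.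
have h3 : (Nm m K)%:R <= Cst * (Nm m E)%:R.
  have : [/\ (forall x, E x -> `|x - c0| <= r0 - m%:R^-1),
      (forall x y, E x -> D k y -> m%:R^-1 <= `|x - y|) &
      (Nm m (K `&` [set x | `|x - c0| <= r0]))%:R <= Cst * (Nm m E)%:R].
    by near: m; exact: evE.
  case=> _ _; apply: le_trans; rewrite ler_nat; apply: Nm_mono => x Kx.
  by split=> //; exact: Kc.
have h4 : (Nm m K)%:R + (Nm m E)%:R <= (5 * r0 * m%:R) ^+ n * ink_rate ^+ k.
  by apply: le_trans h2; rewrite -natrD ler_nat.
have C1 : 0 < Cst + 1 by pos.
rewrite exprSr mulrA /ink_rate mulrA ler_pdivlMr //.
have := ler_wpM2l (ltW Cst0) h4; rewrite -/ink_rate; lra.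
Unshelve. all: by end_near. Qed.
End InkSpots.

(** * Geometric decay for supersolutions and for touching with large opening *)

Section Decay.
Variables (R : realType) (n : nat) (lam Lam : R).
Hypotheses (lam0 : 0 < lam) (Lam0 : 0 < Lam) (n0 : (0 < n)%N).
Local Notation V := 'rV[R]_n.
Implicit Types (x y z p v c : V) (M N P Q : 'M[R]_n) (s u : V -> R).
Local Notation supS := (supS lam Lam).
Local Notation RR := (RR R n).

(** The counting form of [growth] in the cube of centre [c] and radius [r]: the vertices fill a cube
    at [z], and [Nm_lip] carries their count over to the contact points. *)
Lemma growth_content : exists a M1 f0 del : R,
  [/\ 0 < a, 1 <= M1, 0 < f0 & 0 < del] /\
  forall s (Dom : set V) (f : R) y0 c (r : R), 0 <= f -> f <= f0 ->
  visc (supS f) [set y | `|y| < RR] s -> (forall y, `|y| < RR -> Dom y) ->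
  (forall y, Dom y -> 0 <= s y) -> `|y0| <= 3 -> s y0 <= 1 -> 0 < r ->
  (forall x, `|x - c| <= r -> `|x| <= 1) ->
  \forall m \near \oo, del * (r * m%:R) ^+ n <=
    (Nm m [set X | exists x v, X = c + r *: x /\ contact s Dom a M1 2^-1 x v])%:R.
Proof.
have [a [M1 [f0 [L [eta [[a0 M10 f00 L0 eta0] H]]]]]] := growth lam0 Lam0 n0.
have np : 0 < n%:R :> R by rewrite ltr0n.
have n1 : 1 <= n%:R :> R by rewrite ler1n.
set k := (Num.trunc L).+1.
have Lk : L <= k%:R by have /andP[_ /ltW] := truncn_itv L0.
have kp : 0 < ((2 * k).+1 ^ n)%N%:R :> R by rewrite ltr0n expn_gt0.
(* A cube of side [vr] with corner [z] lies in the Euclidean ball of radius 1/8 about [z], since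
   [n * vr ^+ 2 = vr / 8]. *)
set vr : R := (8 * n%:R)^-1; have vr0 : 0 < vr by rewrite /vr; pos.
exists a, M1, f0, (vr ^+ n / ((2 * k).+1 ^ n)%N%:R); split.
  by split=> //; pos.
move=> s Dom f y0 c r fp ff0 sv hDom spos y03 sy0 r0 win.
have [z [z8 ex lip]] := H s Dom f y0 fp ff0 sv hDom spos y03 sy0.
have r1 : r != 0 by rewrite gt_eqF.
set E := [set X | _].
set W := [set Y : V | exists2 v, Y = c + r *: v & forall i, z 0 i <= v 0 i <= z 0 i + vr].
have vr8 : vr <= 8^-1 by rewrite /vr lef_pV2 ?posrE; [rewrite ler_peMr|pos|].
have hv v : (forall i, z 0 i <= v 0 i <= z 0 i + vr) -> `|v - z| <= vr.
  move=> h; apply: norm_le_coord; first exact: ltW.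
  move=> i; rewrite !mxE ler_norml; have /andP[h1 h2] := h i.
  by apply/andP; split; move: vr0 h1 h2; clear -n0 lam0 Lam0; lra.
have cube1 x : `|x| <= 1 -> `|c + r *: x| <= 1.
  move=> hx; apply: win; rewrite addrC addKr normrZ gtr0_norm //.
  by rewrite ler_piMr // ltW.
have wE : window E.
  move=> X [x [v [-> [hx _ _]]]]; apply: cube1; apply: le_trans hx _.
  by clear -n0 lam0 Lam0; lra.
have wW : window W.
  move=> Y [v -> /hv vz]; apply: cube1; rewrite -(subrK z v).
  by apply: le_trans (ler_normD _ _) _; move: vz z8 vr8; clear -n0 lam0 Lam0; lra.
near=> m.
have m0 : (0 < m)%N by near: m; exists 1%N.
have mp : 0 < m%:R :> R by rewrite ltr0n.
have meta : (r * m%:R)^-1 < eta.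
  have rm : 0 < r * m%:R by pos.
  rewrite -[_^-1]mul1r ltr_pdivrMr // mulrA mulrC -ltr_pdivrMr; last by pos.
  apply: lt_le_trans (_ : 1 / (eta * r) + 1 <= _); first by rewrite ltrDl.
  by near: m; exact: ev_large.
have H1 : (Nm m W <= (2 * k).+1 ^ n * Nm m E)%N.
  apply: (@Nm_lip _ _ m k E W (fun X Y => exists x v, [/\ X = c + r *: x, Y = c + r *: v &
     contact s Dom a M1 2^-1 x v])) => //.
    move=> Y [v Yv vz]; have [|x xv] := ex v.
      apply: le_trans (nsq_le_norm _) _.
      apply: le_trans (_ : n%:R * vr ^+ 2 <= _).
        by rewrite ler_wpM2l // ler_sqr ?nnegrE ?(ltW vr0) //; apply: hv.
      have -> : n%:R * vr ^+ 2 = 8^-1 * vr by rewrite /vr; field; rewrite gt_eqF.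
      by rewrite expr2 ler_wpM2l.
    by exists (c + r *: x); exists x, v.
  move=> _ _ _ _ _ _ _ _ [x [v [-> -> xv]]] [x' [v' [-> -> xv']]].
  have dE (p q : V) : c + r *: p - (c + r *: q) = r *: (p - q).
    by rewrite opprD addrACA subrr add0r scalerBr.
  rewrite !dE !normrZ (gtr0_norm r0) => xx.
  have xx1 : `|x - x'| <= (r * m%:R)^-1.
    by rewrite -(ler_pM2l r0) invfM mulrA mulfV // mul1r.
  have vv := lip _ _ _ _ xv xv' (le_lt_trans xx1 meta).
  apply: le_trans (_ : r * (L * `|x - x'|) * m%:R <= _).
    by rewrite ler_wpM2r ?(ltW mp) // ler_wpM2l // ltW.
  apply: le_trans (_ : L * 1 <= _); last by rewrite mulr1.
  rewrite mulrCA -mulrA ler_wpM2l // -ler_pdivlMr // mul1r; exact: xx.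
have H2 : (r * vr * m%:R) ^+ n <= (Nm m W)%:R.
  apply: (Nm_cube_ge (z := c + r *: z)) => //; first by pos.
  move=> Y hY; exists (r^-1 *: (Y - c)).
    by rewrite scalerA mulfV // scale1r addrC subrK.
  move=> i; have := hY i; rewrite !mxE => /andP[h1 h2].
  rewrite [r^-1 * _]mulrC ler_pdivlMr // ler_pdivrMr //.
  by apply/andP; split; move: h1 h2; clear -n0 lam0 Lam0; lra.
rewrite mulrAC -exprMn ler_pdivrMr //.
have -> : vr * (r * m%:R) = r * vr * m%:R by rewrite mulrCA mulrA.
by apply: le_trans H2 _; rewrite -natrM mulnC ler_nat.
Unshelve. all: by end_near. Qed.

(** [ink_spots] for the sets [s <= M ^+ k]: near a point of the set of level [j], the function
    [s / M ^+ j], rescaled, satisfies the growth lemma. The radius [(RR + 1) * r0] makes room for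
    the cubes of radius [RR * r] about all centres in use. *)
Lemma super_decay : exists M th : R, [/\ 1 <= M, 0 < th & th < 1] /\
  forall s c0 (r0 : R) y0, 0 < r0 -> (forall x, `|x - c0| <= r0 -> `|x| <= 1) ->
  visc (supS 0) [set y | `|y - c0| < (RR + 1) * r0] s ->
  (forall y, `|y - c0| < (RR + 1) * r0 -> 0 <= s y) -> `|y0 - c0| <= r0 -> s y0 <= 1 ->
  forall k (K : set V), (forall x, K x -> `|x - c0| <= r0) ->
  (exists2 rho : R, 0 < rho & forall x y, K x -> `|y - c0| < (RR + 1) * r0 ->
     s y <= M ^+ k -> rho <= `|x - y|) ->
  \forall m \near \oo, (Nm m K)%:R <= (5 * r0 * m%:R) ^+ n * th ^+ k.
Proof.
have [a [M1 [f0 [del [[a0 M10 f00 del0] H]]]]] := growth_content.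
have M1p : 0 < M1 by apply: lt_le_trans M10.
have /andP[th0 th1] := @ink_rate_bounds R n del del0.
exists M1, (ink_rate n del); split=> // s c0 r0 y0 r00 win sv spos y0c sy0 k K Kc Kd.
have RR0 : 1 <= RR + 1 by rewrite /RR lerDr; pos.
pose D k := [set y | `|y - c0| < (RR + 1) * r0 /\ s y <= M1 ^+ k].
apply: (@ink_spots R n D del r0 c0) => //.
  by move=> j y [h1 h2]; split=> //; apply: le_trans h2 _; rewrite ler_weXn2l.
  move=> j c r rp rr0 sub [y [Dy1 Dy2] yc].
  have cc0 : `|c - c0| <= r0 by apply: sub; rewrite subrr normr0 ltW.
  have Mj : 0 < (M1 ^+ j)^-1 by pos.
  have dom (x : V) : `|x| < RR -> `|c + r *: x - c0| < (RR + 1) * r0.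
    move=> hx; rewrite addrAC; apply: le_lt_trans (ler_normD _ _) _.
    rewrite normrZ gtr0_norm //.
    have : r * `|x| < r0 * RR.
      by apply: le_lt_trans (_ : r0 * `|x| < _); [rewrite ler_wpM2r|rewrite ltr_pM2l].
    by move: cc0; clear -n0 lam0 Lam0; lra.
  have sv' : visc (supS 0) [set y | `|y| < RR] (fun y => (M1 ^+ j)^-1 * s (c + r *: y) + 0).
    have := @visc_supS_affine R n lam Lam _ s c r (M1 ^+ j)^-1 0 0 rp Mj sv.
    by rewrite mulr0; move/visc_subset; apply=> x /dom.
  have := H _ [set x | `|x| < RR] 0 (r^-1 *: (y - c)) c r (lexx _) (ltW f00) sv' (fun x h => h).
  set E := [set X | exists x v, _] => HE.
  exists E; last first.
    apply: HE => //.
      by move=> x /dom/spos h /=; rewrite addr0 mulr_ge0 // ltW.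
      by rewrite normrZ gtr0_norm ?invr_gt0 // mulrC ler_pdivrMr.
      rewrite scalerA mulfV ?gt_eqF // scale1r addr0 [c + _]addrC subrK.
      by rewrite mulrC ler_pdivrMr ?mul1r //; pos.
    by move=> x /sub/win.
  move=> X [x [v [-> [hx sx _]]]]; split; last first.
    by rewrite addrC addKr normrZ gtr0_norm // ler_wpM2l // ltW.
  split; first by apply: dom; apply: le_lt_trans hx _; rewrite /RR; move: (ler0n R n); clear -n0 lam0 Lam0; lra.
  by move: sx; rewrite addr0 mulrC ler_pdivrMr -?exprS; [|pos].
exists y0; last by apply: le_trans y0c _; move: r00; clear -n0 lam0 Lam0; lra.
split; last by rewrite expr0.
  apply: le_lt_trans y0c _; rewrite ltr_pMl //.
  by rewrite /RR; move: n0; rewrite -(ltr0n R); clear -n0 lam0 Lam0; lra.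
have [rho rho0 h] := Kd; exists rho => // x y Kx [Dy1 Dy2]; exact: h.
Qed.
Lemma visc_supS_quad (O : set V) u (f b e : R) p x0 : 0 <= b ->
  visc (supS f) O u ->
  visc (supS (f + Lam * n%:R * b)) O
    (fun y => u y + (e + dot p (y - x0)) + b / 2 * nsq (y - x0)).
Proof.
move=> b0 [uc uv]; split=> [x Ox|x q M Ox [r rp h]].
  apply: contD; last first.
    by apply: (@contM _ _ (fun=> b / 2)); [exact: contK|exact: cont_nsq].
  apply: contD; first exact: uc.
  by apply: (@contD _ _ (fun=> e)); [exact: contK|exact: cont_dot].
have tch : touch u x (q - p - b *: (x - x0)) (M - b%:M).
  exists r => // y yr; have := h y yr.
  have yE : y - x0 = (x - x0) + (y - x) by rewrite [RHS]addrC addrA subrK.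
  rewrite yE; move: (x - x0) (y - x) => X w.
  by rewrite nsqD !dotE !qfE; clear -n0 lam0 Lam0; lra.
move=> P Q hP hQ MPQ.
have := uv _ _ _ Ox tch P (Q + b%:M) hP (psdqD hQ (psdq_scalar b0)).
rewrite MPQ opprD addrA => /(_ (erefl _)).
by rewrite mxtraceD tr_scalar; clear -n0 lam0 Lam0; lra.
Qed.

Definition touched u (rad b : R) x := `|x| < rad /\ exists p, forall y, `|y| < rad ->
  u x + dot p (y - x) - b / 2 * nsq (y - x) <= u y.

(** [ink_spots] for the points touched with opening [5 * M ^+ k]. Near a point touched with opening
    [b], [u] minus its paraboloid is nonnegative, vanishes at that point and is a supersolution with
    right-hand side [Lam * n * b]; paraboloids sliding below it touch [u] with a larger opening. *)
Lemma opening_decay : exists M th : R, [/\ 1 <= M, 0 < th & th < 1] /\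
  forall u, visc (supS 0) [set y | `|y| < RR + 1] u ->
  (forall y, `|y| < RR + 1 -> `|u y| <= 1) ->
  forall k (K : set V), (forall x, K x -> `|x| <= 1) ->
  (exists2 rho : R, 0 < rho & forall x y, K x -> touched u (RR + 1) (5 * M ^+ k) y ->
     rho <= `|x - y|) ->
  \forall m \near \oo, (Nm m K)%:R <= (5 * m%:R) ^+ n * th ^+ k.
Proof.
have [a [M1 [f0 [del [[a0 M10 f00 del0] H]]]]] := growth_content.
have np : 0 < n%:R :> R by rewrite ltr0n.
have n1 : 1 <= n%:R :> R by rewrite ler1n.
(* After scaling the right-hand side [Lam * n * b] to [f0], sliding with opening [a] means opening
   [a * Lam * n * b / f0] in the original variables; added to [b] this is [M * b]. *)
set M := 1 + a * Lam * n%:R / f0.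
have M1' : 1 <= M by rewrite /M lerDl; pos.
have Mp : 0 < M by apply: lt_le_trans M1'.
have /andP[th0 th1] := @ink_rate_bounds R n del del0.
exists M, (ink_rate n del); split=> // u uv u1 k K Kc Kd.
have RR5 : 5 <= RR by rewrite /RR; move: n1; clear -n0 lam0 Lam0; lra.
pose D k := [set y | touched u (RR + 1) (5 * M ^+ k) y].
suff : \forall m \near \oo, (Nm m K)%:R <= (5 * 1 * m%:R) ^+ n * ink_rate n del ^+ k.
  by apply: filterS => m; rewrite mulr1.
apply: (@ink_spots R n D del 1 0) => //.
  move=> j y [h1 [p h2]]; split=> //; exists p => z /h2; apply: le_trans.
  rewrite lerD2l lerN2 ler_wpM2r ?nsq_ge0 // ler_wpM2r ?invr_ge0 //.
  by rewrite ler_pM2l // ler_weXn2l.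
by move=> x; rewrite subr0.
  move=> j c r rp rr0 sub [y0 [y0R [p hp]] y0c].
  set b := 5 * M ^+ j in hp; have b0 : 0 < b by rewrite /b; pos.
  have cc0 : `|c| <= 1 by rewrite -[c]subr0; apply: sub; rewrite subrr normr0 ltW.
  have r1 : r != 0 by rewrite gt_eqF.
  have dom (x : V) : `|x| < RR -> `|c + r *: x| < RR + 1.
    move=> hx; apply: le_lt_trans (ler_normD _ _) _.
    rewrite normrZ gtr0_norm //.
    have : r * `|x| <= 1 * `|x| by rewrite ler_wpM2r.
    by move: cc0 hx; clear -n0 lam0 Lam0; lra.
  set ka := f0 / (r ^+ 2 * (Lam * n%:R * b)).
  have ka0 : 0 < ka by rewrite /ka; pos.
  have kaE : ka * r ^+ 2 * (Lam * n%:R * b) = f0.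
    by rewrite /ka; field; rewrite !gt_eqF.
  set s := fun y => u y + (- u y0 + dot (- p) (y - y0)) + b / 2 * nsq (y - y0).
  have spos y : `|y| < RR + 1 -> 0 <= s y.
    by move=> /hp; rewrite /s dotNl; clear -n0 lam0 Lam0; lra.
  have sv : visc (supS (0 + Lam * n%:R * b)) [set y | `|y| < RR + 1] s.
    by apply: visc_supS_quad => //; exact: ltW.
  have sv' : visc (supS f0) [set y | `|y| < RR] (fun y => ka * s (c + r *: y) + 0).
    have := @visc_supS_affine R n lam Lam _ s c r ka 0 _ rp ka0 sv.
    by rewrite add0r kaE; move/visc_subset; apply=> x /dom.
  have := H _ [set x | `|c + r *: x| < RR + 1] f0 (r^-1 *: (y0 - c)) c r (ltW f00) (lexx _) sv' dom.
  set E := [set X | exists x v, _] => HE.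
  exists E; last first.
    apply: HE => //.
        by move=> x /spos h /=; rewrite addr0 mulr_ge0 // ltW.
      by rewrite normrZ gtr0_norm ?invr_gt0 // mulrC ler_pdivrMr.
    rewrite scalerA mulfV // scale1r addr0 [c + _]addrC subrK /s subrr dot0r nsq0.
    by rewrite addr0 subrr add0r mulr0 mulr0.
      by move=> x /sub; rewrite subr0.
  move=> X [x [v [XE [hx sx hc]]]]; split; last first.
    by rewrite XE addrC addKr normrZ gtr0_norm // ler_wpM2l // ltW.
  have XR : `|X| < RR + 1.
    by rewrite XE; apply: dom; apply: le_lt_trans hx _; move: RR5; clear -n0 lam0 Lam0; lra.
  split=> //.
  exists (p - b *: (X - y0) - (a / (ka * r)) *: (x - v)) => Y YR.
  have {hc} := hc (r^-1 *: (Y - c)); rewrite /= scalerA mulfV // scale1r [c + (Y - c)]addrC subrK.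
  move=> /(_ YR); rewrite -XE !addr0.
  set w := Y - X.
  have -> : r^-1 *: (Y - c) - v = (x - v) + r^-1 *: w.
    rewrite /w XE opprD addrA [in RHS]scalerBr scalerA mulVf // scale1r.
    by rewrite [RHS]addrC addrA subrK.
  rewrite (nsqD (x - v)) nsqZ dotZr.
  have sE : s Y - s X = u Y - u X - dot p w + b * dot (X - y0) w + b / 2 * nsq w.
    rewrite /s; have -> : Y - y0 = (X - y0) + w by rewrite [RHS]addrC addrA subrK.
    by rewrite (nsqD (X - y0)) !dotNl (dotDr (X - y0)); field.
  move=> hh.
  have h1 : - (a * r^-1 * dot (x - v) w) - a / 2 * (r^-1 ^+ 2 * nsq w) <= ka * (s Y - s X).
    by move: hh; clear -n0 lam0 Lam0; lra.
  have h2 : - (a / (ka * r) * dot (x - v) w) - (a * Lam * n%:R / f0 * b) / 2 * nsq w <= s Y - s X.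
    rewrite -(ler_pM2l ka0); apply: le_trans h1.
    rewrite le_eqVlt; apply/orP; left; apply/eqP; rewrite -kaE; field.
    by rewrite !gt_eqF.
  rewrite sE in h2; rewrite !(dotDl, dotNl, dotZl) -?dotDl.
  rewrite exprS mulrCA -/b /M.
  move: h2; rewrite !(dotDl, dotNl); clear -n0 lam0 Lam0; lra.
(* Level 0: as [|u| <= 1], opening 5 makes the minimum over the unit cube a minimum over the whole
   domain. *)
set g := fun y => u y + 5 / 2 * nsq (y - 0).
set h : V -> R := fun y => `|y - 0| - 1.
have hle y : (h y <= 0) = (`|y| <= 1) by rewrite /h subr0 subr_le0.
have [||||x hx xm] := @evt_min R n h g 1 0.
    by move=> y; apply: (contB (@cont_norm _ _ 0 y) (@contK _ _ _ y)).
  by move=> y; rewrite hle.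
  move=> y; rewrite hle => hy; apply: contD.
    apply: uv.1 => /=; apply: le_lt_trans hy _.
    by move: RR5; clear -n0 lam0 Lam0; lra.
  by apply: (@contM _ _ (fun=> 5 / 2)); [exact: contK|exact: cont_nsq].
  by rewrite hle normr0.
rewrite hle in hx.
have xR : `|x| < RR + 1 by apply: le_lt_trans hx _; move: RR5; clear -n0 lam0 Lam0; lra.
exists x; last by rewrite subr0; apply: le_trans hx _; rewrite mulr1 ler1n.
split=> //; exists (- 5 *: x) => y yR.
have : g x <= g y.
  have [hy|hy] := leP `|y| 1; first by apply: xm; rewrite hle.
  apply: le_trans (_ : g 0 <= _); first by apply: xm; rewrite hle normr0.
  have := u1 _ yR; have := u1 0; rewrite normr0 => /(_ _) h0.
  have {}h0 : `|u 0| <= 1 by apply: h0; move: RR5; clear -n0 lam0 Lam0; lra.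
  have y2 : 1 <= nsq (y - 0).
    by rewrite subr0; apply: le_trans (norm_sq_le _); rewrite expr_ge1 // ltW.
  rewrite /g subrr nsq0; move: h0 y2; rewrite !ler_norml => /andP[_ a1] a2 /andP[a3 _].
  by move: a1 a2 a3; clear -n0 lam0 Lam0; lra.
  rewrite /g !subr0 expr0 mulr1; have -> : nsq y = nsq (x + (y - x)) by rewrite addrC subrK.
  by rewrite (nsqD x) dotZl; clear -n0 lam0 Lam0; lra.
by move=> x /Kc; rewrite subr0.
Qed.
End Decay.

(** * The blow-up scaling and elementary rigidity facts *)

Section Rescale.
Variables (R : realType) (n : nat).
Local Notation V := 'rV[R]_n.
Implicit Types (x y z p v c q : V) (M N P Q : 'M[R]_n) (s u : V -> R).

(** Subtracting an affine function and dividing by [r ^+ 2] leaves Hessians unchanged, so blow-ups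
    satisfy the same condition [A]. *)
Lemma visc_rescale A (O : set V) s c (r e : R) q : 0 < r -> visc A O s ->
  visc A [set y | O (c + r *: y)] (fun y => (r ^+ 2)^-1 * (s (c + r *: y) - (e + dot q y))).
Proof.
move=> r0 [sc sv]; have r1 : r != 0 by rewrite gt_eqF.
have r2 : 0 < r ^+ 2 by pos.
split=> [x Ox|x p M Ox [d d0 h]].
  apply: (@contM _ _ (fun=> (r ^+ 2)^-1)); first exact: contK.
  apply: contB; first by apply: cont_comp_affine; exact: sc.
  apply: (@contD _ _ (fun=> e)); first exact: contK.
  by apply: cont_ext (@cont_dot _ _ q 0 x) => y; rewrite subr0.
apply: (sv (c + r *: x) (r^-1 *: q + r *: p) M) => //.
exists (r * d); first by pos.
move=> Y hY; have := h (r^-1 *: (Y - c)).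
have -> : r^-1 *: (Y - c) - x = r^-1 *: (Y - (c + r *: x)).
  by rewrite opprD addrA [in RHS]scalerBr scalerA mulVf // scale1r.
rewrite normrZ gtr0_norm ?invr_gt0 // mulrC ltr_pdivrMr // mulrC => /(_ hY).
rewrite scalerA mulfV // scale1r [c + (Y - c)]addrC subrK.
have -> : dot q (r^-1 *: (Y - c)) = dot q x + r^-1 * dot q (Y - (c + r *: x)).
  rewrite -dotZr -dotDr; congr dot.
  by rewrite opprD addrA [in RHS]scalerBr scalerA mulVf // scale1r [RHS]addrC subrK.
move: (Y - _) => w; rewrite -(ler_pM2l r2) !dotE qf_scale.
set S := s (c + _) => H.
have -> : S + (r^-1 * dot q w + r * dot p w) + qf M w / 2 =
   r ^+ 2 * ((r ^+ 2)^-1 * (S - (e + dot q x)) + r^-1 * dot p w + r^-1 ^+ 2 * qf M w / 2)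
   + (e + (dot q x + r^-1 * dot q w)).
  by field; rewrite r1.
by move: H; rewrite [r ^+ 2 * ((r ^+ 2)^-1 * (s Y - _))]mulVKf ?gt_eqF //; lra.
Qed.

(** Inserting the midpoint halves the constant in the hypothesis, and this can be repeated. *)
Lemma quad_flat (E : R -> R) (C : R) :
  (forall s t : R, `|E t - E s| <= C * (t - s) ^+ 2) -> forall t : R, E t = E 0.
Proof.
move=> h t.
have H (N : nat) : forall s t : R, `|E t - E s| <= C * (t - s) ^+ 2 / 2 ^+ N.
  elim: N => [|N IH] a b; first by rewrite expr0 divr1.
  have := IH a ((a + b) / 2); have := IH ((a + b) / 2) b.
  have := ler_normD (E b - E ((a + b) / 2)) (E ((a + b) / 2) - E a); rewrite addrA subrK.
  have t0 : 0 < 2 ^+ N :> R by pos.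
  rewrite [2 ^+ N.+1]exprS; move: (2 ^+ N) t0 => q q0.
  have -> : C * (b - a) ^+ 2 / (2 * q) = 2^-1 * (C * (b - a) ^+ 2 / q).
    by field; rewrite gt_eqF.
  have -> : C * ((a + b) / 2 - a) ^+ 2 / q = 4^-1 * (C * (b - a) ^+ 2 / q).
    by field; rewrite gt_eqF.
  have -> : C * (b - (a + b) / 2) ^+ 2 / q = 4^-1 * (C * (b - a) ^+ 2 / q).
    by field; rewrite gt_eqF.
  by lra.
apply/eqP; rewrite -subr_eq0 -normr_le0; apply/ler_addgt0Pr => e e0; rewrite add0r.
set T := C * (t - 0) ^+ 2.
have T0 : 0 <= T by apply: le_trans (h 0 t).
have /andP[_ hk] := truncn_itv (divr_ge0 T0 (ltW e0)).
set k := (Num.trunc (T / e)).+1 in hk.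
apply: le_trans (H k 0 t) _; rewrite -/T ler_pdivrMr ?exprn_gt0 //.
rewrite mulrC -ler_pdivrMr //; apply: ltW; apply: lt_trans hk _.
by rewrite -natrX ltr_nat ltn_expl.
Qed.

(** The hypothesis is tested with the multiple of [D] that has the length of [d]. *)
Lemma lip_of_quad (D d : V) (K : R) : 0 < K ->
  (forall z, nsq z <= nsq d -> dot D z <= 3 * K * (nsq z + nsq d)) -> d != 0 ->
  nsq D <= (6 * K) ^+ 2 * nsq d.
Proof.
move=> K0 h d0; have dp := nsq_gt0 d0.
have [->|D0] := eqVneq D 0; first by rewrite nsq0; pos.
have Dp := nsq_gt0 D0.
set t := Num.sqrt (nsq d / nsq D).
have t2 : t ^+ 2 = nsq d / nsq D by rewrite sqr_sqrtr //; pos.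
have t0 : 0 <= t by apply: sqrtr_ge0.
have nz : nsq (t *: D) = nsq d by rewrite nsqZ t2 mulfVK // gt_eqF.
have := h (t *: D); rewrite nz lexx => /(_ isT); rewrite dotZr -/(nsq D) => H.
have : (t * nsq D) ^+ 2 <= (6 * K * nsq d) ^+ 2.
  rewrite ler_sqr ?nnegrE; [lra|pos|pos].
rewrite exprMn t2 exprMn [nsq D ^+ 2]expr2 mulrA mulfVK ?gt_eqF // [nsq d ^+ 2]expr2 mulrA.
by rewrite [_ * nsq d * nsq d]mulrC ler_pM2l // mulrC.
Qed.

Lemma lin_zero (d : V) (C de : R) : 0 < de ->
  (forall w, `|w| <= de -> dot d w <= C * nsq w) -> d = 0.
Proof.
move=> de0 h; apply: contrapT => /eqP d0; have dp := nsq_gt0 d0.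
have C1 : 0 < `|C| + 1 by pos.
have dn : 0 < `|d| + 1 by pos.
set t := Num.min (de / (`|d| + 1)) (2 * (`|C| + 1))^-1.
have t0 : 0 < t by rewrite lt_min; apply/andP; split; pos.
have := h (t *: d); rewrite normrZ gtr0_norm // dotZr nsqZ -/(nsq d).
have t1 : t * `|d| <= de.
  apply: le_trans (_ : de / (`|d| + 1) * `|d| <= _).
    by rewrite ler_wpM2r // ge_min lexx.
  by rewrite mulrAC ler_pdivrMr // ler_wpM2l ?(ltW de0) // lerDl.
move=> /(_ t1); rewrite expr2 -mulrA mulrCA ler_pM2l // mulrA.
rewrite -{1}[nsq d]mul1r ler_pM2r // => H.
have : C * t <= (`|C| + 1) * t.
  by rewrite ler_wpM2r ?(ltW t0) // (le_trans (ler_norm C)) // lerDl.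
have : (`|C| + 1) * t <= (`|C| + 1) * (2 * (`|C| + 1))^-1.
  by rewrite ler_wpM2l ?(ltW C1) // ge_min lexx orbT.
have -> : (`|C| + 1) * (2 * (`|C| + 1))^-1 = 2^-1 by field; rewrite gt_eqF.
lra.
Qed.
End Rescale.

(** * Stability of viscosity conditions under ultrafilter limits *)

Section Limits.
Variables (R : realType) (n : nat) (U : set_system nat).
Hypothesis UU : UltraFilter U.
Hypothesis oU : \oo `<=` U.
Local Notation V := 'rV[R]_n.
Implicit Types (x y z p v c q : V) (M N P Q : 'M[R]_n) (s u : V -> R).
Local Notation utends := (utends U).

Lemma U_large (B : R) : U [set k | B <= k%:R].
Proof. by apply: oU; exact: ev_large. Qed.

Lemma ulim_lip (sk : nat -> V -> R) s (B L : R) :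
  (forall y, utends (fun k => sk k y) (s y)) ->
  U [set k | forall x y, `|x| <= B -> `|y| <= B -> `|sk k x - sk k y| <= L * `|x - y|] ->
  forall x y, `|x| <= B -> `|y| <= B -> `|s x - s y| <= L * `|x - y|.
Proof.
move=> st lip x y xB yB; apply: utends_le (utends_abs _ (utendsB _ (st x) (st y))) (utends_cst _ _) _.
by apply: filterS lip => k; apply.
Qed.

(** The common Lipschitz constant reduces the cube to one representative per cell of a fine grid,
    and finitely many points are handled by the filter. *)
Lemma ulim_unif (sk : nat -> V -> R) s (B L : R) : 0 < B -> 0 <= L ->
  (forall y, utends (fun k => sk k y) (s y)) ->
  U [set k | forall x y, `|x| <= B -> `|y| <= B -> `|sk k x - sk k y| <= L * `|x - y|] ->
  forall e : R, 0 < e -> U [set k | forall y, `|y| <= B -> `|sk k y - s y| < e].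
Proof.
move=> B0 L0 st lip e e0; have slip := ulim_lip st lip.
have e4 : 0 < e / 4 by pos.
have hm : 0 <= L * B * 4 / e by pos.
have /andP[_ hk] := truncn_itv hm.
set m := (Num.trunc _).+1 in hk.
have mp : 0 < m%:R :> R by rewrite ltr0n.
have small : L * (B / m%:R) < e / 4.
  rewrite mulrA ltr_pdivrMr // -ltr_pdivrMl // invf_div.
  by rewrite mulrC mulrA.
have /choice[rep hrep] (j : {ffun 'I_n -> 'I_(2 * m).+1}) : exists y0 : V,
    forall y, `|y| <= 1 -> cell m y = j -> `|y0| <= 1 /\ cell m y0 = j.
  have [[y [y1 yj]]|hno] := pselect (exists y : V, `|y| <= 1 /\ cell m y = j).
    by exists y.
  by exists 0 => y y1 yj; exfalso; apply: hno; exists y.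
have Uall : U [set k | forall j, `|sk k (B *: rep j) - s (B *: rep j)| < e / 4].
  by apply: filter_forall => j; exact: st.
apply: filterS (filterI lip Uall) => k /= [lk ak] y yB.
have y1 : `|B^-1 *: y| <= 1.
  by rewrite normrZ gtr0_norm ?invr_gt0 // mulrC ler_pdivrMr // mul1r.
have [r1 rc] := hrep _ _ y1 erefl; set z := rep _ in r1 rc.
have zB : `|B *: z| <= B by rewrite normrZ gtr0_norm // ler_piMr // ltW.
have yz : `|y - B *: z| <= B / m%:R.
  have -> : y - B *: z = B *: (B^-1 *: y - z).
    by rewrite scalerBr scalerA mulfV ?gt_eqF // scale1r.
  rewrite normrZ gtr0_norm // ler_pM2l //.
  by apply: cell_eq; rewrite ?rc.
have h1 := lk _ _ yB zB; have h2 := slip _ _ zB yB; have h3 : `|sk k (B *: z) - s (B *: z)| < e / 4 := ak _.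
have h4 : L * `|y - B *: z| <= L * (B / m%:R) by rewrite ler_wpM2l.
have -> : sk k y - s y = (sk k y - sk k (B *: z)) + (sk k (B *: z) - s (B *: z)) + (s (B *: z) - s y) by ring.
apply: le_lt_trans (ler_normD _ _) _.
have := ler_normD (sk k y - sk k (B *: z)) (sk k (B *: z) - s (B *: z)).
by rewrite (distrC (B *: z)) in h2; move: h1 h2 h3 h4 small e0; clear -UU oU; lra.
Qed.

(** Lowering the Hessian by [ka] makes the contact strict, with a gap of order [ka * rho ^+ 2] on
    the boundary of a cube; by uniform convergence [sk k] is then touched nearby by a polynomial
    with Hessian [M - ka%:M]. The conditions [Ak k] may vary because operators will converge along
    with solutions. *)
Lemma visc_ulim (sk : nat -> V -> R) s (Ak : nat -> 'M[R]_n -> Prop) A :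
  (forall y, utends (fun k => sk k y) (s y)) ->
  (forall B : R, 0 < B -> exists2 L : R, 0 <= L & U [set k | forall x y,
     `|x| <= B -> `|y| <= B -> `|sk k x - sk k y| <= L * `|x - y|]) ->
  (forall B : R, U [set k | visc (Ak k) [set y | `|y| < B] (sk k)]) ->
  (forall M, (forall ka : R, 0 < ka -> U [set k | Ak k (M - ka%:M)]) -> A M) ->
  visc A setT s.
Proof.
move=> st lip sv cl; split=> [x _|x p M _ [r r0 h]].
  have Bp : 0 < `|x| + 1 by pos.
  have [L L0 hL] := lip _ Bp; have sl := ulim_lip st hL.
  apply: (@cont_lip _ _ _ _ L) => y yx; apply: sl; last by rewrite lerDl.
  rewrite -(subrK x y) addrC; apply: le_trans (ler_normD _ _) _.
  by rewrite lerD2l ltW.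
apply: cl => ka ka0.
set rho := r / 2; have rho0 : 0 < rho by rewrite /rho; pos.
set B := `|x| + rho; have B0 : 0 < B by rewrite /B; pos.
have inB y : `|y - x| <= rho -> `|y| <= B.
  move=> yx; rewrite -(subrK x y) addrC; apply: le_trans (ler_normD _ _) _.
  by rewrite lerD2l.
have [L L0 hL] := lip _ B0.
have e0 : 0 < ka * rho ^+ 2 / 8 by pos.
have un := ulim_unif B0 L0 st hL e0.
apply: filterS (filterI un (sv (B + 1))) => k /= [uk [kc kv]].
set g := fun y => sk k y - (dot p (y - x) + qf (M - ka%:M) (y - x) / 2).
set hh : V -> R := fun y => `|y - x| - rho.
have hle y : (hh y <= 0) = (`|y - x| <= rho) by rewrite /hh subr_le0.
have hc y : {for y, continuous hh}.
  exact: (contB (@cont_norm _ _ x y) (@contK _ _ _ y)).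
have hbd y : hh y <= 0 -> `|y| <= B by rewrite hle => /inB.
have gc y : hh y <= 0 -> {for y, continuous g}.
  move=> /hbd yB; apply: contB; first by apply: kc => /=; apply: le_lt_trans yB _; rewrite ltrDl.
  apply: (@contD _ _ _ (fun y => qf (M - ka%:M) (y - x) / 2)); first exact: cont_dot.
  by apply: (@contM _ _ _ (fun=> 2^-1)); [exact: cont_qf|exact: contK].
have hx : hh x <= 0 by rewrite hle subrr normr0 ltW.
have gx : g x < s x + ka * rho ^+ 2 / 8.
  have := uk _ (hbd _ hx); rewrite /g subrr dot0r qf_zero add0r mul0r subr0 ltr_norml => /andP[_].
  by clear -UU oU; lra.
have gb y : hh y = 0 -> s x + ka * rho ^+ 2 / 8 <= g y.
  move=> hy; have hy' : hh y <= 0 by rewrite hy.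
  have yx : `|y - x| = rho by apply/eqP; rewrite -subr_eq0 -/(hh y) hy.
  have := uk _ (hbd _ hy'); rewrite ltr_norml => /andP[h1 _].
  have := h y; rewrite yx => /(_ _) h2.
  have {}h2 := h2 ltac:(by rewrite /rho; move: r0; clear -UU oU; lra).
  have h3 : rho ^+ 2 <= nsq (y - x) by rewrite -yx norm_sq_le.
  have h4 := ler_wpM2l (ltW ka0) h3.
  by rewrite /g qfD qfN qf_scalar; move: h1 h2 h4; clear -UU oU e0; lra.
have [c [hc0 _ [d d0 gm]]] := interior_min hc hbd gc hx gx gb.
have [p' tch] := @touch_min _ _ (sk k) x c p (M - ka%:M) ltac:(by exists d).
apply: (kv c p') => //=; apply: le_lt_trans (hbd _ (ltW hc0)) _.
by rewrite ltrDl.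
Qed.
End Limits.

(** * Blow-ups with affine gradients *)

Section Tangent.
Variables (R : realType) (n : nat) (U : set_system nat).
Hypothesis UU : UltraFilter U.
Hypothesis oU : \oo `<=` U.
Local Notation V := 'rV[R]_n.
Implicit Types (x y z p v c q e a w : V).
Local Notation utends := (utends U).

Lemma dyadic_near (t : R) : 0 < t -> t <= 1 ->
  exists j : nat, (2 ^+ j)^-1 <= t /\ t < 2 * (2 ^+ j)^-1.
Proof.
move=> t0 t1.
have ex : exists j : nat, (2 ^+ j)^-1 <= t.
  have t0' : 0 <= t^-1 by pos.
  have /andP[_ h] := truncn_itv t0'; exists (Num.trunc t^-1).+1.
  rewrite -[X in _ <= X]invrK lef_pV2 ?posrE ?invr_gt0 ?exprn_gt0 //.
  by apply: ltW; apply: lt_trans h _; rewrite -natrX ltr_nat ltn_expl.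
exists (ex_minn ex); case: ex_minnP => j hj jm; split=> //.
case: j hj jm => [|j] hj jm; first by rewrite expr0 invr1; lra.
rewrite exprS invfM mulrA mulfV ?pnatr_eq0 // mul1r ltNge; apply/negP => /jm.
by rewrite ltnn.
Qed.

(** First-order expansion of the length at [(l / 2) *: e] with a quadratic error, which is the rate
    at which the cones in [tangent_pts] flatten. *)
Lemma len_le e v (l : R) : nsq e = 1 -> 0 < l -> nsq v <= (l / 2) ^+ 2 ->
  Num.sqrt (nsq ((l / 2) *: e + v)) <= l / 2 + dot e v + nsq v / l.
Proof.
move=> e1 l0 vl; have l2 : 0 <= l / 2 by pos.
have := @dot_le _ _ e v 1 (l / 2) ler01 l2.
rewrite e1 expr1n lexx => /(_ isT vl); rewrite mul1r ler_norml => /andP[h1 _].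
have h2 : 0 <= nsq v / l by pos.
have b0 : 0 <= l / 2 + dot e v + nsq v / l by lra.
rewrite -[X in _ <= X]ger0_norm // -sqrtr_sqr ler_wsqrtr //.
rewrite nsqD nsqZ e1 dotZl.
have -> : (l / 2 + dot e v + nsq v / l) ^+ 2 =
  (l / 2) ^+ 2 + l * dot e v + nsq v + (dot e v + nsq v / l) ^+ 2.
  by field; rewrite gt_eqF.
by have := sqr_ge0 (dot e v + nsq v / l); lra.
Qed.

Variables (I : finType) (K : R).
Hypothesis K0 : 0 < K.
Implicit Types (F : I -> V -> R) (G : I -> V -> V).

(** [C^{1,1}] regularity of a finite family with gradients [G], stated through Taylor remainders so
    that it passes to pointwise limits. *)
Definition C11 F G := forall i x y,
  `|F i y - F i x - dot (G i x) (y - x)| <= K * nsq (y - x).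
Definition rsF F G c (r : R) : I -> V -> R := fun i y =>
  (r ^+ 2)^-1 * (F i (c + r *: y) - (F i c + dot (r *: G i c) y)).
Definition rsG G c (r : R) : I -> V -> V := fun i y => r^-1 *: (G i (c + r *: y) - G i c).
Definition lin G i j := exists a, forall x y, G i x 0 j - G i y 0 j = dot a (x - y).

(** The expansions at [x] and at [y] are compared at the common point [x + z]. *)
Lemma C11_lip F G i x y : C11 F G -> nsq (G i x - G i y) <= (6 * K) ^+ 2 * nsq (x - y).
Proof.
move=> h; have [->|xy] := eqVneq x y; first by rewrite !subrr nsq0 mulr0.
apply: lip_of_quad => //; last by rewrite subr_eq0.
move=> z _; have := h i x (x + z); have := h i y (x + z); have := h i y x.
have -> : x + z - x = z by rewrite addrC addKr.
have -> : x + z - y = (x - y) + z by rewrite addrAC.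
have := nsqD_le (x - y) z; move: (x - y) => d hd.
rewrite !ler_norml !dotE => /andP[a1 a2] /andP[a3 a4] /andP[a5 a6].
have := ler_wpM2l (ltW K0) hd; lra.
Qed.

Lemma rsF0 F G c r i : rsF F G c r i 0 = 0.
Proof. by rewrite /rsF scaler0 addr0 dot0r addr0 subrr mulr0. Qed.
Lemma rsG0 G c r i : rsG G c r i 0 = 0.
Proof. by rewrite /rsG scaler0 addr0 subrr scaler0. Qed.

Lemma rsF_bound F G c r i y : C11 F G -> 0 < r -> `|rsF F G c r i y| <= K * nsq y.
Proof.
move=> h r0; have r2 : 0 < r ^+ 2 by pos.
have := h i c (c + r *: y); rewrite [c + _ - c]addrC addKr dotZr nsqZ => H.
rewrite /rsF normrM gtr0_norm ?invr_gt0 // mulrC ler_pdivrMr // dotZl opprD addrA.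
by rewrite mulrAC -mulrA.
Qed.

Lemma rsG_bound F G c r i y : C11 F G -> 0 < r -> nsq (rsG G c r i y) <= (6 * K) ^+ 2 * nsq y.
Proof.
move=> h r0; have r1 : r != 0 by rewrite gt_eqF.
rewrite /rsG nsqZ; have := C11_lip i (c + r *: y) c h.
rewrite [c + _ - c]addrC addKr nsqZ => H.
have r2 : 0 <= r^-1 ^+ 2 by pos.
apply: le_trans (ler_wpM2l r2 H) _.
by rewrite le_eqVlt; apply/orP; left; apply/eqP; field.
Qed.

Lemma rs_lin G c r i j a : 0 < r ->
  (forall x y, G i x 0 j - G i y 0 j = dot a (x - y)) ->
  forall x y, rsG G c r i x 0 j - rsG G c r i y 0 j = dot a (x - y).
Proof.
move=> r0 ha x y; have r1 : r != 0 by rewrite gt_eqF.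
rewrite /rsG !mxE -mulrBr.
have -> : G i (c + r *: x) 0 j - G i c 0 j - (G i (c + r *: y) 0 j - G i c 0 j) =
  G i (c + r *: x) 0 j - G i (c + r *: y) 0 j by ring.
rewrite ha opprD addrACA subrr add0r -scalerBr dotZr mulrA mulVf // mul1r //.
Qed.

(** [CC] stands for the properties that blow-ups have to keep. The radii are powers of 1/2 because
    the class in [extremal_quadratic] prescribes second differences with dyadic steps. *)
Variable CC : (I -> V -> R) -> (I -> V -> V) -> Prop.
Hypothesis CC11 : forall F G, CC F G -> C11 F G.
Hypothesis CCrs : forall F G c (j : nat), CC F G ->
  CC (rsF F G c (2 ^+ j)^-1) (rsG G c (2 ^+ j)^-1).
Hypothesis CClim : forall (Fk : nat -> I -> V -> R) (Gk : nat -> I -> V -> V) F G,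
  (forall k, CC (Fk k) (Gk k)) -> (forall k i, Fk k i 0 = 0) -> (forall k i, Gk k i 0 = 0) ->
  (forall i y, utends (fun k => Fk k i y) (F i y)) ->
  (forall i y j, utends (fun k => Gk k i y 0 j) (G i y 0 j)) -> CC F G.

(* A Lipschitz function blown up at the midpoint of two points where its slope is
   almost maximal is squeezed between two cones, hence becomes linear in the limit. *)
Lemma tangent_pts F G i0 j0 : C11 F G -> (exists x y : V, x != y) ->
  exists (la : R) (ck ek : nat -> V) (jk : nat -> nat), (forall k, nsq (ek k) = 1) /\
   forall k w, 2 * Num.sqrt (nsq w) <= k.+1%:R ->
   `|rsG G (ck k) (2 ^+ jk k)^-1 i0 w 0 j0 - la * dot (ek k) w| <= (la * nsq w + 2) / k.+1%:R.
Proof.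
move=> hC [x1 [y1 xy1]]; pose len w : R := Num.sqrt (nsq w).
have len0 w : 0 <= len w by apply: sqrtr_ge0.
have lensq w : len w ^+ 2 = nsq w by rewrite sqr_sqrtr // nsq_ge0.
pose ph x := G i0 x 0 j0.
have lenp x y : x != y -> 0 < len (x - y) by move=> xy; rewrite sqrtr_gt0 nsq_gt0 // subr_eq0.
have lenC x y : len (x - y) = len (y - x) by rewrite /len nsqC.
have phl x y : ph x - ph y <= 6 * K * len (x - y).
  apply: sqr_le_le; first by apply: mulr_ge0 => //; pos.
  rewrite exprMn lensq; apply: le_trans (C11_lip i0 x y hC).
  by have := coord_sq_le (G i0 x - G i0 y) j0; rewrite !mxE.
pose S := [set s : R | exists x y, x != y /\ s = (ph x - ph y) / len (x - y)].
have supS : has_sup S.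
  split; first by exists ((ph x1 - ph y1) / len (x1 - y1)), x1, y1.
  exists (6 * K) => s [x [y [xy ->]]]; rewrite ler_pdivrMr ?lenp //.
set la := sup S.
have la_le x y : ph x - ph y <= la * len (x - y).
  have [->|xy] := eqVneq x y; first by rewrite !subrr /len nsq0 sqrtr0 mulr0.
  rewrite -ler_pdivrMr ?lenp //; apply: sup_upper_bound => //; by exists x, y.
have la0 : 0 <= la.
  have h1 := la_le x1 y1; have h2 := la_le y1 x1; rewrite (lenC y1) in h2.
  by rewrite -(pmulr_lge0 _ (lenp _ _ xy1)); lra.
(* One half of a segment has at least the slope of the whole, so almost maximal slopes also occur
   between points at distance at most 1. *)
have halve (m : nat) x y : exists x' y', x' - y' = (2 ^+ m)^-1 *: (x - y) /\
    (2 ^+ m)^-1 * (ph x - ph y) <= ph x' - ph y'.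
  elim: m => [|m [x' [y' [e1 e2]]]].
    by exists x, y; rewrite expr0 invr1 scale1r mul1r.
  set z := y' + 2^-1 *: (x' - y').
  have zy : z - y' = 2^-1 *: (x' - y') by rewrite /z addrC addKr.
  have xz : x' - z = 2^-1 *: (x' - y').
    rewrite /z opprD addrA -[X in X - _]scale1r -scalerBl.
    by congr (_ *: _); lra.
  have sc : 2^-1 *: ((2 ^+ m)^-1 *: (x - y)) = (2 ^+ m.+1)^-1 *: (x - y).
    by rewrite scalerA exprS invfM.
  have sc' : (2 ^+ m.+1)^-1 * (ph x - ph y) = 2^-1 * ((2 ^+ m)^-1 * (ph x - ph y)).
    by rewrite exprS invfM mulrA.
  have [h|h] := leP (2^-1 * (ph x' - ph y')) (ph z - ph y').
    by exists z, y'; rewrite zy e1 sc sc'; split=> //; lra.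
  by exists x', z; rewrite xz e1 sc sc'; split=> //; lra.
(* The blow-up at a scale comparable to [l / k.+1] divides the slope defect times [l] by that scale;
   a defect of [k.+1 ^ -2] leaves an error of order [1 / k.+1]. *)
have near (k : nat) : exists x y, [/\ x != y, len (x - y) <= 1 &
    (la - (k.+1%:R ^+ 2)^-1) * len (x - y) <= ph x - ph y].
  have ep0 : 0 < (k.+1%:R ^+ 2)^-1 :> R by rewrite invr_gt0 exprn_gt0 // ltr0n.
  have [s [x [y [xy ->]]] hs] := sup_adherent ep0 supS.
  rewrite -/la in hs.
  have /andP[_ hm] := truncn_itv (len0 (x - y)).
  have [x' [y' [e1 e2]]] := halve (Num.trunc (len (x - y))).+1 x y.
  set q := 2 ^+ _ in e1 e2.
  have q0 : 0 < q by rewrite /q; pos.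
  have lq : len (x - y) <= q.
    apply: ltW; apply: lt_trans hm _; rewrite /q -natrX ltr_nat; exact: ltn_expl.
  have le' : len (x' - y') = q^-1 * len (x - y).
    by rewrite e1 /len nsqZ sqrtrM ?sqr_ge0 // sqrtr_sqr gtr0_norm // invr_gt0.
  exists x', y'; split.
      apply/negP => /eqP xy'; move/eqP: e1; rewrite xy' subrr eq_sym scaler_eq0 invr_eq0 gt_eqF //=.
      by rewrite subr_eq0 (negPf xy).
    by rewrite le' mulrC ler_pdivrMr // mul1r.
  rewrite le'; apply: le_trans e2; rewrite mulrCA ler_pM2l ?invr_gt0 //.
  by rewrite -ler_pdivlMr ?lenp // ltW.
have data (k : nat) : exists d : V * V * nat, nsq d.1.2 = 1 /\
   forall w, 2 * len w <= k.+1%:R ->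
   `|rsG G d.1.1 (2 ^+ d.2)^-1 i0 w 0 j0 - la * dot d.1.2 w| <= (la * nsq w + 2) / k.+1%:R.
  have [x [y [xy l1 sl]]] := near k.
  set l := len (x - y) in l1 sl; have l0 : 0 < l := lenp _ _ xy.
  have kp : 0 < k.+1%:R :> R by rewrite ltr0n.
  have k1 : 1 <= k.+1%:R :> R by rewrite ler1n.
  have t0 : 0 < l / k.+1%:R by pos.
  have t1 : l / k.+1%:R <= 1 by rewrite ler_pdivrMr // mul1r (le_trans l1).
  have [j [r1 r2]] := dyadic_near t0 t1.
  set r := (2 ^+ j)^-1 in r1 r2; have r0 : 0 < r by rewrite /r; pos.
  set e := l^-1 *: (x - y); set c := y + 2^-1 *: (x - y).
  have e1 : nsq e = 1.
    by rewrite nsqZ -lensq -/l -exprMn mulVf ?expr1n // gt_eqF.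
  exists (c, e, j); split=> //= w hw; rewrite -/r.
  have xyE : x - y = l *: e by rewrite scalerA mulfV ?scale1r // gt_eqF.
  have cy : c - y = (l / 2) *: e.
    by rewrite /c addrC addKr xyE scalerA mulrC.
  have xc : x - c = (l / 2) *: e.
    rewrite /c opprD addrA -[X in X - _]scale1r -scalerBl xyE scalerA.
    by congr (_ *: _); lra.
  have lenw : nsq (r *: w) <= (l / 2) ^+ 2.
    rewrite nsqZ -lensq -exprMn ler_sqr ?nnegrE; [|by apply: mulr_ge0 => //; pos|by pos].
    rewrite ler_pdivlMr // in r1; have := ler_wpM2l (ltW r0) hw; lra.
  have up := @len_le e (r *: w) l e1 l0 lenw.
  have lo := @len_le e (- (r *: w)) l e1 l0; rewrite nsqN in lo; have {}lo := lo lenw.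
  rewrite dotNr in lo; rewrite dotZr nsqZ in up lo.
  (* Maximality of [la] bounds the component from above by a cone with apex [y] and from below by
     one with apex [x]. *)
  have u1 := la_le (c + r *: w) y.
  have -> : rsG G c r i0 w 0 j0 = (ph (c + r *: w) - ph c) / r by rewrite !mxE mulrC.
  have X1 : c + r *: w - y = (l / 2) *: e + r *: w by rewrite addrAC cy.
  have X2 : x - (c + r *: w) = (l / 2) *: e - r *: w by rewrite opprD addrA xc.
  have l1' := la_le x (c + r *: w); rewrite X2 in l1'; rewrite X1 in u1.
  have u2 := la_le x c; have l2' := la_le c y.
  have lh : len ((l / 2) *: e) = l / 2.
    by rewrite /len nsqZ e1 mulr1 sqrtr_sqr ger0_norm //; pos.
  rewrite xc lh in u2; rewrite cy lh in l2'.
  set T := r ^+ 2 * nsq w / l in up lo.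
  have up' := ler_wpM2l la0 up; have lo' := ler_wpM2l la0 lo.
  set ep := (k.+1%:R ^+ 2)^-1 in sl.
  have b1 : ph (c + r *: w) - ph c <= r * (la * dot e w) + (la * T + ep * l).
    by rewrite /len in u1; move: up' u1 u2 l2' sl; clear -UU oU K0; lra.
  have b2 : - (la * T + ep * l) <= ph (c + r *: w) - ph c - r * (la * dot e w).
    by rewrite /len in l1'; move: lo' l1' u2 l2' sl; clear -UU oU K0; lra.
  have -> : (ph (c + r *: w) - ph c) / r - la * dot e w =
    (ph (c + r *: w) - ph c - r * (la * dot e w)) / r by field; rewrite gt_eqF.
  rewrite normrM [`|r^-1|]gtr0_norm ?invr_gt0 // ler_pdivrMr //.
  apply: le_trans (_ : la * T + ep * l <= _).
    by rewrite ler_norml b2 /=; move: b1; clear -UU oU K0; lra.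
  have T1 : T <= nsq w / k.+1%:R * r.
    rewrite /T ler_pdivrMr //.
    have -> : r ^+ 2 * nsq w = nsq w * r * r by ring.
    have -> : nsq w / k.+1%:R * r * l = nsq w * r * (l / k.+1%:R) by ring.
    by rewrite ler_wpM2l //; pos.
  have T2 : ep * l <= 2 / k.+1%:R * r.
    have -> : ep * l = k.+1%:R^-1 * (l / k.+1%:R) by rewrite /ep; field; rewrite gt_eqF.
    have -> : 2 / k.+1%:R * r = k.+1%:R^-1 * (2 * r) by ring.
    by rewrite ler_pM2l ?invr_gt0 // ltW.
  have T3 := ler_wpM2l la0 T1.
  have -> : (la * nsq w + 2) / k.+1%:R * r = la * (nsq w / k.+1%:R * r) + 2 / k.+1%:R * r by ring.
  exact: lerD.
have [d hd] := choice data.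
exists la, (fun k => (d k).1.1), (fun k => (d k).1.2), (fun k => (d k).2).
by split=> k; have [] := hd k.
Qed.

(** Components of the gradients that are already affine stay so under rescaling and in the limit,
    hence the components can be treated one after the other. *)
Lemma tangent_step F G i0 j0 : CC F G -> exists F' G', [/\ CC F' G', lin G' i0 j0 &
  forall i j, lin G i j -> lin G' i j].
Proof.
move=> hCC; have hC := CC11 hCC.
have [hxy|hno] := pselect (exists x y : V, x != y); last first.
  exists F, G; split=> //; exists 0 => x y.
  have -> : x = y by apply/eqP/negPn/negP => h; apply: hno; exists x, y.
  by rewrite !subrr dot0l.
have [la [ck [ek [jk [ek1 hk]]]]] := tangent_pts i0 j0 hC hxy.
pose r k : R := (2 ^+ jk k)^-1.
have r0 k : 0 < r k by rewrite /r; pos.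
pose Fk k := rsF F G (ck k) (r k); pose Gk k := rsG G (ck k) (r k).
have CCk k : CC (Fk k) (Gk k) by apply: CCrs.
have /choice[Fl hFl] (iy : I * V) : exists l, utends (fun k => Fk k iy.1 iy.2) l.
  apply: (utends_ex UU (B := K * nsq iy.2)); apply: filterE => k.
  exact: rsF_bound.
have /choice[Gl hGl] (iy : I * V) : exists l : V, forall j, utends (fun k => Gk k iy.1 iy.2 0 j) (l 0 j).
  have /choice[g hg] (j : 'I_n) : exists l, utends (fun k => Gk k iy.1 iy.2 0 j) l.
    apply: (utends_ex UU (B := 6 * K * (nsq iy.2 + 1))); apply: filterE => k /=.
    have y0 := nsq_ge0 iy.2.
    apply: sqr_le_le; first by pos.
    rewrite real_normK ?num_real //; apply: le_trans (coord_sq_le _ _) _.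
    apply: le_trans (rsG_bound (ck k) iy.1 iy.2 hC (r0 k)) _.
    rewrite [X in _ <= X]exprMn ler_wpM2l //; first by pos.
    by move: y0; move: (nsq iy.2) => t t0; rewrite sqrrD1; have := sqr_ge0 t; lra.
  by exists (\row_j g j) => j; rewrite mxE; exact: hg.
pose F' i y := Fl (i, y); pose G' i y := Gl (i, y).
have tF i y : utends (fun k => Fk k i y) (F' i y) := hFl (i, y).
have tG i y j : utends (fun k => Gk k i y 0 j) (G' i y 0 j) := hGl (i, y) j.
exists F', G'; split.
  apply: (@CClim Fk Gk) => // k i; [exact: rsF0|exact: rsG0].
  have /choice[e he] (j : 'I_n) : exists l, utends (fun k => ek k 0 j) l.
    apply: (utends_ex UU (B := 1)); apply: filterE => k /=.
    apply: sqr_le_le => //; rewrite real_normK ?num_real // expr1n -(ek1 k).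
    exact: coord_sq_le.
  have tl y : utends (fun k => Gk k i0 y 0 j0) (la * dot (\row_j e j) y).
    have t1 : utends (fun k => la * dot (ek k) y) (la * dot (\row_j e j) y).
      by apply: utendsZ => //; apply: utends_dot => // j; rewrite mxE.
    have t2 : utends (fun k => Gk k i0 y 0 j0 - la * dot (ek k) y) 0.
      apply: (@utends_sqz _ _ _ _ (fun k => (la * nsq y + 2) * k.+1%:R^-1)).
        by rewrite -(mulr0 (la * nsq y + 2)); apply: utendsZ => //; exact: utends_inv.
      apply: filterS (U_large oU (2 * Num.sqrt (nsq y))) => k /= hy.
      rewrite subr0; apply: hk; apply: le_trans hy _; rewrite ler_nat //.
    have := utendsD UU t2 t1; rewrite add0r; apply: utends_eq => //.
    by apply: filterE => k /=; rewrite subrK.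
  have GE y : G' i0 y 0 j0 = la * dot (\row_j e j) y.
    exact: utends_uniq (tG i0 y j0) (tl y).
  by exists (la *: \row_j e j) => x y; rewrite !GE !dotE; ring.
move=> i j [a ha]; exists a => x y; apply: utends_uniq (utendsB UU (tG i x j) (tG i y j)) _ => //.
apply: utends_eq (utends_cst UU _) => //; apply: filterE => k /=.
by rewrite (rs_lin (ck k) (r0 k) ha).
Qed.

Lemma tangent F G : CC F G -> exists F' G', CC F' G' /\ forall i j, lin G' i j.
Proof.
move=> hCC.
have H (l : seq (I * 'I_n)) : exists F' G', CC F' G' /\ forall i j, (i, j) \in l -> lin G' i j.
  elim: l => [|[i0 j0] l [F' [G' [h1 h2]]]]; first by exists F, G.
  have [F2 [G2 [a1 a2 a3]]] := tangent_step i0 j0 h1.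
  exists F2, G2; split=> // i j; rewrite inE => /orP[/eqP[-> ->]//|/h2]; exact: a3.
have [F' [G' [h1 h2]]] := H (enum {: I * 'I_n}).
by exists F', G'; split=> // i j; apply: h2; rewrite mem_enum.
Qed.

(** On each ray [F i] and the polynomial with the same gradient differ by a function with increments
    of second order, constant by [quad_flat]. *)
Lemma lin_quad F G i : C11 F G -> (forall j, lin G i j) ->
  exists A : 'M[R]_n, (forall y, G i y = G i 0 + y *m A) /\
   forall y, F i y = F i 0 + dot (G i 0) y + qf A y / 2.
Proof.
move=> hC hl; have [a ha] := choice hl.
pose A : 'M[R]_n := \matrix_(k, j) a j 0 k; exists A.
have GE y : G i y = G i 0 + y *m A.
  apply/rowP => j; have := ha j y 0; rewrite subr0 => h.
  have -> : G i y 0 j = G i 0 0 j + dot (a j) y by rewrite -h addrC subrK.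
  rewrite !mxE; congr (_ + _); rewrite dotC; apply: eq_bigr => k _.
  by rewrite mxE.
split=> // y.
pose E t := F i (t *: y) - t * dot (G i 0) y - t ^+ 2 * qf A y / 2.
suff : E 1 = E 0 by rewrite /E scale1r scale0r expr1n expr0n /= !mul0r !mul1r !subr0; lra.
apply: (@quad_flat _ E (K * nsq y + `|qf A y|)) => s t.
have := hC i (s *: y) (t *: y); rewrite GE -scalerBl nsqZ dotZr dotDl -scalemxAl dotZl -/(qf A y).
have := ler_norm (qf A y); have := ler_norm (- qf A y); rewrite normrN => q1 q2 H.
have -> : E t - E s = (F i (t *: y) - F i (s *: y) - (t - s) * (dot (G i 0) y + s * qf A y))
   - (t - s) ^+ 2 * (qf A y / 2) by rewrite /E; field.
apply: le_trans (ler_normD _ _) _; rewrite normrN [`|(t - s) ^+ 2 * _|]normrM.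
rewrite [`|(t - s) ^+ 2|]ger0_norm ?sqr_ge0 // [X in _ <= X]mulrDl; apply: lerD.
  by apply: le_trans H _; rewrite mulrCA mulrC.
rewrite mulrC ler_wpM2r ?sqr_ge0 // normrM ler_piMr // ger0_norm ?invr_ge0 //.
by rewrite invf_le1 // ler1n.
Qed.
End Tangent.

(** * Density points by counting *)

Section Density.
Variables (R : realType) (n : nat).
Local Notation V := 'rV[R]_n.
Implicit Types (x y z p v c w : V) (E : set V) (m k l : nat).
Local Notation trunc := Num.trunc.

Lemma geom_contra (A B : R) (L : nat) : 0 < A -> (0 < L)%N ->
  (forall k, A * L%:R ^+ k <= B * L.-1%:R ^+ k) -> False.
Proof.
case: L => // L A0 _ h; rewrite /= in h.
have b k : L%:R ^+ k * (1 + k%:R / L.+1%:R) <= L.+1%:R ^+ k :> R.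
  have Lp : 0 < L.+1%:R :> R by rewrite ltr0n.
  elim: k => [|k IH]; first by rewrite !expr0 mul0r addr0 mul1r.
  rewrite ![_ ^+ k.+1]exprSr; apply: le_trans (ler_wpM2r (ltW Lp) IH).
  rewrite -!mulrA ler_wpM2l ?exprn_ge0 // -[k.+1%:R]natr1.
  rewrite [X in _ <= X]mulrDl mulfVK ?gt_eqF // mul1r -!natr1 in Lp *.
  have -> : L%:R * (1 + (k%:R + 1) / (L%:R + 1)) = (L%:R + k%:R + 1) - (k%:R + 1) / (L%:R + 1) :> R.
    by field; rewrite gt_eqF.
  have : 0 <= (k%:R + 1) / (L%:R + 1) :> R by apply: divr_ge0; rewrite natr1.
  by lra.
case: L h b => [|L] h b; first by have := h 1%N; rewrite !expr1 mulr1 mulr0 leNgt A0.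
have H k : A * (1 + k%:R / L.+2%:R) <= B.
  have p0 : 0 < L.+1%:R ^+ k :> R by rewrite exprn_gt0 // ltr0n.
  rewrite -(ler_pM2r p0); apply: le_trans (h k).
  by rewrite -mulrA ler_pM2l // mulrC.
have := unstable.ltr_bound (B / A * L.+2%:R); set k := Num.Def.archi_bound _ => hk.
have := H k; rewrite leNgt => /negP; apply.
rewrite mulrC -ltr_pdivrMr //; rewrite -ltr_pdivlMr // in hk.
by apply: lt_trans hk _; rewrite ltrDr.
Qed.

(** If at all fine meshes every cell missed one of its [l ^ n] subcells, each refinement would
    multiply the count by at most [l ^ n - 1]; iterated, this contradicts a count of order
    [m ^ n]. *)
Lemma dense_cube E (c0 : R) l m1 : window E -> 0 < c0 -> (0 < l)%N ->
  (\forall m \near \oo, c0 * m%:R ^+ n <= (Nm m E)%:R) ->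
  exists m, [/\ (m1 <= m)%N, (0 < m)%N & exists c, forall y, (forall i, 0 <= y 0 i < 1) ->
    exists2 x, E x & `|x - (c + m%:R^-1 *: y)| <= (l * m)%:R^-1].
Proof.
case: l => // l wE cp _ [m2 _ hm2]; rewrite /= in hm2.
apply: contrapT => hno.
have step m : (m1 <= m)%N -> (0 < m)%N -> (Nm (l.+1 * m) E <= Nm m E * (l.+1 ^ n).-1)%N.
  move=> m1m m0; have mp : 0 < m%:R :> R by rewrite ltr0n.
  have lp : 0 < l.+1%:R :> R by rewrite ltr0n.
  have /choice[f hf] (a : {ffun 'I_n -> 'I_(2 * m).+1}) : exists y,
      (forall i, 0 <= y 0 i < 1) /\ forall x, E x ->
      ~ `|x - (\row_i ((a i : nat)%:R / m%:R - 1) + m%:R^-1 *: y)| <= (l.+1 * m)%:R^-1.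
    apply: contrapT => h; apply: hno; exists m; split=> //.
    exists (\row_i ((a i : nat)%:R / m%:R - 1)) => y hy; apply: contrapT => h'.
    by apply: h; exists y; split=> // x Ex hx; apply: h'; exists x.
  (* The subcell containing the point [f a], near which there is no point of [E], is not hit. *)
  pose bad a : {ffun 'I_n -> 'I_l.+1} := [ffun i => inord (trunc (l.+1%:R * f a 0 i))].
  pose g (j : {ffun 'I_n -> 'I_(2 * (l.+1 * m)).+1}) :
    {ffun 'I_n -> 'I_(2 * m).+1} * {ffun 'I_n -> 'I_l.+1} :=
    ([ffun i => inord (j i %/ l.+1)], [ffun i => inord (j i %% l.+1)]).
  have gl j i : (g j).1 i = (j i %/ l.+1)%N :> nat.
    rewrite ffunE inordK // ltnS -[X in (_ <= X)%N](mulnK _ (ltn0Sn l)).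
    by rewrite leq_div2r // -mulnA [(m * _)%N]mulnC; exact: leq_ord.
  have gr j i : (g j).2 i = (j i %% l.+1)%N :> nat by rewrite ffunE inordK // ltn_mod.
  have ginj : injective g.
    move=> j j' e; apply/ffunP => i; apply: val_inj => /=.
    by rewrite (divn_eq (j i) l.+1) (divn_eq (j' i) l.+1) -!gl -!gr e.
  rewrite /Nm -(card_imset _ ginj).
  have -> : (#|hits m E| * (l.+1 ^ n).-1 =
     #|[pred ab | (ab.1 \in hits m E) && (ab.2 != bad ab.1)]|)%N.
    rewrite -[RHS]sum1_card -(pair_big_dep (mem (hits m E)) (fun a b => b != bad a) (fun=> fun=> 1%N)) /=.
    rewrite -sum_nat_const; apply: eq_bigr => a _.
    rewrite sum1_card -[X in (X ^ _)%N]card_ord -[X in (_ ^ X)%N]card_ord -card_ffun.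
    by rewrite -(cardC1 (bad a)); apply: eq_card => b; rewrite !inE.
  apply/subset_leq_card/fintype.subsetP => ab /imsetP[j /hitsP[x Ex xj] ->].
  have x1 := wE x Ex.
  have xi i : (j i : nat)%:R <= l.+1%:R * (m%:R * (x 0 i + 1)) < (j i : nat).+1%:R.
    have := truncn_itv (cell_arg_ge0 (l.+1 * m) i x1).
    by rewrite -cellE // xj natrM -mulrA.
  have hE i : trunc (m%:R * (x 0 i + 1)) = (j i %/ l.+1)%N.
    apply: truncn_def; have /andP[h1 h2] := xi i.
    rewrite -(ler_pM2l lp) -[X in _ && X](ltr_pM2l lp) -!natrM; apply/andP; split.
      by apply: le_trans h1; rewrite ler_nat mulnC leq_trunc_div.
    by apply: lt_le_trans h2 _; rewrite ler_nat [X in (_ <= X)%N]mulnC ltn_ceil.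
  rewrite inE; apply/andP; split.
    apply/hitsP; exists x => //; apply/ffunP => i; apply: val_inj => /=.
    by rewrite cellE // hE gl.
  apply/eqP => hb; have [fy hx] := hf (g j).1; apply: (hx x Ex).
  apply: norm_le_coord; first by rewrite invr_ge0 ler0n.
  move=> i; rewrite !mxE gl.
  have bi : trunc (l.+1%:R * f (g j).1 0 i) = (j i %% l.+1)%N.
    rewrite -gr hb ffunE inordK //.
    have /andP[y0 y1] := fy i.
    rewrite -(ltr_nat R); apply: le_lt_trans (_ : l.+1%:R * f (g j).1 0 i < _).
      by have /andP[] := truncn_itv (mulr_ge0 (ltW lp) y0).
    by rewrite -[X in _ < X]mulr1 ltr_pM2l.
  have /andP[y0 y1] := fy i.
  have := truncn_itv (mulr_ge0 (ltW lp) y0); rewrite bi.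
  move: (xi i) (f (g j).1 0 i) => /andP[h1 h2] Y /andP[h3 h4].
  rewrite (divn_eq (j i) l.+1) in h1 h2.
  rewrite -!natr1 !natrD !natrM -?natr1 in h1 h2 h3 h4 lp *.
  rewrite -[X in _ <= X]mul1r ler_pdivlMr; last by pos.
  rewrite -[X in _ * X]gtr0_norm; last by pos.
  rewrite -normrM.
  have -> : (x 0 i - ((j i %/ l.+1)%N%:R / m%:R - 1 + m%:R^-1 * Y)) * (m%:R + l%:R * m%:R) =
    (l%:R + 1) * (m%:R * (x 0 i + 1)) - (j i %/ l.+1)%N%:R * (l%:R + 1) - (l%:R + 1) * Y.
    by field; rewrite gt_eqF.
  by rewrite ler_norml; apply/andP; split; lra.
pose m0 := (m1 + m2).+1.
have m0k k : (m0 <= l.+1 ^ k * m0)%N by rewrite leq_pmull // expn_gt0.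
have it k : (Nm (l.+1 ^ k * m0) E <= Nm m0 E * (l.+1 ^ n).-1 ^ k)%N.
  elim: k => [|k IH]; first by rewrite !expn0 mul1n muln1.
  rewrite expnS -mulnA; apply: leq_trans (step _ _ _) _.
      by apply: leq_trans (m0k k); rewrite /m0 leqW // leq_addr.
    by rewrite muln_gt0 expn_gt0.
  by rewrite expnSr mulnA leq_mul2r IH orbT.
apply: (@geom_contra (c0 * m0%:R ^+ n) (Nm m0 E)%:R (l.+1 ^ n)).
    by rewrite mulr_gt0 // exprn_gt0 // ltr0n.
  by rewrite expn_gt0.
move=> k; rewrite -[X in _ <= _ * X]natrX -[X in _ <= X]natrM.
apply: le_trans (_ : _ <= (Nm (l.+1 ^ k * m0) E)%:R) _.
  apply: le_trans (hm2 _ _); last by apply: leq_trans (m0k k); rewrite /m0 leqW // leq_addl.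
  rewrite -mulrA -!natrX -natrM expnMn mulnC -!expnM [(n * k)%N]mulnC //.
by rewrite ler_nat.
Qed.

(** A density point at one scale: around [c] the set rescaled by [r] is dense up to [1 / k.+1] in a
    cube of radius [k.+1 / 4]. A cube with [K * K] subcells per side, viewed at [1 / K] of its size,
    offers both a large window and a fine mesh; [c] is taken near its middle. *)
Lemma density_pt E (c0 : R) k : window E -> 0 < c0 ->
  (\forall m \near \oo, c0 * m%:R ^+ n <= (Nm m E)%:R) ->
  exists c (r : R), [/\ E c, 0 < r, r <= k.+1%:R^-1 &
    forall w, 4 * `|w| <= k.+1%:R -> exists2 w', E (c + r *: w') & `|w' - w| <= k.+1%:R^-1].
Proof.
move=> wE cp hm; pose K := k.+4; have Kp : 0 < K%:R :> R by rewrite ltr0n.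
have [m [mK m0 [c hc]]] := @dense_cube E c0 (K * K) K wE cp isT hm.
have mp : 0 < m%:R :> R by rewrite ltr0n.
have [|x0 Ex0 hx0] := hc (const_mx 2^-1); first by move=> i; rewrite mxE; lra.
pose r : R := (K * m)%:R^-1.
have r0 : 0 < r by rewrite invr_gt0 ltr0n muln_gt0.
have KV : K%:R^-1 <= k.+1%:R^-1 :> R by rewrite lef_pV2 ?posrE ?ltr0n // ler_nat /K; lia.
exists x0, r; split=> //.
  apply: le_trans KV; rewrite lef_pV2 ?posrE ?ltr0n ?muln_gt0 // ler_nat leq_pmulr //.
move=> w hw.
have rE : (K * K * m)%:R^-1 = r * K%:R^-1 by rewrite /r !natrM; field; rewrite !gt_eqF.
have mr : m%:R * r = K%:R^-1 by rewrite /r natrM; field; rewrite !gt_eqF.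
have K4 : 4 <= K%:R :> R by rewrite ler_nat.
have KV4 : K%:R^-1 <= 4^-1 :> R by rewrite lef_pV2 ?posrE.
pose y := m%:R *: (x0 + r *: w - c).
have yE : c + m%:R^-1 *: y = x0 + r *: w.
  by rewrite scalerA mulVf ?gt_eqF // scale1r addrC subrK.
have hy i : 0 <= y 0 i < 1.
  have h1 : `|m%:R * (x0 - (c + m%:R^-1 *: const_mx 2^-1)) 0 i| <= 16^-1.
    rewrite normrM gtr0_norm //.
    apply: le_trans (_ : m%:R * (K * K * m)%:R^-1 <= _).
      by rewrite ler_pM2l //; apply: le_trans hx0; exact: coord_le_norm.
    rewrite rE mulrA mr; apply: le_trans (ler_pM _ _ KV4 KV4) _; rewrite ?invr_ge0 //; lra.
  have h2 : `|m%:R * (r * w 0 i)| <= 4^-1.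
    rewrite mulrA mr normrM gtr0_norm ?invr_gt0 // mulrC ler_pdivrMr //.
    apply: le_trans (coord_le_norm _ _) _.
    have : k.+1%:R <= K%:R :> R by rewrite ler_nat /K ltnS ltnW // ltnW.
    by move: hw; clear; lra.
  rewrite !mxE in h1 *; rewrite !ler_norml in h1 h2.
  have e : m%:R * (x0 0 i - (c 0 i + m%:R^-1 / 2)) = m%:R * (x0 0 i - c 0 i) - 2^-1.
    by field; rewrite gt_eqF.
  have -> : m%:R * (x0 0 i + r * w 0 i - c 0 i) = m%:R * (x0 0 i - c 0 i) + m%:R * (r * w 0 i) by ring.
  rewrite e in h1; move: h1 h2; move: (m%:R * (x0 0 i - c 0 i)) (m%:R * (r * w 0 i)).
  move=> a b /andP[h1 h2] /andP[h3 h4]; clear -h1 h2 h3 h4.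
  by apply/andP; split; lra.
have [x Ex hx] := hc y hy; rewrite yE rE in hx.
exists (r^-1 *: (x - x0)); first by rewrite scalerA mulfV ?gt_eqF // scale1r addrC subrK.
have -> : r^-1 *: (x - x0) - w = r^-1 *: (x - (x0 + r *: w)).
  by rewrite opprD addrA scalerBr [in RHS]scalerBr scalerA mulVf ?gt_eqF // scale1r scalerBr.
have rV : 0 < r^-1 by rewrite invr_gt0.
rewrite mx_normZ (gtr0_norm rV); apply: le_trans (ler_wpM2l (ltW rV) hx) _.
by rewrite mulrA mulVf ?gt_eqF // mul1r.
Qed.
End Density.

(** * Compactness of families with bounded Taylor remainders *)

Section C11Limits.
Variables (R : realType) (n : nat).
Local Notation V := 'rV[R]_n.
Implicit Types (x y z p v c q e a w : V).
Variables (I : finType) (K : R).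
Hypothesis K0 : 0 < K.
Implicit Types (F : I -> V -> R) (G : I -> V -> V).

Definition trem F G i x y : R := F i y - F i x - dot (G i x) (y - x).

Lemma trem_rs F G c (r : R) i x y : 0 < r ->
  trem (rsF F G c r) (rsG G c r) i x y = (r ^+ 2)^-1 * trem F G i (c + r *: x) (c + r *: y).
Proof.
move=> r0; rewrite /trem /rsF /rsG.
have -> : c + r *: y - (c + r *: x) = r *: (y - x).
  by rewrite opprD addrACA subrr add0r scalerBr.
rewrite !dotE; field; by rewrite gt_eqF.
Qed.

Lemma C11_rs F G c (r : R) : 0 < r -> C11 K F G -> C11 K (rsF F G c r) (rsG G c r).
Proof.
move=> r0 h i x y; have r2 : 0 < r ^+ 2 by pos.
rewrite -/(trem _ _ i x y) trem_rs // normrM gtr0_norm ?invr_gt0 // mulrC ler_pdivrMr //.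
apply: le_trans (h i _ _) _; rewrite opprD addrACA subrr add0r -scalerBr nsqZ.
by rewrite mulrCA mulrC.
Qed.

Lemma C11_loclip F G i (B : R) : C11 K F G -> G i 0 = 0 -> 0 < B ->
  forall x y, `|x| <= B -> `|y| <= B ->
  `|F i x - F i y| <= n%:R * (6 * K * (n%:R + 1) * B + 2 * B * K) * `|x - y|.
Proof.
move=> h G0 B0 x y xB yB; have n0 : 0 <= n%:R :> R by [].
have Gy : `|G i y| <= 6 * K * (n%:R + 1) * B.
  apply: norm_le_of_nsq; first by pos.
  have := C11_lip K0 i y 0 h; rewrite G0 !subr0 => H; apply: le_trans H _.
  have -> : 6 * K * (n%:R + 1) * B = 6 * K * ((n%:R + 1) * B) by ring.
  rewrite [X in _ <= X]exprMn ler_wpM2l //; first by pos.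
  apply: le_trans (nsq_le_norm _) _; rewrite exprMn; apply: ler_pM => //.
    by have := sqr_ge0 (n%:R : R); rewrite sqrrD1; lra.
  by rewrite ler_sqr ?nnegrE // ltW.
have xy : `|x - y| <= 2 * B.
  by apply: le_trans (ler_normB _ _) _; lra.
have h1 := h i y x; have h2 := dot_norm_le (G i y) (x - y).
have h3 := nsq_le_norm (x - y).
have d0 := normr_ge0 (x - y).
have h4 : n%:R * `|G i y| * `|x - y| <= n%:R * (6 * K * (n%:R + 1) * B) * `|x - y|.
  by rewrite ler_wpM2r // ler_wpM2l.
have h5 : K * nsq (x - y) <= n%:R * (2 * B * K) * `|x - y|.
  apply: le_trans (ler_wpM2l (ltW K0) h3) _.
  have -> : K * (n%:R * `|x - y| ^+ 2) = (n%:R * K * `|x - y|) * `|x - y| by ring.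
  have -> : n%:R * (2 * B * K) * `|x - y| = (n%:R * K * `|x - y|) * (2 * B) by ring.
  by rewrite ler_wpM2l //; pos.
have -> : F i x - F i y = (F i x - F i y - dot (G i y) (x - y)) + dot (G i y) (x - y) by ring.
apply: le_trans (ler_normD _ _) _.
have -> : n%:R * (6 * K * (n%:R + 1) * B + 2 * B * K) * `|x - y| =
  n%:R * (2 * B * K) * `|x - y| + n%:R * (6 * K * (n%:R + 1) * B) * `|x - y| by ring.
by apply: lerD; [exact: le_trans h1 h5|exact: le_trans h2 h4].
Qed.

Variable (U : set_system nat).
Hypothesis UU : UltraFilter U.
Hypothesis oU : \oo `<=` U.
Local Notation utends := (utends U).

Lemma trem_ulim (Fk : nat -> I -> V -> R) (Gk : nat -> I -> V -> V) F G i x y :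
  (forall i y, utends (fun k => Fk k i y) (F i y)) ->
  (forall i y j, utends (fun k => Gk k i y 0 j) (G i y 0 j)) ->
  utends (fun k => trem (Fk k) (Gk k) i x y) (trem F G i x y).
Proof. by move=> hF hG; do 2?[apply: utendsB => //]; apply: utends_dot. Qed.

Lemma C11_ulim (Fk : nat -> I -> V -> R) (Gk : nat -> I -> V -> V) F G :
  (forall k, C11 K (Fk k) (Gk k)) ->
  (forall i y, utends (fun k => Fk k i y) (F i y)) ->
  (forall i y j, utends (fun k => Gk k i y 0 j) (G i y 0 j)) -> C11 K F G.
Proof.
move=> h hF hG i x y.
apply: (utends_le UU (utends_abs UU (trem_ulim i x y hF hG)) (utends_cst UU (K * nsq (y - x)))).
by apply: filterE => k; exact: h.
Qed.

Lemma visc_C11_ulim (A : 'M[R]_n -> Prop) (Fk : nat -> I -> V -> R) (Gk : nat -> I -> V -> V) F i :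
  (forall M, (forall ka : R, 0 < ka -> A (M - ka%:M)) -> A M) ->
  (forall k, C11 K (Fk k) (Gk k)) -> (forall k i, Gk k i 0 = 0) ->
  (forall i y, utends (fun k => Fk k i y) (F i y)) ->
  (forall k, visc A setT (Fk k i)) -> visc A setT (F i).
Proof.
move=> cl h hG hF hv; apply: (@visc_ulim _ _ U UU (fun k => Fk k i) (F i) (fun=> A) A) => //.
    move=> B B0; exists (n%:R * (6 * K * (n%:R + 1) * B + 2 * B * K)).
      by have : 0 <= n%:R :> R by []; move=> n0; pos.
    by apply: filterE => k x y; apply: (C11_loclip (h k)).
  by move=> B; apply: filterE => k; apply: visc_subset (hv k) _.
move=> M hM; apply: cl => ka ka0; have := hM ka ka0.
by move=> /filter_ex[].
Qed.
End C11Limits.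

(** * Hessians of polynomials touching a sum of supersolutions *)

Section SumLemma.
Variables (R : realType) (n : nat).
Local Notation V := 'rV[R]_n.
Implicit Types (x y z p v c q e a w : V) (M : 'M[R]_n).

Lemma cube_bounds (f : V -> R) (rho : R) : 0 <= rho ->
  (forall y, `|y| <= rho -> {for y, continuous f}) ->
  exists2 B : R, 0 <= B & forall y, `|y| <= rho -> `|f y| <= B.
Proof.
move=> r0 fc; pose h y : R := `|y - 0| - rho.
have hE y : (h y <= 0) = (`|y| <= rho) by rewrite /h subr0 subr_le0.
have hc y : {for y, continuous h} by exact: (contB (@cont_norm _ _ 0 y) (@contK _ _ _ y)).
have hb y : h y <= 0 -> `|y| <= rho by rewrite hE.
have h0 : h 0 <= 0 by rewrite hE normr0.
have fc' y : h y <= 0 -> {for y, continuous f} by move=> /hb/fc.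
have [a _ ha] := evt_min hc hb fc' h0.
have [b _ hbb] := evt_min hc hb (fun y hy => contN (fc' y hy)) h0.
exists (`|f a| + `|f b|); first by pos.
move=> y yr; rewrite -hE in yr; have := ha y yr; have := hbb y yr.
have := ler_norm (f b); have := ler_norm (- f a); rewrite normrN.
have := normr_ge0 (f a); have := normr_ge0 (f b).
by rewrite ler_norml => *; apply/andP; split; lra.
Qed.

(** [fe x] is the minimum of [f y + k * nsq (x - y)] over a cube. A minimiser [Y x] competes at
    every other point, whence semiconcavity. A polynomial touching [fe] at [x], translated by
    [Y x - x], touches [f] at [Y x], so the condition [A] is inherited. *)
Lemma inf_convolution (A : 'M[R]_n -> Prop) (O : set V) (f : V -> R) (rho eta : R) :
  0 < rho -> 0 < eta -> visc A O f -> (forall y, `|y| <= rho -> O y) ->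
  exists2 k0 : R, 0 < k0 & forall k : R, k0 <= k -> exists (fe : V -> R) (g : V -> V),
   [/\ forall x z, fe z <= fe x + dot (g x) (z - x) + k * nsq (z - x),
       forall x, `|x| <= rho -> fe x <= f x,
       forall x, `|x| <= rho -> f x - eta <= fe x &
       visc A [set x | `|x| < 3 / 4 * rho] fe].
Proof.
move=> r0 e0 [fc fv] hO.
have fc' y : `|y| <= rho -> {for y, continuous f} by move=> /hO/fc.
have [B B0 hB] := cube_bounds (ltW r0) fc'.
have fc0 y : `|y - 0| <= rho -> {for y, continuous f} by rewrite subr0; exact: fc'.
have [d d0 hd] := unif_cont fc0 e0.
pose d1 := Num.min d (rho / 8).
have d10 : 0 < d1 by rewrite /d1 lt_min d0 /=; pos.
have k00 : 0 < (2 * B + 1) / d1 ^+ 2 by pos.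
(* As [|f| <= B], minimality forces [k * nsq (x - Y x) <= 2 * B], so such a [k] brings [Y x] within
   [d1] of [x]. *)
exists ((2 * B + 1) / d1 ^+ 2) => // k hk; have kp : 0 < k by exact: lt_le_trans hk.
pose h y : R := `|y - 0| - rho.
have hE y : (h y <= 0) = (`|y| <= rho) by rewrite /h subr0 subr_le0.
have hc y : {for y, continuous h} by exact: (contB (@cont_norm _ _ 0 y) (@contK _ _ _ y)).
have hb y : h y <= 0 -> `|y| <= rho by rewrite hE.
have h0 : h 0 <= 0 by rewrite hE normr0 ltW.
have /choice[Y hY] x : exists Y, `|Y| <= rho /\ forall y, `|y| <= rho ->
    f Y + k * nsq (x - Y) <= f y + k * nsq (x - y).
  have gc y : h y <= 0 -> {for y, continuous (fun y => f y + k * nsq (x - y))}.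
    move=> /hb/fc' fy; apply: contD => //.
    apply: (@cont_ext _ _ (fun y => k * nsq (y - x))); first by move=> z; rewrite nsqC.
    by apply: (@contM _ _ (fun=> k)); [exact: contK|exact: cont_nsq].
  have [c hc1 hc2] := evt_min hc hb gc h0.
  by exists c; split; [exact: hb|move=> y; rewrite -hE; exact: hc2].
pose fe x := f (Y x) + k * nsq (x - Y x); pose g x := (2 * k) *: (x - Y x).
have semi x z : fe z <= fe x + dot (g x) (z - x) + k * nsq (z - x).
  have [Yx _] := hY x; have [_ hz] := hY z; apply: le_trans (hz _ Yx) _.
  rewrite /fe /g; have -> : z - Y x = (x - Y x) + (z - x) by rewrite [RHS]addrC addrA subrK.
  by rewrite (nsqD (x - Y x)) dotZl le_eqVlt; apply/orP; left; apply/eqP; ring.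
have le1 x : `|x| <= rho -> fe x <= f x.
  by move=> xr; have [_ H] := hY x; have := H x xr; rewrite subrr nsq0 mulr0 addr0.
have near x : `|x| <= rho -> `|x - Y x| < d1.
  move=> xr; have [Yx H] := hY x; apply: norm_lt_of_nsq; first exact: ltW.
  have := le1 x xr; rewrite /fe => h1.
  have := hB _ xr; have := hB _ Yx; rewrite !ler_norml => /andP[a1 a2] /andP[a3 a4].
  have k2 : (2 * B + 1) <= k * d1 ^+ 2 by rewrite -ler_pdivrMr // exprn_gt0.
  by rewrite -(ltr_pM2l kp); move: h1 a1 a4 k2; clear; lra.
exists fe, g; split=> //.
  move=> x xr; have [Yx _] := hY x.
  have : `|f x - f (Y x)| < eta.
    apply: hd; rewrite ?subr0 //; apply: lt_le_trans (near x xr) _.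
    by rewrite /d1 ge_min lexx.
  rewrite ltr_norml /fe => /andP[_]; have := nsq_ge0 (x - Y x) => q0.
  by have : 0 <= k * nsq (x - Y x) by [pos]; lra.
split=> [x _|x p M /= xr [r rp ht]].
  set C := n%:R * (2 * k * (`|x| + 1 + rho)) + n%:R * k.
  apply: (@cont_lip _ _ _ _ C) => y yx.
  have gb z : `|z| <= `|x| + 1 -> `|g z| <= 2 * k * (`|x| + 1 + rho).
    move=> zx; have [Yz _] := hY z; rewrite /g mx_normZ ger0_norm; last by pos.
    rewrite ler_pM2l; last by pos.
    by apply: le_trans (ler_normB _ _) _; apply: lerD.
  have q1 : k * nsq (y - x) <= n%:R * k * `|y - x|.
    rewrite mulrAC [n%:R * _ * _]mulrC ler_pM2l //; apply: le_trans (nsq_le_norm _) _.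
    by rewrite ler_wpM2l // expr2 ler_piMl // ltW.
  have db z w : `|z| <= `|x| + 1 -> `|w| = `|y - x| ->
     `|dot (g z) w| <= n%:R * (2 * k * (`|x| + 1 + rho)) * `|y - x|.
    move=> zx <-; apply: le_trans (dot_norm_le _ _) _.
    by rewrite ler_wpM2r // ler_wpM2l // gb.
  have yB : `|y| <= `|x| + 1.
    by rewrite -(subrK x y) addrC; apply: le_trans (ler_normD _ _) _; rewrite lerD2l ltW.
  have := db x (y - x) ltac:(by rewrite lerDl) erefl.
  have := db y (x - y) yB (distrC _ _).
  have := semi x y; have := semi y x; rewrite (nsqC x y) !ler_norml /C mulrDl.
  move=> s1 s2 /andP[t1 t2] /andP[t3 t4]; apply/andP; split.
    by move: s1 t2 q1; clear; lra.
  by move: s2 t4 q1; clear; lra.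
have xr' : `|x| <= rho by apply: ltW; apply: lt_le_trans xr _; move: r0; clear; lra.
have nY := near x xr'; have [Yx HY] := hY x.
have Yr : `|Y x| < rho.
  have -> : Y x = x - (x - Y x) by rewrite subKr.
  apply: le_lt_trans (ler_normB _ _) _.
  have : d1 <= rho / 8 by rewrite /d1 ge_min lexx orbT.
  by move: xr nY r0; clear; lra.
apply: (fv (Y x) p M); first exact: hO.
exists (Num.min r (rho - `|Y x|)); first by rewrite lt_min rp subr_gt0.
move=> y; rewrite lt_min => /andP[y1 y2].
have yr : `|y| <= rho.
  rewrite -(subrK (Y x) y); apply: le_trans (ler_normD _ _) _.
  by move: y2; clear; lra.
have [_ Hz] := hY (x + (y - Y x)).
have := ht (x + (y - Y x)); rewrite [x + _ - x]addrC addKr => /(_ y1) h1.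
have := Hz y yr; rewrite -/(fe _).
have -> : x + (y - Y x) - y = x - Y x by rewrite addrA addrAC addrK.
by move: h1; rewrite /fe; clear; lra.
Qed.

(* The contact points of an [h] that is semiconcave with the planes of small slope:
   the slope is a Lipschitz function of the contact point, so there are many of these. *)
Lemma contact_content (h : V -> R) (a : V -> V) (K rho ga : R) :
  0 < K -> 0 < rho -> rho <= 1 -> 0 < ga -> ga <= 1 ->
  (forall x, `|x| <= rho / 2 -> {for x, continuous h}) ->
  (forall x z, h z <= h x + dot (a x) (z - x) + K * nsq (z - x)) ->
  (forall y, rho / 4 <= `|y| -> `|y| <= rho / 2 -> h 0 + n%:R * ga * `|y| < h y) ->
  exists2 c0 : R, 0 < c0 & \forall m \near \oo, c0 * m%:R ^+ n <=
    (Nm m [set x | `|x| <= rho / 4 /\ forall y, `|y| <= rho / 2 -> h x + dot (a x) (y - x) <= h y])%:R.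
Proof.
move=> K0 r0 r1 g0 g1 hc semi grow.
set E := [set x | _].
have n0 : 0 <= n%:R :> R by [].
pose W : set V := [set p | `|p| <= ga].
have wE : window E by move=> x [xr _]; apply: le_trans xr _; move: r1; clear; lra.
have wW : window W by move=> p /= hp; apply: le_trans hp g1.
(* Every small slope occurs: by [grow] the minimum of [h] minus the linear function of slope [p]
   lies in the inner cube, and semiconcavity identifies [p] with [a x] there. *)
have ex p : W p -> exists2 x, E x & p = a x.
  move=> /= pg.
  pose d y : R := `|y - 0| - rho / 2.
  have dE y : (d y <= 0) = (`|y| <= rho / 2) by rewrite /d subr0 subr_le0.
  have dc y : {for y, continuous d} by exact: (contB (@cont_norm _ _ 0 y) (@contK _ _ _ y)).
  have db y : d y <= 0 -> `|y| <= rho / 2 by rewrite dE.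
  have d0 : d 0 <= 0 by rewrite dE normr0; pos.
  have gc y : d y <= 0 -> {for y, continuous (fun y => h y - dot p (y - 0))}.
    by move=> /db/hc hy; apply: contB => //; exact: cont_dot.
  have [x xd hx] := evt_min dc db gc d0; have {}xd := db x xd.
  have hx' y : `|y| <= rho / 2 -> h x + dot p (y - x) <= h y.
    by move=> yr; have := hx y; rewrite dE yr => /(_ isT); rewrite !dotE; clear; lra.
  have xr : `|x| <= rho / 4.
    rewrite leNgt; apply/negP => xr; have := grow x (ltW xr) xd.
    have := hx' 0; rewrite normr0 => /(_ ltac:(by pos)); rewrite sub0r dotNr.
    have := dot_norm_le p x; rewrite ler_norml => /andP[_ e1].
    have : n%:R * `|p| * `|x| <= n%:R * ga * `|x| by rewrite ler_wpM2r // ler_wpM2l.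
    by move: e1; clear; lra.
  have pa : p = a x.
    apply/eqP; rewrite -subr_eq0; apply/eqP; apply: (@lin_zero _ _ _ K (rho / 4)); first by pos.
    move=> w wr; have := hx' (x + w); have := semi x (x + w).
    rewrite [x + w - x]addrC addKr => s1 s2.
    have : `|x + w| <= rho / 2 by apply: le_trans (ler_normD _ _) _; move: xr wr; clear; lra.
    by move=> /s2; move: s1; rewrite !dotE; clear; lra.
  by exists x => //; split=> // y /hx'; rewrite pa.
have lip x x' : E x -> E x' -> (n%:R + 1) * `|x - x'| <= rho / 4 ->
    `|a x - a x'| <= 6 * K * (n%:R + 1) * `|x - x'|.
  move=> [xr Ex] [xr' Ex'] xx.
  have [->|ne] := eqVneq x x'; first by rewrite !subrr normr0 mulr0.
  set d := x - x' in xx *.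
  have nd : nsq d <= ((n%:R + 1) * `|d|) ^+ 2.
    apply: le_trans (nsq_le_norm _) _; rewrite exprMn ler_wpM2r ?sqr_ge0 //.
    by have := sqr_ge0 (n%:R : R); rewrite sqrrD1; lra.
  have : nsq (a x - a x') <= (6 * K) ^+ 2 * nsq d.
    apply: lip_of_quad => //; last by rewrite subr_eq0.
    move=> z zd.
    have zr : `|x + z| <= rho / 2.
      apply: le_trans (ler_normD _ _) _.
      have : `|z| <= (n%:R + 1) * `|d|.
        apply: norm_le_of_nsq; first by pos.
        exact: le_trans zd nd.
      by move: xr xx; clear; lra.
    have := Ex _ zr; have := semi x' (x + z).
    have := Ex' x ltac:(by move: xr r0; clear; lra).
    have -> : x + z - x = z by rewrite addrC addKr.
    have -> : x + z - x' = d + z by rewrite addrAC.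
    rewrite -/d; have := ler_wpM2l (ltW K0) (nsqD_le d z).
    have : 0 <= K * nsq d by pos.
    have : 0 <= K * nsq z by pos.
    by rewrite !dotE; clear; lra.
  move=> H; apply: norm_le_of_nsq; first by pos.
  apply: le_trans H _; rewrite -mulrA [X in _ <= X]exprMn ler_wpM2l //; pos.
have := unstable.ltr_bound (6 * K * (n%:R + 1)); set k := Num.Def.archi_bound _ => hk.
have kp : 0 < (2 * k).+1%:R :> R by rewrite ltr0n.
exists (ga ^+ n / (2 * k).+1%:R ^+ n); first by pos.
near=> m.
have mr : 4 * (n%:R + 1) / rho <= m%:R by near: m; exact: ev_large.
have m1 : (1 : R) <= m%:R by near: m; exact: ev_large.
have mp : 0 < m%:R :> R by apply: lt_le_trans m1.
have m0 : (0 < m)%N by rewrite -(ltr_nat R).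
have : (Nm m W <= (2 * k).+1 ^ n * Nm m E)%N.
  apply: (@Nm_lip _ _ m k E W (fun x p => p = a x)) => //.
  move=> x x' p p' Ex Ex' _ _ -> -> xx.
  have xx' : (n%:R + 1) * `|x - x'| <= rho / 4.
    apply: le_trans (_ : (n%:R + 1) * m%:R^-1 <= _); first by rewrite ler_wpM2l //; pos.
    by rewrite ler_pdivrMr //; rewrite ler_pdivrMr // in mr; move: mr; clear; lra.
  apply: le_trans (ler_wpM2r (ltW mp) (lip x x' Ex Ex' xx')) _.
  apply: le_trans (ltW hk).
  apply: le_trans (_ : 6 * K * (n%:R + 1) * (`|x - x'| * m%:R) <= _); first by rewrite mulrA.
  rewrite ler_piMr //; first by pos.
  by rewrite -ler_pdivlMr // mul1r.
rewrite -(ler_nat R) natrM natrX => H1.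
have H2 : (ga * m%:R) ^+ n <= (Nm m W)%:R.
  apply: (@Nm_cube_ge _ _ m W 0) => //; first exact: ltW.
  move=> x hx /=; apply: norm_le_coord; first exact: ltW.
  move=> i; have /andP[] := hx i; rewrite mxE add0r => x0 x1.
  by rewrite ger0_norm.
rewrite mulrAC ler_pdivrMr ?exprn_gt0 // -exprMn mulrC [X in _ <= X]mulrC.
by apply: le_trans H1; rewrite mulrC.
Unshelve. all: by end_near.
Qed.

Lemma cont_sum (J : finType) (f : J -> V -> R) x : (forall i, {for x, continuous (f i)}) ->
  {for x, continuous (fun y => \sum_i f i y)}.
Proof.
move=> fc; elim: (index_enum J) => [|i s IH].
  by apply: (@cont_ext _ _ (fun=> 0)); [move=> y; rewrite big_nil|exact: contK].
apply: (@cont_ext _ _ (fun y => f i y + \sum_(j <- s) f j y)); last exact: contD.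
by move=> y; rewrite big_cons.
Qed.

Lemma free_ultrafilter : exists U : set_system nat, UltraFilter U /\ \oo `<=` U.
Proof. by have [U [UU h]] := ultraFilterLemma eventually_filter; exists U. Qed.

Lemma utends_cont (U : set_system nat) (f : V -> R) (wk : nat -> V) y :
  UltraFilter U -> \oo `<=` U -> {for y, continuous f} ->
  U [set k | `|wk k - y| <= k.+1%:R^-1] -> utends U (fun k => f (wk k)) (f y).
Proof.
move=> UU oU /contP fc hw e e0; have [d d0 hd] := fc e e0.
have hi : U [set k | `|k.+1%:R^-1 - 0 : R| < d] by exact: utends_inv.
apply: filterS (filterI hw hi) => k /= [h1 h2].
apply: hd; apply: le_lt_trans h1 _; move: h2; rewrite subr0.
by apply: le_lt_trans; exact: ler_norm.
Qed.

Variables (I : finType) (A : I -> 'M[R]_n -> Prop).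
Hypothesis clA : forall i M, (forall ka : R, 0 < ka -> A i (M - ka%:M)) -> A i M.

(** The last condition says that at every point the sum is touched from below, globally, by a
    polynomial with Hessian [M]; unlike contact at a single point this survives blow-ups at
    arbitrary centres. *)
Definition super_tuple (K : R) M (F : I -> V -> R) (G : I -> V -> V) :=
  [/\ C11 K F G, forall i, visc (A i) setT (F i) &
      forall x y, qf M (y - x) / 2 <= \sum_i trem F G i x y].

(** After [tangent] all [F i] are quadratic polynomials. Each touches itself, so its Hessian lies in
    [A i], and the inequality between remainders becomes one between quadratic forms. *)
Lemma quad_tuple (K : R) M F G : 0 < K -> super_tuple K M F G ->
  exists Mi, (forall i, A i (Mi i)) /\ psdq (\sum_i Mi i - M).
Proof.
move=> K0 hFG; have [U [UU oU]] := free_ultrafilter.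
have CC11 F0 G0 : super_tuple K M F0 G0 -> C11 K F0 G0 by case.
have CCrs F0 G0 c (j : nat) : super_tuple K M F0 G0 ->
    super_tuple K M (rsF F0 G0 c (2 ^+ j)^-1) (rsG G0 c (2 ^+ j)^-1).
  move=> [a1 a2 a3]; have r0 : 0 < (2 ^+ j)^-1 :> R by pos.
    split; first exact: C11_rs.
      move=> i; apply: visc_subset (visc_rescale c (F0 i c) (_ *: G0 i c) r0 (a2 i)) _.
      by [].
    move=> x y; under eq_bigr => i _ do rewrite trem_rs //.
    rewrite -mulr_sumr [X in _ <= X]mulrC ler_pdivlMr ?exprn_gt0 //.
    apply: le_trans (a3 _ _); rewrite opprD addrACA subrr add0r -scalerBr qf_scale.
    by rewrite le_eqVlt; apply/orP; left; apply/eqP; ring.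
have [F' [G' [[h1 h2 h3] hl]]] : exists F' G', super_tuple K M F' G' /\ forall i j, lin G' i j.
  apply: (tangent UU oU K0 CC11 CCrs _ hFG).
  move=> Fk Gk F0 G0 hk Fk0 Gk0 tF tG; split.
      by apply: (C11_ulim UU (Fk := Fk) (Gk := Gk)) => // k; have [] := hk k.
    move=> i; apply: (visc_C11_ulim K0 UU (Fk := Fk) (Gk := Gk)) => //; first exact: clA.
        by move=> k; have [] := hk k.
      by move=> k; have [] := hk k.
  move=> x y.
  apply: (utends_le UU (utends_cst UU _) (utends_sum UU (fun i => trem_ulim UU i x y tF tG))).
  by apply: filterE => k; have [_ _] := hk k; apply.
have /choice[Mi hMi] i := lin_quad h1 (hl i).
exists Mi; split.
  move=> i; have [_ hv] := h2 i; have [_ hF] := hMi i.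
  apply: (hv 0 (G' i 0)) => //; exists 1 => // y _; by rewrite subr0 (hF y).
move=> y; rewrite qfD qfN; have -> : qf (\sum_i Mi i) y = \sum_i qf (Mi i) y.
  by elim/big_rec2: _ => [|i a b _ <-]; rewrite ?qf0 // qfD.
have := h3 0 y; rewrite subr0.
rewrite (eq_bigr (fun i => qf (Mi i) y / 2)); last first.
  by move=> i _; rewrite /trem subr0; have [_ ->] := hMi i; ring.
by rewrite -mulr_suml; lra.
Qed.

(** Two-sided remainder bounds are known only at base points in the contact set [E]. Around density
    points, [wk j y] is a point of the rescaled [E] close to [y], and the gradient of the limit at
    [y] is the limit of the gradients taken there. *)
Lemma blow_up (K k rho : R) M (fe : I -> V -> R) (g : I -> V -> V) (E : set V) (c0 : R) :
  0 < K -> 0 < k -> 0 < rho -> rho <= 1 ->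
  (forall i x z, trem fe g i x z <= k * nsq (z - x)) ->
  (forall i, visc (A i) [set x | `|x| < 3 / 4 * rho] (fe i)) ->
  (forall x, E x -> `|x| <= rho / 4) ->
  (forall i x z, E x -> `|z| <= rho / 2 -> `|trem fe g i x z| <= K * nsq (z - x)) ->
  (forall x z, E x -> `|z| <= rho / 2 -> qf M (z - x) / 2 <= \sum_i trem fe g i x z) ->
  0 < c0 -> (\forall m \near \oo, c0 * m%:R ^+ n <= (Nm m E)%:R) ->
  exists F G, super_tuple K M F G.
Proof.
move=> K0 k0 r0 r1 semi fv Er Erem Elow cp hm; have [U [UU oU]] := free_ultrafilter.
have n0 : 0 <= n%:R :> R by [].
have wE : window E by move=> x /Er xr; apply: le_trans xr _; move: r1; clear -clA; lra.
have /choice[d hd] (j : nat) : exists d : V * R * (V -> V),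
   [/\ E d.1.1, 0 < d.1.2, d.1.2 <= j.+1%:R^-1 & forall w, 4 * `|w| <= j.+1%:R ->
     E (d.1.1 + d.1.2 *: d.2 w) /\ `|d.2 w - w| <= j.+1%:R^-1].
  have [c [r [h1 h2 h3 h4]]] := density_pt j wE cp hm.
  have /choice[f hf] (w : V) : exists w', 4 * `|w| <= j.+1%:R ->
      E (c + r *: w') /\ `|w' - w| <= j.+1%:R^-1.
    have [/h4[w' ? ?]|hw] := pselect (4 * `|w| <= j.+1%:R); first by exists w'.
    by exists 0.
  by exists (c, r, f).
pose ck j := (d j).1.1; pose rk j := (d j).1.2; pose wk j := (d j).2.
pose Fk j := rsF fe g (ck j) (rk j).
pose Gk j i y := rsG g (ck j) (rk j) i (wk j y).
have r0k j : 0 < rk j by have [] := hd j.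
pose good j (B : R) := 4 * B <= j.+1%:R /\ forall y, `|y| <= B -> `|ck j + rk j *: y| <= rho / 2.
have evg (B : R) : 0 < B -> U [set j | good j B].
  move=> B0; apply: filterS (filterI (U_large oU (4 * B)) (U_large oU (4 * B / rho))) => j /= [b1 b2].
  have jj : j%:R <= j.+1%:R :> R by rewrite ler_nat.
  split; first exact: le_trans jj.
  move=> y yB; have [Ec _ rj _] := hd j; apply: le_trans (ler_normD _ _) _.
  rewrite mx_normZ (gtr0_norm (r0k j)).
  have : rk j * `|y| <= rho / 4.
    apply: le_trans (_ : j.+1%:R^-1 * B <= _); first by apply: ler_pM => //; exact: ltW.
    rewrite mulrC ler_pdivrMr ?ltr0n //; rewrite ler_pdivrMr // in b2.
    have := ler_wpM2r (ltW r0) jj; move: b2; clear -clA; lra.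
  have := Er _ Ec; rewrite -/(ck j); clear -clA; lra.
have wkE j (B : R) y : good j B -> `|y| <= B -> E (ck j + rk j *: wk j y) /\ `|wk j y - y| <= j.+1%:R^-1.
  move=> [gB _] yB; have [_ _ _ H] := hd j; apply: H; move: yB gB; clear -clA; lra.

have rsrem j i x y : E (ck j + rk j *: x) -> `|ck j + rk j *: y| <= rho / 2 ->
    `|trem (Fk j) (rsG g (ck j) (rk j)) i x y| <= K * nsq (y - x).
  move=> Ex yr; have r2 : 0 < rk j ^+ 2 by have := r0k j; move=> ?; pos.
  rewrite trem_rs // normrM gtr0_norm ?invr_gt0 // mulrC ler_pdivrMr //.
  apply: le_trans (Erem i _ _ Ex yr) _; rewrite opprD addrACA subrr add0r -scalerBr nsqZ.
  by rewrite mulrCA mulrC.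
have rslow j x y : E (ck j + rk j *: x) -> `|ck j + rk j *: y| <= rho / 2 ->
    qf M (y - x) / 2 <= \sum_i trem (Fk j) (rsG g (ck j) (rk j)) i x y.
  move=> Ex yr; have r2 : 0 < rk j ^+ 2 by have := r0k j; move=> ?; pos.
  under eq_bigr => i _ do rewrite trem_rs //.
  rewrite -mulr_sumr [X in _ <= X]mulrC ler_pdivlMr //.
  apply: le_trans (Elow _ _ Ex yr); rewrite opprD addrACA subrr add0r -scalerBr qf_scale.
  by rewrite le_eqVlt; apply/orP; left; apply/eqP; ring.
have Fkb j i (B : R) y : good j B -> `|y| <= B -> `|Fk j i y| <= K * nsq y.
  move=> [_ gB] yB; have [Ec _ _ _] := hd j.
  have := rsrem j i 0 y; rewrite scaler0 addr0 => /(_ Ec (gB y yB)).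
  by rewrite /trem /Fk rsF0 rsG0 dot0l !subr0.
have nsqB (B : R) x : 0 < B -> `|x| <= B -> nsq x <= n%:R * B ^+ 2.
  move=> B0 xB; apply: le_trans (nsq_le_norm _) _; rewrite ler_wpM2l //.
  by rewrite ler_sqr ?nnegrE // ltW.
have /choice[Fl hFl] (iy : I * V) : exists l, utends U (fun j => Fk j iy.1 iy.2) l.
  apply: (utends_ex UU (B := K * nsq iy.2)).
  have Bp : 0 < `|iy.2| + 1 by pos.
  by apply: filterS (evg _ Bp) => j gj; apply: Fkb gj _; rewrite lerDl.
have delta1 (j : 'I_n) : `|delta_mx 0 j : V| <= 1.
  by apply: norm_le_of_nsq => //; rewrite nsq_delta expr1n.
have /choice[Gl hGl] (iy : I * V) : exists l : V, forall j, utends U (fun m => Gk m iy.1 iy.2 0 j) (l 0 j).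
  have /choice[gg hg] (j : 'I_n) : exists l, utends U (fun m => Gk m iy.1 iy.2 0 j) l.
    case: iy => i y /=; set B := `|y| + 2; have Bp : 0 < B by rewrite /B; pos.
    apply: (utends_ex UU (B := 2 * (K * (n%:R * B ^+ 2)) + K)).
    apply: filterS (evg _ Bp) => m gm /=.
    have yB : `|y| <= B by rewrite lerDl.
    have [Ew dw] := wkE _ _ _ gm yB; set w := wk m y in Ew dw.
    have m1 : m.+1%:R^-1 <= 1 :> R by rewrite invf_le1 ?ltr0n // ler1n.
    have w1 : `|w| <= `|y| + 1.
      have := ler_normD (w - y) y; rewrite subrK => tri.
      by apply: le_trans tri _; rewrite addrC lerD2l; apply: le_trans dw m1.
    have w2 : `|w + delta_mx 0 j| <= B.
      by apply: le_trans (ler_normD _ _) _; have := delta1 j; move: w1; rewrite /B; clear -clA; lra.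
    have w3 : `|w| <= B by move: w1; rewrite /B; clear -clA; lra.
    have [_ gm'] := gm.
    have := rsrem m i w (w + delta_mx 0 j) Ew (gm' _ w2).
    rewrite /trem [w + _ - w]addrC addKr nsq_delta dot_delta mulr1.
    have b1 := le_trans (Fkb _ i _ _ gm w2) (ler_wpM2l (ltW K0) (nsqB _ _ Bp w2)).
    have b2 := le_trans (Fkb _ i _ _ gm w3) (ler_wpM2l (ltW K0) (nsqB _ _ Bp w3)).
    rewrite /Gk -/w; move: b1 b2; move: (rsG _ _ _ _ _ _ _) (Fk m i _) (Fk m i _) => t1 t2 t3.
    rewrite !ler_norml => /andP[u1 u2] /andP[u3 u4] /andP[u5 u6].
    by move: u1 u2 u3 u4 u5 u6; clear -clA => *; apply/andP; split; lra.
  by exists (\row_j gg j) => j; rewrite mxE; exact: hg.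
pose F' i y := Fl (i, y); pose G' i y := Gl (i, y).
have tF i y : utends U (fun k => Fk k i y) (F' i y) := hFl (i, y).
have tG i y j : utends U (fun k => Gk k i y 0 j) (G' i y 0 j) := hGl (i, y) j.
(* With the gradient taken at [wk j x], the remainder is a difference of two remainders based at
   [wk j x]; the second tends to 0 because [wk j x] tends to [x]. *)
have remE j i x y : trem (Fk j) (Gk j) i x y = trem (Fk j) (rsG g (ck j) (rk j)) i (wk j x) y -
    trem (Fk j) (rsG g (ck j) (rk j)) i (wk j x) x.
  rewrite /trem /Gk; move: (rsG _ _ _ _ _) => t; rewrite !dotE; ring.
have tw x : U [set j | `|wk j x - x| <= j.+1%:R^-1].
  have Bp : 0 < `|x| + 1 by pos.
  by apply: filterS (evg _ Bp) => j /wkE H; have [] := H x; rewrite ?lerDl.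
have tns x y : utends U (fun j => nsq (y - wk j x)) (nsq (y - x)).
  apply: (utends_cont (f := fun w => nsq (y - w))) => //.
  by apply: (@cont_ext _ _ (fun w => nsq (w - y))); [move=> z; rewrite nsqC|exact: cont_nsq].
have tqf x y : utends U (fun j => qf M (y - wk j x)) (qf M (y - x)).
  apply: (utends_cont (f := fun w => qf M (y - w))) => //.
  by apply: (@cont_ext _ _ (fun w => qf M (w - y))); [move=> z; rewrite -qf_opp opprB|exact: cont_qf].
have gxy x y : U [set j | good j (Num.max `|x| `|y| + 1)].
  by apply: evg; rewrite ltr_wpDl // le_max normr_ge0.
exists F', G'; split.
    move=> i x y; rewrite -/(trem F' G' i x y).
    have t1 := utends_abs UU (trem_ulim UU i x y tF tG).
    have t2 := utendsD UU (utendsZ UU K (tns x y)) (utendsZ UU K (tns x x)).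
    rewrite subrr nsq0 mulr0 addr0 in t2; apply: (utends_le UU t1 t2).
    apply: filterS (gxy x y) => j gj /=.
    have xB : `|x| <= Num.max `|x| `|y| + 1 by rewrite -[X in X <= _]addr0 lerD // le_max lexx.
    have yB : `|y| <= Num.max `|x| `|y| + 1 by rewrite -[X in X <= _]addr0 lerD // le_max lexx orbT.
    have [Ew _] := wkE _ _ _ gj xB; have [_ gj'] := gj.
    rewrite remE; apply: le_trans (ler_normB _ _) _.
    by apply: lerD; apply: rsrem => //; apply: gj'.
  move=> i; apply: (@visc_ulim _ _ U UU (fun j => Fk j i) (F' i) (fun=> A i) (A i)) => //.
      move=> B B0; set L1 := 2 * (K * (n%:R * (B + 1) ^+ 2)) + k.
      have L10 : 0 <= L1 by rewrite /L1; pos.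
      have B1 : 0 < B + 1 by pos.
      exists (n%:R * L1 + k * n%:R * (2 * B)); first by pos.
      apply: filterS (evg _ B1) => j gj /=.
      have sem x y : trem (Fk j) (rsG g (ck j) (rk j)) i x y <= k * nsq (y - x).
        have r2 : 0 < rk j ^+ 2 by have := r0k j; move=> ?; pos.
        rewrite trem_rs // mulrC ler_pdivrMr //; apply: le_trans (semi _ _ _) _.
        by rewrite opprD addrACA subrr add0r -scalerBr nsqZ mulrCA mulrC.
      have Gb x : `|x| <= B -> `|rsG g (ck j) (rk j) i x| <= L1.
        move=> xB; apply: norm_le_coord => // l.
        have x1 : `|x| <= B + 1 by move: xB; clear -clA; lra.
        have bx := le_trans (Fkb _ i _ _ gj x1) (ler_wpM2l (ltW K0) (nsqB _ _ B1 x1)).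
        have bd (s : R) : `|s| = 1 -> - (s * rsG g (ck j) (rk j) i x 0 l) <= L1.
          move=> s1; have x2 : `|x + s *: delta_mx 0 l| <= B + 1.
            apply: le_trans (ler_normD _ _) _; rewrite mx_normZ s1 mul1r.
            by have := delta1 l; move: xB; clear -clA; lra.
          have b2 := le_trans (Fkb _ i _ _ gj x2) (ler_wpM2l (ltW K0) (nsqB _ _ B1 x2)).
          have := sem x (x + s *: delta_mx 0 l).
          rewrite /trem [x + _ - x]addrC addKr dotZr dot_delta nsqZ nsq_delta mulr1.
          have -> : s ^+ 2 = 1 by rewrite -real_normK ?num_real // s1 expr1n.
          move: bx b2; rewrite /L1 !ler_norml => /andP[u1 u2] /andP[u3 u4].
          by move: u1 u2 u3 u4; clear -clA; lra.
        have := bd 1; have := bd (-1); rewrite normrN normr1 mulN1r opprK mul1r.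
        by move=> /(_ erefl) v1 /(_ erefl) v2; rewrite ler_norml; move: v1 v2; clear -clA; lra.
      have one x y : `|x| <= B -> `|y| <= B ->
          Fk j i y - Fk j i x <= (n%:R * L1 + k * n%:R * (2 * B)) * `|y - x|.
        move=> xB yB; have := sem x y; rewrite /trem.
        have := dot_norm_le (rsG g (ck j) (rk j) i x) (y - x); rewrite ler_norml => /andP[_ d1].
        have d2 : n%:R * `|rsG g (ck j) (rk j) i x| * `|y - x| <= n%:R * L1 * `|y - x|.
          by rewrite ler_wpM2r // ler_wpM2l // Gb.
        have d3 : k * nsq (y - x) <= k * n%:R * (2 * B) * `|y - x|.
          rewrite -!mulrA ler_pM2l //; apply: le_trans (nsq_le_norm _) _.
          rewrite ler_wpM2l // expr2 mulrA ler_wpM2r //.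
          by apply: le_trans (ler_normB _ _) _; move: xB yB; clear -clA; lra.
        by rewrite mulrDl; move: d1 d2 d3; clear -clA; lra.
      move=> x y xB yB; have := one x y xB yB; have := one y x yB xB; rewrite (distrC y x).
      by rewrite ler_norml => u1 u2; move: u1 u2; clear -clA; lra.
    move=> B; have B1 : 0 < `|B| + 1 by pos.
    apply: filterS (evg _ B1) => j [_ gj] /=.
    apply: visc_subset (visc_rescale (ck j) (fe i (ck j)) (rk j *: g i (ck j)) (r0k j) (fv i)) _.
    move=> y /= yB; apply: le_lt_trans (gj y _) _; last by move: r0; clear -clA; lra.
    by apply: ltW; apply: lt_le_trans yB _; have := ler_norm B; clear -clA; lra.
  move=> M' hM'; apply: clA => ka ka0; have := hM' ka ka0.
  by move=> /filter_ex[].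
move=> x y.
have t1 := utends_sum UU (fun i => trem_ulim UU i x y tF tG).
have t2 := utendsB UU (utendsZ UU 2^-1 (tqf x y)) (utendsZ UU (#|I|%:R * K) (tns x x)).
rewrite subrr nsq0 mulr0 subr0 in t2; rewrite mulrC; apply: (utends_le UU t2 t1).
apply: filterS (gxy x y) => j gj /=.
have xB : `|x| <= Num.max `|x| `|y| + 1 by rewrite -[X in X <= _]addr0 lerD // le_max lexx.
have yB : `|y| <= Num.max `|x| `|y| + 1 by rewrite -[X in X <= _]addr0 lerD // le_max lexx orbT.
have [Ew _] := wkE _ _ _ gj xB; have [_ gj'] := gj.
under [X in _ <= X]eq_bigr => i _ do rewrite remE.
rewrite big_split /= sumrN; apply: lerB.
  by rewrite [X in X <= _]mulrC; apply: rslow => //; apply: gj'.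
rewrite -mulrA mulr_natl -sumr_const; apply: ler_sum => i _.
apply: le_trans (ler_norm _) _; apply: rsrem => //; exact: gj'.
Qed.

(** The counterpart of the theorem on sums. With Hessian [M - ka%:M] the contact is strict, hence
    stable under inf-convolution and small changes of slope; [contact_content] gives many contact
    points of the regularised sum, and the two blow-ups extract the Hessians. *)
Lemma sum_touch0 (O : set V) (f : I -> V -> R) (rho ka : R) p M :
  0 < rho -> rho <= 1 -> 0 < ka -> (forall i, visc (A i) O (f i)) ->
  (forall y, `|y| <= rho -> O y) ->
  (forall y, `|y| <= rho -> \sum_i f i 0 + dot p y + qf M y / 2 <= \sum_i f i y) ->
  exists Mi, (forall i, A i (Mi i)) /\ psdq (\sum_i Mi i - M + ka%:M).
Proof.
move=> r0 r1 ka0 fv hO ht; set M' := M - ka%:M.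
set N : R := #|I|%:R; have N0 : 0 <= N by rewrite /N.
have n0 : 0 <= n%:R :> R by [].
(* [eta] and [ga] make the errors from regularisation and from the slopes smaller than the gain
   [ka / 2 * nsq y] at [|y| >= rho / 4]. *)
set eta := ka * rho ^+ 2 / (128 * (N + 1)); have eta0 : 0 < eta by rewrite /eta; pos.
set ga := Num.min 1 (ka * rho / (128 * (n%:R + 1))).
have ga0 : 0 < ga by rewrite /ga lt_min ltr01 /=; pos.
have ga1 : ga <= 1 by rewrite /ga ge_min lexx.
have gan : n%:R * ga <= ka * rho / 128.
  apply: le_trans (_ : (n%:R + 1) * (ka * rho / (128 * (n%:R + 1))) <= _).
    by apply: ler_pM => //; [exact: ltW|lra|rewrite /ga ge_min lexx orbT].
  by rewrite le_eqVlt; apply/orP; left; apply/eqP; field; rewrite gt_eqF //; lra.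
have Neta : N * eta <= ka * rho ^+ 2 / 128.
  apply: le_trans (_ : (N + 1) * eta <= _); first by rewrite ler_pM2r //; lra.
  by rewrite /eta le_eqVlt; apply/orP; left; apply/eqP; field; rewrite gt_eqF //; lra.
have /choice[k0 hk0] i : exists k0 : R, 0 < k0 /\ forall k : R, k0 <= k -> exists (fe : V -> R) (g : V -> V),
   [/\ forall x z, fe z <= fe x + dot (g x) (z - x) + k * nsq (z - x),
       forall x, `|x| <= rho -> fe x <= f i x,
       forall x, `|x| <= rho -> f i x - eta <= fe x &
       visc (A i) [set x | `|x| < 3 / 4 * rho] fe].
  by have [k0 ? ?] := inf_convolution r0 eta0 (fv i) hO; exists k0.
set k := \sum_i k0 i + 1.
have kk i : k0 i <= k.
  rewrite /k (bigD1 i) //= -addrA lerDl addr_ge0 // sumr_ge0 // => j _; exact: ltW (hk0 j).1.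
have kp : 0 < k by rewrite /k ltr_wpDl // sumr_ge0 // => j _; exact: ltW (hk0 j).1.
have /choice[fg hfg] i : exists fg : (V -> R) * (V -> V),
   [/\ forall x z, fg.1 z <= fg.1 x + dot (fg.2 x) (z - x) + k * nsq (z - x),
       forall x, `|x| <= rho -> fg.1 x <= f i x,
       forall x, `|x| <= rho -> f i x - eta <= fg.1 x &
       visc (A i) [set x | `|x| < 3 / 4 * rho] fg.1].
  by have [fe [g ?]] := (hk0 i).2 k (kk i); exists (fe, g).
pose fe i := (fg i).1; pose g i := (fg i).2.
have semi i x z : trem fe g i x z <= k * nsq (z - x).
  by have [/(_ x z) + _ _ _] := hfg i; rewrite /trem -/(fe i) -/(g i); clear -clA; lra.
have [C C0 hC] := qf_bound M'.
(* At a contact point the sum of the remainders is bounded below and each of them above by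
   semiconcavity, so each one is bounded below as well, with this constant. *)
set K := (N + 1) * k + C; have K0 : 0 < K by rewrite /K; pos.
pose h z := \sum_i fe i z - (dot p (z - 0) + qf M' (z - 0) / 2).
pose a x := \sum_i g i x - (p + 2^-1 *: (x *m (M' + M'^T))).
have hid x z : h z - h x - dot (a x) (z - x) = \sum_i trem fe g i x z - qf M' (z - x) / 2.
  rewrite /h /a /trem !subr0.
  have -> : \sum_i (fe i z - fe i x - dot (g i x) (z - x)) =
      \sum_i fe i z - \sum_i fe i x - dot (\sum_i g i x) (z - x).
    rewrite big_split big_split /= !sumrN; congr (_ - _).
    by elim/big_rec2: _ => [|i b c _ ->]; rewrite ?dot0l // dotDl.
  have : qf M' z = qf M' x + dot (x *m (M' + M'^T)) (z - x) + qf M' (z - x).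
    by rewrite -qf_addr addrC subrK.
  by move=> ->; move: (x *m _) (\sum_i g i x) => b c; rewrite !dotE; field.
have fec i x : `|x| <= rho / 2 -> {for x, continuous (fe i)}.
  move=> xr; have [_ _ _ [fc _]] := hfg i; apply: fc => /=.
  by apply: le_lt_trans xr _; move: r0; clear -clA; lra.
have hc x : `|x| <= rho / 2 -> {for x, continuous h}.
  move=> xr; apply: contB.
    by apply: cont_sum => i; exact: fec.
  apply: (@contD _ _ _ (fun y => qf M' (y - 0) / 2)); first exact: cont_dot.
  by apply: (@contM _ _ _ (fun=> 2^-1)); [exact: cont_qf|exact: contK].
have sumsemi x z : \sum_i trem fe g i x z <= N * (k * nsq (z - x)).
  by rewrite /N mulr_natl -sumr_const; apply: ler_sum => i _.
have hsemi x z : h z <= h x + dot (a x) (z - x) + K * nsq (z - x).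
  have := hid x z; have := sumsemi x z; have := hC (z - x); rewrite ler_norml => /andP[q1 _].
  have : 0 <= k * nsq (z - x) by pos.
  have : 0 <= C * nsq (z - x) by pos.
  by move: q1; rewrite /K; clear -clA; lra.
have grow y : rho / 4 <= `|y| -> `|y| <= rho / 2 -> h 0 + n%:R * ga * `|y| < h y.
  move=> y1 y2; have y0 : 0 < `|y| by apply: lt_le_trans y1; pos.
  have yr : `|y| <= rho by apply: le_trans y2 _; move: r0; clear -clA; lra.
  have h0 : h 0 <= \sum_i f i 0.
    rewrite /h subr0 dot0r qf_zero mul0r addr0 subr0; apply: ler_sum => i _.
    by have [_ + _ _] := hfg i; apply; rewrite normr0 ltW.
  have hy : \sum_i f i y - N * eta <= \sum_i fe i y.
    rewrite lerBlDr /N mulr_natl -sumr_const -big_split /=; apply: ler_sum => i _.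
    by have [_ _ /(_ y yr) + _] := hfg i; rewrite lerBlDr.
  have := ht y yr; have q1 := ler_wpM2l (ltW ka0) (norm_sq_le y).
  have g1 := ler_wpM2r (ltW y0) gan.
  have r2 := ler_wpM2l (mulr_ge0 (ltW ka0) (ltW y0)) y1.
  have r3 := ler_wpM2l (mulr_ge0 (ltW ka0) (ltW r0)) y1.
  have r4 : 0 < ka * rho * `|y| by pos.
  have hyE : h y = \sum_i fe i y - (dot p y + (qf M y - ka * nsq y) / 2).
    by rewrite /h !subr0 /M' qfD qfN qf_scalar.
  by rewrite hyE; move: h0 hy q1 g1 r2 r3 r4 Neta; rewrite !expr2; clear -clA; lra.
have [c0 cp hm] := contact_content K0 r0 r1 ga0 ga1 hc hsemi grow.
set E := [set x | _] in hm.
have Elow x z : E x -> `|z| <= rho / 2 -> qf M' (z - x) / 2 <= \sum_i trem fe g i x z.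
  by move=> [_ Ex] zr; have := Ex z zr; have := hid x z; clear -clA; lra.
have Erem i x z : E x -> `|z| <= rho / 2 -> `|trem fe g i x z| <= K * nsq (z - x).
  move=> Ex zr; have := Elow x z Ex zr; have := hC (z - x); rewrite !ler_norml => /andP[q1 _].
  have b1 : 0 <= k * nsq (z - x) by pos.
  have b2 : 0 <= C * nsq (z - x) by pos.
  have b3 : 0 <= N * (k * nsq (z - x)) by pos.
  rewrite (bigD1 i) //=.
  have : \sum_(j | j != i) trem fe g j x z <= N * (k * nsq (z - x)).
    rewrite /N mulr_natl -sumr_const [X in _ <= X](bigD1 i) //=.
    by apply: le_trans (_ : _ <= \sum_(j | j != i) k * nsq (z - x)) _; [exact: ler_sum|rewrite lerDr].
  have := semi i x z; rewrite /K; move: q1 b1 b2 b3; clear -clA => *.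
  by apply/andP; split; lra.
have [||F [G hFG]] := blow_up K0 kp r0 r1 semi _ _ Erem Elow cp hm.
    by move=> i; have [] := hfg i.
  by move=> x [].
have [Mi [h1 h2]] := quad_tuple K0 hFG; exists Mi; split=> //.
by move: h2; rewrite /M' opprB addrA -addrA [ka%:M - M]addrC addrA.
Qed.

Lemma sum_touch (O : set V) (f : I -> V -> R) (x0 : V) (ka : R) p M : 0 < ka ->
  (forall i, visc (A i) O (f i)) -> (exists2 r : R, 0 < r & forall y, `|y - x0| < r -> O y) ->
  touch (fun y => \sum_i f i y) x0 p M ->
  exists Mi, (forall i, A i (Mi i)) /\ psdq (\sum_i Mi i - M + ka%:M).
Proof.
move=> ka0 fv [r r0 hO] [r' r0' ht].
set rho := Num.min 1 (Num.min r r' / 2).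
have m0 : 0 < Num.min r r' by rewrite lt_min r0.
have rho0 : 0 < rho by rewrite /rho lt_min ltr01 /=; pos.
have rho1 : rho <= 1 by rewrite /rho ge_min lexx.
have rhor : rho < r /\ rho < r'.
  have : rho <= Num.min r r' / 2 by rewrite /rho ge_min lexx orbT.
  have : Num.min r r' <= r by rewrite ge_min lexx.
  have : Num.min r r' <= r' by rewrite ge_min lexx orbT.
  by move: m0; clear -clA => *; split; lra.
pose f0 i y := (1 ^+ 2)^-1 * (f i (x0 + 1 *: y) - (0 + dot 0 y)).
have f0E i y : f0 i y = f i (x0 + y).
  by rewrite /f0 expr1n invr1 mul1r scale1r dot0l addr0 subr0.
apply: (@sum_touch0 [set y | O (x0 + 1 *: y)] f0 rho ka p M) => //.
    by move=> i; apply: visc_rescale => //; exact: ltr01.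
  move=> y yr /=; apply: hO; rewrite scale1r [x0 + _]addrC addrK.
  by apply: le_lt_trans yr _; case: rhor.
move=> y yr; under eq_bigr do rewrite f0E; under [X in _ <= X]eq_bigr do rewrite f0E.
rewrite addr0; have := ht (x0 + y); rewrite [x0 + y - x0]addrC addKr; apply.
by apply: le_lt_trans yr _; case: rhor.
Qed.
End SumLemma.

(** * Bernoulli inequality and geometric sequences *)

Section Powers.
Variable R : realType.
Implicit Types (t b e M : R) (k : nat).

Lemma bernoulli t k : -1 <= t -> 1 + k%:R * t <= (1 + t) ^+ k.
Proof.
move=> t1; elim: k => [|k IH]; first by rewrite mul0r addr0 expr0.
have t2 : 0 <= 1 + t by lra.
rewrite exprS; apply: le_trans (ler_wpM2l t2 IH).
have : 0 <= k%:R * t ^+ 2 by apply: mulr_ge0 => //; exact: sqr_ge0.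
by rewrite -natr1; lra.
Qed.

Lemma expr_large b M : 1 < b -> exists k, M <= b ^+ k.
Proof.
move=> b1; have b0 : 0 < b - 1 by rewrite subr_gt0.
have := unstable.ltr_bound (M / (b - 1)); set k := Num.Def.archi_bound _ => hk.
exists k; have := @bernoulli (b - 1) k; rewrite [1 + (b - 1)]addrC subrK => /(_ _) H.
apply: le_trans (H _); last by lra.
by rewrite ltr_pdivrMr // in hk; lra.
Qed.

Lemma expr_small t e : 0 < t -> t < 1 -> 0 < e -> exists k, t ^+ k <= e.
Proof.
move=> t0 t1 e0; have b1 : 1 < t^-1 by rewrite invf_gt1.
have [k hk] := expr_large e^-1 b1; exists k.
rewrite -[X in _ <= X]invrK -[X in X <= _]invrK lef_pV2 ?posrE ?invr_gt0 ?exprn_gt0 //.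
by rewrite -exprVn.
Qed.
End Powers.

(** * Second differences and the interior [C^{1,1}] estimate *)

Section Operators.
Variables (R : realType) (n : nat) (lam Lam : R).
Local Notation V := 'rV[R]_n.
Implicit Types (x y z p v w : V) (M N P Q X Y : 'M[R]_n) (s u : V -> R) (F : 'M[R]_n -> R) (O : set V).
Hypothesis lam0 : 0 < lam.
Hypothesis Lam0 : 0 < Lam.
Local Notation supS := (supS lam Lam).

Definition ellF F := forall M N, psdq N -> lam * \tr N <= F (M + N) - F M <= Lam * \tr N.
Definition qcF F := forall M N, Num.min (F M) (F N) <= F (2^-1 *: (M + N)).
(** The subsolution half is phrased for [- u], so that only contact from below occurs. *)
Definition sol F O u := visc (fun M => F M <= 0) O u /\
  visc (fun M => 0 <= F (- M)) O (fun y => - u y).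

Lemma ell_diff F M P Q : ellF F -> psdq P -> psdq Q ->
  lam * \tr P - Lam * \tr Q <= F (M + (P - Q)) - F M.
Proof.
move=> eF hP hQ; have /andP[h1 _] := eF M P hP.
have /andP[_ h2] := eF (M + (P - Q)) Q hQ.
have e : M + (P - Q) + Q = M + P by rewrite -addrA subrK.
by rewrite e in h2; lra.
Qed.

Lemma ell_scalar F M (t : R) : ellF F -> 0 <= t -> F M - F (M - t%:M) <= Lam * n%:R * t.
Proof.
move=> eF t0; have /andP[_] := eF (M - t%:M) t%:M (psdq_scalar t0).
by rewrite subrK tr_scalar mulrCA mulrC.
Qed.

(** Supplies the closedness under [M - ka%:M] that [sum_touch] and [visc_ulim] require; the factor
    [r] accounts for multiples of a solution. *)
Lemma ell_super_closed F M (r : R) : ellF F -> 0 <= r ->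
  (forall ka : R, 0 < ka -> F (r *: (M - ka%:M)) <= 0) -> F (r *: M) <= 0.
Proof.
move=> eF r0 h; apply/ler_addgt0Pr => e e0.
have n0 : 0 <= n%:R :> R by [].
set C := Lam * n%:R * r + 1; have C0 : 0 < C by rewrite /C; pos.
have ec : 0 < e / C by pos.
have := h _ ec; rewrite scalerBr scale_scalar_mx => h1.
have rt : 0 <= r * (e / C) by pos.
have := @ell_scalar F (r *: M) _ eF rt.
have : Lam * n%:R * (r * (e / C)) <= e.
  have -> : Lam * n%:R * (r * (e / C)) = e * ((C - 1) / C) by rewrite /C; ring.
  by rewrite ler_piMr //; [exact: ltW|rewrite ler_pdivrMr // mul1r; lra].
by move: h1; clear -lam0 Lam0; lra.
Qed.

Lemma ell_sub_closed F M (r : R) : ellF F -> 0 <= r ->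
  (forall ka : R, 0 < ka -> 0 <= F (- (r *: (M - ka%:M)))) -> 0 <= F (- (r *: M)).
Proof.
move=> eF r0 h; rewrite -oppr_le0; apply/ler_addgt0Pr => e e0.
have n0 : 0 <= n%:R :> R by [].
set C := Lam * n%:R * r + 1; have C0 : 0 < C by rewrite /C; pos.
have ec : 0 < e / C by pos.
have := h _ ec; rewrite scalerBr scale_scalar_mx opprB addrC => h1.
have rt : 0 <= r * (e / C) by pos.
have := @ell_scalar F (- (r *: M) + (r * (e / C))%:M) _ eF rt; rewrite addrK.
have : Lam * n%:R * (r * (e / C)) <= e.
  have -> : Lam * n%:R * (r * (e / C)) = e * ((C - 1) / C) by rewrite /C; ring.
  by rewrite ler_piMr //; [exact: ltW|rewrite ler_pdivrMr // mul1r; lra].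
by move: h1; clear -lam0 Lam0; lra.
Qed.

Lemma sol_sup F O u : ellF F -> F 0 = 0 -> sol F O u ->
  visc (supS 0) O u /\ visc (supS 0) O (fun y => - u y).
Proof.
move=> eF F0 [[uc uv] [vc vv]]; split; split=> // x p M Ox tM P Q hP hQ MPQ.
  have := uv _ _ _ Ox tM; have := ell_diff 0 eF hP hQ; rewrite add0r -MPQ F0.
  by clear -lam0 Lam0; lra.
have := vv _ _ _ Ox tM; have := ell_diff (- M) eF hP hQ; rewrite -MPQ addNr F0.
by clear -lam0 Lam0; lra.
Qed.

Lemma visc_affine (A : 'M[R]_n -> Prop) O s v (r k d : R) : 0 < r -> 0 < k -> visc A O s ->
  visc (fun M => A ((k * r ^+ 2)^-1 *: M)) [set y | O (v + r *: y)] (fun y => k * s (v + r *: y) + d).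
Proof.
move=> r0 k0 [sc sv]; split=> [x /= Ox|x p M /= Ox tM].
  apply: (@contD _ _ _ (fun=> d)); last exact: contK.
  apply: (@contM _ _ (fun=> k)); first exact: contK.
  by apply: cont_comp_affine; apply: sc.
by apply: (sv _ _ _ Ox (touch_comp_affine r0 k0 tM)).
Qed.

Definition sdiff u y x : R := u (x + y) + u (x - y) - 2 * u x.

(** [sum_touch] is applied to [2 u], [- u (. + y)] and [- u (. - y)]. Their Hessians satisfy
    [F (M1 / 2) <= 0], [F (- M2) >= 0] and [F (- M3) >= 0], and their sum dominates [M] up to [ka];
    quasiconcavity and ellipticity turn this into the Pucci inequality for [M]. *)
Lemma sdiff_super F O u y : ellF F -> qcF F ->
  (forall x, O x -> exists2 r : R, 0 < r & forall z, `|z - x| < r -> O z) -> sol F O u ->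
  visc (supS 0) [set x | [/\ O x, O (x + y) & O (x - y)]] (fun x => - sdiff u y x).
Proof.
move=> eF qF opO [u1 u2]; split.
  move=> x [h1 h2 h3]; have [uc _] := u1; apply: contN; apply: contB.
    apply: (@contD _ _ (fun z => u (z + y)) (fun z => u (z - y))).
      by apply: cont_shift; apply: uc.
    by apply: cont_shift; apply: uc.
  by apply: (@contM _ _ (fun=> 2) u); [exact: contK|exact: uc].
move=> x0 p M [h1 h2 h3] tM P Q hP hQ MPQ; rewrite addr0.
pose f (i : 'I_3) : V -> R := match (i : nat) with
  | 0%N => fun x => 2 * u (0 + 1 *: x) + 0
  | 1%N => fun x => 1 * - u (y + 1 *: x) + 0
  | _ => fun x => 1 * - u (- y + 1 *: x) + 0 end.
pose A (i : 'I_3) : 'M[R]_n -> Prop := match (i : nat) with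
  | 0%N => fun M => F ((2 * 1 ^+ 2)^-1 *: M) <= 0
  | _ => fun M => 0 <= F (- ((1 * 1 ^+ 2)^-1 *: M)) end.
pose O' := [set x | [/\ O x, O (x + y) & O (x - y)]].
have fv i : visc (A i) O' (f i).
  case: i => -[|[|[|//]]] hi; rewrite /A /f /=.
      apply: visc_subset (visc_affine 0 0 ltr01 (ltr0n _ 2) u1) _.
      by move=> x [? _ _] /=; rewrite add0r scale1r.
    apply: visc_subset (visc_affine y 0 ltr01 ltr01 u2) _.
    by move=> x [_ ? _] /=; rewrite addrC scale1r.
  apply: visc_subset (visc_affine (- y) 0 ltr01 ltr01 u2) _.
  by move=> x [_ _ ?] /=; rewrite addrC scale1r.
have clA i M0 : (forall ka : R, 0 < ka -> A i (M0 - ka%:M)) -> A i M0.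
  case: i => -[|[|[|//]]] hi; rewrite /A /=.
      by apply: ell_super_closed => //; rewrite expr1n mulr1 invr_ge0.
    by apply: ell_sub_closed => //; rewrite expr1n mulr1 invr1.
  by apply: ell_sub_closed => //; rewrite expr1n mulr1 invr1.
have opO' : exists2 r : R, 0 < r & forall z, `|z - x0| < r -> O' z.
  have [r1 r10 k1] := opO _ h1; have [r2 r20 k2] := opO _ h2; have [r3 r30 k3] := opO _ h3.
  exists (Num.min r1 (Num.min r2 r3)); first by rewrite !lt_min r10 r20.
  move=> z; rewrite !lt_min => /and3P[a1 a2 a3]; split; [exact: k1| |].
    by apply: k2; rewrite opprD addrACA subrr addr0.
  by apply: k3; rewrite opprD addrACA subrr addr0.
have tf : touch (fun x => \sum_i f i x) x0 p M.
  suff -> : (fun x => \sum_i f i x) = (fun x => - sdiff u y x) by [].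
  apply/funext => x; rewrite !big_ord_recl big_ord0 /f /= /sdiff !scale1r !mul1r !addr0.
  by rewrite add0r [y + x]addrC [- y + x]addrC; ring.
have n0 : 0 <= n%:R :> R by [].
apply/ler_addgt0Pr => e e0.
set ka : R := e / (Lam * n%:R + 1); have C0 : 0 < Lam * n%:R + 1 by pos.
have ka0 : 0 < ka by rewrite /ka; pos.
have [Mi [hA hS]] := sum_touch clA ka0 fv opO' tf.
move: hS; rewrite !big_ord_recl big_ord0 addr0.
set M1 := Mi _; set M2 := Mi _; set M3 := Mi _ => hS.
have a1 : F ((2 * 1 ^+ 2)^-1 *: M1) <= 0 := hA ord0.
have a2 : 0 <= F (- ((1 * 1 ^+ 2)^-1 *: M2)) := hA (lift ord0 ord0).
have a3 : 0 <= F (- ((1 * 1 ^+ 2)^-1 *: M3)) := hA (lift ord0 (lift ord0 ord0)).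
rewrite expr1n mulr1 in a1; rewrite expr1n mulr1 invr1 !scale1r in a2 a3.
set D := M1 + (M2 + M3) - M + ka%:M in hS.
(* The mean of the Hessians of the two translates has [F X >= 0] by quasiconcavity, and [2^-1 *: M1]
   differs from it by half of [M + D - ka%:M] with [D] nonnegative. *)
set X := 2^-1 *: (- M2 - M3).
have hX : 0 <= F X by apply: le_trans (qF (- M2) (- M3)); rewrite le_min a2 a3.
have P2 : psdq (2^-1 *: (P + D)) by apply: psdqZ; [rewrite invr_ge0|exact: psdqD].
have Q2 : psdq (2^-1 *: (Q + ka%:M)).
  by apply: psdqZ; [rewrite invr_ge0|apply: psdqD => //; apply: psdq_scalar; exact: ltW].
have := ell_diff X eF P2 Q2.
have -> : X + (2^-1 *: (P + D) - 2^-1 *: (Q + ka%:M)) = 2^-1 *: M1.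
  rewrite /X -scalerBr -scalerDr; congr (_ *: _); rewrite /D MPQ.
  by apply/matrixP => i j; rewrite !mxE; ring.
clearbody D; rewrite !mxtraceZ !mxtraceD tr_scalar.
have := psdq_tr_ge0 hS; have : Lam * n%:R * ka <= e.
  rewrite /ka mulrA ler_pdivrMr // mulrC ler_wpM2l ?ltW //; lra.
move=> e1 e2 e3; have := mulr_ge0 (ltW lam0) e2.
by move: a1 hX e1 e3; clear -lam0 Lam0; lra.
Qed.

Local Notation RR := (RR R n).
Definition sol1 F u := [/\ ellF F, qcF F, F 0 = 0,
  sol F [set y | `|y| < RR + 1] u & forall y, `|y| < RR + 1 -> `|u y| <= 1].

Hypothesis n0 : (0 < n)%N.

Lemma RR1_ge6 : 6 <= RR + 1.
Proof.
have : 1 <= n%:R :> R by rewrite ler1n.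
by rewrite [RR](erefl : _ = 4 * n%:R + 1); lra.
Qed.

(* A large second difference quotient propagates: it is attained, up to a factor [beta],
   on most of a neighbourhood unless it increases by the factor [beta] nearby, while the
   set where it is large has small content.  The increase cannot go on forever. *)
Lemma sdiff_bound : exists2 C : R, 0 < C & forall F u y x, sol1 F u -> y != 0 ->
  `|y| <= 1 -> `|x| <= 1 / 2 -> sdiff u y x <= C * nsq y.
Proof.
have [M1 [t1 [[M11 t10 t11] OL]]] := opening_decay lam0 Lam0 n0.
have [M2 [t2 [[M21 t20 t21] VL]]] := super_decay lam0 Lam0 n0.
have np : 0 < n%:R :> R by rewrite ltr0n.
have n1 : 1 <= n%:R :> R by rewrite ler1n.
have D6 := RR1_ge6; set D := RR + 1 in OL VL D6 *.
have D0 : 0 < D by apply: lt_le_trans D6.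
have [k1 hk1] : exists k1, t2 ^+ k1 <= (2 * 5 ^+ n)^-1 by apply: expr_small => //; pos.
have m20 : 0 < M2 ^+ k1 by apply: exprn_gt0; apply: lt_le_trans M21.
(* With this factor, [s' <= M2 ^+ k1] forces a quotient above 3/4 of [A]; by continuity such points
   keep a positive distance from those with quotient at most [A / 2]. *)
pose be := 1 + (4 * M2 ^+ k1)^-1.
have be1 : 1 < be by rewrite /be ltrDl; pos.
pose G := 2 * M1; have G2 : 2 <= G by rewrite /G; lra.
have G0 : 0 < G by apply: lt_le_trans G2.
have [B hB] := expr_large G be1.
(* By Bernoulli [t1 <= vt ^+ n]: a cube of radius proportional to [vt ^+ k] has a volume comparable
   to or above the bound [t1 ^+ k] for the exceptional set. *)
pose vt := 1 - (1 - t1) / n%:R.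
have vt1 : vt < 1 by rewrite /vt ltrBlDr ltrDl; apply: divr_gt0 => //; lra.
have vtt : t1 <= vt.
  by rewrite /vt lerBrDr addrC -lerBrDr ler_pdivrMr // ler_peMr //; lra.
have vt0 : 0 < vt by apply: lt_le_trans vtt.
have vtn : t1 <= vt ^+ n.
  have := @bernoulli _ (vt - 1) n; rewrite [1 + (vt - 1)]addrC subrK => H.
  apply: le_trans (H _); last by lra.
  rewrite /vt; have -> : 1 + n%:R * (1 - (1 - t1) / n%:R - 1) = t1 by field; rewrite gt_eqF.
  by [].
have s0 : 0 < 1 - vt by rewrite subr_gt0.
(* [c * vt ^+ k] is the total length of all moves from level [k] on, a geometric series of blocks of
   [B.+1] moves. *)
pose c := 11 * B.+1%:R * D / (1 - vt).
have Bp : 0 < B.+1%:R :> R by rewrite ltr0n.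
have c0 : 0 < c by rewrite /c; pos.
have [k0 hk0] : exists k0, vt ^+ k0 <= (2 * c)^-1 by apply: expr_small => //; pos.
have ck k : (k0 <= k)%N -> c * vt ^+ k <= 1 / 2.
  move=> kk; apply: le_trans (_ : c * vt ^+ k0 <= _).
    by rewrite ler_pM2l // ler_wiXn2l // ltW.
  apply: le_trans (ler_wpM2l (ltW c0) hk0) _.
  by rewrite le_eqVlt; apply/orP; left; apply/eqP; field; rewrite gt_eqF.
exists (20 * G ^+ k0); first by pos.
move=> F u y x [eF qF F0 su u1] y0 y1 x1.
have ny := nsq_gt0 y0.
pose zz x := sdiff u y x / nsq y.
rewrite -ler_pdivrMr // -/(zz x) leNgt; apply/negP => zx.
have opn w : `|w| < D -> exists2 r : R, 0 < r & forall z, `|z - w| < r -> `|z| < D.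
  move=> wD; exists (D - `|w|); first by rewrite subr_gt0.
  move=> z zw; rewrite -(subrK w z); apply: le_lt_trans (ler_normD _ _) _.
  by rewrite -ltrBrDr.
have sv := sdiff_super y eF qF opn su.
have inD w : `|w| <= 2 -> [/\ `|w| < D, `|w + y| < D & `|w - y| < D].
  move=> w2; have := ler_normD w y; have := ler_normB w y.
  by move: w2 y1 D6; clear -lam0 Lam0 n0 => *; split; lra.
have [_ v2] := sol_sup eF F0 su.
have {}sv : visc (supS 0) [set w | `|w| < 2] (fun w => - sdiff u y w).
  by apply: visc_subset sv _ => w /= w2; apply: inD; exact: ltW.
have szc w : `|w - 0| <= 3 / 2 -> {for w, continuous zz}.
  rewrite subr0 => w2; have [sc _] := sv; apply: (@contM _ _ _ (fun=> (nsq y)^-1)); last exact: contK.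
  apply: (@cont_ext _ _ (fun w => - - sdiff u y w)); first by move=> ?; rewrite opprK.
  by apply: contN; apply: sc => /=; apply: le_lt_trans w2 _; lra.
have uz (e : R) : 0 < e -> exists2 d : R, 0 < d & forall a b, `|a| <= 3 / 2 -> `|b| <= 3 / 2 ->
    `|a - b| < d -> `|zz a - zz b| < e.
  move=> e0; have [d d0 hd] := unif_cont szc e0.
  by exists d => // a b; have := hd a b; rewrite !subr0.
(* Otherwise the cube of radius [11 * vt ^+ k] about [w] would be covered by [K], with at most half
   of its cells by [VL], and by [K2], with fewer than half by [OL]; 11 is large enough because
   [2 * 5 ^+ n < 11 ^+ n]. *)
have step k w : (k0 <= k)%N -> `|w| + D * (11 * vt ^+ k) <= 1 -> 20 * G ^+ k <= zz w ->
    exists2 w', `|w' - w| < D * (11 * vt ^+ k) & be * zz w < zz w'.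
  move=> kk wr zw; set r := 11 * vt ^+ k in wr *; set A := zz w in zw *.
  have r0 : 0 < r by rewrite /r; pos.
  have rD : r <= D * r by rewrite ler_peMl //; [exact: ltW|move: D6; clear -lam0 Lam0 n0; lra].
  have Gk : 0 < G ^+ k by pos.
  have A0 : 0 < A by apply: lt_le_trans zw; pos.
  apply: contrapT => hno.
  have hle w' : `|w' - w| < D * r -> zz w' <= be * A.
    by move=> h; rewrite leNgt; apply/negP => h'; apply: hno; exists w'.
  have nw w' (rr : R) : `|w' - w| <= rr -> `|w'| <= `|w| + rr.
    move=> h; rewrite -(subrK w w') addrC; apply: le_trans (ler_normD _ _) _.
    by rewrite lerD2l.
  pose bA := (be - 1) * A; have bA0 : 0 < bA by rewrite /bA; apply: mulr_gt0 => //; rewrite subr_gt0.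
  pose kk' := (nsq y * bA)^-1; have kp : 0 < kk' by rewrite /kk'; pos.
  pose s' w := kk' * - sdiff u y (0 + 1 *: w) + be * A / bA.
  have s'E w' : s' w' = (be * A - zz w') / bA.
    by rewrite /s' /zz add0r scale1r /kk'; field; rewrite !gt_eqF.
  have s'v : visc (supS 0) [set w' | `|w' - w| < D * r] s'.
    have := visc_supS_affine 0 (be * A / bA) ltr01 kp sv; rewrite mulr0 => H.
    apply: visc_subset H _ => w' /= h; rewrite add0r scale1r.
    by apply: le_lt_trans (nw _ _ (ltW h)) _; move: wr; clear -lam0 Lam0 n0; lra.
  have s'0 w' : `|w' - w| < D * r -> 0 <= s' w'.
    by move=> h; rewrite s'E divr_ge0 ?subr_ge0 ?hle // ltW.
  pose K : set V := [set w' | `|w' - w| <= r /\ zz w' <= A / 2].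
  pose K2 : set V := [set w' | `|w'| <= 1 /\ A / 2 <= zz w'].
  have e4 : 0 < A / 4 by pos.
  have wr1 : `|w| + r <= 1 by move: wr rD; clear -lam0 Lam0 n0; lra.
  have HK : \forall m \near \oo, (Nm m K)%:R <= (5 * r * m%:R) ^+ n * t2 ^+ k1.
    apply: (VL s' w r w) => //.
            by move=> w' /nw h; apply: le_trans h wr1.
          by rewrite subrr normr0 ltW.
        rewrite s'E -/A; have -> : be * A - A = bA by rewrite /bA; ring.
        by rewrite divff ?gt_eqF.
      by move=> w' [].
    have [d d0 hd] := uz _ e4; exists d => // a b [a1 a2] b1 b2; rewrite leNgt; apply/negP => ab.
    have := hd a b _ _ ab; rewrite ltr_norml => /(_ _ _) H.
    have /andP[h1 h2] : - (A / 4) < zz a - zz b < A / 4.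
      apply: H; first by apply: le_trans (nw _ _ a1) _; move: wr1; clear -lam0 Lam0 n0; lra.
      by apply: le_trans (nw _ _ (ltW b1)) _; move: wr; clear -lam0 Lam0 n0; lra.
    move: b2; rewrite s'E ler_pdivrMr //.
    have -> : M2 ^+ k1 * bA = A / 4 by rewrite /bA /be; field; rewrite gt_eqF.
    have : A < be * A by rewrite ltr_pMl.
    by move: h1 a2; clear -lam0 Lam0 n0; lra.
  have b0 : 0 < 5 * M1 ^+ k by apply: mulr_gt0 => //; apply: exprn_gt0; apply: lt_le_trans M11.
  have HK2 : \forall m \near \oo, (Nm m K2)%:R <= (5 * m%:R) ^+ n * t1 ^+ k.
    apply: (OL (fun y => - u y)) => //.
        by move=> w' /u1; rewrite normrN.
      by move=> w' [].
    have [d d0 hd] := uz _ b0.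
    exists (Num.min (2^-1) d); first by rewrite lt_min d0 andbT.
    move=> a b [a1 a2] [bD [p hp]]; rewrite leNgt lt_min; apply/negP => /andP[ab1 ab2].
    have b32 : `|b| <= 3 / 2.
      have := ler_normB a (a - b); rewrite subKr; move: a1 ab1; clear -lam0 Lam0 n0; lra.
    have := hd a b _ b32 ab2; rewrite ltr_norml => H.
    have /andP[h1 h2] : - (5 * M1 ^+ k) < zz a - zz b < 5 * M1 ^+ k.
      by apply: H; move: a1; clear -lam0 Lam0 n0; lra.
    have [|_ b2 b3] := inD b; first by move: b32; clear -lam0 Lam0 n0; lra.
    have zb : zz b <= 5 * M1 ^+ k.
      rewrite /zz ler_pdivrMr // /sdiff.
      have := hp _ b2; have := hp _ b3; rewrite [b + y]addrC addrK.
      have -> : b - y - b = - y by rewrite addrAC subrr add0r.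
      by rewrite dotNr nsqN addrC; clear -lam0 Lam0 n0; lra.
    have MG : M1 ^+ k <= G ^+ k by rewrite lerXn2r ?nnegrE /G //; move: M11; clear -lam0 Lam0 n0; lra.
    by move: h2 a2 zw MG b0 zb; clear -lam0 Lam0 n0; lra.
  have [m [[m1 m2] m3]] : exists m : nat, (((Nm m K)%:R <= (5 * r * m%:R) ^+ n * t2 ^+ k1) /\
     ((Nm m K2)%:R <= (5 * m%:R) ^+ n * t1 ^+ k)) /\ 1 <= m%:R :> R.
    by apply: (@filter_ex _ \oo); apply: filterI; [exact: filterI|exact: ev_large].
  have mp : 0 < m%:R :> R by apply: lt_le_trans m3.
  have mm : (0 < m)%N by rewrite -(ltr_nat R).
  pose E : set V := [set w' | `|w' - w| <= r].
  have wE : window E by move=> w' /= /nw h; apply: le_trans h wr1.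
  have hE : (r * m%:R) ^+ n <= (Nm m E)%:R.
    apply: (@Nm_cube_ge _ _ m E w) => //; first exact: ltW.
    move=> w' hw; rewrite /E /=; apply: norm_le_coord; first exact: ltW.
    move=> i; have /andP[a1 a2] := hw i; rewrite !mxE ger0_norm; first by rewrite lerBlDr addrC.
    by rewrite subr_ge0.
  have hU : (Nm m E <= Nm m K + Nm m K2)%N.
    apply: leq_trans (NmU _ _ _); apply: Nm_mono => w' wE'; have [h|h] := leP (zz w') (A / 2).
      by left.
    by right; split; [exact: wE|exact: ltW].
  rewrite -(ler_nat R) natrD in hU.
  have T : t2 ^+ k1 * (5 * r * m%:R) ^+ n <= (r * m%:R) ^+ n / 2.
    rewrite -mulrA [(5 * _) ^+ n]exprMn.
    have rm : 0 <= (r * m%:R) ^+ n by pos.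
    have h5 : 0 < 5 ^+ n :> R by pos.
    apply: le_trans (_ : (2 * 5 ^+ n)^-1 * (5 ^+ n * (r * m%:R) ^+ n) <= _).
      by rewrite ler_wpM2r // mulr_ge0 // ltW.
    by rewrite le_eqVlt; apply/orP; left; apply/eqP; field; rewrite gt_eqF.
  have T1 : (11 * m%:R) ^+ n * t1 ^+ k <= (r * m%:R) ^+ n.
    have -> : r * m%:R = 11 * m%:R * vt ^+ k by rewrite /r; ring.
    rewrite [X in _ <= X]exprMn -[(vt ^+ k) ^+ n]exprM mulnC exprM; apply: ler_wpM2l; first by pos.
    by rewrite lerXn2r ?nnegrE // ?exprn_ge0 // ltW.
  have T2 : 2 * (5 * m%:R) ^+ n < (11 * m%:R) ^+ n :> R.
    rewrite !exprMn mulrA ltr_pM2r ?exprn_gt0 //.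
    case: (n) n0 => // n' _; rewrite !exprS mulrA.
    have : 5 ^+ n' <= 11 ^+ n' :> R by rewrite lerXn2r ?nnegrE ?ler0n ?ler_nat.
    have : 0 < 5 ^+ n' :> R by rewrite exprn_gt0 // ltr0n.
    by move: (5 ^+ n') (11 ^+ n') => a b; clear -n0 lam0 Lam0; lra.
  have tk : 0 < t1 ^+ k by pos.
  have := T2; rewrite -(ltr_pM2r tk).
  by move: hE hU m1 m2 T T1; clear -lam0 Lam0 n0; lra.
(* [B.+1] moves multiply the quotient by at least [G], which raises the level by one. *)
have block k w : (k0 <= k)%N -> `|w| <= 1 - c * vt ^+ k -> 20 * G ^+ k <= zz w ->
    exists2 w', `|w'| <= 1 - c * vt ^+ k.+1 & 20 * G ^+ k.+1 <= zz w'.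
  move=> kk wr zw; set r := D * (11 * vt ^+ k).
  have r0 : 0 < r by rewrite /r; pos.
  have rc : B.+1%:R * r = c * vt ^+ k - c * vt ^+ k.+1.
    by rewrite /r /c exprS; field; rewrite gt_eqF.
  have cp : 0 < c * vt ^+ k.+1 by pos.
  have Gk : 0 < 20 * G ^+ k by pos.
  have it (j : nat) : (j <= B.+1)%N -> exists2 w', `|w'| <= `|w| + j%:R * r & be ^+ j * (20 * G ^+ k) <= zz w'.
    elim: j => [|j IH] jB; first by exists w; rewrite ?mul0r ?addr0 ?expr0 ?mul1r.
    have [w' a1 a2] := IH (ltnW jB).
    have jr : j.+1%:R * r <= B.+1%:R * r by rewrite ler_pM2r // ler_nat.
    rewrite -natr1 mulrDl mul1r in jr *.
    have bj : 1 <= be ^+ j by apply: exprn_ege1; exact: ltW.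
    have z' : 20 * G ^+ k <= zz w' by apply: le_trans a2; rewrite ler_peMl // ltW.
    have wr' : `|w'| + D * (11 * vt ^+ k) <= 1.
      by rewrite -/r; move: a1 jr rc wr cp; clear -lam0 Lam0 n0; lra.
    have [w2 b1 b2] := step k w' kk wr' z'.
    exists w2.
      rewrite -(subrK w' w2); apply: le_trans (ler_normD _ _) _.
      by rewrite -/r in b1; move: b1 a1; clear -lam0 Lam0 n0; lra.
    apply: ltW; apply: le_lt_trans b2; rewrite exprS -mulrA ler_pM2l //.
    by apply: lt_trans be1.
  have [w' a1 a2] := it B.+1 (leqnn _); exists w'.
    by apply: le_trans a1 _; rewrite rc; move: wr; clear -lam0 Lam0 n0; lra.
  apply: le_trans a2; rewrite exprS mulrCA ler_pM2r //.
  apply: le_trans hB _; rewrite exprS ler_peMl //; last exact: ltW.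
  by apply: exprn_ge0; apply: ltW; apply: lt_trans be1.
have iter_ (i : nat) : exists2 w, `|w| <= 1 - c * vt ^+ (k0 + i) & 20 * G ^+ (k0 + i) <= zz w.
  elim: i => [|i [w a1 a2]].
    rewrite addn0; exists x; last exact: ltW.
    by have := ck k0 (leqnn _); move: x1; clear -lam0 Lam0 n0; lra.
  by rewrite addnS; apply: block a1 a2; exact: leq_addr.
(* For fixed [y] the quotient is at most [4 / nsq y], whereas along the moves it exceeds every bound
   since [G >= 2]. *)
have [i hi] := expr_large (4 / nsq y) (ltr1n R 2).
have [w a1 a2] := iter_ i.
have vp : 0 < c * vt ^+ (k0 + i) by pos.
have w2 : `|w| <= 2 by move: a1 vp; clear -lam0 Lam0 n0; lra.
have [b1 b2 b3] := inD w w2.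
have : zz w <= 4 / nsq y.
  rewrite /zz ler_pM2r ?invr_gt0 // /sdiff.
  have := u1 _ b1; have := u1 _ b2; have := u1 _ b3; rewrite !ler_norml.
  by move=> /andP[e1 e2] /andP[e3 e4] /andP[e5 e6]; move: e2 e4 e5; clear -lam0 Lam0 n0; lra.
have : 2 ^+ i <= G ^+ (k0 + i).
  apply: le_trans (_ : G ^+ i <= _); first by rewrite lerXn2r ?nnegrE // ltW.
  by rewrite ler_weXn2l ?leq_addl //; move: G2; clear -lam0 Lam0 n0; lra.
have : 0 < 2 ^+ i :> R by pos.
by move: hi a2; clear -lam0 Lam0 n0; lra.
Qed.
(** Near any [v] some point is touched from above with a huge opening. There the excess [H] over the
    paraboloid of opening [C] satisfies [H w <= 2 * H (w / 2)], by the bound on second differences,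
    and is at most of order [nsq w] near 0; iterating the first gives [H <= 0]. *)
Lemma touched_above_dense (C : R) u v (ep : R) : 0 < ep -> ep <= 1 / 8 -> `|v| <= 1 / 8 ->
  (forall y, `|y| <= 1 / 2 -> {for y, continuous u}) -> (forall y, `|y| <= 1 / 2 -> `|u y| <= 1) ->
  (forall y x, y != 0 -> `|y| <= 1 -> `|x| <= 1 / 2 -> sdiff u y x <= C * nsq y) ->
  exists x p, `|x - v| <= ep /\
   forall y, `|y| <= 1 / 2 -> u y <= u x + dot p (y - x) + C / 2 * nsq (y - x).
Proof.
move=> e0 e1 v1 uc u1 hC; pose a := 8 / ep ^+ 2; have a0 : 0 < a by rewrite /a; pos.
pose g y := a / 2 * nsq (y - v) - u y; pose h y : R := `|y - v| - ep.
have hE y : (h y <= 0) = (`|y - v| <= ep) by rewrite /h subr_le0.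
have hc y : {for y, continuous h} by exact: (contB (@cont_norm _ _ v y) (@contK _ _ _ y)).
have hb y : h y <= 0 -> `|y| <= 1 / 2.
  rewrite hE => yv; rewrite -(subrK v y); apply: le_trans (ler_normD _ _) _.
  by move: yv v1 e1; clear -lam0 Lam0 n0; lra.
have gc y : h y <= 0 -> {for y, continuous g}.
  move=> /hb/uc uy; apply: contB => //; apply: (@contM _ _ (fun=> a / 2)); [exact: contK|exact: cont_nsq].
have hv : h v <= 0 by rewrite hE subrr normr0 ltW.
have gv : g v < 2.
  have := u1 v; rewrite ler_norml /g subrr nsq0 mulr0 => /(_ _)/andP[|+ _]; last by clear -lam0 Lam0 n0; lra.
  by move: v1; clear -lam0 Lam0 n0; lra.
have gb y : h y = 0 -> 2 <= g y.
  move=> hy; have hy' : h y <= 0 by rewrite hy.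
  have := u1 _ (hb _ hy'); rewrite ler_norml => /andP[_ h1].
  have yv : `|y - v| = ep by apply/eqP; rewrite -subr_eq0 -/(h y) hy.
  have h2 : ep ^+ 2 <= nsq (y - v) by rewrite -yv norm_sq_le.
  have : 4 <= a / 2 * nsq (y - v).
    apply: le_trans (_ : a / 2 * ep ^+ 2 <= _); last by rewrite ler_pM2l //; pos.
    by rewrite /a le_eqVlt; apply/orP; left; apply/eqP; field; rewrite gt_eqF.
  by rewrite /g; move: h1; clear -lam0 Lam0 n0; lra.
have [x [hx _ [r r0 gm]]] := interior_min hc hb gc hv gv gb.
have xb := hb _ (ltW hx).
pose p := a *: (x - v); exists x, p; split; first by rewrite -hE ltW.
move=> y yb; pose H w := u (x + w) - u x - dot p w - C / 2 * nsq w.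
have mid (t : R) w : 0 <= t -> t <= 1 -> `|x + w| <= 1 / 2 -> `|x + t *: w| <= 1 / 2.
  move=> t0 t1 xw; have -> : x + t *: w = (1 - t) *: x + t *: (x + w).
    by rewrite scalerDr addrA -scalerDl subrK scale1r.
  apply: le_trans (ler_normD _ _) _; rewrite !mx_normZ (ger0_norm t0) ger0_norm ?subr_ge0 //.
  have i1 : (1 - t) * `|x| <= (1 - t) * (1 / 2) by rewrite ler_wpM2l // subr_ge0.
  have i2 : t * `|x + w| <= t * (1 / 2) by rewrite ler_wpM2l.
  by move: i1 i2; clear -lam0 Lam0 n0; lra.
have half w : `|x + w| <= 1 / 2 -> H w <= 2 * H (2^-1 *: w).
  move=> xw; have [->|w0] := eqVneq w 0.
    by rewrite scaler0 /H addr0 dot0r nsq0 mulr0; clear -lam0 Lam0 n0; lra.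
  have w1 : `|w| <= 1.
    have := ler_normB (x + w) x; rewrite [x + w - x]addrC addKr; move: xb xw; clear -lam0 Lam0 n0; lra.
  have := hC (2^-1 *: w) (x + 2^-1 *: w).
  rewrite scaler_eq0 invr_eq0 (negPf w0) orbF pnatr_eq0 => /(_ isT) H1.
  have {}H1 := H1 _ (mid _ _ _ _ xw).
  have i1 : sdiff u (2^-1 *: w) (x + 2^-1 *: w) <= C * nsq (2^-1 *: w).
    apply: H1; last by rewrite invf_le1 // ler1n.
      by rewrite mx_normZ ger0_norm ?invr_ge0 //; move: w1; clear -lam0 Lam0 n0; lra.
    by rewrite invr_ge0.
  have e2 : x + 2^-1 *: w + 2^-1 *: w = x + w.
    by rewrite -addrA -scalerDl (_ : 2^-1 + 2^-1 = 1 :> R) ?scale1r //; field.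
  move: i1; rewrite /sdiff addrK e2 /H nsqZ dotZr; clear -lam0 Lam0 n0; lra.
have dyad (k : nat) w : `|x + w| <= 1 / 2 -> H w <= 2 ^+ k * H ((2 ^+ k)^-1 *: w).
  elim: k => [|k IH] xw; first by rewrite expr0 invr1 scale1r mul1r.
  apply: le_trans (IH xw) _; rewrite exprSr -mulrA ler_pM2l ?exprn_gt0 //.
  have t0 : 0 <= (2 ^+ k)^-1 :> R by pos.
  have t1 : (2 ^+ k)^-1 <= 1 :> R by rewrite invf_le1 ?exprn_gt0 // exprn_ege1 // ler1n.
  by have := half _ (mid _ _ t0 t1 xw); rewrite scalerA -invfM [2 * _ ^+ k]mulrC.
have loc w : `|w| < r -> H w <= (a / 2 + `|C|) * nsq w.
  move=> wr; have := gm (x + w); rewrite [x + w - x]addrC addKr => /(_ wr); rewrite /g.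
  have -> : x + w - v = (x - v) + w by rewrite addrAC.
  rewrite (nsqD (x - v)) /H /p dotZl.
  have : - C / 2 * nsq w <= `|C| * nsq w.
    by rewrite ler_wpM2r ?nsq_ge0 //; have := ler_norm (- C); rewrite normrN; have := normr_ge0 C; clear -lam0 Lam0 n0; lra.
  by clear -lam0 Lam0 n0; lra.
set w := y - x; have xw : x + w = y by rewrite addrC subrK.
have wb : `|x + w| <= 1 / 2 by rewrite xw.
suff : H w <= 0 by rewrite /H xw; clear -lam0 Lam0 n0; lra.
apply/ler_addgt0Pr => e ep0; rewrite add0r.
pose T := (a / 2 + `|C|) * nsq w; have T0 : 0 <= T by rewrite /T; pos.
have [k hk] := expr_large (T / e + `|w| / r + 1) (ltr1n R 2).
have p0 : 0 < 2 ^+ k :> R by pos.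
have wr0 : 0 <= `|w| / r by pos.
have Te : 0 <= T / e by pos.
have kr : `|(2 ^+ k)^-1 *: w| < r.
  rewrite mx_normZ gtr0_norm ?invr_gt0 // mulrC ltr_pdivrMr // mulrC -ltr_pdivrMr //.
  by apply: lt_le_trans hk; move: Te; clear -lam0 Lam0 n0; lra.
apply: le_trans (dyad k w wb) _; apply: le_trans (ler_wpM2l (ltW p0) (loc _ kr)) _.
rewrite nsqZ; have -> : 2 ^+ k * ((a / 2 + `|C|) * ((2 ^+ k)^-1 ^+ 2 * nsq w)) = T / 2 ^+ k.
  by rewrite /T; field; rewrite gt_eqF.
rewrite ler_pdivrMr // mulrC -ler_pdivrMr //.
by apply: le_trans hk; move: wr0; clear -lam0 Lam0 n0; lra.
Qed.

(** [contact_lip] for [- u]: contact at [x] with slope [p] and opening [C] is contact with the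
    paraboloid of vertex [x - C^-1 *: p], so Lipschitz vertices mean Lipschitz slopes. *)
Lemma slope_lip (C NN : R) u x0 x1 p0 p1 : 0 < C ->
  visc (supS 0) [set y | `|y| < 1 / 2] (fun y => - u y) -> `|x0| <= 1 / 4 ->
  1 <= NN -> 32 * n%:R * Lam <= lam * NN ^+ 2 -> NN * ((n%:R + 1) * `|x1 - x0|) < 1 / 4 ->
  (forall y, `|y| <= 1 / 2 -> u y <= u x0 + dot p0 (y - x0) + C / 2 * nsq (y - x0)) ->
  (forall y, `|y| <= 1 / 2 -> u y <= u x1 + dot p1 (y - x1) + C / 2 * nsq (y - x1)) ->
  x1 != x0 -> nsq (p1 - p0) <= (2 * C ^+ 2 + 2 * (16 * (Lam * n%:R * C) / lam * (n%:R + 1)) ^+ 2) * nsq (x1 - x0).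
Proof.
move=> C0 uv x0b NN1 NN2 NN3 h0 h1 ne.
have nn : 0 <= n%:R :> R by [].

pose vx (x p : V) := x - C^-1 *: p.
have vtx x p y : (forall y, `|y| <= 1 / 2 -> u y <= u x + dot p (y - x) + C / 2 * nsq (y - x)) ->
    `|y| <= 1 / 2 -> - u x + C / 2 * nsq (x - vx x p) <= - u y + C / 2 * nsq (y - vx x p).
  move=> h /h; have -> : y - vx x p = (y - x) + C^-1 *: p by rewrite /vx opprB addrA addrAC.
  have -> : x - vx x p = C^-1 *: p by rewrite /vx subKr.
  rewrite (nsqD (y - x)) dotZr [dot (y - x) p]dotC.
  have -> : C / 2 * (nsq (y - x) + 2 * (C^-1 * dot p (y - x)) + nsq (C^-1 *: p)) =
     C / 2 * nsq (y - x) + dot p (y - x) + C / 2 * nsq (C^-1 *: p) by field; rewrite gt_eqF.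
  by clear -lam0 Lam0 n0; lra.
have d0 : 0 < `|x1 - x0| by rewrite normr_gt0 subr_eq0.
have r0 : 0 < (n%:R + 1) * `|x1 - x0| by pos.
have nsr : nsq (x1 - x0) <= ((n%:R + 1) * `|x1 - x0|) ^+ 2.
  apply: le_trans (nsq_le_norm _) _; rewrite exprMn ler_wpM2r ?sqr_ge0 //.
  by have := sqr_ge0 (n%:R : R); rewrite sqrrD1; clear -lam0 Lam0 n0 nn; lra.
have yb y : `|y - x0| < 1 / 4 -> `|y| <= 1 / 2.
  move=> h; rewrite -(subrK x0 y); apply: le_trans (ler_normD _ _) _.
  by move: h x0b; clear -lam0 Lam0 n0; lra.
have yb' y : `|y - x0| < 1 / 4 -> [set y | `|y| < 1 / 2] y.
  move=> h /=; rewrite -(subrK x0 y); apply: le_lt_trans (ler_normD _ _) _.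
  by move: h x0b; clear -lam0 Lam0 n0; lra.
have := contact_lip lam0 Lam0 uv (lexx 0) C0 r0 NN1 NN2 NN3 nsr yb'
  (fun y hy => vtx _ _ _ h0 (yb y hy)) (fun y hy => vtx _ _ _ h1 (yb y hy)).
rewrite addr0 => L.
have -> : p1 - p0 = C *: (x1 - x0) + (- C) *: (vx x1 p1 - vx x0 p0).
  rewrite /vx; apply/rowP => j; rewrite !mxE; field; by rewrite gt_eqF.
apply: le_trans (nsqD_le _ _) _; rewrite !nsqZ sqrrN.
move: L; set q := vx x1 p1 - vx x0 p0 => L.
have ns := norm_sq_le (x1 - x0).
have : (16 * (Lam * n%:R * C) / lam * ((n%:R + 1) * `|x1 - x0|)) ^+ 2 <=
   (16 * (Lam * n%:R * C) / lam * (n%:R + 1)) ^+ 2 * nsq (x1 - x0).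
  set c16 := 16 * _ / lam.
  have -> : (c16 * ((n%:R + 1) * `|x1 - x0|)) ^+ 2 = (c16 * (n%:R + 1)) ^+ 2 * `|x1 - x0| ^+ 2 by ring.
  by apply: ler_wpM2l => //; exact: sqr_ge0.
by move: L; clear -lam0 Lam0 n0; lra.
Qed.

(** Contact from above at two points with nearby slopes gives the lower bound between them as well.
    Such points are dense, so the bound extends to all [y] by continuity and to all [x] by passing
    to limits of slopes. *)
Lemma local_C11 : exists K rho : R, [/\ 0 < K, 0 < rho & rho <= 1 / 16] /\
  forall F u, sol1 F u -> exists g : V -> V, forall x y, `|x| <= rho -> `|y| <= rho ->
    `|u y - u x - dot (g x) (y - x)| <= K * nsq (y - x).
Proof.
have [C C0 hC] := sdiff_bound; have D6 := RR1_ge6.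
have nn : 0 <= n%:R :> R by [].
pose NN := 32 * n%:R * Lam / lam + 1.
have NN1 : 1 <= NN by rewrite /NN lerDr; pos.
have NN2 : 32 * n%:R * Lam <= lam * NN ^+ 2.
  rewrite [X in _ <= X]mulrC -ler_pdivrMr //; apply: le_trans (_ : NN <= _); first by rewrite /NN lerDl.
  by rewrite expr2 ler_peMl // (le_trans _ NN1).
pose rho := (32 * NN * (n%:R + 1))^-1.
have NN0 : 0 < NN by apply: lt_le_trans NN1.
have rho0 : 0 < rho by rewrite /rho; pos.
have rho1 : rho <= 1 / 32.
  rewrite /rho mul1r lef_pV2 ?posrE //; last by pos.
  rewrite -mulrA ler_peMr //; have : 1 * 1 <= NN * (n%:R + 1) by apply: ler_pM => //; lra.
  by rewrite mulr1.
pose L2 := 2 * C ^+ 2 + 2 * (16 * (Lam * n%:R * C) / lam * (n%:R + 1)) ^+ 2.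
have L20 : 0 <= L2 by rewrite /L2; pos.
pose K := L2 + 1 + C; have K0 : 0 < K by rewrite /K; pos.
exists K, rho; split; first by split=> //; apply: le_trans rho1 _; lra.
move=> F u su; have [eF qF F0 sO u1] := su.
have [_ v2] := sol_sup eF F0 sO.
have inD y : `|y| <= 1 / 2 -> `|y| < RR + 1 by move=> h; apply: le_lt_trans h _; move: D6; clear -lam0 Lam0 n0; lra.
have uc y : `|y| <= 1 / 2 -> {for y, continuous u}.
  by move=> /inD h; have [[+ _] _] := sO; apply.
have ub y : `|y| <= 1 / 2 -> `|u y| <= 1 by move=> /inD; exact: u1.
have v2' : visc (supS 0) [set y | `|y| < 1 / 2] (fun y => - u y).
  by apply: visc_subset v2 _ => y /= h; apply: inD; exact: ltW.
pose tch x p := forall y, `|y| <= 1 / 2 -> u y <= u x + dot p (y - x) + C / 2 * nsq (y - x).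
have dense v (ep : R) : 0 < ep -> ep <= 1 / 8 -> `|v| <= 1 / 8 -> exists x p, `|x - v| <= ep /\ tch x p.
  by move=> e0 e1 v1; apply: touched_above_dense => // y x; exact: (hC F u y x su).
have two x x' p p' : tch x p -> tch x' p' -> `|x| <= 2 * rho -> `|x'| <= 2 * rho ->
    `|u x' - u x - dot p (x' - x)| <= K * nsq (x' - x).
  move=> t t' xr xr'; have [->|ne] := eqVneq x' x; first by rewrite !subrr dot0r nsq0 mulr0 subrr normr0.
  have x4 : `|x| <= 1 / 4 by apply: le_trans xr _; move: rho1; clear -lam0 Lam0 n0; lra.
  have xh : `|x| <= 1 / 2 by apply: le_trans x4 _; clear -lam0 Lam0 n0; lra.
  have xh' : `|x'| <= 1 / 2 by apply: le_trans xr' _; move: rho1; clear -lam0 Lam0 n0; lra.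
  have N3 : NN * ((n%:R + 1) * `|x' - x|) < 1 / 4.
    apply: le_lt_trans (_ : NN * ((n%:R + 1) * (4 * rho)) < _).
      rewrite ler_pM2l // ler_wpM2l //.
      by apply: le_trans (ler_normB _ _) _; move: xr xr'; clear -lam0 Lam0 n0; lra.
    have -> : NN * ((n%:R + 1) * (4 * rho)) = 1 / 8.
      by rewrite /rho; field; rewrite !gt_eqF //; pos.
    by clear -lam0 Lam0 n0; lra.
  have lp := slope_lip C0 v2' x4 NN1 NN2 N3 t t' ne; rewrite -/L2 in lp.
  have t1 := t x' xh'; have t2 := t' x xh.
  have cs : - (2 * dot (p' - p) (x' - x)) <= nsq (p' - p) + nsq (x' - x).
    by have := nsq_ge0 ((p' - p) + (x' - x)); rewrite (nsqD (p' - p)); clear -lam0 Lam0 n0; lra.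
  have e1 : dot p' (x - x') = - dot p (x' - x) - dot (p' - p) (x' - x) by rewrite !dotE; ring.
  rewrite e1 (nsqC x) in t2.
  have q0 := nsq_ge0 (x' - x).
  have q1 : 0 <= L2 * nsq (x' - x) by pos.
  have q2 : 0 <= C * nsq (x' - x) by pos.
  rewrite ler_norml /K; move: t1 t2 cs lp q0 q1 q2; clear -lam0 Lam0 n0 => *.
  by apply/andP; split; lra.
have one x p y : tch x p -> `|x| <= 2 * rho -> `|y| <= rho ->
    `|u y - u x - dot p (y - x)| <= K * nsq (y - x).
  move=> t xr yr; rewrite -subr_le0 leNgt; apply/negP.
  pose ps y := `|u y - u x - dot p (y - x)| - K * nsq (y - x); rewrite -/(ps y) => py.
  have yh : `|y| <= 1 / 2 by apply: le_trans yr _; move: rho1; clear -lam0 Lam0 n0; lra.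
  have psc : {for y, continuous (fun y => u y - u x - dot p (y - x))}.
    by apply: contB; [apply: contB; [exact: uc|exact: contK]|exact: cont_dot].
  have nsc : {for y, continuous (fun y => K * nsq (y - x))}.
    by apply: (@contM _ _ (fun=> K)); [exact: contK|exact: cont_nsq].
  have p2 : 0 < ps y / 2 by pos.
  have [d1 d10 h1] := (contP _ _).1 psc _ p2.
  have [d2 d20 h2] := (contP _ _).1 nsc _ p2.
  pose d := Num.min (rho / 2) (Num.min d1 d2 / 2).
  have dd0 : 0 < Num.min d1 d2 by rewrite lt_min d10.
  have d0 : 0 < d by rewrite /d lt_min; apply/andP; split; pos.
  have dr : d <= rho / 2 by rewrite /d ge_min lexx.
  have d12 : d <= Num.min d1 d2 / 2 by rewrite /d ge_min lexx orbT.
  have [||x' [p' [xy t']]] := dense y d d0.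
      by move: dr rho1; clear -lam0 Lam0 n0; lra.
    by move: yr rho1; clear -lam0 Lam0 n0; lra.
  have xr' : `|x'| <= 2 * rho.
    rewrite -(subrK y x'); apply: le_trans (ler_normD _ _) _.
    by move: xy yr dr rho0; clear -lam0 Lam0 n0; lra.
  have := two _ _ _ _ t t' xr xr'.
  have xlt : `|x' - y| < Num.min d1 d2 by move: xy d12 dd0; clear -lam0 Lam0 n0; lra.
  move: xlt; rewrite lt_min => /andP[/h1 k1 /h2 k2].
  have k3 := ler_dist_dist (u y - u x - dot p (y - x)) (u x' - u x - dot p (x' - x)).
  rewrite distrC in k1; move: (le_lt_trans k3 k1) k2 p2; rewrite /ps !ltr_norml.
  by move=> /andP[l1 l2] /andP[l3 l4]; clear -lam0 Lam0 n0 l1 l2 l3 l4; lra.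
have [U [UU oU]] := free_ultrafilter.
have pb x p : tch x p -> `|x| <= 2 * rho -> `|p| <= 8 * (2 + C).
  move=> t xr; apply: norm_le_coord; first by pos.
  move=> j; have dl : `|delta_mx 0 j : V| <= 1.
    by apply: norm_le_of_nsq => //; rewrite nsq_delta expr1n.
  have x4 : `|x| <= 1 / 4 by apply: le_trans xr _; move: rho1; clear -lam0 Lam0 n0; lra.
  have bd (s : R) : `|s| = 1 -> - (s * p 0 j) <= 8 * (2 + C).
    move=> s1; have yb : `|x + (s / 8) *: delta_mx 0 j| <= 1 / 2.
      apply: le_trans (ler_normD _ _) _; rewrite mx_normZ normrM s1 mul1r ger0_norm ?invr_ge0 //.
      by move: dl x4; clear -lam0 Lam0 n0; lra.
    have := t _ yb; rewrite [x + _ - x]addrC addKr dotZr dot_delta nsqZ nsq_delta mulr1 exprMn.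
    have -> : s ^+ 2 = 1 by rewrite -real_normK ?num_real // s1 expr1n.
    have := ub _ yb; have := ub x ltac:(by move: x4; clear -lam0 Lam0 n0; lra).
    rewrite !ler_norml => /andP[a1 a2] /andP[a3 a4]; move: a1 a2 a3 a4 C0.
    by rewrite exprVn; clear -lam0 Lam0 n0; lra.
  have := bd 1; have := bd (-1); rewrite normrN normr1 mulN1r opprK mul1r.
  by move=> /(_ erefl) b1 /(_ erefl) b2; rewrite ler_norml; move: b1 b2; clear -lam0 Lam0 n0; lra.
suff /choice[g hg] x : exists g, `|x| <= rho -> forall y, `|y| <= rho ->
    `|u y - u x - dot g (y - x)| <= K * nsq (y - x) by exists g => x y xr; apply: hg.
have [xr|xr] := leP `|x| rho; last by exists 0.
have /choice[xp hxp] (k : nat) : exists xp : V * V,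
    [/\ `|xp.1 - x| <= k.+1%:R^-1, `|xp.1| <= 2 * rho & tch xp.1 xp.2].
  pose e := Num.min k.+1%:R^-1 (rho / 2).
  have e0 : 0 < e by rewrite /e lt_min invr_gt0 ltr0n /=; pos.
  have er : e <= rho / 2 by rewrite /e ge_min lexx orbT.
  have ek : e <= k.+1%:R^-1 by rewrite /e ge_min lexx.
  have [||x' [p' [xy t']]] := dense x e e0.
      by move: er rho1; clear -lam0 Lam0 n0; lra.
    by move: xr rho1; clear -lam0 Lam0 n0; lra.
  exists (x', p'); split=> //=; first exact: le_trans xy ek.
  rewrite -(subrK x x'); apply: le_trans (ler_normD _ _) _.
  by move: xy xr er rho0; clear -lam0 Lam0 n0; lra.
have /choice[g hg] (j : 'I_n) : exists l, utends U (fun k => (xp k).2 0 j) l.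
  apply: (utends_ex UU (B := 8 * (2 + C))); apply: filterE => k /=.
  apply: le_trans (coord_le_norm _ _) _; have [_ h1 h2] := hxp k; exact: pb h2 h1.
exists (\row_j g j) => _ y yr.
have tw : U [set k | `|(xp k).1 - x| <= k.+1%:R^-1] by apply: filterE => k; have [] := hxp k.
have xh : `|x| <= 1 / 2 by apply: le_trans xr _; move: rho1; clear -lam0 Lam0 n0; lra.
have tu := utends_cont UU oU (uc x xh) tw.
have tq : utends U (fun k => nsq (y - (xp k).1)) (nsq (y - x)).
  apply: (utends_cont (f := fun w => nsq (y - w))) => //.
  by apply: (@cont_ext _ _ (fun w => nsq (w - y))); [move=> z; rewrite nsqC|exact: cont_nsq].
have td : utends U (fun k => dot (xp k).2 (y - x)) (dot (\row_j g j) (y - x)).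
  by apply: utends_dot => // j; rewrite mxE.
have tz : utends U (fun k => dot (xp k).2 (x - (xp k).1)) 0.
  apply: (@utends_sqz _ _ _ _ (fun k => n%:R * (8 * (2 + C)) * k.+1%:R^-1)).
    by rewrite -(mulr0 (n%:R * (8 * (2 + C)))); apply: utendsZ => //; exact: utends_inv.
  apply: filterE => k /=; rewrite subr0; have [h1 h2 h3] := hxp k.
  apply: le_trans (dot_norm_le _ _) _; apply: ler_pM => //; [|by rewrite distrC].
  by rewrite ler_wpM2l // (pb _ _ h3).
have t1 := utends_abs UU (utendsB UU (utendsB UU (utends_cst UU (u y)) tu) (utendsD UU td tz)).
rewrite addr0 in t1.
apply: (utends_le UU t1 (utendsZ UU K tq)); apply: filterE => k /=.
have [h1 h2 h3] := hxp k; have := one _ _ _ h3 h2 yr.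
by rewrite -dotDr addrA subrK.
Qed.
End Operators.

(** * Entire solutions *)

Section Liouville.
Variables (R : realType) (n : nat) (lam Lam : R).
Local Notation V := 'rV[R]_n.
Implicit Types (x y z p v w e : V) (M N P Q A : 'M[R]_n) (s u : V -> R).
Hypothesis lam0 : 0 < lam.
Hypothesis Lam0 : 0 < Lam.
Hypothesis n0 : (0 < n)%N.
Local Notation supS := (supS lam Lam).
Local Notation RR := (RR R n).

Lemma supS0_affine (O : set V) s c (r k d : R) : 0 < r -> 0 < k -> visc (supS 0) O s ->
  visc (supS 0) [set y | O (c + r *: y)] (fun y => k * s (c + r *: y) + d).
Proof. by move=> r0 k0 sv; have := visc_supS_affine c d r0 k0 sv; rewrite mulr0. Qed.

(** If [s x > 0], a large multiple of [s] exceeds the constant of [barrier] on a small ball about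
    [x] and still vanishes at [x0]. *)
Lemma strong_min s x0 : visc (supS 0) setT s -> (forall y, 0 <= s y) -> s x0 = 0 ->
  forall x, s x = 0.
Proof.
move=> sv s0 sx0 x; apply/eqP; rewrite eq_le s0 andbT leNgt; apply/negP => sx.
have [sc _] := sv; have sx2 : 0 < s x / 2 by pos.
have [d d0 hd] := (contP _ _).1 (sc x I) _ sx2.
have rho0 : 0 < d / 2 by pos.
pose R1 := nsq (x0 - x) + 1; have R10 : 0 <= R1 by rewrite /R1; pos.
have R12 : R1 < R1 + 1 by rewrite ltrDl.
have [C [f0 [C1 f00 hb]]] := barrier n lam0 Lam0 rho0 R10 R12.
have C0 : 0 < C by apply: lt_le_trans C1.
pose k := 2 * C / s x; have k0 : 0 < k by rewrite /k; pos.
have sv' := supS0_affine 0 0 ltr01 k0 sv.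
have [] := hb _ _ 0 x x0 (ltW f00) sv'.
      move=> y _; split=> //=; rewrite addr0 add0r scale1r mulr_ge0 //; exact: ltW.
    have := nsq_ge0 (x0 - x); rewrite /R1; move: (nsq _) => t t0.
    by rewrite sqrrD1; have := sqr_ge0 t; clear -lam0 Lam0 n0 t0; lra.
  by rewrite add0r scale1r sx0 mulr0 addr0.
move=> z z1; rewrite add0r scale1r addr0.
have zd : `|z - x| < d.
  apply: le_lt_trans (_ : d / 2 < d); last by move: d0; clear -lam0 Lam0 n0; lra.
  by apply: norm_le_of_nsq => //; exact: ltW.
have := hd z zd; rewrite ltr_norml => /andP[h1 _].
rewrite leNgt => /negP; apply.
have -> : C = k * (s x / 2) by rewrite /k; field; rewrite gt_eqF.
by rewrite ltr_pM2l //; move: h1; clear -lam0 Lam0 n0; lra.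
Qed.

(* Each of the [s i] is small on most of a large cube, hence they are small simultaneously. *)
Lemma common_small (J : finType) : exists2 T : R, 0 < T &
  forall (s : J -> V -> R) (x : J -> V), (forall i, visc (supS 0) setT (s i)) ->
  (forall i y, 0 <= s i y) -> (forall i, s i (x i) <= 1) -> exists y, forall i, s i y <= T.
Proof.
have [M [th [[M1 th0 th1] VL]]] := super_decay lam0 Lam0 n0.
have D6 := @RR1_ge6 R n n0; set D := RR + 1 in D6 VL.
set N : R := #|J|%:R; have N0 : 0 <= N by rewrite /N.
have [k hk] : exists k, th ^+ k <= (2 * ((N + 1) * 5 ^+ n))^-1 by apply: expr_small => //; pos.
have Mk : 0 < M ^+ k by apply: exprn_gt0; apply: lt_le_trans M1.
exists (2 * M ^+ k); first by pos.
move=> s x sv s0 sx; apply: contrapT => hno.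
(* If the conclusion failed, the sets [K i] below would cover the rescaled cube, yet for this [k]
   their counts add up to at most half of it. *)
have hex y : exists i, 2 * M ^+ k <= s i y.
  apply: contrapT => h; apply: hno; exists y => i; rewrite leNgt; apply/negP => h'.
  by apply: h; exists i; exact: ltW.
pose B := \sum_i `|x i| + 1.
have xB i : `|x i| <= B.
  by rewrite /B (bigD1 i) //= -addrA lerDl addr_ge0 // sumr_ge0.
have B0 : 0 < B by rewrite /B ltr_wpDl // sumr_ge0.
pose s' i y := 1 * s i (0 + B *: y) + 0.
have s'E i y : s' i y = s i (B *: y) by rewrite /s' mul1r add0r addr0.
have s'v i : visc (supS 0) setT (s' i) by exact: (supS0_affine 0 0 B0 ltr01 (sv i)).
pose K i : set V := [set y | `|y| <= 1 /\ 2 * M ^+ k <= s' i y].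
have HK i : \forall m \near \oo, (Nm m (K i))%:R <= (5 * 1 * m%:R) ^+ n * th ^+ k.
  apply: (VL (s' i) 0 1 (B^-1 *: x i)) => //.
              by move=> y; rewrite subr0.
            exact: visc_subset (s'v i) _.
          by move=> y _; rewrite s'E.
        by rewrite subr0 mx_normZ gtr0_norm ?invr_gt0 // mulrC ler_pdivrMr // mul1r.
      by rewrite s'E scalerA mulfV ?gt_eqF // scale1r.
    by move=> y [? _]; rewrite subr0.
  have sc y : `|y - 0| <= 2 -> {for y, continuous (s' i)} by move=> _; apply: (s'v i).1.
  have [d d0 hd] := unif_cont sc Mk.
  exists (Num.min 1 d); first by rewrite lt_min ltr01.
  move=> a b [a1 a2] _ b2; rewrite leNgt lt_min; apply/negP => /andP[ab1 ab2].
  have b3 : `|b - 0| <= 2.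
    by rewrite subr0; have := ler_normB a (a - b); rewrite subKr; move: a1 ab1; clear -lam0 Lam0 n0; lra.
  have a3 : `|a - 0| <= 2 by rewrite subr0; move: a1; clear -lam0 Lam0 n0; lra.
  have := hd a b a3 b3 ab2; rewrite ltr_norml => /andP[_].
  by move: a2 b2; clear -lam0 Lam0 n0; lra.
have [m [m1 m2]] : exists m : nat, (forall i, (Nm m (K i))%:R <= (5 * 1 * m%:R) ^+ n * th ^+ k) /\
    1 <= m%:R :> R.
  apply: (@filter_ex _ \oo); apply: filterI; last exact: ev_large.
  exact: (@filter_forall _ J (fun i m => (Nm m (K i))%:R <= (5 * 1 * m%:R) ^+ n * th ^+ k) \oo _ HK).
have mp : 0 < m%:R :> R by apply: lt_le_trans m2.
have mm : (0 < m)%N by rewrite -(ltr_nat R).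
pose E : set V := [set y | `|y| <= 1].
have wE : window E by [].
have hE : (1 * m%:R) ^+ n <= (Nm m E)%:R :> R.
  apply: (@Nm_cube_ge _ _ m E 0) => // y hy; apply: norm_le_coord => // i.
  by have /andP[] := hy i; rewrite mxE add0r => y0 y1; rewrite ger0_norm.
have hU : (Nm m E <= \sum_i Nm m (K i))%N.
  by apply: Nm_bigU => y yE; have [i hi] := hex (B *: y); exists i; split=> //; rewrite s'E.
rewrite -(ler_nat R) natr_sum in hU.
have hS : \sum_i (Nm m (K i))%:R <= N * ((5 * 1 * m%:R) ^+ n * th ^+ k).
  by rewrite /N mulr_natl -sumr_const; apply: ler_sum => i _.
have p5 : 0 < 5 ^+ n :> R by pos.
have pm : 0 < m%:R ^+ n :> R by pos.
have : N * ((5 * 1 * m%:R) ^+ n * th ^+ k) <= m%:R ^+ n / 2.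
  rewrite mulr1 exprMn.
  apply: le_trans (_ : (N + 1) * (5 ^+ n * m%:R ^+ n * (2 * ((N + 1) * 5 ^+ n))^-1) <= _).
    apply: ler_pM => //; [by pos|by rewrite lerDl|by apply: ler_wpM2l => //; pos].
  rewrite le_eqVlt; apply/orP; left; apply/eqP; field.
  by rewrite !gt_eqF //; move: N0; clear -lam0 Lam0 n0; lra.
by rewrite mul1r in hE; move: hE hU hS pm; clear -lam0 Lam0 n0; lra.
Qed.

Definition C11on (K B : R) u (g : V -> V) := forall x y, `|x| <= B -> `|y| <= B ->
  `|u y - u x - dot (g x) (y - x)| <= K * nsq (y - x).

Lemma C11on_slope (K B : R) u (g : V -> V) : 0 < K -> 0 < B -> C11on K (B + 1) u g ->
  u 0 = 0 -> g 0 = 0 ->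
  (forall y, `|y| <= B + 1 -> `|u y| <= K * nsq y) /\
  (forall y, `|y| <= B -> `|g y| <= 2 * (K * (n%:R * (B + 1) ^+ 2)) + K).
Proof.
move=> K0 B0 h u0 g0; have nn : 0 <= n%:R :> R by [].
have b1 y : `|y| <= B + 1 -> `|u y| <= K * nsq y.
  move=> yB; have := h 0 y _ yB; rewrite u0 g0 dot0l !subr0; apply.
  by rewrite normr0; pos.
split=> // y yB; apply: norm_le_coord; first by pos.
move=> j; have dl : `|delta_mx 0 j : V| <= 1.
  by apply: norm_le_of_nsq => //; rewrite nsq_delta expr1n.
have y1 : `|y| <= B + 1 by move: yB; clear -lam0 Lam0 n0; lra.
have y2 : `|y + delta_mx 0 j| <= B + 1.
  by apply: le_trans (ler_normD _ _) _; move: yB dl; clear -lam0 Lam0 n0; lra.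
have nb z : `|z| <= B + 1 -> K * nsq z <= K * (n%:R * (B + 1) ^+ 2).
  move=> zB; rewrite ler_pM2l //; apply: le_trans (nsq_le_norm _) _; rewrite ler_wpM2l //.
  by rewrite ler_sqr ?nnegrE //; pos.
have := h y _ y1 y2; rewrite [y + _ - y]addrC addKr nsq_delta dot_delta mulr1.
have := le_trans (b1 _ y1) (nb _ y1); have := le_trans (b1 _ y2) (nb _ y2).
rewrite !ler_norml => /andP[a1 a2] /andP[a3 a4] /andP[a5 a6].
by move: a1 a2 a3 a4 a5 a6; clear -lam0 Lam0 n0 => *; apply/andP; split; lra.
Qed.

Lemma C11_limit (U : set_system nat) (K : R) (vk : nat -> V -> R) (gk : nat -> V -> V) :
  UltraFilter U -> 0 < K -> (forall B : R, 0 < B -> U [set k | C11on K B (vk k) (gk k)]) ->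
  (forall k, vk k 0 = 0) -> (forall k, gk k 0 = 0) ->
  exists (v : V -> R) (g : V -> V), [/\ forall y, utends U (fun k => vk k y) (v y),
    forall B, C11on K B v g, v 0 = 0, g 0 = 0 &
    forall B : R, 0 < B -> exists2 L : R, 0 <= L & U [set k | forall x y,
     `|x| <= B -> `|y| <= B -> `|vk k x - vk k y| <= L * `|x - y|]].
Proof.
move=> UU K0 hk v0 g0; have nn : 0 <= n%:R :> R by [].
have sl (B : R) : 0 < B -> U [set k | [/\ C11on K (B + 1) (vk k) (gk k),
   forall y, `|y| <= B + 1 -> `|vk k y| <= K * nsq y &
   forall y, `|y| <= B -> `|gk k y| <= 2 * (K * (n%:R * (B + 1) ^+ 2)) + K]].
  move=> B0; have B1 : 0 < B + 1 by pos.
  apply: filterS (hk _ B1) => k h; have [] := C11on_slope K0 B0 h (v0 k) (g0 k).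
  by split.
have y1 y : 0 < `|y| + 1 by pos.
have /choice[v tv] y : exists l, utends U (fun k => vk k y) l.
  apply: (utends_ex UU (B := K * nsq y)); apply: filterS (sl _ (y1 y)) => k [_ h _] /=.
  by apply: h; rewrite -addrA lerDl.
have /choice[g tg] y : exists l : V, forall j, utends U (fun k => gk k y 0 j) (l 0 j).
  have /choice[gg hg] (j : 'I_n) : exists l, utends U (fun k => gk k y 0 j) l.
    apply: (utends_ex UU (B := 2 * (K * (n%:R * (`|y| + 1 + 1) ^+ 2)) + K)).
    apply: filterS (sl _ (y1 y)) => k [_ _ h] /=; apply: le_trans (coord_le_norm _ _) (h _ _).
    by rewrite lerDl.
  by exists (\row_j gg j) => j; rewrite mxE; exact: hg.
exists v, g; split=> //.
        move=> B x y _ _.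
        have td : utends U (fun k => dot (gk k x) (y - x)) (dot (g x) (y - x)) by apply: utends_dot.
        have t1 := utends_abs UU (utendsB UU (utendsB UU (tv y) (tv x)) td).
        apply: (utends_le UU t1 (utends_cst UU _)).
        have Bp : 0 < `|x| + `|y| + 1 by pos.
        apply: filterS (hk _ Bp) => k h /=; apply: h.
          by rewrite -addrA lerDl; pos.
        by rewrite addrAC lerDr; pos.
      apply: utends_uniq (tv 0) _ => //; apply: utends_eq (utends_cst UU 0) => //.
      by apply: filterE => k /=; rewrite v0.
    apply/rowP => j; rewrite mxE; apply: utends_uniq (tg 0 j) _ => //.
    apply: utends_eq (utends_cst UU 0) => //.
    by apply: filterE => k /=; rewrite g0 mxE.
move=> B B0; set L1 := 2 * (K * (n%:R * (B + 1) ^+ 2)) + K.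
have L10 : 0 <= L1 by rewrite /L1; pos.
exists (n%:R * L1 + K * n%:R * (2 * B)); first by pos.
apply: filterS (sl _ B0) => k [h1 h2 h3] x y xB yB.
have x1 : `|x| <= B + 1 by move: xB; clear -lam0 Lam0 n0; lra.
have y2 : `|y| <= B + 1 by move: yB; clear -lam0 Lam0 n0; lra.
have d1 := dot_norm_le (gk k y) (x - y).
have d2 : n%:R * `|gk k y| * `|x - y| <= n%:R * L1 * `|x - y|.
  by rewrite ler_wpM2r // ler_wpM2l // h3.
have d3 : K * nsq (x - y) <= K * n%:R * (2 * B) * `|x - y|.
  rewrite -!mulrA ler_pM2l //; apply: le_trans (nsq_le_norm _) _.
  rewrite ler_wpM2l // expr2 mulrA ler_wpM2r //.
  by apply: le_trans (ler_normB _ _) _; move: xB yB; clear -lam0 Lam0 n0; lra.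
have d4 := h1 y x y2 x1.
have -> : vk k x - vk k y = (vk k x - vk k y - dot (gk k y) (x - y)) + dot (gk k y) (x - y) by ring.
apply: le_trans (ler_normD _ _) _; rewrite mulrDl.
by move: d1 d2 d3 d4; clear -lam0 Lam0 n0; lra.
Qed.

(** Polarisation, where the case [i = j] supplies the diagonal. *)
Lemma qf_determined A M :
  (forall i j, qf A (delta_mx 0 i + delta_mx 0 j) = qf M (delta_mx 0 i + delta_mx 0 j)) ->
  forall x, qf A x = qf M x.
Proof.
move=> h x; apply/eqP; rewrite -subr_eq0 -qfN -qfD; set D := A - M.
have hD i j : qf D (delta_mx 0 i + delta_mx 0 j) = 0 by rewrite qfD qfN h subrr.
have ent i j : dot ((delta_mx 0 i : V) *m (D + D^T)) (delta_mx 0 j) = D i j + D j i.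
  by rewrite dot_delta -rowE !mxE.
have di i : D i i = 0.
  by have := hD i i; rewrite qf_addr ent qf_delta; clear -lam0 Lam0 n0; lra.
have dij i j : D i j + D j i = 0.
  by have := hD i j; rewrite qf_addr ent !qf_delta !di; clear -lam0 Lam0 n0; lra.
have -> : qf D x = 2^-1 * dot (x *m (D + D^T)) x.
  by rewrite mulmxDr dotDl [dot (x *m D^T) x]dot_mulmx trmxK [dot x _]dotC -/(qf D x); field.
suff -> : D + D^T = 0 by rewrite mulmx0 dot0l mulr0.
by clearbody D; apply/matrixP => i j; rewrite !mxE dij.
Qed.

Variable F : 'M[R]_n -> R.
Hypothesis eF : ellF lam Lam F.
Hypothesis qF : qcF F.

Lemma sol_rescale (O : set V) u c (r a : R) q : 0 < r -> sol F O u ->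
  sol F [set y | O (c + r *: y)] (fun y => (r ^+ 2)^-1 * (u (c + r *: y) - (a + dot q y))).
Proof.
move=> r0 [u1 u2]; split; first exact: visc_rescale.
have := visc_rescale c (- a) (- q) r0 u2; congr (visc _ _ _); apply/funext => y.
by rewrite dotNl; ring.
Qed.

Lemma sol_ulim (U : set_system nat) (Fk : nat -> 'M[R]_n -> R) (vk : nat -> V -> R) (v : V -> R) :
  UltraFilter U -> (forall k, ellF lam Lam (Fk k)) -> (forall M, utends U (fun k => Fk k M) (F M)) ->
  (forall y, utends U (fun k => vk k y) (v y)) ->
  (forall B : R, 0 < B -> exists2 L : R, 0 <= L & U [set k | forall x y,
     `|x| <= B -> `|y| <= B -> `|vk k x - vk k y| <= L * `|x - y|]) ->
  (forall B : R, U [set k | sol (Fk k) [set y | `|y| < B] (vk k)]) -> sol F setT v.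
Proof.
move=> UU ek tF tv lip sv; split.
  apply: (visc_ulim UU (sk := vk) (Ak := fun k M => Fk k M <= 0)) => //.
    by move=> B; apply: filterS (sv B) => k [].
  move=> M hM; have := @ell_super_closed _ _ _ _ Lam0 F M 1 eF ler01; rewrite scale1r; apply.
  move=> ka ka0; rewrite scale1r; apply: (utends_le UU (tF _) (utends_cst UU 0)).
  exact: hM.
apply: (visc_ulim UU (sk := fun k y => - vk k y) (Ak := fun k M => 0 <= Fk k (- M))).
      by move=> y; apply: utendsN.
    move=> B B0; have [L L0 h] := lip B B0; exists L => //; apply: filterS h => k h x y xB yB.
    by rewrite -opprD normrN; apply: h.
  by move=> B; apply: filterS (sv B) => k [].
move=> M hM; have := @ell_sub_closed _ _ _ _ Lam0 F M 1 eF ler01; rewrite scale1r; apply.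
move=> ka ka0; rewrite scale1r; apply: (utends_le UU (utends_cst UU 0) (tF _)).
exact: hM.
Qed.

Definition dq u (j : nat) e x : R := 4 ^+ j * sdiff u ((2 ^+ j)^-1 *: e) x.

(** Halving the step writes a quotient as an average of finer ones, so passing to finer steps loses
    nothing of the supremum. *)
Lemma dq_avg u j e x : dq u j e x = 4^-1 * dq u j.+1 e (x + (2 ^+ j.+1)^-1 *: e) +
  2^-1 * dq u j.+1 e x + 4^-1 * dq u j.+1 e (x - (2 ^+ j.+1)^-1 *: e).
Proof.
rewrite /dq; have -> : (2 ^+ j)^-1 *: e = (2 ^+ j.+1)^-1 *: e + (2 ^+ j.+1)^-1 *: e.
  by rewrite -scalerDl; congr (_ *: _); rewrite exprS invfM; field; rewrite expf_neq0 ?pnatr_eq0.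
move: (_ *: e) => h; rewrite /sdiff !addrK !subrK exprS.
have -> : x + (h + h) = x + h + h by rewrite addrA.
have -> : x - (h + h) = x - h - h by rewrite opprD addrA.
by field.
Qed.

Lemma sdiff_rs u g c (r : R) e y : 0 < r ->
  sdiff (fun y => (r ^+ 2)^-1 * (u (c + r *: y) - (u c + dot (r *: g) y))) e y =
  (r ^+ 2)^-1 * sdiff u (r *: e) (c + r *: y).
Proof.
move=> r0; rewrite /sdiff !scalerDr scalerN !addrA !dotE; ring.
Qed.

Lemma dq_rs u g c (m j : nat) e y :
  dq (fun y => (((2 ^+ m)^-1) ^+ 2)^-1 * (u (c + (2 ^+ m)^-1 *: y) -
      (u c + dot ((2 ^+ m)^-1 *: g) y))) j e y =
  dq u (m + j) e (c + (2 ^+ m)^-1 *: y).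
Proof.
have r0 : 0 < (2 ^+ m)^-1 :> R by pos.
rewrite /dq sdiff_rs // scalerA -invfM -!exprD mulrA; congr (_ * _).
have -> : 4 = 2 ^+ 2 :> R by rewrite -natrX.
by rewrite exprVn invrK [RHS]exprD [LHS]mulrC -!exprM [(2 * m)%N]mulnC.
Qed.

Section Entire.
Variables (K : R) (u : V -> R) (g : V -> V).
Hypothesis K0 : 0 < K.
Hypothesis uC : forall B, C11on K B u g.
Hypothesis us : sol F setT u.

Lemma dq_le j e x : `|dq u j e x| <= 2 * K * nsq e.
Proof.
rewrite /dq; set h := _ *: e; have t0 : 0 < 2 ^+ j :> R by pos.
have := @uC (`|x| + `|h|) x (x + h); have := @uC (`|x| + `|h|) x (x - h).
have -> : x + h - x = h by rewrite addrC addKr.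
have -> : x - h - x = - h by rewrite addrAC subrr add0r.
rewrite ler_normB ler_normD lerDl normr_ge0 dotNr nsqN => /(_ isT isT) h1 /(_ isT isT) h2.
have : `|sdiff u h x| <= 2 * (K * nsq h).
  have -> : sdiff u h x = (u (x + h) - u x - dot (g x) h) + (u (x - h) - u x - - dot (g x) h).
    by rewrite /sdiff; ring.
  by apply: le_trans (ler_normD _ _) _; move: h1 h2; clear -lam0 Lam0 n0 eF qF K0; lra.
rewrite normrM ger0_norm ?exprn_ge0 // => h3.
apply: le_trans (ler_wpM2l _ h3) _; first by pos.
rewrite /h nsqZ le_eqVlt; apply/orP; left; apply/eqP.
have -> : 4 = 2 ^+ 2 :> R by rewrite -natrX.
by rewrite -exprM mulnC exprM; field; rewrite gt_eqF.
Qed.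

Definition Ssup e := sup [set t : R | exists j x, t = dq u j e x].

Lemma Ssup_has e : has_sup [set t : R | exists j x, t = dq u j e x].
Proof.
split; first by exists (dq u 0 e 0), 0%N, 0.
by exists (2 * K * nsq e) => t [j [x ->]]; apply: le_trans (ler_norm _) (dq_le _ _ _).
Qed.

Lemma Ssup_ge j e x : dq u j e x <= Ssup e.
Proof. by apply: sup_upper_bound; [exact: Ssup_has|exists j, x]. Qed.

(** By [dq_avg] a large quotient forces one at least as large at the next finer step; hence finitely
    many directions can share one step. *)
Lemma Ssup_near e (ep : R) : 0 < ep ->
  exists j0, forall j, (j0 <= j)%N -> exists x, Ssup e - ep < dq u j e x.
Proof.
move=> ep0; have [t [j0 [x0 ->]] h] := sup_adherent ep0 (Ssup_has e).
exists j0 => j /subnKC <-; elim: (j - j0)%N => [|m [x hx]].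
  by exists x0; rewrite addn0.
rewrite addnS; apply: contrapT => hno.
have H z : dq u (j0 + m).+1 e z <= Ssup e - ep.
  by rewrite leNgt; apply/negP => hz; apply: hno; exists z.
have := dq_avg u (j0 + m) e x; set a := dq _ _ _ _; set b := dq _ _ _ (x + _); set c := dq _ _ _ x.
set d := dq _ _ _ (x - _) => e1.
have := H (x + (2 ^+ (j0 + m).+1)^-1 *: e); have := H x; have := H (x - (2 ^+ (j0 + m).+1)^-1 *: e).
by rewrite -/b -/c -/d; move: hx; rewrite -/a; clear -lam0 Lam0 n0 eF qF K0 uC us e1; lra.
Qed.

Lemma dq_super (w : V -> R) j e (k d : R) : sol F setT w -> 0 < k ->
  visc (supS 0) setT (fun x => d - k * dq w j e x).
Proof.
move=> ws k0.
have opT x : [set: V] x -> exists2 r : R, 0 < r & forall z, `|z - x| < r -> [set: V] z by exists 1.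
have h : visc (supS 0) setT (fun x => - sdiff w ((2 ^+ j)^-1 *: e) x).
  by apply: visc_subset (sdiff_super lam0 Lam0 ((2 ^+ j)^-1 *: e) eF qF opT ws) _.
have k4 : 0 < k * 4 ^+ j by pos.
have := supS0_affine 0 d ltr01 k4 h; congr (visc _ _ _); apply/funext => x.
by rewrite add0r scale1r /dq; ring.
Qed.

(* Blowing up where the second difference quotients in the directions [ed] are almost
   maximal simultaneously, they become constant by the strong maximum principle. *)
Lemma extremal_quadratic (J : finType) (ed : J -> V) :
  exists2 A, F A = 0 & forall i, qf A (ed i) = Ssup (ed i).
Proof.
have [U [UU oU]] := free_ultrafilter.
have [T T0 hT] := common_small J.
have /choice[d hd] (k : nat) : exists d : nat * V, forall i, Ssup (ed i) - dq u d.1 (ed i) d.2 <= T / k.+1%:R.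
  have e0 : 0 < k.+1%:R^-1 :> R by rewrite invr_gt0 ltr0n.
  have /choice[j0 hj0] i := Ssup_near (ed i) e0.
  pose m := (\sum_i j0 i)%N.
  have mj i : (j0 i <= m)%N by rewrite /m (bigD1 i) //= leq_addr.
  have /choice[x hx] i := hj0 i m (mj i).
  have kp : 0 < k.+1%:R :> R by rewrite ltr0n.
  (* The deficits from the suprema, multiplied by [k.+1], are nonnegative supersolutions, each at
     most 1 somewhere, so [common_small] finds one point where all are at most [T]. *)
  have [|||y hy] := hT (fun i x => k.+1%:R * Ssup (ed i) - k.+1%:R * dq u m (ed i) x) x.
        by move=> i; apply: dq_super.
      by move=> i y; rewrite -mulrBr mulr_ge0 // subr_ge0; exact: Ssup_ge.
    move=> i; rewrite -mulrBr mulrC -ler_pdivlMr // mul1r.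
    by apply: ltW; rewrite ltrBlDl -ltrBlDr; exact: hx.
  by exists (m, y) => i; rewrite ler_pdivlMr // mulrC mulrBr; exact: hy.
pose r k : R := (2 ^+ (d k).1)^-1; pose c k := (d k).2.
have r0 k : 0 < r k by rewrite /r; pos.
pose vk k y := (r k ^+ 2)^-1 * (u (c k + r k *: y) - (u (c k) + dot (r k *: g (c k)) y)).
pose gk k y := (r k)^-1 *: (g (c k + r k *: y) - g (c k)).
have vC k B : C11on K B (vk k) (gk k).
  have h : C11 K (fun _ : unit => u) (fun _ => g) by move=> _ x y; apply: (@uC (`|x| + `|y|)); rewrite ?lerDl ?lerDr.
  by move=> x y _ _; exact: (@C11_rs _ _ _ K _ _ (c k) (r k) (r0 k) h tt x y).
have v0 k : vk k 0 = 0 by rewrite /vk scaler0 addr0 dot0r addr0 subrr mulr0.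
have g0 k : gk k 0 = 0 by rewrite /gk scaler0 addr0 subrr scaler0.
have vs k : sol F setT (vk k) by have := sol_rescale (c k) (u (c k)) (r k *: g (c k)) (r0 k) us.
have vCU (B : R) : 0 < B -> U [set k | C11on K B (vk k) (gk k)].
  by move=> _; apply: filterE => k; exact: vC.
have [w [gw [tw wC w0 gw0 wl]]] := C11_limit UU K0 vCU v0 g0.
have ws : sol F setT w.
  apply: (sol_ulim UU (Fk := fun=> F) (vk := vk)) => //.
    by move=> M; exact: utends_cst.
  move=> B; apply: filterE => k; have [a1 a2] := vs k.
  by split; [apply: visc_subset a1 _|apply: visc_subset a2 _].
have tdq j e y : utends U (fun k => dq (vk k) j e y) (dq w j e y).
  apply: utendsZ => //; apply: utendsB => //; first by apply: utendsD.
  exact: utendsZ.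
have dqk k j e y : dq (vk k) j e y = dq u ((d k).1 + j) e (c k + r k *: y) by exact: dq_rs.
have dqw j e y : dq w j e y <= Ssup e.
  apply: (utends_le UU (tdq j e y) (utends_cst UU _)); apply: filterE => k /=.
  by rewrite dqk Ssup_ge.
have dq0 i : dq w 0 (ed i) 0 = Ssup (ed i).
  apply/eqP; rewrite eq_le dqw /= -subr_le0.
  have t1 := utendsB UU (utends_cst UU (Ssup (ed i))) (tdq 0%N (ed i) 0).
  have ti : utends U (fun k => k.+1%:R^-1) (0 : R) by exact: utends_inv.
  have t2 := utendsZ UU T ti; rewrite mulr0 in t2.
  apply: (utends_le UU t1 t2); apply: filterE => k /=.
  by rewrite dqk addn0 scaler0 addr0; exact: hd.
(* At step index 0 the deficit vanishes at the origin, hence everywhere by [strong_min]; at finer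
   steps, an average of quotients bounded by the supremum can equal it only if each of them does. *)
have dqE j i y : dq w j (ed i) y = Ssup (ed i).
  elim: j y => [|j IH] y.
    have h : visc (supS 0) setT (fun x => Ssup (ed i) - 1 * dq w 0 (ed i) x) by exact: dq_super.
    have := @strong_min _ 0 h _ _ y; rewrite mul1r dq0 subrr => /(_ _ erefl) H.
    apply/eqP; rewrite eq_sym -subr_eq0 -[dq w _ _ _]mul1r; apply/eqP; apply: H => x.
    by rewrite mul1r subr_ge0.
  have := dq_avg w j (ed i) y; rewrite IH.
  have := dqw j.+1 (ed i) y; have := dqw j.+1 (ed i) (y + (2 ^+ j.+1)^-1 *: ed i).
  have := dqw j.+1 (ed i) (y - (2 ^+ j.+1)^-1 *: ed i).
  by clear -lam0 Lam0 n0 eF qF K0 uC us; lra.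
(* A second blow-up, along which these constant quotients persist, replaces [w] by a quadratic
   polynomial. *)
pose CC (F' : unit -> V -> R) (G' : unit -> V -> V) := [/\ C11 K F' G', sol F setT (F' tt) &
  forall i j y, dq (F' tt) j (ed i) y = Ssup (ed i)].
have CC11 F' G' : CC F' G' -> C11 K F' G' by case.
have CCrs F' G' x (j : nat) : CC F' G' -> CC (rsF F' G' x (2 ^+ j)^-1) (rsG G' x (2 ^+ j)^-1).
  move=> [a1 a2 a3]; have rj : 0 < (2 ^+ j)^-1 :> R by pos.
  split; first exact: C11_rs.
    by have := sol_rescale x (F' tt x) ((2 ^+ j)^-1 *: G' tt x) rj a2.
  by move=> i m y; rewrite dq_rs a3.
have CClim (Fk : nat -> unit -> V -> R) (Gk : nat -> unit -> V -> V)
    (F' : unit -> V -> R) (G' : unit -> V -> V) :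
  (forall k, CC (Fk k) (Gk k)) -> (forall k i, Fk k i 0 = 0) -> (forall k i, Gk k i 0 = 0) ->
  (forall i y, utends U (fun k => Fk k i y) (F' i y)) ->
  (forall i y j, utends U (fun k => Gk k i y 0 j) (G' i y 0 j)) -> CC F' G'.
  move=> hk Fk0 Gk0 tF tG.
  have hC k : C11 K (Fk k) (Gk k) by have [] := hk k.
  split; first exact: (C11_ulim UU (Fk := Fk) (Gk := Gk)).
    apply: (sol_ulim UU (Fk := fun=> F) (vk := fun k => Fk k tt)) => //.
        by move=> M; exact: utends_cst.
      move=> B B0; exists (n%:R * (6 * K * (n%:R + 1) * B + 2 * B * K)).
        by have : 0 <= n%:R :> R by []; move=> nn; pos.
      by apply: filterE => k x y; apply: (C11_loclip K0 (hC k)).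
    move=> B; apply: filterE => k; have [_ [a1 a2] _] := hk k.
    by split; [apply: visc_subset a1 _|apply: visc_subset a2 _].
  move=> i j y; apply: utends_uniq (_ : utends U (fun k => dq (Fk k tt) j (ed i) y) _) _ => //.
    apply: utendsZ => //; apply: utendsB => //; first by apply: utendsD.
    exact: utendsZ.
  apply: utends_eq (utends_cst UU _) => //; apply: filterE => k /=.
  by have [_ _ ->] := hk k.
have wCC : CC (fun=> w) (fun=> gw).
  by split=> // _ x y; apply: (@wC (`|x| + `|y|)); rewrite ?lerDl ?lerDr.
have [F' [G' [[a1 a2 a3] hl]]] := tangent UU oU K0 CC11 CCrs CClim wCC.
have [A [_ hA]] := lin_quad a1 (hl tt).
exists A.
  have [[_ b1] [_ b2]] := a2; apply/eqP; rewrite eq_le; apply/andP; split.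
    by apply: (b1 0 (G' tt 0)) => //; exists 1 => // y _; rewrite subr0 (hA y).
  rewrite -[A]opprK; apply: (b2 0 (- G' tt 0)) => //; exists 1 => // y _.
  by rewrite subr0 dotNl qfN (hA y); clear -lam0 Lam0 n0 eF qF K0 uC us; lra.
move=> i; rewrite -(a3 i 0%N 0) /dq /sdiff !expr0 invr1 scale1r add0r sub0r mul1r.
by rewrite (hA (ed i)) (hA (- ed i)) dotNr qf_opp; field.
Qed.

(** The slot [None] of [ed] carries an arbitrary direction next to the sums of basis vectors, which
    already determine a quadratic form; this identifies [Ssup e] with [qf A e] for every [e], with
    one and the same [A]. *)
Lemma liouville : exists2 A, F A = 0 & forall y, u y = u 0 + dot (g 0) y + qf A y / 2.
Proof.
pose ed (e : V) (i : option ('I_n * 'I_n)) : V :=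
  if i is Some ab then delta_mx 0 ab.1 + delta_mx 0 ab.2 else e.
have [A FA hA] := extremal_quadratic (ed 0).
have Se e : Ssup e = qf A e.
  have [M FM hM] := extremal_quadratic (ed e).
  rewrite -(hM None); apply: qf_determined => i j.
  by have := hM (Some (i, j)); have := hA (Some (i, j)) => /= -> ->.
have sd h x : sdiff u h x <= qf A h.
  by rewrite -Se; have := Ssup_ge 0 h x; rewrite /dq expr0 mul1r expr0 invr1 scale1r.
exists A => //.
pose h y := u y - (u 0 + dot (g 0) y + qf A y / 2).
(* Nonpositive second differences and [h 0 = 0] give this; iterated together with the bound of order
   [nsq w], it yields [h <= 0], so that [- h] has a minimum at 0. *)
have half w : h w <= 2 * h (2^-1 *: w).
  have := sd (2^-1 *: w) (2^-1 *: w); rewrite /sdiff subrr -scalerDl.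
  rewrite (_ : 2^-1 + 2^-1 = 1 :> R); last by field.
  by rewrite scale1r /h dotZr qf_scale; clear -lam0 Lam0 n0 eF qF K0 uC us; lra.
have [C C0 hC] := qf_bound A.
have loc w : h w <= (K + C) * nsq w.
  have := @uC `|w| 0 w; rewrite normr0 normr_ge0 lexx subr0 => /(_ isT isT).
  have := hC w; rewrite !ler_norml => /andP[b1 _] /andP[_ b2].
  have q0 : 0 <= C * nsq w by pos.
  by rewrite /h; move: b1 b2 q0; clear -lam0 Lam0 n0 eF qF K0 uC us; lra.
have dyad (k : nat) w : h w <= 2 ^+ k * h ((2 ^+ k)^-1 *: w).
  elim: k => [|k IH]; first by rewrite expr0 invr1 scale1r mul1r.
  apply: le_trans IH _; rewrite exprSr -mulrA ler_pM2l ?exprn_gt0 //.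
  by have := half ((2 ^+ k)^-1 *: w); rewrite scalerA -invfM [2 * _ ^+ k]mulrC.
have hle w : h w <= 0.
  apply/ler_addgt0Pr => e ep0; rewrite add0r.
  pose T := (K + C) * nsq w; have T0 : 0 <= T by rewrite /T; pos.
  have [k hk] := expr_large (T / e) (ltr1n R 2).
  have p0 : 0 < 2 ^+ k :> R by pos.
  apply: le_trans (dyad k w) _; apply: le_trans (ler_wpM2l (ltW p0) (loc _)) _.
  rewrite nsqZ; have -> : 2 ^+ k * ((K + C) * ((2 ^+ k)^-1 ^+ 2 * nsq w)) = T / 2 ^+ k.
    by rewrite /T; field; rewrite gt_eqF.
  by rewrite ler_pdivrMr // mulrC -ler_pdivrMr.
have hv : visc (supS 0) setT (fun y => - h y).
  have [_ [uc uv]] := us; split=> [x _|x p M _ [r rp ht] P Q hP hQ MPQ].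
    apply: (@cont_ext _ _ (fun y => - u y + (u 0 + dot (g 0) (y - 0) + qf A (y - 0) / 2))).
      by move=> y; rewrite /h !subr0; ring.
    apply: contD; first exact: uc.
    apply: (@contD _ _ _ (fun y => qf A (y - 0) / 2)).
      by apply: (@contD _ _ (fun=> u 0)); [exact: contK|exact: cont_dot].
    by apply: (@contM _ _ _ (fun=> 2^-1)); [exact: cont_qf|exact: contK].
  have t : touch (fun y => - u y) x (p - g 0 - 2^-1 *: (x *m (A + A^T))) (M - A).
    exists r => // y yx; have := ht y yx; rewrite /h.
    have : qf A y = qf A x + dot (x *m (A + A^T)) (y - x) + qf A (y - x).
      by rewrite -qf_addr addrC subrK.
    have : dot (g 0) y = dot (g 0) x + dot (g 0) (y - x) by rewrite !dotE; ring.
    move=> -> ->; move: (x *m _) (y - x) => a b; rewrite !dotE qfD qfN.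
    by clear -lam0 Lam0 n0 eF qF K0 uC us; lra.
  have := uv _ _ _ Logic.I t; have := ell_diff (A - M) eF hP hQ.
  rewrite -MPQ subrK FA opprB addr0; clear -lam0 Lam0 n0 eF qF K0 uC us; lra.
move=> y; have := @strong_min _ 0 hv _ _ y.
rewrite {2}/h dot0r qf_zero mul0r !addr0 subrr oppr0 => /(_ _ erefl) H.
have : - h y = 0 by apply: H => z; rewrite oppr_ge0.
by rewrite /h; clear -lam0 Lam0 n0 eF qF K0 uC us; lra.
Qed.
End Entire.
End Liouville.

(** * Improvement of quadratic approximation, and its iteration *)

Section Iteration.
Variables (R : realType) (n : nat) (lam Lam : R).
Local Notation V := 'rV[R]_n.
Implicit Types (x y z p v w h : V) (M N P Q A : 'M[R]_n) (u : V -> R) (F : 'M[R]_n -> R).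
Hypothesis lam0 : 0 < lam.
Hypothesis Lam0 : 0 < Lam.
Hypothesis n0 : (0 < n)%N.
Local Notation RR := (RR R n).
Local Notation ellF := (ellF lam Lam).
Local Notation sol1 := (sol1 lam Lam).

Lemma qf_sym A x : qf (2^-1 *: (A + A^T)) x = qf A x.
Proof. by rewrite qfZ qfD [qf A^T x]dot_mulmx trmxK dotC -/(qf A x); field. Qed.

Lemma tr_sym A : (2^-1 *: (A + A^T))^T = 2^-1 *: (A + A^T).
Proof. by rewrite linearZ /= linearD /= trmxK addrC. Qed.

Lemma qf_entries M (c : R) x : 0 <= c -> (forall i j, `|M i j| <= c) ->
  `|qf M x| <= c * n%:R ^+ 2 * `|x| ^+ 2.
Proof.
move=> c0 h; have nn : 0 <= n%:R :> R by [].
have xM : `|x *m M| <= n%:R * c * `|x|.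
  apply: norm_le_coord; first by pos.
  move=> j; rewrite mulmx_sum; apply: le_trans (ler_norm_sum _ _ _) _.
  rewrite -mulrA mulr_natl -[n in _ *+ n]card_ord -sumr_const; apply: ler_sum => i _.
  by rewrite normrM mulrC; apply: ler_pM => //; exact: coord_le_norm.
apply: le_trans (dot_norm_le _ _) _.
have -> : c * n%:R ^+ 2 * `|x| ^+ 2 = n%:R * (n%:R * c * `|x|) * `|x| by ring.
by rewrite ler_wpM2r // ler_wpM2l.
Qed.

(** The coefficients are read off at 0 and at [d] times plus or minus basis vectors and sums of two
    of them; polarisation accounts for the 6. *)
Lemma quad_coef (a e d : R) p A : A^T = A -> 0 < d ->
  (forall h, `|h| <= d -> `|a + dot p h + qf A h / 2| <= e) ->
  [/\ `|a| <= e, `|p| <= e / d & forall i j, `|A i j| <= 6 * e / d ^+ 2].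
Proof.
move=> sA d0 hQ.
have a1 : `|a| <= e by have := hQ 0; rewrite normr0 dot0r qf_zero mul0r !addr0 => /(_ (ltW d0)).
have e0 : 0 <= e by apply: le_trans a1.
have d2 : 0 < d ^+ 2 by pos.
have dl i : `|delta_mx 0 i : V| <= 1.
  by apply: norm_le_of_nsq => //; rewrite nsq_delta expr1n.
have two w : `|w| <= 1 -> `|dot p w| <= e / d /\ `|qf A w| <= 4 * e / d ^+ 2.
  move=> w1; have dw : `|d *: w| <= d by rewrite mx_normZ gtr0_norm // ler_piMr // ltW.
  have := hQ _ dw; have := hQ (- (d *: w)); rewrite normrN => /(_ dw).
  rewrite dotNr qf_opp dotZr qf_scale !ler_pdivlMr // -[X in `|dot p w| * X]gtr0_norm //.
  rewrite -[X in `|qf A w| * X]gtr0_norm // -!normrM.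
  move: a1; rewrite !ler_norml => /andP[b1 b2] /andP[b3 b4] /andP[b5 b6].
  by move: b1 b2 b3 b4 b5 b6; clear -lam0 Lam0 n0 => *; split; apply/andP; split; lra.
have Ai i : `|A i i| <= 4 * e / d ^+ 2 by rewrite -qf_delta; exact: (two _ (dl i)).2.
split=> //.
  apply: norm_le_coord; first by pos.
  by move=> i; rewrite -(dot_delta p i); exact: (two _ (dl i)).1.
move=> i j; have [->|ij] := eqVneq i j.
  apply: le_trans (Ai j) _; rewrite ler_pM2r ?invr_gt0 // ler_wpM2r //; lra.
have nij : `|delta_mx 0 i + delta_mx 0 j : V| <= 1.
  apply: norm_le_coord => // l; rewrite !mxE eqxx /=.
  have [->|_] := eqVneq l i; first by rewrite (negPf ij) addr0 normr1.
  by rewrite add0r; case: (l == j); rewrite ?normr1 ?normr0.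
have := (two _ nij).2; rewrite qf_addr !qf_delta.
have -> : dot ((delta_mx 0 i : V) *m (A + A^T)) (delta_mx 0 j) = 2 * A i j.
  by rewrite dot_delta -rowE !mxE -[in A j i]sA mxE; ring.
have := Ai i; have := Ai j; rewrite !ler_norml -!mulrA; move: (e / _) => t.
move=> /andP[b1 b2] /andP[b3 b4] /andP[b5 b6].
by move: b1 b2 b3 b4 b5 b6; clear -lam0 Lam0 n0 => *; apply/andP; split; lra.
Qed.

(** Along multiples of the identity the operator increases with slope at least [lam * n]; an
    approximate zero is thus corrected to an exact one at a proportionate cost. *)
Lemma ell_root F M : ellF F -> exists2 t : R, F (M + t%:M) = 0 & lam * n%:R * `|t| <= `|F M|.
Proof.
move=> eF; have np : 0 < n%:R :> R by rewrite ltr0n.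
pose f (t : R) := F (M + t%:M).
have fd (s t : R) : s <= t -> lam * n%:R * (t - s) <= f t - f s <= Lam * n%:R * (t - s).
  move=> st; have ts : 0 <= t - s by rewrite subr_ge0.
  have := eF (M + s%:M) (t - s)%:M (psdq_scalar ts); rewrite tr_scalar -addrA -raddfD /=.
  by rewrite [s + (t - s)]addrC subrK /f !mulrA ![_ * (t - s) * _]mulrAC.
have fl (s t : R) : `|f t - f s| <= Lam * n%:R * `|t - s|.
  wlog st : s t / s <= t.
    by move=> H; have [/H//|/ltW/H] := leP s t; rewrite distrC [`|s - t|]distrC.
  have /andP[h1 h2] := fd s t st; have ts : 0 <= t - s by rewrite subr_ge0.
  have h0 : 0 <= lam * n%:R * (t - s) by pos.
  by rewrite [`|t - s|]ger0_norm // ger0_norm //; apply: le_trans h1.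
have fc : continuous f.
  move=> t; apply/cvgrPdist_lt => e e0; have C0 : 0 < Lam * n%:R + 1 by pos.
  near=> s; apply: le_lt_trans (fl s t) _.
  have : `|t - s| < e / (Lam * n%:R + 1).
    near: s; apply/nbhs_ballP; exists (e / (Lam * n%:R + 1)) => /=; first by pos.
    by move=> s; rewrite /ball /=.
  rewrite ltr_pdivlMr //; apply: le_lt_trans; rewrite mulrC ler_wpM2l //; lra.
pose T := `|F M| / (lam * n%:R).
have ln : 0 < lam * n%:R by pos.
have T0 : 0 <= T by rewrite /T; pos.
have TE : lam * n%:R * T = `|F M| by rewrite /T mulrC mulfVK // gt_eqF.
have f0 : f 0 = F M by rewrite /f raddf0 addr0.
have h1 : 0 <= f T.
  have /andP[+ _] := fd 0 T T0; rewrite subr0 TE f0; have := ler_norm (- F M); rewrite normrN.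
  by clear -lam0 Lam0 n0; lra.
have h2 : f (- T) <= 0.
  have nT : - T <= 0 by rewrite oppr_le0.
  have /andP[+ _] := fd (- T) 0 nT; rewrite sub0r opprK TE f0; have := ler_norm (F M).
  by clear -lam0 Lam0 n0; lra.
have TT : - T <= T by move: T0; clear -lam0 Lam0 n0; lra.
have [|t tT ft] := @IVT _ f (- T) T 0 TT (continuous_subspaceT fc).
  by rewrite ge_min le_max h1 h2 orbT.
exists t => //; rewrite -TE ler_pM2l //.
by move: tT; rewrite in_itv /= ler_norml.
Unshelve. all: by end_near.
Qed.

Lemma sol_quad F O u (a : R) p A : sol F O u ->
  sol (fun X => F (X + A)) O (fun y => u y - (a + dot p y + qf A y / 2)).
Proof.
have quadE x y : qf A y = qf A x + dot (x *m (A + A^T)) (y - x) + qf A (y - x).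
  by rewrite -qf_addr addrC subrK.
have linE x y : dot p y = dot p x + dot p (y - x) by rewrite !dotE; ring.
have qc x : {for x, continuous (fun y => a + dot p y + qf A y / 2)}.
  apply: (@cont_ext _ _ (fun y => a + dot p (y - 0) + qf A (y - 0) / 2)).
    by move=> y; rewrite !subr0.
  apply: (@contD _ _ _ (fun y => qf A (y - 0) / 2)).
    by apply: (@contD _ _ (fun=> a)); [exact: contK|exact: cont_dot].
  by apply: (@contM _ _ _ (fun=> 2^-1)); [exact: cont_qf|exact: contK].
move=> [[uc uv] [vc vv]]; split; split.
      by move=> x Ox; apply: contB; [exact: uc|exact: qc].
    move=> x q M Ox [r r0 ht]; apply: (uv x (q + p + 2^-1 *: (x *m (A + A^T)))) => //.
    exists r => // y yx; have := ht y yx; rewrite (quadE x y) (linE x y).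
    move: (x *m _) (y - x) => b c; rewrite !dotE qfD; clear -lam0 Lam0 n0; lra.
  by move=> x Ox; apply: contN; apply: contB; [exact: uc|exact: qc].
move=> x q M Ox [r r0 ht].
have -> : - M + A = - (M - A) by rewrite opprB addrC.
apply: (vv x (q - p - 2^-1 *: (x *m (A + A^T)))) => //.
exists r => // y yx; have := ht y yx; rewrite (quadE x y) (linE x y).
move: (x *m _) (y - x) => b c; rewrite !dotE qfD qfN; clear -lam0 Lam0 n0; lra.
Qed.

Lemma sol_affine F O u v (r k : R) : 0 < r -> 0 < k -> sol F O u ->
  sol (fun X => k * r ^+ 2 * F ((k * r ^+ 2)^-1 *: X)) [set y | O (v + r *: y)]
    (fun y => k * u (v + r *: y)).
Proof.
move=> r0 k0 [u1 u2]; have kr : 0 < k * r ^+ 2 by pos.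
have fE s : (fun y => k * s (v + r *: y) + 0) = (fun y => k * s (v + r *: y)).
  by apply/funext => y; rewrite addr0.
split.
  have [c1 c2] := visc_affine v 0 r0 k0 u1; rewrite fE in c1 c2; split=> // x p M Ox tM.
  by rewrite pmulr_rle0 //; exact: c2 tM.
have [c1 c2] := visc_affine v 0 r0 k0 u2.
have fE2 : (fun y => k * - u (v + r *: y) + 0) = (fun y => - (k * u (v + r *: y))).
  by apply/funext => y; rewrite addr0 mulrN.
rewrite fE2 in c1 c2; split=> // x p M Ox tM.
by rewrite pmulr_rge0 // scalerN; exact: c2 tM.
Qed.

Lemma ellF_scale F (k : R) A : 0 < k -> ellF F -> ellF (fun X => k * F (k^-1 *: X + A)).
Proof.
move=> k0 eF M N hN; rewrite -mulrBr scalerDr addrAC.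
have hN' : psdq (k^-1 *: N) by apply: psdqZ => //; rewrite invr_ge0 ltW.
have := eF (k^-1 *: M + A) _ hN'; rewrite mxtraceZ => /andP[h1 h2].
have e c : c * \tr N = k * (c * (k^-1 * \tr N)) by field; rewrite gt_eqF.
by rewrite (e lam) (e Lam) !ler_pM2l // h1.
Qed.

Lemma qcF_scale F (k : R) A : 0 < k -> qcF F -> qcF (fun X => k * F (k^-1 *: X + A)).
Proof.
move=> k0 qF M N; rewrite -minr_pMr; last exact: ltW.
rewrite ler_pM2l //; apply: le_trans (qF _ _) _; rewrite le_eqVlt; apply/orP; left; apply/eqP.
congr (F _); apply/matrixP => i j; rewrite !mxE; field.
by rewrite gt_eqF.
Qed.

(** Bounds all normalised operators at a given matrix, so that sequences of operators have pointwise
    limits. *)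
Lemma ellF_bound M : exists2 C : R, 0 <= C & forall F, ellF F -> F 0 = 0 -> `|F M| <= C.
Proof.
have [c c0 hc] := qf_bound M.
have hP : psdq (M + c%:M).
  move=> x; rewrite qfD qf_scalar; have := hc x; rewrite ler_norml => /andP[+ _].
  by clear -lam0 Lam0 n0; lra.
have hQ : psdq (c%:M : 'M[R]_n) := psdq_scalar c0.
have t1 := psdq_tr_ge0 hP; have t2 := psdq_tr_ge0 hQ.
exists (Lam * \tr (M + c%:M) + Lam * \tr (c%:M : 'M[R]_n)); first by pos.
move=> F eF F0; have := ell_diff 0 eF hP hQ; have := ell_diff M eF hQ hP.
have -> : 0 + (M + c%:M - c%:M) = M by rewrite add0r addrK.
have -> : M + (c%:M - (M + c%:M)) = 0 by apply/matrixP => i j; rewrite !mxE; ring.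
rewrite F0 ler_norml => h1 h2.
have p1 : 0 <= lam * \tr (M + c%:M) by pos.
have p2 : 0 <= lam * \tr (c%:M : 'M[R]_n) by pos.
have p3 : 0 <= Lam * \tr (M + c%:M) by pos.
have p4 : 0 <= Lam * \tr (c%:M : 'M[R]_n) by pos.
by move: h1 h2 p1 p2 p3 p4; clear -lam0 Lam0 n0 => *; apply/andP; split; lra.
Qed.

(** By contradiction, with scales [r k] tending to 0. The second-order rescalings at 0 have uniform
    [C^{1,1}] bounds on growing cubes, so solutions and operators converge together and [liouville]
    applies to the limit. *)
Lemma improvement : exists r : R, [/\ 0 < r, r < 1 / 2 & forall F u, sol1 F u ->
  exists (a : R) p A, F A = 0 /\ forall y, `|y| < RR + 1 ->
   `|u (r *: y) - (a + dot p (r *: y) + qf A (r *: y) / 2)| <= r ^+ 2 / 2].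
Proof.
have [K [rho [[K0 rho0 _] hK]]] := local_C11 lam0 Lam0 n0.
have np : 0 < n%:R :> R by rewrite ltr0n.
have D6 := @RR1_ge6 R n n0; set D := RR + 1 in D6 *.
have D0 : 0 < D by apply: lt_le_trans D6.
apply: contrapT => hno.
pose r (k : nat) : R := k.+3%:R^-1.
have r0 k : 0 < r k by rewrite invr_gt0 ltr0n.
have r2 k : r k < 1 / 2 by rewrite /r mul1r ltf_pV2 ?posrE ?ltr0n // ltr_nat.
have /choice[Fu hFu] (k : nat) : exists Fu : ('M[R]_n -> R) * (V -> R), sol1 Fu.1 Fu.2 /\
   ~ exists (a : R) p A, Fu.1 A = 0 /\ forall y, `|y| < D ->
   `|Fu.2 (r k *: y) - (a + dot p (r k *: y) + qf A (r k *: y) / 2)| <= r k ^+ 2 / 2.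
  apply: contrapT => h; apply: hno; exists (r k); split=> // F u su.
  by apply: contrapT => h'; apply: h; exists (F, u).
pose Fk k := (Fu k).1; pose uk k := (Fu k).2.
have suk k : sol1 (Fk k) (uk k) by have [] := hFu k.
have /choice[g hg] k := hK _ _ (suk k).
have [U [UU oU]] := free_ultrafilter.
pose vk k y := (r k ^+ 2)^-1 * (uk k (0 + r k *: y) - (uk k 0 + dot (r k *: g k 0) y)).
pose gk k y := (r k)^-1 *: (g k (0 + r k *: y) - g k 0).
have rB (B c : R) : 0 < c -> U [set k | r k * B <= c].
  move=> c0; apply: filterS (U_large oU (B / c)) => k /=.
  rewrite ler_pdivrMr // => h; rewrite /r mulrC ler_pdivrMr ?ltr0n //.
  apply: le_trans h _; rewrite [k%:R * c]mulrC ler_pM2l // ler_nat; exact: (leq_addl 3 k).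
have vC (B : R) : 0 < B -> U [set k | C11on K B (vk k) (gk k)].
  move=> B0; apply: filterS (rB B _ rho0) => k /= hr x y xB yB.
  have in_ z : `|z| <= B -> `|0 + r k *: z| <= rho.
    move=> zB; rewrite add0r mx_normZ gtr0_norm //; apply: le_trans hr; rewrite ler_pM2l //.
  have := hg k _ _ (in_ _ xB) (in_ _ yB).
  have := @trem_rs _ _ unit (fun=> uk k) (fun=> g k) 0 (r k) tt x y (r0 k).
  rewrite /trem /rsF /rsG -/(vk k y) -/(vk k x) -/(gk k x) => -> h.
  have rr : 0 < r k ^+ 2 by have := r0 k => ?; pos.
  rewrite normrM gtr0_norm ?invr_gt0 // mulrC ler_pdivrMr //.
  apply: le_trans h _; rewrite opprD addrACA subrr add0r -scalerBr nsqZ.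
  by rewrite mulrCA mulrC.
have v0 k : vk k 0 = 0 by rewrite /vk scaler0 addr0 dot0r addr0 subrr mulr0.
have g0 k : gk k 0 = 0 by rewrite /gk scaler0 addr0 subrr scaler0.
have [v [gv [tv vCl vl0 gv0 vl]]] := C11_limit UU K0 vC v0 g0.
have /choice[F tF] M : exists l, utends U (fun k => Fk k M) l.
  have [C C0 hC] := ellF_bound M; apply: (utends_ex UU (B := C)); apply: filterE => k /=.
  by have [eF _ F0 _ _] := suk k; exact: hC.
have eF : ellF F.
  move=> M N hN; have t := utendsB UU (tF (M + N)) (tF M); apply/andP; split.
    apply: (utends_le UU (utends_cst UU _) t); apply: filterE => k /=.
    by have [/(_ M N hN)/andP[+ _] _ _ _ _] := suk k.
  apply: (utends_le UU t (utends_cst UU _)); apply: filterE => k /=.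
  by have [/(_ M N hN)/andP[]] := suk k.
have qF : qcF F.
  move=> M N; rewrite minr_absE mulrC.
  have t1 := utendsD UU (tF M) (tF N).
  have t2 := utends_abs UU (utendsB UU (tF M) (tF N)).
  have t3 := utendsZ UU 2^-1 (utendsB UU t1 t2).
  apply: (utends_le UU t3 (tF _)); apply: filterE => k /=.
  by have [_ /(_ M N) + _ _ _] := suk k; rewrite minr_absE mulrC.
have vs : sol F setT v.
  apply: (sol_ulim Lam0 eF UU (Fk := Fk) (vk := vk)) => //.
    by move=> k; have [] := suk k.
  move=> B; apply: filterS (rB (`|B| + 1) _ D0) => k /= hr.
  have [_ _ _ sk _] := suk k.
  have [a1 a2] := sol_rescale 0 (uk k 0) (r k *: g k 0) (r0 k) sk.
  have sub : [set y : V | `|y| < B] `<=` [set y : V | `|0 + r k *: y| < RR + 1].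
    move=> y /= yB; rewrite add0r mx_normZ gtr0_norm // -/D; apply: lt_le_trans hr.
    by rewrite ltr_pM2l //; have := ler_norm B; move: yB; clear -lam0 Lam0 n0; lra.
  by split; [apply: visc_subset a1 sub|apply: visc_subset a2 sub].
have [A FA hA] := liouville lam0 Lam0 n0 eF qF K0 vCl vs.
have {}hA y : v y = qf A y / 2 by rewrite hA vl0 gv0 dot0l !add0r.
have [L L0 hL] := vl D D0.
have un := ulim_unif UU D0 L0 tv hL (e := 8^-1) (ltac:(by rewrite invr_gt0)).
have e0 : 0 < lam / (4 * D ^+ 2) by pos.
have [k [k1 k2]] := filter_ex (filterI un (tF A _ e0)).
have [_ []] := hFu k.
(* [A] is a zero of the limit operator; a small multiple of the identity turns it into a zero of
   [Fk k]. *)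
have [eFk _ _ _ _] := suk k; have [t Ft ht] := ell_root A eFk.
exists (uk k 0), (g k 0), (A + t%:M); split=> // y yD.
have tb : n%:R * `|t| * D ^+ 2 <= 1 / 4.
  move: k2; rewrite /= FA subr0 => k2; have := le_lt_trans ht k2; rewrite ltr_pdivlMr; last by pos.
  have -> : lam * n%:R * `|t| * (4 * D ^+ 2) = lam * (n%:R * `|t| * (4 * D ^+ 2)) by ring.
  rewrite -[X in _ < X]mulr1 ltr_pM2l // => h.
  by move: h; clear -lam0 Lam0 n0; lra.
have rk := r0 k; have rr : 0 < r k ^+ 2 by pos.
have -> : (Fu k).2 (r k *: y) - (uk k 0 + dot (g k 0) (r k *: y) + qf (A + t%:M) (r k *: y) / 2) =
   r k ^+ 2 * ((vk k y - v y) - t * nsq y / 2).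
  rewrite /vk add0r dotZl dotZr qf_scale qfD qf_scalar hA -/(uk k).
  by field; rewrite gt_eqF.
rewrite normrM gtr0_norm // ler_pM2l //.
apply: le_trans (ler_normB _ _) _.
have b1 : `|vk k y - v y| < 8^-1 by apply: k1; exact: ltW.
have b2 : `|t * nsq y / 2| <= 1 / 8.
  rewrite normrM [`|2^-1|]ger0_norm ?invr_ge0 // normrM (ger0_norm (nsq_ge0 y)).
  have : `|t| * nsq y <= 1 / 4.
    apply: le_trans tb; rewrite [n%:R * _]mulrC -mulrA ler_wpM2l //.
    apply: le_trans (nsq_le_norm _) _; rewrite ler_wpM2l // ler_sqr ?nnegrE //; exact: ltW.
  by clear -lam0 Lam0 n0; lra.
by move: b1 b2; clear -lam0 Lam0 n0; lra.
Qed.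

Lemma geom_limit (t : nat -> R) (C q : R) : 0 <= C -> 0 < q -> q <= 1 / 2 ->
  (forall k, `|t k.+1 - t k| <= C * q ^+ k) ->
  exists l, forall k, `|t k - l| <= 2 * C * q ^+ k.
Proof.
move=> C0 q0 q2 ht.
have tele (k j : nat) : `|t (k + j)%N - t k| <= C * q ^+ k * (2 - 2 * (1 / 2) ^+ j).
  elim: j => [|j IH]; first by rewrite addn0 subrr normr0 expr0 mulr1 subrr mulr0.
  have -> : t (k + j.+1)%N - t k = (t (k + j).+1 - t (k + j)%N) + (t (k + j)%N - t k).
    by rewrite addnS addrA subrK.
  apply: le_trans (ler_normD _ _) _.
  have qk : 0 <= C * q ^+ k by pos.
  have qj : C * q ^+ (k + j) <= C * q ^+ k * (1 / 2) ^+ j.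
    by rewrite exprD mulrA ler_wpM2l // lerXn2r ?nnegrE //; lra.
  have := ht (k + j)%N; rewrite exprS; move: IH qj; move: ((1 / 2) ^+ j) => s.
  by clear -lam0 Lam0 n0; lra.
have [U [UU oU]] := free_ultrafilter.
have tb (k j : nat) : (k <= j)%N -> `|t j - t k| <= 2 * C * q ^+ k.
  move=> kj; have := tele k (j - k)%N; rewrite subnKC // => h; apply: le_trans h _.
  have p0 : 0 <= (1 / 2) ^+ (j - k) :> R by pos.
  have qk : 0 <= C * q ^+ k by pos.
  by have := mulr_ge0 qk p0; clear -lam0 Lam0 n0; lra.
have [l hl] : exists l, utends U t l.
  apply: (utends_ex UU (B := `|t 0%N| + 2 * C)); apply: filterE => j /=.
  have := tb 0%N j isT; rewrite expr0 mulr1 => h.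
  by rewrite -(subrK (t 0%N) (t j)) addrC; apply: le_trans (ler_normD _ _) _; rewrite lerD2l.
exists l => k; have h := utends_abs UU (utendsB UU (utends_cst UU (t k)) hl).
apply: (utends_le UU h (utends_cst UU _)).
apply: oU; exists k => // j /= kj; rewrite distrC; exact: tb.
Qed.

(** The error of [improvement] at scale [r], multiplied by [2 / r ^+ 2], is again a normalised
    solution, for the operator [2 * F (X / 2 + A)], which vanishes at 0 because [F A = 0]. Iterating
    gives errors [(r ^+ 2 / 2) ^+ k] at scale [r ^+ k], and the approximating polynomials
    converge. *)
Lemma pointwise_expansion : exists C r : R, [/\ 0 < C, 0 < r, r < 1 / 2 & forall F u, sol1 F u ->
  exists p A, [/\ A^T = A, `|p| <= C, forall i j, `|A i j| <= C &
   forall (k : nat) x, `|x| <= r ^+ k -> `|u x - (u 0 + dot p x + qf A x / 2)| <= C * (r ^+ 2 / 2) ^+ k]].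
Proof.
have [r [r0 r2 himp]] := improvement.
have D6 := @RR1_ge6 R n n0; set D := RR + 1 in D6 himp.
have nn : 0 <= n%:R :> R by [].
have approx (k : nat) : forall F u, sol1 F u -> exists (a : R) p A, A^T = A /\
   forall y, `|y| < D -> `|u (r ^+ k *: y) - (a + dot p (r ^+ k *: y) + qf A (r ^+ k *: y) / 2)|
     <= (r ^+ 2 / 2) ^+ k.
  elim: k => [|k IH] F u su.
    exists 0, 0, 0; split; first by rewrite trmx0.
    move=> y yD; rewrite !expr0 scale1r dot0l qf0 mul0r !addr0 subr0.
    by have [_ _ _ _] := su; apply.
  have [a [p [A [FA hq]]]] := himp _ _ su; have [eF qF F0 sF u1] := su.
  pose k2 := 2 / r ^+ 2; have k20 : 0 < k2 by rewrite /k2; pos.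
  have kr : k2 * r ^+ 2 = 2 by rewrite /k2 mulfVK // gt_eqF //; pos.
  pose u' y := k2 * (u (0 + r *: y) - (a + dot p (0 + r *: y) + qf A (0 + r *: y) / 2)).
  pose F' X := 2 * F (2^-1 *: X + A).
  have su' : sol1 F' u'.
    split.
            exact: ellF_scale.
          exact: qcF_scale.
        by rewrite /F' scaler0 add0r FA mulr0.
      have := sol_affine 0 r0 k20 (sol_quad a p A sF); rewrite kr => -[b1 b2].
      have sub : [set y : V | `|y| < RR + 1] `<=` [set y : V | `|0 + r *: y| < RR + 1].
        move=> y /= yD; rewrite add0r mx_normZ gtr0_norm //; apply: le_lt_trans yD.
        by rewrite ler_piMl //; move: r2; clear -lam0 Lam0 n0; lra.
      by split; [apply: visc_subset b1 sub|apply: visc_subset b2 sub].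
    move=> y /hq h; rewrite /u' add0r normrM gtr0_norm //.
    apply: le_trans (ler_wpM2l (ltW k20) h) _.
    by rewrite mulrA kr divff ?pnatr_eq0.
  have [a1 [p1 [A1 [sA1 h1]]]] := IH _ _ su'.
  exists (a + r ^+ 2 / 2 * a1), (p + (r / 2) *: p1), (2^-1 *: (A + A^T) + 2^-1 *: A1); split.
    by rewrite linearD /= tr_sym linearZ /= sA1.
  move=> y yD; have := h1 y yD.
  have e : r *: (r ^+ k *: y) = r ^+ k.+1 *: y by rewrite scalerA exprS.
  rewrite /u' add0r e [(r ^+ 2 / 2) ^+ k.+1]exprS => h2.
  have rp : 0 < r ^+ 2 / 2 by pos.
  have := ler_wpM2l (ltW rp) h2; rewrite -[X in X * `|_|]gtr0_norm // -normrM.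
  congr (`|_| <= _); rewrite qfD qf_sym qfZ -e dotDl !dotZl !dotZr !qf_scale /k2.
  by field; rewrite gt_eqF.
pose C0 := 5 + 4 * n%:R / r + 12 * n%:R ^+ 2 / r ^+ 2.
have C00 : 0 < C0 by rewrite /C0; pos.
exists (6 * (1 + C0)), r; split=> //; first by pos.
move=> F u su; have /choice[d hd] (k : nat) : exists d : R * V * 'M[R]_n, d.2^T = d.2 /\
   forall y, `|y| < D -> `|u (r ^+ k *: y) - (d.1.1 + dot d.1.2 (r ^+ k *: y) +
     qf d.2 (r ^+ k *: y) / 2)| <= (r ^+ 2 / 2) ^+ k.
  by have [a [p [A h]]] := approx k _ _ su; exists (a, p, A).
pose q : R := r ^+ 2 / 2; have q0 : 0 < q by rewrite /q; pos.
have r1 : r <= 1 by move: r2; clear -lam0 Lam0 n0; lra.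
have q2 : q <= 1 / 2.
  have : r ^+ 2 <= 1 by rewrite exprn_ile1 // ltW.
  by rewrite /q; clear -lam0 Lam0 n0; lra.
have hx (k : nat) x : `|x| <= r ^+ k -> `|u x - ((d k).1.1 + dot (d k).1.2 x + qf (d k).2 x / 2)| <= q ^+ k.
  move=> xr; have rk : 0 < r ^+ k by pos.
  have := (hd k).2 ((r ^+ k)^-1 *: x); rewrite scalerA mulfV ?gt_eqF // scale1r; apply.
  rewrite mx_normZ gtr0_norm ?invr_gt0 // mulrC; apply: le_lt_trans (_ : 1 < D).
    by rewrite ler_pdivrMr // mul1r.
  by move: D6; clear -lam0 Lam0 n0; lra.
(* Consecutive polynomials are close on the smaller cube; dividing by powers of its radius leaves
   the rates [q], [r / 2] and [1 / 2] for the coefficients of order 0, 1 and 2. *)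
have diff (k : nat) : [/\ `|(d k.+1).1.1 - (d k).1.1| <= 2 * q ^+ k,
    `|(d k.+1).1.2 - (d k).1.2| <= 2 / r * (r / 2) ^+ k &
    forall i j, `|((d k.+1).2 - (d k).2) i j| <= 12 / r ^+ 2 * (1 / 2) ^+ k].
  have rk : 0 < r ^+ k.+1 by pos.
  have sy : ((d k.+1).2 - (d k).2)^T = (d k.+1).2 - (d k).2.
    by rewrite linearB /= (hd k.+1).1 (hd k).1.
  have [|h1 h2 h3] := @quad_coef ((d k.+1).1.1 - (d k).1.1) (2 * q ^+ k) _
     ((d k.+1).1.2 - (d k).1.2) _ sy rk.
    move=> h hr; have hr' : `|h| <= r ^+ k.
      by apply: le_trans hr _; rewrite exprS ler_piMl // exprn_ge0 // ltW.
    have := hx _ _ hr; have := hx _ _ hr'.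
    have : q ^+ k.+1 <= q ^+ k.
      rewrite exprS ler_piMl ?exprn_ge0 //; [exact: ltW|move: q2; clear -lam0 Lam0 n0; lra].
    rewrite dotDl dotNl qfD qfN !ler_norml => m1 /andP[m2 m3] /andP[m4 m5].
    by move: m1 m2 m3 m4 m5; clear -lam0 Lam0 n0 => *; apply/andP; split; lra.
  have rkk : 0 < r ^+ k by pos.
  have tk : 0 < 2 ^+ k :> R by pos.
  have qE : q ^+ k = (r ^+ k) ^+ 2 * (2 ^+ k)^-1.
    by rewrite /q exprMn exprVn -!exprM mulnC.
  split=> //.
    apply: le_trans h2 _; rewrite qE [r ^+ k.+1]exprS [(r / 2) ^+ k]exprMn exprVn.
    move: (r ^+ k) (2 ^+ k) rkk tk => s t s0 t0.
    by rewrite le_eqVlt; apply/orP; left; apply/eqP; field; rewrite !gt_eqF.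
  move=> i j; apply: le_trans (h3 i j) _; rewrite qE [r ^+ k.+1]exprS mul1r exprVn.
  move: (r ^+ k) (2 ^+ k) rkk tk => s t s0 t0.
  by rewrite le_eqVlt; apply/orP; left; apply/eqP; field; rewrite !gt_eqF.
have [a ha] := @geom_limit (fun k => (d k).1.1) 2 q ltac:(by []) q0 q2 (fun k => let: And3 h _ _ := diff k in h).
have /choice[p hp] (i : 'I_n) : exists l, forall k : nat, `|(d k).1.2 0 i - l| <= 2 * (2 / r) * (r / 2) ^+ k.
  apply: geom_limit; [by pos|by pos|by move: r1; clear -lam0 Lam0 n0; lra|].
  move=> k; have [_ h _] := diff k; apply: le_trans h.
  by have := coord_le_norm ((d k.+1).1.2 - (d k).1.2) i; rewrite !mxE.
have /choice[AA hAA] (ij : 'I_n * 'I_n) : exists l, forall k : nat,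
    `|(d k).2 ij.1 ij.2 - l| <= 2 * (12 / r ^+ 2) * (1 / 2) ^+ k.
  apply: geom_limit; [by pos|by clear -lam0 Lam0 n0; lra|by []|].
  by move=> k; have [_ _ h] := diff k; have := h ij.1 ij.2; rewrite !mxE.
pose pp : V := \row_i p i; pose A := \matrix_(i, j) AA (i, j) : 'M[R]_n.

have sA : A^T = A.
  apply/matrixP => i j; rewrite !mxE; apply/eqP; rewrite -subr_eq0 -normr_le0.
  apply/ler_addgt0Pr => e e0; rewrite add0r.
  pose c := 2 * (12 / r ^+ 2) + 2 * (12 / r ^+ 2); have c0 : 0 < c by rewrite /c; pos.
  have ec : 0 < e / c by pos.
  have p1 : 0 < 1 / 2 :> R by pos.
  have p2 : 1 / 2 < 1 :> R by clear -lam0 Lam0 n0; lra.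
  have [k hk] := expr_small p1 p2 ec.
  rewrite ler_pdivlMr // in hk; apply: le_trans hk.
  have h1 := hAA (j, i) k; have h2 := hAA (i, j) k; rewrite /= in h1 h2.
  have sd : (d k).2 j i = (d k).2 i j by rewrite -[in LHS](hd k).1 mxE.
  rewrite sd in h1; have := ler_distD ((d k).2 i j) (AA (j, i)) (AA (i, j)).
  rewrite (distrC (AA (j, i)) ((d k).2 i j)) /c; move: h1 h2; clear -lam0 Lam0 n0; lra.
have exp (k : nat) x : `|x| <= r ^+ k -> `|u x - (a + dot pp x + qf A x / 2)| <= C0 * q ^+ k.
  move=> xr; have h1 := hx k x xr; have h2 := ha k.
  have rk : 0 < r ^+ k by pos.
  have tk : 0 < 2 ^+ k :> R by pos.
  have qE : q ^+ k = (r ^+ k) ^+ 2 * (2 ^+ k)^-1.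
    by rewrite /q exprMn exprVn -!exprM mulnC.
  have h3 : `|dot ((d k).1.2 - pp) x| <= 4 * n%:R / r * q ^+ k.
    apply: le_trans (dot_norm_le _ _) _.
    have pb : `|(d k).1.2 - pp| <= 2 * (2 / r) * (r / 2) ^+ k.
      apply: norm_le_coord; first by pos.
      by move=> i; rewrite !mxE; exact: hp.
    apply: le_trans (_ : n%:R * (2 * (2 / r) * (r / 2) ^+ k) * r ^+ k <= _).
      by apply: ler_pM => //; rewrite ler_wpM2l.
    rewrite qE exprMn exprVn; move: (r ^+ k) (2 ^+ k) rk tk => s t s0 t0.
    by rewrite le_eqVlt; apply/orP; left; apply/eqP; field; rewrite !gt_eqF.
  have h4 : `|qf ((d k).2 - A) x| <= 24 * n%:R ^+ 2 / r ^+ 2 * q ^+ k.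
    apply: le_trans (@qf_entries _ (2 * (12 / r ^+ 2) * (1 / 2) ^+ k) x _ _) _; first by pos.
      by move=> i j; rewrite !mxE; exact: (hAA (i, j)).
    apply: le_trans (_ : 2 * (12 / r ^+ 2) * (1 / 2) ^+ k * n%:R ^+ 2 * (r ^+ k) ^+ 2 <= _).
      rewrite ler_wpM2l //; first by pos.
      by rewrite ler_sqr ?nnegrE // ltW.
    rewrite qE exprMn exprVn expr1n mul1r; move: (r ^+ k) (2 ^+ k) rk tk => s t s0 t0.
    by rewrite le_eqVlt; apply/orP; left; apply/eqP; field; rewrite !gt_eqF.
  have -> : C0 * q ^+ k = 5 * q ^+ k + 4 * n%:R / r * q ^+ k + 2^-1 * (24 * n%:R ^+ 2 / r ^+ 2 * q ^+ k).
    rewrite /C0; move: (q ^+ k) => s; by field; rewrite gt_eqF.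
  move: h1 h2 h3 h4; rewrite dotDl dotNl qfD qfN; move: (4 * n%:R / r * _) (24 * _ / _ * _) => s1 s2.
  rewrite !ler_norml => /andP[m1 m2] /andP[m3 m4] /andP[m5 m6] /andP[m7 m8].
  by move: m1 m2 m3 m4 m5 m6 m7 m8; clear -lam0 Lam0 n0 => *; apply/andP; split; lra.
have au : a = u 0.
  apply/eqP; rewrite eq_sym -subr_eq0 -normr_le0; apply/ler_addgt0Pr => e e0; rewrite add0r.
  have ec : 0 < e / C0 by pos.
  have q1 : q < 1 by move: q2; clear -lam0 Lam0 n0; lra.
  have [k hk] := expr_small q0 q1 ec.
  rewrite ler_pdivlMr // mulrC in hk; apply: le_trans hk.
  have := exp k 0; rewrite normr0 dot0r qf_zero mul0r !addr0; apply.
  by apply: exprn_ge0; exact: ltW.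
rewrite au in exp.
have [|ub pb Ab] := @quad_coef (u 0) (1 + C0) 1 pp A sA ltr01.
  move=> h h1; have := exp 0%N h; rewrite !expr0 mulr1 => /(_ h1).
  have : `|u h| <= 1.
    have [_ _ _ _] := su; apply; apply: le_lt_trans h1 _; rewrite -/D; move: D6; clear -lam0 Lam0 n0; lra.
  by rewrite !ler_norml => /andP[m1 m2] /andP[m3 m4]; move: m1 m2 m3 m4; clear -lam0 Lam0 n0 => *; apply/andP; split; lra.
exists pp, A; split=> //.
    by apply: le_trans pb _; rewrite divr1; move: C00; clear -lam0 Lam0 n0; lra.
  by move=> i j; apply: le_trans (Ab i j) _; rewrite expr1n divr1.
move=> k x xr; apply: le_trans (exp k x xr) _; rewrite ler_wpM2r //; first by apply: exprn_ge0; exact: ltW.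
by move: C00; clear -lam0 Lam0 n0; lra.
Qed.
End Iteration.

(** * From Taylor expansions at all points to the [C^{2,alpha}] norm *)

Section Taylor.
Variables (R : realType) (n : nat).
Local Notation V := 'rV[R]_n.
Implicit Types (x y z v w h : V) (f u : V -> R).

Lemma derive_expansion f x v (L : R) :
  (forall e : R, 0 < e -> exists2 d : R, 0 < d & forall t : R, `|t| < d ->
     `|f (t *: v + x) - f x - t * L| <= e * `|t|) ->
  derivable f x v /\ 'D_v f x = L.
Proof.
move=> hf.
have c : (t^-1 *: ((f \o shift x) (t *: v) - f x)) @[t --> (0 : R)^'] --> L.
  apply/cvgrPdist_le => e e0; have [d d0 hd] := hf e e0.
  near=> t.
  have t0 : t != 0 by near: t; exact: nbhs_dnbhs_neq.
  have td : `|t| < d by near: t; exact: dnbhs0_lt.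
  have -> : L - t^-1 *: ((f \o shift x) (t *: v) - f x) =
      - (t^-1 * (f (t *: v + x) - f x - t * L)).
    have -> : t^-1 *: ((f \o shift x) (t *: v) - f x) = t^-1 * (f (t *: v + x) - f x) by [].
    by field.
  rewrite normrN normrM normfV mulrC ler_pdivrMr ?normr_gt0 //; exact: hd.
split; [exact: cvgP c|exact: cvg_lim c].
Unshelve. all: by end_near.
Qed.

Lemma powR_small (al C e : R) : 0 < al -> 0 <= C -> 0 < e ->
  exists2 d : R, 0 < d & forall t : R, 0 <= t -> t < d -> C * t `^ al <= e.
Proof.
move=> al0 C0 e0; have c1 : 0 < C + 1 by pos.
have ec : 0 < e / (C + 1) by pos.
exists ((e / (C + 1)) `^ al^-1); first exact: powR_gt0.
move=> t t0 td; have h : t `^ al <= e / (C + 1).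
  apply: le_trans (_ : ((e / (C + 1)) `^ al^-1) `^ al <= _).
    apply: ge0_ler_powR; rewrite ?nnegrE ?powR_ge0 //; exact: ltW.
  by rewrite -powRrM mulVf ?gt_eqF // powRr1 // ltW.
apply: le_trans (ler_wpM2l C0 h) _; rewrite mulrCA ler_piMr //; first exact: ltW.
by rewrite ler_pdivrMr // mul1r lerDl.
Qed.

Definition expands u (B : set V) (C rho al : R) (p : V -> V) (A : V -> 'M[R]_n) :=
  forall x, B x -> [/\ (A x)^T = A x, `|p x| <= C, forall i j, `|A x i j| <= C &
    forall h, `|h| <= rho ->
     `|u (x + h) - (u x + dot (p x) h + qf (A x) h / 2)| <= C * `|h| ^+ 2 * `|h| `^ al].

(** The expansions at [x] and at [y] are compared on the cube of radius [d] about [y]. Doubling the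
    distance costs at most [2 ^ 2 * 2 = 8], so the errors add up to 9 times [C * d ^+ 2] times the
    power of [d]; the 6 of [quad_coef] makes it 54. *)
Lemma expands_two u B (C rho al : R) p A x y : 0 < C -> 0 < al -> al < 1 ->
  expands u B C rho al p A -> B x -> B y -> 0 < `|y - x| -> `|y - x| <= rho / 2 ->
  `|p y - p x - (y - x) *m A x| <= 9 * C * `|y - x| * `|y - x| `^ al /\
  forall i j, `|A y i j - A x i j| <= 54 * C * `|y - x| `^ al.
Proof.
move=> C0 al0 al1 hE Bx By; set k := y - x; set d := `|k| => d0 dr.
have [sx _ _ hx] := hE x Bx; have [sy _ _ hy] := hE y By.
pose e := 9 * C * d ^+ 2 * d `^ al.
have pa : 0 < d `^ al by exact: powR_gt0.
have rho0 : 0 < rho by lra.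
have mono (t : R) : 0 <= t -> t <= d -> C * t ^+ 2 * t `^ al <= C * d ^+ 2 * d `^ al.
  move=> t0 td; rewrite -[C * t ^+ 2 * _]mulrA -[C * d ^+ 2 * _]mulrA ler_pM2l //; apply: ler_pM; rewrite ?sqr_ge0 ?powR_ge0 //.
    by rewrite ler_sqr ?nnegrE // ltW.
  by apply: ge0_ler_powR; rewrite ?nnegrE //; exact: ltW.
have two : (2 * d) `^ al <= 2 * d `^ al.
  rewrite powRM //; last exact: ltW.
  rewrite ler_pM2r //; apply: le_trans (_ : 2 `^ 1 <= _); last by rewrite powRr1.
  by apply: ler_powR; [rewrite ler1n|exact: ltW].
have sD : (A y - A x)^T = A y - A x by rewrite linearB /= sx sy.
have [|_ h2 h3] := @quad_coef R n (u y - (u x + dot (p x) k + qf (A x) k / 2)) e d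
    (p y - p x - k *m A x) (A y - A x) sD d0.
  move=> h hd; have hr : `|h| <= rho by lra.
  have yE : y + h = x + (k + h) by rewrite addrA [x + k]addrC subrK.
  have khd : `|k + h| <= 2 * d by apply: le_trans (ler_normD _ _) _; rewrite -/d; lra.
  have khr : `|k + h| <= rho by lra.
  have b1 := le_trans (hy h hr) (mono _ (normr_ge0 h) hd).
  have b2 := hx _ khr; rewrite -yE in b2.
  have b3 : C * `|k + h| ^+ 2 * `|k + h| `^ al <= 8 * (C * d ^+ 2 * d `^ al).
    apply: le_trans (_ : C * (2 * d) ^+ 2 * (2 * d `^ al) <= _); last first.
      by rewrite le_eqVlt; apply/orP; left; apply/eqP; ring.
    rewrite -[C * _ ^+ 2 * _]mulrA -[C * (2 * d) ^+ 2 * _]mulrA ler_pM2l //.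
    have d2 : 0 <= 2 * d by apply: le_trans khd.
    apply: ler_pM; [exact: sqr_ge0|exact: powR_ge0| |].
      by rewrite ler_sqr ?nnegrE.
    by apply: le_trans two; apply: ge0_ler_powR; rewrite ?nnegrE ?normr_ge0 ?(ltW al0).
  have qE : qf (A x) (k + h) = qf (A x) k + 2 * dot (k *m A x) h + qf (A x) h.
    by rewrite qf_addr sx mulmxDr dotDl; ring.
  have -> : u y - (u x + dot (p x) k + qf (A x) k / 2) + dot (p y - p x - k *m A x) h +
      qf (A y - A x) h / 2 = (u (y + h) - (u x + dot (p x) (k + h) + qf (A x) (k + h) / 2)) -
      (u (y + h) - (u y + dot (p y) h + qf (A y) h / 2)).
    by rewrite qE qfD qfN !dotDl !dotNl dotDr; field.
  apply: le_trans (ler_normB _ _) _; apply: le_trans (lerD (le_trans b2 b3) b1) _.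
  by rewrite /e le_eqVlt; apply/orP; left; apply/eqP; ring.
split.
  apply: le_trans h2 _; rewrite /e le_eqVlt; apply/orP; left; apply/eqP.
  by field; rewrite gt_eqF.
move=> i j; have := h3 i j; rewrite !mxE => h; apply: le_trans h _.
rewrite /e le_eqVlt; apply/orP; left; apply/eqP.
by field; rewrite gt_eqF.
Qed.

Lemma delta_norm i : `|delta_mx 0 i : V| <= 1.
Proof. by apply: norm_le_of_nsq => //; rewrite nsq_delta expr1n. Qed.

Lemma delta_normE i : `|delta_mx 0 i : V| = 1.
Proof.
apply/eqP; rewrite eq_le delta_norm /=.
by have := coord_le_norm (delta_mx 0 i : V) i; rewrite mxE !eqxx normr1.
Qed.

(** First derivatives are read off the expansions, second derivatives off the increments of the
    slopes in [expands_two]. *)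
Lemma expands_C2on u B (C rho al : R) p A : 0 < C -> 0 < rho -> rho <= 1 -> 0 < al -> al < 1 ->
  (forall x, B x -> exists2 r : R, 0 < r & forall y, `|y - x| < r -> B y) ->
  (forall x, B x -> {for x, continuous u}) -> expands u B C rho al p A ->
  C2on B u /\ forall x, B x -> (forall i, pd u i x = p x 0 i) /\
    forall i j, pd (pd u i) j x = A x i j.
Proof.
move=> C0 rho0 rho1 al0 al1 opB uc hE.
have d1 x i : B x -> derivable u x (delta_mx 0 i) /\ pd u i x = p x 0 i.
  move=> Bx; apply: derive_expansion => e e0; have [_ _ Ab hx] := hE x Bx.
  have c2 : 0 < 2 * C by pos.
  exists (Num.min rho (e / (2 * C))); first by rewrite lt_min rho0 divr_gt0.
  move=> t; rewrite lt_min => /andP[t1 t2].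
  have tn : `|t *: delta_mx 0 i : V| = `|t| by rewrite mx_normZ delta_normE mulr1.
  have := hx (t *: delta_mx 0 i); rewrite tn => /(_ (ltW t1)).
  rewrite [t *: _ + x]addrC dotZr dot_delta qf_scale qf_delta => b1.
  have b2 := Ab i i; have t0 := normr_ge0 t.
  have b3 : `|t| `^ al <= 1.
    apply: le_trans (_ : 1 `^ al <= _); last by rewrite powR1.
    by apply: ge0_ler_powR; rewrite ?nnegrE //; [exact: ltW|lra].
  have b4 : C * `|t| ^+ 2 * `|t| `^ al <= C * `|t| ^+ 2 by rewrite ler_piMr //; pos.
  have b5 : `|t ^+ 2 * A x i i / 2| <= C * `|t| ^+ 2.
    have s0 := sqr_ge0 t; rewrite real_normK ?num_real //; move: (t ^+ 2) s0 => s s0.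
    rewrite !normrM (ger0_norm s0) [`|2^-1|]ger0_norm ?invr_ge0 //.
    have := ler_wpM2l s0 b2; have : 0 <= s * `|A x i i| by apply: mulr_ge0.
    by move: s0; clear; lra.
  have b6 : C * `|t| ^+ 2 + C * `|t| ^+ 2 <= e * `|t|.
    have : 2 * C * `|t| <= e by rewrite mulrC -ler_pdivlMr // ltW.
    by move=> /(ler_wpM2r t0); rewrite expr2; lra.
  have -> : u (x + t *: delta_mx 0 i) - u x - t * p x 0 i =
     (u (x + t *: delta_mx 0 i) - (u x + t * p x 0 i + t ^+ 2 * A x i i / 2)) + t ^+ 2 * A x i i / 2 by ring.
  apply: le_trans (ler_normD _ _) _; apply: le_trans b6.
  by apply: lerD => //; apply: le_trans b4.
have near x : B x -> exists2 r : R, 0 < r & r <= rho / 2 /\ forall y, `|y - x| < r -> B y.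
  move=> Bx; have [r r0 hr] := opB x Bx; exists (Num.min r (rho / 2)).
    by rewrite lt_min r0 /=; pos.
  split; first by rewrite ge_min lexx orbT.
  by move=> y; rewrite lt_min => /andP[/hr].
have nn : 0 <= n%:R :> R by [].
have xA x y i : B x -> `|((y - x) *m A x) 0 i| <= n%:R * C * `|y - x|.
  move=> Bx; have [_ _ Ab _] := hE x Bx; rewrite mulmx_sum; apply: le_trans (ler_norm_sum _ _ _) _.
  rewrite -mulrA mulr_natl -[n in _ *+ n]card_ord -sumr_const; apply: ler_sum => j _.
  by rewrite normrM mulrC; apply: ler_pM => //; exact: coord_le_norm.
have c1 x i : B x -> {for x, continuous (pd u i)}.
  move=> Bx; apply/contP => e e0; have [r r0 [rr hr]] := near x Bx.
  pose L := 9 * C + n%:R * C + 1; have L0 : 0 < L by rewrite /L; pos.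
  exists (Num.min r (e / L)); first by rewrite lt_min r0 divr_gt0.
  move=> y; rewrite lt_min => /andP[y1 y2]; have By := hr y y1.
  rewrite (d1 y i By).2 (d1 x i Bx).2.
  have [->|yx] := eqVneq y x; first by rewrite subrr normr0.
  have dy : 0 < `|y - x| by rewrite normr_gt0 subr_eq0.
  have [b1 _] := expands_two C0 al0 al1 hE Bx By dy (le_trans (ltW y1) rr).
  have b2 := le_trans (coord_le_norm _ i) b1; rewrite 2!mxE in b2.
  have b3 := xA x y i Bx.
  have b4 : `|y - x| `^ al <= 1.
    apply: le_trans (_ : 1 `^ al <= _); last by rewrite powR1.
    by apply: ge0_ler_powR; rewrite ?nnegrE //; [exact: ltW|lra].
  have b5 : 9 * C * `|y - x| * `|y - x| `^ al <= 9 * C * `|y - x|.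
    by rewrite ler_piMr //; pos.
  rewrite ltr_pdivlMr // in y2; apply: le_lt_trans y2.
  have -> : p y 0 i - p x 0 i = (p y 0 i - p x 0 i - ((y - x) *m A x) 0 i) + ((y - x) *m A x) 0 i by ring.
  apply: le_trans (ler_normD _ _) _; rewrite mxE mxE in b2.
  by rewrite /L; move: b2 b3 b5 dy; move: (((y - x) *m A x) 0 i) => s; lra.
have d2 x i j : B x -> derivable (pd u i) x (delta_mx 0 j) /\ pd (pd u i) j x = A x i j.
  move=> Bx; apply: derive_expansion => e e0; have [r r0 [rr hr]] := near x Bx.
  have [sA _ _ _] := hE x Bx.
  have c9 : 0 <= 9 * C by pos.
  have [d d0 hd] := powR_small al0 c9 e0.
  exists (Num.min r d); first by rewrite lt_min r0.
  move=> t; rewrite lt_min => /andP[t1 t2]; set y := t *: delta_mx 0 j + x.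
  have yx : y - x = t *: delta_mx 0 j by rewrite /y addrK.
  have tn : `|y - x| = `|t| by rewrite yx mx_normZ delta_normE mulr1.
  have By : B y by apply: hr; rewrite tn.
  rewrite (d1 y i By).2 (d1 x i Bx).2.
  have [t0|tn0] := eqVneq t 0.
    by rewrite /y t0 scale0r add0r subrr mul0r subr0 normr0 mulr0.
  have tp : 0 < `|t| by rewrite normr_gt0.
  have [] := expands_two C0 al0 al1 hE Bx By; rewrite tn //; first exact: le_trans (ltW t1) rr.
  move=> b1 _; have b2 := le_trans (coord_le_norm _ i) b1.
  have b3 : ((y - x) *m A x) 0 i = t * A x i j.
    by rewrite yx -scalemxAl mxE -rowE mxE -[in LHS]sA mxE.
  move: b2; rewrite mxE [(p y - p x) 0 i]mxE [(- p x) 0 i]mxE [(- _ : V) 0 i]mxE b3 => b2.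
  apply: le_trans b2 _; rewrite mulrAC ler_wpM2r //; exact: hd.
split.
  move=> x Bx; split; first exact: uc.
    by move=> i; split; [exact: (d1 x i Bx).1|exact: c1].
  move=> i j; split; first exact: (d2 x i j Bx).1.
  apply/contP => e e0; have [r r0 [rr hr]] := near x Bx.
  have c54 : 0 <= 54 * C by pos.
  have e2 : 0 < e / 2 by pos.
  have [d d0 hd] := powR_small al0 c54 e2.
  exists (Num.min r d); first by rewrite lt_min r0.
  move=> y; rewrite lt_min => /andP[y1 y2]; have By := hr y y1.
  rewrite (d2 y i j By).2 (d2 x i j Bx).2.
  have [->|yx] := eqVneq y x; first by rewrite subrr normr0.
  have dy : 0 < `|y - x| by rewrite normr_gt0 subr_eq0.
  have [_ b1] := expands_two C0 al0 al1 hE Bx By dy (le_trans (ltW y1) rr).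
  apply: le_lt_trans (b1 i j) _; apply: le_lt_trans (hd _ (ltW dy) y2) _; lra.
by move=> x Bx; split=> [i|i j]; [exact: (d1 x i Bx).2|exact: (d2 x i j Bx).2].
Qed.

Lemma enormE (x : V) : enorm x = Num.sqrt (nsq x).
Proof. by rewrite /enorm big_ord1; congr Num.sqrt; apply: eq_bigr => i _; rewrite expr2. Qed.

Lemma norm_le_enorm (x : V) : `|x| <= enorm x.
Proof.
rewrite enormE; apply: norm_le_of_nsq; first exact: sqrtr_ge0.
by rewrite sqr_sqrtr // nsq_ge0.
Qed.

Lemma expands_norm u B (C rho al : R) p A : 0 < C -> 0 < rho -> rho <= 1 -> 0 < al -> al < 1 ->
  (forall x, B x -> exists2 r : R, 0 < r & forall y, `|y - x| < r -> B y) ->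
  (forall x, B x -> {for x, continuous u}) -> (forall x, B x -> `|u x| <= C) ->
  expands u B C rho al p A ->
  (C2a_norm B al u <= (C + \sum_(i < n) C +
     \sum_(i < n) \sum_(j < n | (i <= j)%N) (C + (54 * C + 2 * C / (rho / 2) `^ al)))%:E)%E.
Proof.
move=> C0 rho0 rho1 al0 al1 opB uc ub hE.
have [_ hd] := expands_C2on C0 rho0 rho1 al0 al1 opB uc hE.
have es f (c : R) : (forall x, B x -> `|f x| <= c) -> (esupn B f <= c%:E)%E.
  by move=> h; apply: ge_ereal_sup => _ [x Bx <-]; rewrite lee_fin; exact: h.
have r2 : 0 < (rho / 2) `^ al by apply: powR_gt0; pos.
rewrite /C2a_norm !EFinD -!sumEFin; apply: leeD; first apply: leeD.
    exact: es.
  apply: lee_sum => i _; apply: es => x Bx; rewrite (hd x Bx).1.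
  by have [_ pb _ _] := hE x Bx; apply: le_trans (coord_le_norm _ _) pb.
apply: lee_sum => i _; rewrite -sumEFin; apply: lee_sum => j _; rewrite EFinD; apply: leeD.
  by apply: es => x Bx; rewrite (hd x Bx).2; have [_ _ Ab _] := hE x Bx; exact: Ab.
apply: ge_ereal_sup => _ [x [y [Bx By xy ->]]]; rewrite lee_fin (hd x Bx).2 (hd y By).2.
have ne : 0 < `|x - y| by rewrite normr_gt0 subr_eq0; apply/eqP.
have en := norm_le_enorm (x - y).
have en0 : 0 < enorm (x - y) by apply: lt_le_trans en.
rewrite ler_pdivrMr; last exact: powR_gt0.
have pe : `|x - y| `^ al <= enorm (x - y) `^ al.
  by apply: ge0_ler_powR; rewrite ?nnegrE //; [exact: ltW|exact: ltW].
have c2 : 0 <= 2 * C / (rho / 2) `^ al by pos.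
have c54 : 0 <= 54 * C by pos.
(* Beyond distance [rho / 2] the Hoelder quotient is controlled by the sup bound on the Hessian. *)
have [h|h] := leP `|x - y| (rho / 2).
  have [_ b] := expands_two C0 al0 al1 hE By Bx ne h; apply: le_trans (b i j) _.
  by apply: ler_pM => //; rewrite ?powR_ge0 ?lerDl.
have [_ _ Ax _] := hE x Bx; have [_ _ Ay _] := hE y By.
apply: le_trans (ler_normB _ _) _.
have r3 : (rho / 2) `^ al <= enorm (x - y) `^ al.
  apply: le_trans pe; apply: ge0_ler_powR; rewrite ?nnegrE //; [exact: ltW|by pos|exact: ltW].
have := Ax i j; have := Ay i j.
have := ler_wpM2l c2 r3; rewrite mulfVK ?gt_eqF // mulrDl.
have : 0 <= 54 * C * enorm (x - y) `^ al by apply: mulr_ge0 => //; exact: powR_ge0.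
by lra.
Qed.
End Taylor.

(** * From the stated hypotheses to normalised solutions *)

Section Reduction.
Variables (R : realType) (n : nat).
Local Notation V := 'rV[R]_n.
Implicit Types (x y z h : V) (M N S : 'M[R]_n) (u : V -> R) (F : 'M[R]_n -> R).

Definition sy M : 'M[R]_n := 2^-1 *: (M + M^T).

Lemma syD M N : sy (M + N) = sy M + sy N.
Proof. by apply/matrixP => i j; rewrite !mxE; ring. Qed.

Lemma tr_syE M : \tr (sy M) = \tr M.
Proof. by rewrite mxtraceZ mxtraceD mxtrace_tr; field. Qed.

Lemma psd_psdq N : psdq N -> psd N.
Proof.
move=> h x; have := h x^T; rewrite /qf /dot mxE; congr (_ <= _).
by apply: eq_bigr => j _; rewrite [x^T 0 j]mxE.
Qed.

Lemma psd_cauchy S y z : S^T = S -> psdq S -> dot (y *m S) z ^+ 2 <= qf S y * qf S z.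
Proof.
move=> sS hS; set b := dot _ z.
have q (t : R) : 0 <= qf S y + 2 * t * b + t ^+ 2 * qf S z.
  have := hS (y + t *: z); rewrite qf_addr qf_scale sS dotZr mulmxDr dotDl -/b.
  by congr (_ <= _); ring.
have [z0|z0] := eqVneq (qf S z) 0.
  have [->|b0] := eqVneq b 0; first by rewrite z0 mulr0 expr0n.
  have := q (- (qf S y + 1) / (2 * b)); rewrite z0 mulr0 addr0.
  have -> : qf S y + 2 * (- (qf S y + 1) / (2 * b)) * b = -1 by field.
  by move=> h; exfalso; move: h; clear; lra.
have zp : 0 < qf S z by rewrite lt_neqAle eq_sym z0 hS.
have := q (- b / qf S z).
have -> : qf S y + 2 * (- b / qf S z) * b + (- b / qf S z) ^+ 2 * qf S z =
   (qf S y * qf S z - b ^+ 2) / qf S z by field.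
by rewrite pmulr_lge0 ?invr_gt0 // subr_ge0.
Qed.

Lemma enorm_col (x : 'cV[R]_n) : enorm x = Num.sqrt (nsq x^T).
Proof.
rewrite /enorm; congr Num.sqrt; apply: eq_bigr => i _.
by rewrite big_ord1 mxE expr2.
Qed.

(** Cauchy-Schwarz for the form of [S] against basis vectors gives [nsq (y *m S) <= qf S y * \tr S];
    as [qf S y ^+ 2 <= nsq (y *m S)] for a unit [y], also [qf S y <= \tr S]. *)
Lemma opnorm_bound S (x : 'cV[R]_n) : S^T = S -> psdq S -> enorm x = 1 -> enorm (S *m x) <= \tr S.
Proof.
move=> sS hS; rewrite !enorm_col trmx_mul sS; set y := x^T => y1.
have ny : nsq y = 1 by rewrite -(sqr_sqrtr (nsq_ge0 y)) y1 expr1n.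
have T0 := psdq_tr_ge0 hS; have q0 := hS y.
have h1 : nsq (y *m S) <= qf S y * \tr S.
  rewrite /mxtrace mulr_sumr; apply: ler_sum => i _.
  by have := psd_cauchy y (delta_mx 0 i) sS hS; rewrite dot_delta qf_delta expr2.
have h2 : qf S y ^+ 2 <= nsq (y *m S).
  by have := cauchy_schwarz (y *m S) y; rewrite ny mulr1.
have h3 : qf S y <= \tr S.
  have [->//|qn] := eqVneq (qf S y) 0.
  have qp : 0 < qf S y by rewrite lt_neqAle eq_sym qn.
  by rewrite -(ler_pM2l qp) -expr2; apply: le_trans h2 h1.
rewrite -[X in _ <= X]ger0_norm // -sqrtr_sqr ler_wsqrtr //.
by apply: le_trans h1 _; rewrite expr2 ler_wpM2r.
Qed.

Lemma opnorm_set_bounded S : S^T = S -> psdq S ->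
  ubound [set enorm (S *m x) | x in [set x : 'cV[R]_n | enorm x = 1]] (\tr S).
Proof. by move=> sS hS _ [x x1 <-]; exact: opnorm_bound. Qed.

Lemma enorm_delta (i : 'I_n) : enorm (delta_mx i 0 : 'cV[R]_n) = 1.
Proof. by rewrite enorm_col trmx_delta nsq_delta sqrtr1. Qed.

Lemma opnorm_le_tr S : (0 < n)%N -> S^T = S -> psdq S -> opnorm S <= \tr S.
Proof.
move=> n0 sS hS; apply: ge_sup; last exact: opnorm_set_bounded.
pose e1 : 'cV[R]_n := delta_mx (Ordinal n0) 0.
exists (enorm (S *m e1)), e1 => //.
exact: enorm_delta.
Qed.

Lemma tr_le_opnorm S : S^T = S -> psdq S -> \tr S <= n%:R * opnorm S.
Proof.
move=> sS hS; rewrite mulr_natl -[n in _ *+ n]card_ord -sumr_const; apply: ler_sum => i _.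
pose e1 : 'cV[R]_n := delta_mx i 0.
have mem : [set enorm (S *m x) | x in [set x : 'cV[R]_n | enorm x = 1]] (enorm (S *m e1)).
  by exists e1 => //; exact: enorm_delta.
apply: le_trans (_ : enorm (S *m e1) <= _); last first.
  apply: sup_upper_bound => //; split; first by exists (enorm (S *m e1)).
  by exists (\tr S); exact: opnorm_set_bounded.
rewrite enorm_col /e1 -colE; set y := (col i S)^T.
have -> : S i i = y 0 i by rewrite !mxE.
apply: le_trans (ler_norm _) _; apply: le_trans (coord_le_norm y i) _.
by rewrite -enormE; exact: norm_le_enorm.
Qed.

(** For a positive semidefinite symmetric matrix the operator norm lies between the trace over [n]
    and the trace, hence the constant [lam / n]. *)
Lemma ellF_sy (lam Lam : R) F : (0 < n)%N -> 0 < lam -> 0 < Lam -> unif_elliptic lam Lam F ->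
  ellF (lam / n%:R) Lam (fun M => F (sy M)).
Proof.
move=> n0 lam0 Lam0 eF M N hN; rewrite syD.
have np : 0 < n%:R :> R by rewrite ltr0n.
have hS : psdq (sy N) by move=> x; rewrite qf_sym.
have /andP[h1 h2] := eF (sy M) (sy N) (tr_sym M) (tr_sym N) (psd_psdq hS).
have t1 := tr_le_opnorm (tr_sym N) hS; have t2 := opnorm_le_tr n0 (tr_sym N) hS.
rewrite -/(sy N) tr_syE in t1 t2; apply/andP; split.
  by apply: le_trans h1; rewrite mulrAC ler_pdivrMr // -mulrA ler_pM2l // mulrC.
by apply: le_trans h2 _; rewrite ler_pM2l.
Qed.

Lemma qcF_sy F : quasiconcave F -> qcF (fun M => F (sy M)).
Proof.
move=> qF M N; have := qF (sy M) (sy N) 2^-1 (tr_sym M) (tr_sym N).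
have -> : 2^-1 *: sy M + (1 - 2^-1) *: sy N = sy (2^-1 *: (M + N)).
  by apply/matrixP => i j; rewrite !mxE; field.
by apply; rewrite invr_ge0 invf_le1 // ler1n ler0n.
Qed.

Lemma quad_C2 (a : R) (p x0 : V) M (q := fun y => a + dot p (y - x0) + qf M (y - x0) / 2) :
  (forall O, C2on O q) /\ forall x, hess q x = sy M.
Proof.
have pd1 x i : derivable q x (delta_mx 0 i) /\ pd q i x = (p + (x - x0) *m sy M) 0 i.
  apply: derive_expansion => e e0; exists (e / (`|M i i| + 1)); first by apply: divr_gt0 => //; pos.
  move=> t td; have M1 : 0 < `|M i i| + 1 by pos.
  have -> : q (t *: delta_mx 0 i + x) - q x - t * (p + (x - x0) *m sy M) 0 i = t ^+ 2 * M i i / 2.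
    rewrite /q; have -> : t *: delta_mx 0 i + x - x0 = (x - x0) + t *: delta_mx 0 i.
      by rewrite addrC addrA addrAC [x0 *- 1 + x]addrC.
    have -> : (p + (x - x0) *m sy M) 0 i = p 0 i + 2^-1 * ((x - x0) *m (M + M^T)) 0 i.
      by rewrite [LHS]mxE /sy -scalemxAr; congr (_ + _); rewrite mxE.
    rewrite qf_addr qf_scale qf_delta dotDr !dotZr !dot_delta.
    by field.
  rewrite ltr_pdivlMr // in td.
  rewrite !normrM [`|2^-1|]ger0_norm ?invr_ge0 //.
  have h1 : 0 <= `|M i i| * (`|t| * `|t|) by rewrite !mulr_ge0.
  have h2 := ler_wpM2r (normr_ge0 t) (ltW td).
  have h3 : 0 <= `|t| * `|t| by rewrite mulr_ge0.
  by move: h1 h2 h3; clear; lra.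
have pdE i : pd q i = fun x => (p + (x - x0) *m sy M) 0 i by apply/funext => x; exact: (pd1 x i).2.
have pd2 x i j : derivable (pd q i) x (delta_mx 0 j) /\ pd (pd q i) j x = sy M i j.
  apply: derive_expansion => e e0; exists 1 => // t _; rewrite pdE.
  have -> : (p + (t *: delta_mx 0 j + x - x0) *m sy M) 0 i - (p + (x - x0) *m sy M) 0 i - t * sy M i j = 0.
    have -> : t *: delta_mx 0 j + x - x0 = t *: delta_mx 0 j + (x - x0) by rewrite addrA.
    have addE (v w : V) : (v + w) 0 i = v 0 i + w 0 i by rewrite mxE.
    have -> : sy M i j = sy M j i by rewrite /sy !mxE addrC.
    rewrite mulmxDl -scalemxAl -rowE !addE.
    have -> : (t *: row j (sy M)) 0 i = t * sy M j i by rewrite mxE [row _ _ _ _]mxE.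
    by ring.
  by rewrite normr0 mulr_ge0 // ltW.
split=> [U x _|x]; last by apply/matrixP => i j; rewrite mxE; exact: (pd2 x i j).2.
split.
    apply: (@contD _ _ _ (fun y => qf M (y - x0) / 2)).
      by apply: (@contD _ _ (fun=> a)); [exact: contK|exact: cont_dot].
    by apply: (@contM _ _ _ (fun=> 2^-1)); [exact: cont_qf|exact: contK].
  move=> i; split; first exact: (pd1 x i).1.
  rewrite pdE; apply: (@cont_ext _ _ (fun y => p 0 i + dot (col i (sy M))^T (y - x0))).
    move=> y; rewrite [RHS]mxE dotC; congr (_ + _); rewrite mulmx_sum.
    by apply: eq_bigr => j _; rewrite [_^T _ _]mxE [col _ _ _ _]mxE.
  by apply: (@contD _ _ (fun=> p 0 i)); [exact: contK|exact: cont_dot].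
move=> i j; split; first exact: (pd2 x i j).1.
apply: (@cont_ext _ _ (fun=> sy M i j)); last exact: contK.
by move=> y; rewrite (pd2 y i j).2.
Qed.

(** Quadratic polynomials are admissible test functions, and a sup-norm neighbourhood contains a
    Euclidean one. *)
Lemma visc_sol_sol F (O : set V) u : visc_sol F O u -> sol (fun M => F (sy M)) O u.
Proof.
move=> [[uc usub] [_ usup]]; split; split=> //.
    move=> x p M Ox [r r0 ht].
    have [qC qh] := quad_C2 (u x) p x M; rewrite -(qh x); apply: usup => //.
    exists r => // y _ yx; have := ht y (le_lt_trans (norm_le_enorm _) yx).
    by rewrite subrr dot0r qf_zero mul0r; clear; lra.
  by move=> x Ox; apply: contN; exact: uc.
move=> x p M Ox [r r0 ht].
have [qC qh] := quad_C2 (u x) (- p) x (- M); rewrite -(qh x); apply: usub => //.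
exists r => // y _ yx; have := ht y (le_lt_trans (norm_le_enorm _) yx).
by rewrite subrr dot0r qf_zero mul0r dotNl qfN; clear; lra.
Qed.

Lemma enorm_lt x (r : R) : 0 < r -> (enorm x < r) = (nsq x < r ^+ 2).
Proof.
move=> r0; rewrite enormE -[in RHS](sqr_sqrtr (nsq_ge0 x)) ltr_sqr ?nnegrE ?sqrtr_ge0 //.
exact: ltW.
Qed.

Lemma enorm_le x (r : R) : 0 < r -> (enorm x <= r) = (nsq x <= r ^+ 2).
Proof.
move=> r0; rewrite enormE -[in RHS](sqr_sqrtr (nsq_ge0 x)) ler_sqr ?nnegrE ?sqrtr_ge0 //.
exact: ltW.
Qed.

Lemma oball_open (r : R) x : 0 < r -> oball 0 r x ->
  exists2 d : R, 0 < d & forall y, `|y - x| < d -> oball 0 r y.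
Proof.
move=> r0; rewrite /oball /= subr0 enorm_lt // => xr.
have e0 : 0 < r ^+ 2 - nsq x by rewrite subr_gt0.
have [d d0 hd] := (contP _ _).1 (@cont_nsq _ _ 0 x) _ e0.
exists d => // y /hd; rewrite !subr0 ltr_norml enorm_lt // => /andP[_].
by clear; lra.
Qed.

(** A function continuous in the open unit ball may be unbounded near the sphere, so the estimates
    take the bound on [u] at radius 3/4. *)
Lemma bounded_inside u : (forall x, oball 0 1 x -> {for x, continuous u}) ->
  exists M0 : R, forall x, enorm x <= 3 / 4 -> `|u x| <= M0.
Proof.
move=> uc; have t0 : 0 < 3 / 4 :> R by clear; lra.
pose h y : R := nsq (y - 0) - (3 / 4) ^+ 2.
have hE y : (h y <= 0) = (enorm y <= 3 / 4) by rewrite /h subr0 subr_le0 enorm_le.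
have hc y : {for y, continuous h} by exact: (contB (@cont_nsq _ _ 0 y) (@contK _ _ _ y)).
have hb y : h y <= 0 -> `|y| <= 3 / 4 by rewrite hE; apply: le_trans; exact: norm_le_enorm.
have h0 : h 0 <= 0 by rewrite /h subr0 nsq0 sub0r oppr_le0 sqr_ge0.
have uc' y : h y <= 0 -> {for y, continuous u}.
  by rewrite hE => yr; apply: uc; rewrite /oball /= subr0; apply: le_lt_trans yr _; clear; lra.
have [a _ ha] := evt_min hc hb uc' h0.
have [b _ hbb] := evt_min hc hb (fun y hy => contN (uc' y hy)) h0.
exists (`|u a| + `|u b|) => y yr; rewrite -hE in yr; have := ha y yr; have := hbb y yr.
have := ler_norm (u b); have := ler_norm (- u a); rewrite normrN.
have := normr_ge0 (u a); have := normr_ge0 (u b).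
by rewrite ler_norml => *; apply/andP; split; lra.
Qed.

(* [r `^ al = 1 / 2] turns the geometric rates into powers of the distance. *)
Lemma dyadic_powR (r al t : R) : 0 < r -> r < 1 -> r `^ al = 1 / 2 -> 0 <= al -> 0 < t -> t <= 1 ->
  exists k : nat, t <= r ^+ k /\ (r ^+ 2 / 2) ^+ k <= 2 / r ^+ 2 * (t ^+ 2 * t `^ al).
Proof.
move=> r0 r1 ral al0 t0 t1.
have ex : exists k : nat, r ^+ k < t.
  have t2 : 0 < t / 2 by pos.
  have [k hk] := expr_small r0 r1 t2; exists k; apply: le_lt_trans hk _; lra.
case: (ex_minnP ex) => -[|k] hk km; first by move: hk; rewrite expr0 ltNge t1.
exists k; have tk : t <= r ^+ k by rewrite leNgt; apply/negP => /km; rewrite ltnn.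
split=> //; have rk : 0 < r ^+ k by pos.
have rkt : r ^+ k <= t / r by rewrite ler_pdivlMr // -exprSr ltW.
have tr0 : 0 <= t / r by pos.
have half : (1 / 2) ^+ k = (r ^+ k) `^ al.
  by rewrite -ral -(powR_mulrn _ (powR_ge0 r al)) -(powR_mulrn _ (ltW r0)) -!powRrM mulrC.
have rinv : r^-1 `^ al = 2.
  have ri : 0 <= r^-1 by rewrite invr_ge0 ltW.
  have := powRM al (ltW r0) ri; rewrite mulfV ?gt_eqF // powR1 ral.
  by clear; lra.
have -> : (r ^+ 2 / 2) ^+ k = (r ^+ k) ^+ 2 * (r ^+ k) `^ al.
  by rewrite -half exprMn -exprM mulnC exprM mul1r exprVn.
have -> : 2 / r ^+ 2 * (t ^+ 2 * t `^ al) = (t / r) ^+ 2 * (t / r) `^ al.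
  rewrite powRM ?rinv; [|exact: ltW|by rewrite invr_ge0 ltW].
  by field; rewrite gt_eqF.
apply: ler_pM; rewrite ?sqr_ge0 ?powR_ge0 //.
  by rewrite ler_sqr ?nnegrE // ltW.
by apply: ge0_ler_powR; rewrite ?nnegrE //; exact: ltW.
Qed.

(** Around each point of the half ball a cube is rescaled to radius [D]. Subtracting [tau / 2] times
    [nsq], with [tau%:M] a zero of the operator, restores [F 0 = 0], and division by [B0] normalises
    the sup bound. *)
Lemma interior_expansion (lam Lam : R) : (0 < n)%N -> 0 < lam -> 0 < Lam ->
  exists2 al : R, 0 < al < 1 & forall M0 K : R, exists C rho : R,
  [/\ 0 < C, 0 < rho & rho <= 1] /\ forall F u, quasiconcave F -> unif_elliptic lam Lam F ->
    visc_sol F (oball 0 1) u -> (forall x, enorm x <= 3 / 4 -> `|u x| <= M0) -> `|F 0| <= K ->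
    (exists p A, expands u (oball 0 (1 / 2)) C rho al p A) /\
    forall x, oball 0 (1 / 2) x -> `|u x| <= C.
Proof.
move=> n0 lam0 Lam0; have np : 0 < n%:R :> R by rewrite ltr0n.
have n1 : 1 <= n%:R :> R by rewrite ler1n.
have lmn : 0 < lam / n%:R by pos.
have [C1 [r [C10 r0 r2 hexp]]] := pointwise_expansion lmn Lam0 n0.
have D6 := @RR1_ge6 R n n0; set D := RR R n + 1 in D6.
have D0 : 0 < D by apply: lt_le_trans D6.
have r1 : r < 1 by move: r2; clear; lra.
have lr : ln r < 0 by apply: ln_lt0; rewrite r0.
(* Solves [powR r al = 1 / 2]; it is below 1 because [r < 1 / 2]. *)
pose al := ln (1 / 2) / ln r.
have hp : 0 < 1 / 2 :> R by clear; lra.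
have l2 : ln (1 / 2) < 0 :> R by apply: ln_lt0; clear; lra.
have al0 : 0 < al by rewrite /al nmulr_rgt0 // invr_lt0.
have al1 : al < 1.
  by rewrite /al ltr_ndivrMr // [1 * ln r]mul1r ltr_ln // posrE.
have ral : r `^ al = 1 / 2.
  by rewrite /powR gt_eqF // /al mulfVK ?lt_eqF // lnK // posrE.
exists al; first by rewrite al0.
move=> M0 K.
pose T := `|K| / lam; have T0 : 0 <= T by rewrite /T; pos.
pose B0 := `|M0| + T + 1; have B00 : 0 < B0 by rewrite /B0; pos.
(* A cube of radius [rho * D] lies in the Euclidean ball of radius 1/4, so that about points of the
   half ball it stays within radius 3/4. *)
pose rho := (4 * n%:R * D)^-1; have rho0 : 0 < rho by rewrite /rho; pos.
have rho1 : rho <= 1.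
  rewrite /rho invf_le1; last by pos.
  apply: le_trans (_ : 4 * 1 * 6 <= _); first by clear; lra.
  by apply: ler_pM => //; apply: ler_pM => //.
have nrD : n%:R * (rho * D) = 1 / 4.
  by rewrite /rho; field; rewrite !gt_eqF.
pose Ce := B0 * C1 * (2 / r ^+ 2) / rho ^+ 3.
pose C := Ce + B0 * C1 / rho + B0 * C1 / rho ^+ 2 + T + `|M0| + 1.
have Ce0 : 0 < Ce by rewrite /Ce; pos.
have c1 : 0 < B0 * C1 / rho by pos.
have c2 : 0 < B0 * C1 / rho ^+ 2 by pos.
have C0 : 0 < C by rewrite /C; pos.
exists C, rho; split=> // F u qF eF us ub FK.
have inside x : oball 0 (1 / 2) x -> nsq x < (1 / 2) ^+ 2.
  by rewrite /oball /= subr0 enorm_lt.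
split; last first.
  move=> x /inside xb; apply: le_trans (ub x _) _.
    rewrite enorm_le; last by clear; lra.
    by apply: ltW; apply: lt_trans xb _; clear; lra.
  have := ler_norm M0; move: Ce0 c1 c2 T0; rewrite /C; clear; lra.
have eF' := ellF_sy n0 lam0 Lam0 eF; have qF' := qcF_sy qF; have us' := visc_sol_sol us.
have [tau Ftau htau] := ell_root lmn Lam0 n0 0 eF'.
have sy0 : sy 0 = 0 by rewrite /sy trmx0 addr0 scaler0.
have tauT : `|tau| <= T.
  rewrite /T ler_pdivlMr //; have -> : `|tau| * lam = lam / n%:R * n%:R * `|tau|.
    by field; rewrite gt_eqF.
  by apply: le_trans htau _; rewrite sy0; apply: le_trans FK (ler_norm _).
pose k := B0^-1; have k0 : 0 < k by rewrite /k; pos.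
have kr : 0 < k * rho ^+ 2 by pos.
suff /choice[pA hpA] x : exists pA : V * 'M[R]_n, oball 0 (1 / 2) x ->
   [/\ pA.2^T = pA.2, `|pA.1| <= C, forall i j, `|pA.2 i j| <= C &
    forall h, `|h| <= rho ->
     `|u (x + h) - (u x + dot pA.1 h + qf pA.2 h / 2)| <= C * `|h| ^+ 2 * `|h| `^ al].
  by exists (fun x => (pA x).1), (fun x => (pA x).2) => x Bx; exact: hpA.
have [Bx|nB] := pselect (oball 0 (1 / 2) x); last by exists (0, 0) => /nB.
have xb := inside x Bx.
pose w y := u y - (0 + dot 0 y + qf tau%:M y / 2).
have wE y : w y = u y - tau * nsq y / 2 by rewrite /w dot0l addr0 add0r qf_scalar.
have inb y : `|y| < D -> nsq (x + rho *: y) <= (3 / 4) ^+ 2.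
  move=> yD; have ny : nsq (rho *: y) <= (1 / 4) ^+ 2.
    rewrite nsqZ -nrD; apply: le_trans (_ : rho ^+ 2 * (n%:R * `|y| ^+ 2) <= _).
      by rewrite ler_wpM2l ?sqr_ge0 // nsq_le_norm.
    have -> : (n%:R * (rho * D)) ^+ 2 = rho ^+ 2 * (n%:R * (n%:R * D ^+ 2)) by ring.
    rewrite ler_wpM2l ?sqr_ge0 // ler_pM2l //; apply: le_trans (_ : D ^+ 2 <= _).
      by rewrite ler_sqr ?nnegrE // ltW.
    by rewrite ler_peMl // sqr_ge0.
  have := @dot_le _ _ x (rho *: y) (1 / 2) (1 / 4) ltac:(by clear; lra) ltac:(by clear; lra) (ltW xb) ny.
  rewrite ler_norml nsqD => /andP[_]; move: ny xb; clear; lra.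
pose ut y := k * w (x + rho *: y).
pose F' X := k * rho ^+ 2 * F (sy ((k * rho ^+ 2)^-1 *: X + tau%:M)).
have su : sol1 (lam / n%:R) Lam F' ut.
  split.
          exact: (ellF_scale tau%:M kr eF').
        exact: (qcF_scale tau%:M kr qF').
      by rewrite /F' scaler0 Ftau mulr0.
    have [s1 s2] := sol_affine x rho0 k0 (sol_quad 0 0 tau%:M us').
    have sub : [set y : V | `|y| < RR R n + 1] `<=` [set y | oball 0 1 (x + rho *: y)].
      move=> y /inb yb; rewrite /oball /= subr0 enorm_lt // expr1n.
      by apply: le_lt_trans yb _; clear; lra.
    by split; [exact: visc_subset s1 sub|exact: visc_subset s2 sub].
  move=> y /inb yb; rewrite /ut normrM (gtr0_norm k0) /k mulrC ler_pdivrMr // mul1r wE.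
  apply: le_trans (ler_normB _ _) _.
  have b1 : `|u (x + rho *: y)| <= `|M0|.
    apply: le_trans (ub _ _) (ler_norm _); rewrite enorm_le //; clear; lra.
  have b2 : `|tau * nsq (x + rho *: y) / 2| <= T.
    rewrite !normrM [`|2^-1|]ger0_norm ?invr_ge0 // (ger0_norm (nsq_ge0 _)).
    have y1 : nsq (x + rho *: y) <= 1 by apply: le_trans yb _; clear; lra.
    have := ler_pM (normr_ge0 tau) (nsq_ge0 (x + rho *: y)) tauT y1; move: T0; clear; lra.
  by rewrite /B0; move: b1 b2; clear; lra.
have [p [A [sA pb Ab hk]]] := hexp _ _ su.
exists ((B0 / rho) *: p + tau *: x, (B0 / rho ^+ 2) *: A + tau%:M) => _ /=.
have x1 : `|x| <= 1.
  apply: norm_le_of_nsq => //; apply: ltW; apply: lt_trans xb _; rewrite expr1n; clear; lra.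
split.
      by rewrite linearD /= linearZ /= sA tr_scalar_mx.
    apply: le_trans (ler_normD _ _) _; rewrite !mx_normZ gtr0_norm; last by pos.
    have e1 : B0 / rho * `|p| <= B0 * C1 / rho.
      by rewrite [X in _ <= X]mulrAC; apply: ler_wpM2l => //; pos.
    have e2 := ler_pM (normr_ge0 tau) (normr_ge0 x) tauT x1.
    by have := normr_ge0 M0; move: e1 e2 Ce0 c2; rewrite /C; clear; lra.
  move=> i j; rewrite !mxE; apply: le_trans (ler_normD _ _) _; rewrite normrM gtr0_norm; last by pos.
  have e1 : B0 / rho ^+ 2 * `|A i j| <= B0 * C1 / rho ^+ 2.
    by rewrite [X in _ <= X]mulrAC; apply: ler_wpM2l => //; pos.
  have e2 : `|tau *+ (i == j)| <= T by case: (i == j); rewrite ?mulr1n ?mulr0n ?normr0.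
  by have := normr_ge0 M0; move: e1 e2 Ce0 c1; rewrite /C; clear; lra.
move=> h hr; have [->|h0] := eqVneq h 0.
  rewrite addr0 dot0r qf_zero mul0r !addr0 subrr normr0.
  by rewrite mulr_ge0 ?powR_ge0 // mulr_ge0 ?exprn_ge0 ?normr_ge0 // ltW.
pose y : V := rho^-1 *: h; have hy : h = rho *: y by rewrite /y scalerA mulfV ?scale1r // gt_eqF.
have hn : 0 < `|h| by rewrite normr_gt0.
have rhoV : 0 < rho^-1 by pos.
have yn : `|y| = `|h| / rho by rewrite /y mx_normZ (gtr0_norm rhoV) mulrC.
have y0 : 0 < `|y| by rewrite yn; pos.
have y1 : `|y| <= 1 by rewrite yn ler_pdivrMr // mul1r.
have [m [m1 m2]] := dyadic_powR r0 r1 ral (ltW al0) y0 y1.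
have b1 := hk m y m1.
have -> : u (x + h) - (u x + dot ((B0 / rho) *: p + tau *: x) h + qf ((B0 / rho ^+ 2) *: A + tau%:M) h / 2) =
   B0 * (ut y - (ut 0 + dot p y + qf A y / 2)).
  rewrite hy /ut !wE /k scaler0 addr0 nsqD dotDl !dotZl !dotZr qfD qfZ qf_scalar qf_scale nsqZ.
  by field; rewrite !gt_eqF.
rewrite normrM gtr0_norm //.
have yal : `|y| `^ al <= `|h| `^ al / rho.
  rewrite yn powRM; [|exact: normr_ge0|by rewrite invr_ge0 ltW].
  rewrite ler_wpM2l ?powR_ge0 //; have ri : 1 <= rho^-1 by rewrite invf_ge1.
  by apply: le_trans (ler_powR ri (ltW al1)) _; rewrite powRr1 // (le_trans _ ri).
apply: le_trans (_ : B0 * (C1 * (2 / r ^+ 2 * (`|y| ^+ 2 * (`|h| `^ al / rho)))) <= _).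
  rewrite ler_pM2l //; apply: le_trans b1 _; rewrite ler_pM2l //; apply: le_trans m2 _.
  rewrite ler_wpM2l //; [by pos|]; rewrite ler_wpM2l // sqr_ge0.
have -> : B0 * (C1 * (2 / r ^+ 2 * (`|y| ^+ 2 * (`|h| `^ al / rho)))) = Ce * `|h| ^+ 2 * `|h| `^ al.
  by rewrite yn /Ce; field; rewrite !gt_eqF.
rewrite ler_wpM2r ?powR_ge0 // ler_wpM2r ?sqr_ge0 //.
by have := normr_ge0 M0; move: c1 c2 T0; rewrite /C; clear; lra.
Qed.
End Reduction.

Theorem theorem4p1 (R : realType) (n : nat) (lam Lam : R) :
  0 < lam -> lam <= Lam ->
  exists alpha : R, 0 < alpha < 1 /\
   (forall (F : 'M[R]_n -> R) (u : 'rV[R]_n -> R),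
      cont_on_Sn F -> quasiconcave F -> unif_elliptic lam Lam F ->
      visc_sol F (oball 0 1) u ->
      C2on (oball 0 (1/2)) u /\ (C2a_norm (oball 0 (1/2)) alpha u < +oo)%E) /\
   (forall M0 K : R, exists C : R,
    forall (F : 'M[R]_n -> R) (u : 'rV[R]_n -> R),
      cont_on_Sn F -> quasiconcave F -> unif_elliptic lam Lam F ->
      visc_sol F (oball 0 1) u ->
      (forall x, oball 0 1 x -> `|u x| <= M0) -> `|F 0| <= K ->
      (C2a_norm (oball 0 (1/2)) alpha u <= C%:E)%E).
Proof.
move=> lam0 lamLam; have Lam0 : 0 < Lam by apply: lt_le_trans lamLam.
case: (posnP n) => [n0|n0].
  (* In dimension 0 the space is a point and the norm reduces to the absolute value of [u 0]. *)
  subst n; exists (1 / 2); split; first by lra.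
  have all0 (x y : 'rV[R]_0) : x = y by apply/rowP => -[].
  have es (u : 'rV[R]_0 -> R) (C : R) : `|u 0| <= C -> (C2a_norm (oball 0 (1 / 2)) (1 / 2) u <= C%:E)%E.
    move=> h; rewrite /C2a_norm !big_ord0 !adde0; apply: ge_ereal_sup => _ [x _ <-].
    by rewrite lee_fin (all0 x 0).
  split=> [F u _ _ _ _|M0 K].
    split; last by apply: le_lt_trans (es u _ (lexx _)) _; exact: ltry.
    move=> x _; split=> [|i|i]; [|by case: i..].
    by apply/contP => e e0; exists 1 => // y _; rewrite (all0 y x) subrr normr0.
  exists M0 => F u _ _ _ _ ub _; apply: es; apply: ub.
  by rewrite /oball /= subr0 enormE nsq0 sqrtr0.
have [al /andP[al0 al1] hal] := interior_expansion n0 lam0 Lam0.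
have h2 : 0 < 1 / 2 :> R by lra.
(* With the bound on [u] taken at radius 3/4, this serves both the qualitative claim, through
   [bounded_inside], and the quantitative one. *)
have main (M0 K : R) : exists C : R, forall (F : 'M[R]_n -> R) (u : 'rV[R]_n -> R),
    quasiconcave F -> unif_elliptic lam Lam F -> visc_sol F (oball 0 1) u ->
    (forall x, enorm x <= 3 / 4 -> `|u x| <= M0) -> `|F 0| <= K ->
    C2on (oball 0 (1 / 2)) u /\ (C2a_norm (oball 0 (1 / 2)) al u <= C%:E)%E.
  have [C [rho [[C0 rho0 rho1] h]]] := hal M0 K.
  eexists => F u qF eF us ub FK; have [[p [A hE]] uC] := h F u qF eF us ub FK.
  have uc x : oball 0 (1 / 2) x -> {for x, continuous u}.
    move=> Bx; have [[uc _] _] := us; apply: uc; apply: lt_trans Bx _; lra.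
  have opB x := @oball_open R n _ x h2.
  split; first exact: (expands_C2on C0 rho0 rho1 al0 al1 opB uc hE).1.
  exact: (expands_norm C0 rho0 rho1 al0 al1 opB uc uC hE).
exists al; split; first by rewrite al0.
split=> [F u _ qF eF us|M0 K].
  have [[uc _] _] := us; have [M0 hM0] := bounded_inside uc.
  have [C hC] := main M0 `|F 0|.
  have [h1 h3] := hC F u qF eF us hM0 (lexx _).
  by split=> //; apply: le_lt_trans h3 _; exact: ltry.
have [C hC] := main M0 K; exists C => F u _ qF eF us ub FK.
apply: (hC F u qF eF us _ FK).2.
by move=> x xr; apply: ub; rewrite /oball /= subr0; apply: le_lt_trans xr _; lra.
Qed.
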